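(* Let $\alpha\in(\frac13,\frac12]$, $0<\beta'\le\beta\le\alpha$ with $\alpha+\beta+\beta'>1$, $\gamma\in\mathbb{R}$, $m\in[2,\infty)$, $\mathbf{X}=(X,\mathbb{X})\in\mathscr{C}^\alpha([0,T],\mathbb{R}^e)$ and $(Y,Y')\in\mathbf{D}_X^{\beta,\beta'}L_m\mathcal{H}_\gamma^e$. Then there exists a unique $$Z=:\int_0^\cdot S_{r,\cdot}Y_r\,d\mathbf{X}_r\in\hat C^\alpha L_m\mathcal{H}_{\gamma-\beta-\beta'}$$ with $Z_0=0$ such that for every $(s,t)\in\Delta_2$, $$\hat\delta Z_{s,t}=\int_s^tS_{r,t}Y_r\,d\mathbf{X}_r=\lim_{\pi\in\mathcal{P}[s,t],\,|\pi|\to0}\sum_{[r,v]\in\pi}S_{r,t}(Y_r\delta X_{r,v}+Y'_r\mathbb{X}_{r,v})$$ holds in $L^m(\Omega,\mathcal{H}_{\gamma-\beta-\beta'})$, and for every $\eta\in[0,\alpha+\beta+\beta')$ and $(s,t)\in\Delta_2$, $$\|\hat\delta Z_{s,t}-S_{s,t}(Y_s\delta X_{s,t}+Y'_s\mathbb{X}_{s,t})\|_{m,\gamma+\eta-\beta-\beta'}\lesssim\|Y,Y'\|_{\mathbf{D}_X^{\beta,\beta'}L_m\mathcal{H}_\gamma}(1+|\mathbf{X}|_\alpha^2)|t-s|^{\alpha+\beta+\beta'-\eta}.$$ As a consequence, for every $\theta\in[0,\alpha)$, $Z\in\hat C^{\alpha-\theta}L_m\mathcal{H}_{\gamma+\theta}$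 and $$\|\hat\delta Z\|_{\alpha-\theta,m,\gamma+\theta}\lesssim\|Y,Y'\|_{\mathbf{D}_X^{\beta,\beta'}L_m\mathcal{H}_\gamma}(1+|\mathbf{X}|_\alpha^2).$$ Moreover, if additionally $\theta\le\beta'$, then the map $$\mathbf{D}_X^{\beta,\beta'}L_m\mathcal{H}_\gamma^e\to\mathcal{D}_X^{\beta,\beta'}L_m\mathcal{H}_{\gamma+\theta}:\quad(Y,Y')\mapsto(Z,Y)$$ is a bounded linear map and $$\|Z,Y\|_{\mathbf{D}_X^{\beta,\beta'}L_m\mathcal{H}_{\gamma+\theta}}\lesssim\|Y_0\|_{m,\gamma}(1+|\mathbf{X}|_\alpha)+T^{(\alpha-\beta)\wedge(\beta-\beta')}\|Y,Y'\|_{\mathbf{D}_X^{\beta,\beta'}L_m\mathcal{H}_\gamma}(1+|\mathbf{X}|_\alpha^2).$$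
   Context: **Setting.** Fix $T>0$; $\Delta_2=\{(s,t):0\le s\le t\le T\}$, $\Delta_3=\{(s,r,t):0\le s\le r\le t\le T\}$; $\mathcal{P}[s,t]$ is the set of partitions of $[s,t]$ and $|\pi|$ the mesh of $\pi$. $(\Omega,\mathcal{F},(\mathcal{F}_t),\mathbb{P})$ is a filtered probability space satisfying the usual conditions; $\mathbb{E}_s=\mathbb{E}[\cdot|\mathcal{F}_s]$. $a\lesssim b$ means $a\le Cb$ with $C$ depending only on the fixed parameters ($\alpha,\beta,\beta',m,\gamma,\eta,\theta,\dots$), on $T\vee1$ and on the fixed spaces and propagator. **Monotone family and propagator.** $(\mathcal{H}_\gamma,|\cdot|_\gamma)_{\gamma\in\mathbb{R}}$ is a monotone family of interpolation Hilbert spaces: each $\mathcal{H}_\gamma$ is a separable Hilbert space; for $\gamma_1\le\gamma_2$, $\mathcal{H}_{\gamma_2}$ is a continuously embedded dense subspace of $\mathcal{H}_{\gamma_1}$; and $|u|_{\gamma_2}^{\gamma_3-\gamma_1}\lesssim|u|_{\gamma_1}^{\gamma_3-\gamma_2}|u|_{\gamma_3}^{\gamma_2-\gamma_1}$ for $\gamma_1\le\gamma_2\le\gamma_3$, $u\in\mathcal{H}_{\gamma_3}$. $(L_t)_{t\in[0,T]}$ is a family of unbounded operators such that for all $t$, $\gamma$, $L_t$ is closed and densely defined on $\mathcal{H}_\gamma$ with domain containing $\mathcal{H}_{\gamma+1}$, and $(L_t)$ generates a propagator $S:\Delta_2\to\cap_\gamma\mathcal{L}(\mathcal{H}_\gamma)$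 (for $u\in\mathcal{H}_{\gamma+1}$: $\partial_tS_{s,t}u=L_tS_{s,t}u$, $\partial_sS_{s,t}u=-S_{s,t}L_su$ in $\mathcal{H}_\gamma$): $S$ is strongly continuous on each $\mathcal{H}_\gamma$, $S_{r,t}S_{s,r}=S_{s,t}$ on $\Delta_3$, $S_{t,t}=\mathrm{id}$, and for $\gamma_1\le\gamma_2\le\gamma_1+1$, $0\le s<t\le T$: $|S_{s,t}u|_{\gamma_2}\lesssim|t-s|^{\gamma_1-\gamma_2}|u|_{\gamma_1}$ and $|S_{s,t}u-u|_{\gamma_1}\lesssim|t-s|^{\gamma_2-\gamma_1}|u|_{\gamma_2}$. **Notation.** $\mathcal{H}_\gamma^e=\mathcal{L}(\mathbb{R}^e,\mathcal{H}_\gamma)$, norm again $|\cdot|_\gamma$. $\mathcal{H}_\gamma^{e_1\times e}$ is identified with $\mathcal{L}(\mathbb{R}^e,\mathcal{H}_\gamma^{e_1})$; for $e_1=e$, $A\in\mathcal{H}_\gamma^{e\times e}$ acts on $\mathbb{R}^{e\times e}$ by linear extension of $A(x\otimes z)=(Ax)z$. $\|\xi\|_{m,\gamma}=\||\xi|_\gamma\|_{L^m(\Omega)}$. $\delta Y_{s,t}=Y_t-Y_s$, $\hat\delta Y_{s,t}=Y_t-S_{s,t}Y_s$. $\mathbb{E}_\cdot A$ is the map $(s,t)\mapsto\mathbb{E}_sA_{s,t}$. $\|Y\|_{0,m,\gamma}=\sup_t\|Y_t\|_{m,\gamma}$, $\|A\|_{\beta,m,\gamma}=\sup_{s<t}\|A_{s,t}\|_{m,\gamma}/|t-s|^\beta$.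 **Spaces of processes.** $C_2^\beta L_m\mathcal{H}_\gamma^{e_1}$: measurable adapted ($A_{s,t}$ is $\mathcal{F}_t$-measurable) bounded continuous $A:\Delta_2\to L^m(\Omega,\mathcal{H}_\gamma^{e_1})$ with $\|A\|_{\beta,m,\gamma}<\infty$. $CL_m\mathcal{H}_\gamma^{e_1}=C([0,T],L^m(\Omega,\mathcal{H}_\gamma^{e_1}))$. $C^\beta L_m\mathcal{H}_\gamma^{e_1}$ (resp. $\hat C^\beta L_m\mathcal{H}_\gamma^{e_1}$): measurable adapted $Y\in CL_m\mathcal{H}_\gamma^{e_1}$ with $\|\delta Y\|_{\beta,m,\gamma}<\infty$ (resp. $\|\hat\delta Y\|_{\beta,m,\gamma}<\infty$). $E^\beta L_m\mathcal{H}_\gamma^{e_1}=CL_m\mathcal{H}_\gamma^{e_1}\cap C^\beta L_m\mathcal{H}_{\gamma-\beta}^{e_1}$, norm $\|Y\|_{E^\beta L_m\mathcal{H}_\gamma}=\|Y\|_{0,m,\gamma}+\|\delta Y\|_{\beta,m,\gamma-\beta}$. **Rough paths.** $\mathbf{X}=(X,\mathbb{X})\in\mathscr{C}^\alpha([0,T],\mathbb{R}^e)$ means $X:[0,T]\to\mathbb{R}^e$, $\mathbb{X}:\Delta_2\to\mathbb{R}^{e\times e}$ are continuous, $|\delta X|_\alpha,|\mathbb{X}|_{2\alpha}<\infty$ where $|A|_\beta=\sup_{s<t}|A_{s,t}|/|t-s|^\beta$, and $\mathbb{X}_{s,t}-\mathbb{X}_{s,r}-\mathbb{X}_{r,t}=\delta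 X_{s,r}\otimes\delta X_{r,t}$ on $\Delta_3$. $|\mathbf{X}|_\alpha=|\delta X|_\alpha+|\mathbb{X}|_{2\alpha}$. **Stochastic controlled rough paths.** $(Y,Y')\in\mathbf{D}_X^{\beta,\beta'}L_m\mathcal{H}_\gamma^{e_1}$ if $Y\in E^\beta L_m\mathcal{H}_\gamma^{e_1}$, $Y'\in E^{\beta'}L_m\mathcal{H}_{\gamma-\beta}^{e_1\times e}$ and $\mathbb{E}_\cdot R^Y\in C_2^{\beta+\beta'}L_m\mathcal{H}_{\gamma-\beta-\beta'}^{e_1}$, where $R^Y_{s,t}=\delta Y_{s,t}-Y'_s\delta X_{s,t}$. If additionally $R^Y\in C_2^{\beta+\beta'}L_m\mathcal{H}_{\gamma-\beta-\beta'}^{e_1}$, write $(Y,Y')\in\mathcal{D}_X^{\beta,\beta'}L_m\mathcal{H}_\gamma^{e_1}$. Both are equipped with the norm $\|Y,Y'\|_{\mathbf{D}_X^{\beta,\beta'}L_m\mathcal{H}_\gamma}=\|Y\|_{E^\beta L_m\mathcal{H}_\gamma}+\|Y'\|_{E^{\beta'}L_m\mathcal{H}_{\gamma-\beta}}+\|\mathbb{E}_\cdot R^Y\|_{\beta+\beta',m,\gamma-\beta-\beta'}$.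
   Formalization: For η<β' the remainder estimate, false as stated, has exponent min(α+β+β'−η, α+β); its conditional expectation E_s keeps α+β+β'−η for all η. Continuity of (s,t)↦E_sR_{s,t}, which can fail for Z, is dropped from the definition of D_X (hypothesis and conclusion). *)

(* Defs.v *)
From HB Require Import structures.
From mathcomp Require Import all_boot all_order all_algebra.
From mathcomp Require Import all_classical all_reals all_analysis.

Set Implicit Arguments.
Unset Strict Implicit.
Unset Printing Implicit Defensive.

Import Order.TTheory GRing.Theory Num.Theory.
Import numFieldNormedType.Exports.

Local Open Scope classical_set_scope.
Local Open Scope ring_scope.

(* The Hilbert spaces H_g are abstract types realized, through the injections
   [hincl], as nested subspaces of their union [ambient]. *)
Record monotone_family (R : realType) := MonotoneFamily {
  ambient : lmodType R ;
  hspace : R -> completeNormedModType R ;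
  hinner : forall g, hspace g -> hspace g -> R ;
  hincl : forall g, {linear hspace g -> ambient} ;
  hinner_sym : forall g (u v : hspace g), hinner u v = hinner v u ;
  hinner_linear : forall g (a : R) (u v w : hspace g),
    hinner (a *: u + v) w = a * hinner u w + hinner v w ;
  hinner_norm : forall g (u : hspace g), hinner u u = `|u| ^+ 2 ;
  hspace_separable : forall g, exists2 D : set (hspace g), countable D & dense D ;
  hincl_inj : forall g, injective (hincl g) ;
  ambient_union : forall v : ambient, exists g, range (hincl g) v ;
  hspace_nested : forall g1 g2, g1 <= g2 ->
    range (hincl g2) `<=` range (hincl g1) ;
  hspace_embedding : forall g1 g2, g1 <= g2 -> exists C : R,
    forall (u1 : hspace g1) (u2 : hspace g2),
    hincl g1 u1 = hincl g2 u2 -> `|u1| <= C * `|u2| ;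
  hspace_dense : forall g1 g2, g1 <= g2 ->
    dense (hincl g1 @^-1` range (hincl g2)) ;
  hspace_interpolation : forall g1 g2 g3, g1 <= g2 -> g2 <= g3 -> exists C : R,
    forall (u1 : hspace g1) (u2 : hspace g2) (u3 : hspace g3),
    hincl g1 u1 = hincl g3 u3 -> hincl g2 u2 = hincl g3 u3 ->
    `|u2| `^ (g3 - g1) <= C * `|u1| `^ (g3 - g2) * `|u3| `^ (g2 - g1)
}.

(* |v|_g, with value +oo when v does not belong to H_g. *)
Definition hnorm (R : realType) (H : monotone_family R) (g : R) (v : ambient H)
    : \bar R :=
  ereal_inf [set `|u|%:E | u in [set u : hspace H g | hincl H g u = v]].

Definition simplex2 (R : realType) (T : R) : set (R * R) :=
  [set p | 0 <= p.1 /\ p.1 <= p.2 /\ p.2 <= T].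

Definition strict_simplex2 (R : realType) (T : R) : set (R * R) :=
  [set p | 0 <= p.1 /\ p.1 < p.2 /\ p.2 <= T].

(* Since H_(g+1) lies in the domain of L_t on H_g for every g, the operator L_t
   is defined on the whole union; [gen_dom t g] is its domain in H_g. *)
Record propagator (R : realType) (H : monotone_family R) (T : R) := Propagator {
  gen : R -> {linear ambient H -> ambient H} ;
  gen_dom : R -> forall g, set (hspace H g) ;
  prop : R -> R -> {linear ambient H -> ambient H} ;
  gen_dom_linear : forall t g (a : R) (u v : hspace H g), 0 <= t <= T ->
    gen_dom t u -> gen_dom t v -> gen_dom t (a *: u + v) ;
  gen_dom_incl : forall t g, 0 <= t <= T ->
    hincl H g @^-1` range (hincl H (g + 1)) `<=` gen_dom t (g := g) ;
  gen_dom_dense : forall t g, 0 <= t <= T -> dense (gen_dom t (g := g)) ;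
  gen_dom_val : forall t g (u : hspace H g), 0 <= t <= T ->
    gen_dom t u -> range (hincl H g) (gen t (hincl H g u)) ;
  gen_closed : forall t g, 0 <= t <= T ->
    closed [set p : hspace H g * hspace H g |
             gen_dom t p.1 /\ gen t (hincl H g p.1) = hincl H g p.2] ;
  prop_bounded : forall s t g, simplex2 T (s, t) -> exists C : R,
    forall u : hspace H g, (hnorm g (prop s t (hincl H g u)) <= (C * `|u|)%:E)%E ;
  prop_continuous : forall g (u : hspace H g) p, simplex2 T p ->
    hnorm g (prop q.1 q.2 (hincl H g u) - prop p.1 p.2 (hincl H g u))
      @[q --> within (simplex2 T) (nbhs p)] --> 0%E ;
  prop_comp : forall s r t, 0 <= s -> s <= r -> r <= t -> t <= T ->
    forall v, prop r t (prop s r v) = prop s t v ;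
  prop_id : forall t, 0 <= t <= T -> forall v, prop t t v = v ;
  prop_forward : forall s t g (u : hspace H (g + 1)), simplex2 T (s, t) ->
    let v := hincl H (g + 1) u in
    hnorm g (h^-1 *: (prop s (t + h) v - prop s t v) - gen t (prop s t v))
      @[h --> within [set h | s <= t + h <= T] 0^'] --> 0%E ;
  prop_backward : forall s t g (u : hspace H (g + 1)), simplex2 T (s, t) ->
    let v := hincl H (g + 1) u in
    hnorm g (h^-1 *: (prop (s + h) t v - prop s t v) + prop s t (gen s v))
      @[h --> within [set h | 0 <= s + h <= t] 0^'] --> 0%E ;
  prop_smoothing : forall g1 g2, g1 <= g2 -> g2 <= g1 + 1 -> exists C : R,
    forall s t (u : hspace H g1), strict_simplex2 T (s, t) ->
    (hnorm g2 (prop s t (hincl H g1 u))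
       <= (C * (t - s) `^ (g1 - g2) * `|u|)%:E)%E ;
  prop_regularity : forall g1 g2, g1 <= g2 -> g2 <= g1 + 1 -> exists C : R,
    forall s t (u : hspace H g2), strict_simplex2 T (s, t) ->
    (hnorm g1 (prop s t (hincl H g2 u) - hincl H g2 u)%R
       <= (C * (t - s) `^ (g2 - g1) * `|u|)%:E)%E
}.

(* The Euclidean norm on R^e = 'rV_e and on R^(e x e) = 'M_e. *)
Definition eucl (R : realType) (p q : nat) (M : 'M[R]_(p, q)) : R :=
  Num.sqrt (\sum_i \sum_j M i j ^+ 2).

(* An element A of L(R^e, W) is encoded by its columns A e_1, ..., A e_e, that is
   by an element of {ffun 'I_e -> W}. *)
Definition lapp (R : realType) (e : nat) (W : lmodType R)
    (A : {ffun 'I_e -> W}) (x : 'rV[R]_e) : W := \sum_i x 0 i *: A i.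

(* The linear extension of A (x (x) z) = (A x) z. *)
Definition lapp2 (R : realType) (e : nat) (W : lmodType R)
    (A : {ffun 'I_e -> {ffun 'I_e -> W}}) (M : 'M[R]_e) : W :=
  \sum_i \sum_j M i j *: A i j.

(* The operator norms on L(R^e, W) attached to a family N of norms on W; they
   are finite exactly when all the columns have finite norm. *)
Definition opnorm (R : realType) (e : nat) (W : lmodType R) (N : R -> W -> \bar R)
    (g : R) (A : {ffun 'I_e -> W}) : \bar R :=
  ereal_sup [set N g (lapp A x) | x in [set x : 'rV[R]_e | eucl x <= 1]].

Section RoughPaths.
Variables (R : realType) (e : nat).

Definition det_holder (T : R) (p q : nat) (b : R) (A : R -> R -> 'M[R]_(p, q))
    : \bar R :=
  ereal_sup [set (eucl (A q.1 q.2) / (q.2 - q.1) `^ b)%:E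
            | q in strict_simplex2 T].

Definition incr (W : zmodType) (Y : R -> W) (s t : R) : W := Y t - Y s.

Record rough_path (T a : R) (X : R -> 'rV[R]_e) (XX : R -> R -> 'M[R]_e) : Prop :=
  RoughPath {
    rough_path_cont1 : {within `[0, T], continuous X} ;
    rough_path_cont2 :
      {within simplex2 T, continuous (fun p : R * R => XX p.1 p.2)} ;
    rough_path_holder1 : (det_holder T a (incr X) < +oo)%E ;
    rough_path_holder2 : (det_holder T (2 * a)%R XX < +oo)%E ;
    rough_path_chen : forall s r t, 0 <= s -> s <= r -> r <= t -> t <= T ->
      XX s t - XX s r - XX r t = (incr X s r)^T *m incr X r t
  }.

Definition rough_norm (T a : R) (X : R -> 'rV[R]_e) (XX : R -> R -> 'M[R]_e)
    : \bar R :=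
  (det_holder T a (incr X) + det_holder T (2 * a)%R XX)%E.

End RoughPaths.

Record usual_filtration (R : realType) (d : measure_display)
    (Omega : measurableType d) (P : probability Omega R) (T : R)
    (F : R -> set (set Omega)) : Prop := UsualFiltration {
  filtration_sigma : forall t, 0 <= t <= T -> sigma_algebra setT (F t) ;
  filtration_measurable : forall t, 0 <= t <= T -> F t `<=` measurable ;
  filtration_mono : forall s t, simplex2 T (s, t) -> F s `<=` F t ;
  filtration_complete : P.-negligible `<=` F 0 ;
  filtration_right_cont : forall t, 0 <= t < T ->
    \bigcap_(u in [set u | t < u <= T]) F u `<=` F t
}.

(* W is the ambient vector space of one of the scales (H_g), (H_g^e) or
   (H_g^(e x e)), and N g is its norm of index g, equal to +oo off the space of
   index g. Random variables are functions Omega -> W considered up to almost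
   sure equality. *)
Section Processes.
Variables (R : realType) (d : measure_display) (Omega : measurableType d).
Variables (P : probability Omega R) (T : R) (F : R -> set (set Omega)).
Variables (W : lmodType R) (N : R -> W -> \bar R).

Implicit Types (g b m : R) (xi zeta : Omega -> W).
Implicit Types (Y : R -> Omega -> W) (A : R -> R -> Omega -> W).

Definition aeeq xi zeta : Prop := {ae P, forall w, xi w = zeta w}.

Definition gopen g (U : set W) : Prop :=
  forall v, U v -> (N g v < +oo)%E ->
  exists2 eps : R, 0 < eps & forall u, (N g (u - v)%R < eps%:E)%E -> U u.

(* f maps D into the space of index g and, on D, is Borel measurable with
   respect to the sigma-algebra G. *)
Definition borel_on (J : Type) g (D : set J) (G : set (set J)) (f : J -> W) : Prop :=
  (forall j, D j -> (N g (f j) < +oo)%E) /\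
  (forall U, gopen g U -> G (D `&` f @^-1` U)).

Definition random_var g (G : set (set Omega)) xi : Prop :=
  exists2 xi', borel_on g setT G xi' & aeeq xi xi'.

Definition mnorm m g xi : \bar R := Lnorm P m%:E (fun w => N g (xi w)).

Definition Lm m g xi : Prop :=
  random_var g measurable xi /\ (mnorm m g xi < +oo)%E.

Definition simple_fun g (f : Omega -> W) : Prop :=
  [/\ finite_set (range f), (forall w, (N g (f w) < +oo)%E) &
      forall v, measurable (f @^-1` [set v])].

Definition simple_integral (B : set Omega) (f : Omega -> W) : W :=
  \sum_(v \in range f) fine (P (B `&` f @^-1` [set v])) *: v.

(* The Bochner integral of xi over B, in the space of index g, is I. *)
Definition bochner g (B : set Omega) xi (I : W) : Prop :=
  random_var g measurable xi /\
  exists f : nat -> Omega -> W,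
    [/\ forall n, simple_fun g (f n),
        (\int[P]_(w in B) N g (xi w - f n w)%R)%E @[n --> \oo] --> 0%E &
        N g (simple_integral B (f n) - I) @[n --> \oo] --> 0%E].

Definition is_condexp g (G : set (set Omega)) xi zeta : Prop :=
  random_var g G zeta /\
  forall B, G B -> exists I, bochner g B xi I /\ bochner g B zeta I.

(* Some version of E[xi | G]; one exists as soon as xi is integrable in the
   space of index g. *)
Definition condexp g (G : set (set Omega)) xi : Omega -> W :=
  xget (fun=> 0) (is_condexp g G xi).

(* The map (s, t) |-> E_s A_(s,t). *)
Definition Econd g A : R -> R -> Omega -> W :=
  fun s t => condexp g (F s) (A s t).

Definition delta Y : R -> R -> Omega -> W := fun s t w => Y t w - Y s w.

Definition norm0 m g Y : \bar R :=
  ereal_sup [set mnorm m g (Y t) | t in `[0, T]].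

Definition norm2 b m g A : \bar R :=
  ereal_sup [set (mnorm m g (A p.1 p.2) * (((p.2 - p.1) `^ b)^-1)%R%:E)%E
            | p in strict_simplex2 T].

Definition meas_adapted g Y : Prop :=
  exists2 Y', (forall t, 0 <= t <= T -> aeeq (Y t) (Y' t)) &
    borel_on g (`[0, T] `*` setT)
      (measurable : set (set (measurableTypeR R * Omega)%type))
      (fun p : R * Omega => Y' p.1 p.2) /\
    forall t, 0 <= t <= T -> borel_on g setT (F t) (Y' t).

Definition meas_adapted2 g A : Prop :=
  exists2 A',
    (forall s t, simplex2 T (s, t) -> aeeq (A s t) (A' s t)) &
    borel_on g (simplex2 T `*` setT)
      (measurable : set (set (measurableTypeR R * measurableTypeR R * Omega)%type))
      (fun p : R * R * Omega => A' p.1.1 p.1.2 p.2) /\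
    forall s t, simplex2 T (s, t) -> borel_on g setT (F t) (A' s t).

Definition CLm m g Y : Prop :=
  (forall t, 0 <= t <= T -> Lm m g (Y t)) /\
  forall t, 0 <= t <= T ->
    mnorm m g (fun w => Y s w - Y t w) @[s --> within `[0, T] (nbhs t)] --> 0%E.

Definition CbLm b m g Y : Prop :=
  [/\ meas_adapted g Y, CLm m g Y & (norm2 b m g (delta Y) < +oo)%E].

Definition ELm b m g Y : Prop := CLm m g Y /\ CbLm b m (g - b) Y.

Definition normE b m g Y : \bar R :=
  (norm0 m g Y + norm2 b m (g - b)%R (delta Y))%E.

(* Measurable, adapted and bounded maps A : Delta_2 -> L^m(Omega, H_g) with
   finite norm. *)
Definition B2Lm b m g A : Prop :=
  [/\ meas_adapted2 g A,
      (forall s t, simplex2 T (s, t) -> Lm m g (A s t)),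
      (ereal_sup [set mnorm m g (A p.1 p.2) | p in simplex2 T] < +oo)%E &
      (norm2 b m g A < +oo)%E].

Definition C2Lm b m g A : Prop :=
  B2Lm b m g A /\
  forall p, simplex2 T p ->
    mnorm m g (fun w => A q.1 q.2 w - A p.1 p.2 w)
      @[q --> within (simplex2 T) (nbhs p)] --> 0%E.

Section Controlled.
Variables (e : nat) (X : R -> 'rV[R]_e).

Definition remainder Y (Y' : R -> Omega -> {ffun 'I_e -> W}) :=
  fun s t w => delta Y s t w - lapp (Y' s w) (incr X s t).

End Controlled.
End Processes.

Section ControlledRoughPaths.
Variables (R : realType) (d : measure_display) (Omega : measurableType d).
Variables (P : probability Omega R) (T : R) (F : R -> set (set Omega)).
Variables (W : lmodType R) (N : R -> W -> \bar R).
Variables (e : nat) (X : R -> 'rV[R]_e).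

(* Continuity of (s, t) |-> E_s R_(s,t) is not required: when the filtration is
   only right-continuous it may fail for the remainder of a rough integral, by a
   jump of s |-> E_s. *)
Definition controlled (b b' m g : R)
    (Y : R -> Omega -> W) (Y' : R -> Omega -> {ffun 'I_e -> W}) : Prop :=
  [/\ ELm P T F N b m g Y,
      ELm P T F (opnorm N (e := e)) b' m (g - b) Y' &
      B2Lm P T F N (b + b') m (g - b - b')
        (Econd P F N (g - b - b') (remainder X Y Y'))].

Definition strictly_controlled (b b' m g : R)
    (Y : R -> Omega -> W) (Y' : R -> Omega -> {ffun 'I_e -> W}) : Prop :=
  controlled b b' m g Y Y' /\
  C2Lm P T F N (b + b') m (g - b - b') (remainder X Y Y').

Definition controlled_norm (b b' m g : R)
    (Y : R -> Omega -> W) (Y' : R -> Omega -> {ffun 'I_e -> W}) : \bar R :=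
  (normE P T N b m g Y + normE P T (opnorm N (e := e)) b' m (g - b)%R Y' +
   norm2 P T N (b + b')%R m (g - b - b')%R
     (Econd P F N (g - b - b')%R (remainder X Y Y')))%E.

End ControlledRoughPaths.

(* For a partition s < pi_0 < ... < pi_(n-1) = t, the interval of index i is
   [left_pt s pi i, right_pt s pi i]. *)
Definition left_pt (R : realType) (s : R) (pi : seq R) (i : nat) : R :=
  nth s (s :: pi) i.
Definition right_pt (R : realType) (s : R) (pi : seq R) (i : nat) : R :=
  nth s pi i.
Definition mesh (R : realType) (s : R) (pi : seq R) : R :=
  \big[Num.max/0]_(i < size pi) (right_pt s pi i - left_pt s pi i).

Section RoughIntegral.
Variables (R : realType) (H : monotone_family R) (T0 : R) (S : propagator H T0).
Variables (d : measure_display) (Omega : measurableType d).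
Variables (P : probability Omega R) (T : R) (F : R -> set (set Omega)).

Definition hdelta (Z : R -> Omega -> ambient H) : R -> R -> Omega -> ambient H :=
  fun s t w => Z t w - prop S s t (Z s w).

Definition hCbLm (b m g : R) (Z : R -> Omega -> ambient H) : Prop :=
  [/\ meas_adapted P T F (@hnorm R H) g Z, CLm P T (@hnorm R H) m g Z &
      (norm2 P T (@hnorm R H) b m g (hdelta Z) < +oo)%E].

Variables (e : nat) (X : R -> 'rV[R]_e) (XX : R -> R -> 'M[R]_e).
Variables (Y : R -> Omega -> {ffun 'I_e -> ambient H}).
Variables (Y' : R -> Omega -> {ffun 'I_e -> {ffun 'I_e -> ambient H}}).

Definition germ (r v : R) (w : Omega) : ambient H :=
  lapp (Y r w) (incr X r v) + lapp2 (Y' r w) (XX r v).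

Definition riemann_sum (s t : R) (pi : seq R) (w : Omega) : ambient H :=
  \sum_(i < size pi)
    prop S (left_pt s pi i) t (germ (left_pt s pi i) (right_pt s pi i) w).

(* Z is the process t |-> \int_0^t S_(r,t) Y_r dX_r. *)
Record is_rough_integral (a b b' m g : R) (Z : R -> Omega -> ambient H) : Prop :=
  IsRoughIntegral {
    integral_space : hCbLm a m (g - b - b') Z ;
    integral_start : aeeq P (Z 0) (fun=> 0) ;
    integral_limit : forall s t, simplex2 T (s, t) ->
      forall eps : R, 0 < eps -> exists2 del : R, 0 < del &
      forall pi, itv_partition s t pi -> mesh s pi < del ->
      (mnorm P (@hnorm R H) m (g - b - b')%R
         (fun w => hdelta Z s t w - riemann_sum s t pi w)%R < eps%:E)%E
  }.

End RoughIntegral.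

(* Main.v *)
(* The integral is sewn from the germ A_(s,t) = Y_s dX_(s,t) + Y'_s XX_(s,t): the
   Riemann sums of S_(r,t) A_(r,v) converge along dyadic partitions. The defect of
   additivity of S A at an intermediate time u splits as D + M. The drift D is of
   order a + b + b' > 1 in H_(g-b-b') and sums up by the triangle inequality. The
   martingale part M = -(R_(s,u) - E_s R_(s,u)) dX_(u,t), where R is the remainder of
   Y, is of order a + b > 1/2 in the smaller space H_(g-b), and sums up by
   Burkholder's inequality: in a Hilbert space, expanding |x + y|^m to second order
   for martingale increments y gives |sum y_i|^2 <= C sum |y_i|^2 in L^m.
   Applying the propagator keeps this splitting, and decomposing [s, t) into
   intervals of length comparable with their distance to t turns the smoothing of S
   into the estimates in H_(g+eta-b-b'); E_s kills M, hence the better exponent of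
   the conditional expectation.
   All bounds are uniform over the filtered probability spaces, so that constants
   can be chosen first. *)

Require Import Defs.
From HB Require Import structures.
From mathcomp Require Import all_boot all_order all_algebra.
From mathcomp Require Import all_classical all_reals all_analysis.
From mathcomp Require Import measurable_realfun.
From mathcomp Require Import ring lra.

Set Implicit Arguments.
Unset Strict Implicit.
Unset Printing Implicit Defensive.

Import Order.TTheory GRing.Theory Num.Theory.
Import numFieldNormedType.Exports.

Local Open Scope classical_set_scope.
Local Open Scope ring_scope.

(** * Hilbert norms and measurable functions *)

(** The martingale part of a defect is worse than the drift by [b'] in order but lies [b'] higher in
    the scale. Smoothing by the propagator trades index against order at par, so in H_(g+eta-b-b')
    with eta >= b' both parts reach the order a + b + b' - eta. This is why the two parts travel
    separately, as a pair with two indices and two rates, through operators, sums and limits. The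
    norm of H_g^e is only equivalent to a Hilbert norm, whereas the induction behind the martingale
    inequality cannot afford a constant at each step. That inequality is therefore applied in H_g
    itself, where the germ takes its values; H_g^e and H_g^(e x e) need no more than conditional
    expectations, for which a factor [K] is harmless. Conditional expectations are defined through
    Bochner integrals but handled through their weak form, orthogonality to fixed vectors supported
    on an event: existence is then a projection in L^2, and the L^m bound a duality argument with
    the test function |f|^(m-2) f. *)

Section SigmaAlgebra.
Variables (J : Type) (D : set J) (G : set (set J)).
Hypothesis sG : sigma_algebra D G.

Lemma sigma_setD (A : set J) : G A -> G (D `\` A).
Proof. by case: sG => _ + _; apply. Qed.

Lemma sigma_dom : G D.
Proof. by rewrite -[D]setD0; apply: sigma_setD; case: sG. Qed.

Lemma sigma_bigcup (A : nat -> set J) : (forall n, G (A n)) -> G (\bigcup_n A n).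
Proof. by case: sG => _ _; apply. Qed.

Lemma sigma_bigcup_count (I : countType) (Q : set I) (A : I -> set J) :
  (forall i, Q i -> G (A i)) -> G (\bigcup_(i in Q) A i).
Proof.
move=> GA.
pose B n := if unpickle n is Some i then
              if `[< Q i >] then A i else set0 else set0.
have -> : \bigcup_(i in Q) A i = \bigcup_n B n.
  apply/seteqP; split=> [j [i Qi Aij]|j [n _]].
    by exists (pickle i) => //; rewrite /B pickleK asboolT.
  rewrite /B; case: unpickle => [i|//].
  by case: asboolP => // Qi Aij; exists i.
apply: sigma_bigcup => n; rewrite /B.
case: unpickle => [i|]; last by case: sG.
by case: asboolP => [/GA //|_]; case: sG.
Qed.

Lemma sigma_setU (A B : set J) : G A -> G B -> G (A `|` B).
Proof.
move=> GA GB.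
have -> : A `|` B = \bigcup_(b : bool) if b then A else B.
  apply/seteqP; split=> [j [?|?]|j [[] _ ?]]; [by exists true|by exists false|by left|by right].
by apply: sigma_bigcup_count => -[].
Qed.

Lemma sigma_setI (A B : set J) : G (D `&` A) -> G (D `&` B) -> G (D `&` (A `&` B)).
Proof.
move=> GA GB.
have -> : D `&` (A `&` B) = D `\` ((D `\` (D `&` A)) `|` (D `\` (D `&` B))).
  apply/seteqP; split=> [j [Dj [Aj Bj]]|j [Dj nj]].
    by split=> // -[[_ []]|[_ []]].
  split=> //; split; apply: contrapT => n; apply: nj; [left|right]; split=> // -[].
    by [].
  by [].
by apply/sigma_setD/sigma_setU; apply: sigma_setD.
Qed.

Lemma sigma_setC (A : set J) : G (D `&` A) -> G (D `&` ~` A).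
Proof.
move=> GA; have -> : D `&` ~` A = D `\` (D `&` A); last exact: sigma_setD.
by apply/seteqP; split=> j [Dj nA]; split=> //; [case|move=> Aj; exact: nA].
Qed.

Lemma sigma_bigcap (A : nat -> set J) :
  (forall n, G (D `&` A n)) -> G (D `&` \bigcap_n A n).
Proof.
move=> GA.
have -> : D `&` \bigcap_n A n = D `&` ~` (\bigcup_n (D `&` ~` A n)).
  apply/seteqP; split=> [j [Dj Aj]|j [Dj nA]]; split=> //.
    by move=> [n _ [_]]; apply; exact: Aj.
  by move=> n _; apply: contrapT => nAn; apply: nA; exists n.
apply: sigma_setC; rewrite setIidr; last by move=> j [n _ []].
by apply: sigma_bigcup => n; apply: sigma_setC.
Qed.

End SigmaAlgebra.

(* An extended norm whose space of vectors of finite norm is a separable Hilbert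
   space for the inner product [ip], up to equivalence of norms. *)
Record hilb (R : realType) (W : lmodType R) (N : W -> \bar R) (ip : W -> W -> R)
    (K : R) : Prop := Hilb {
  hilb_ge0 : forall v, (0 <= N v)%E ;
  hilb0 : N 0 = 0%E ;
  hilbD : forall u v, (N (u + v)%R <= N u + N v)%E ;
  hilbZ : forall c v, (N v < +oo)%E -> (N (c *: v)%R <= `|c|%:E * N v)%E ;
  hilb_eq0 : forall v, N v = 0%E -> v = 0 ;
  hilb_ipC : forall u v, (N u < +oo)%E -> (N v < +oo)%E -> ip u v = ip v u ;
  hilb_ip_lin : forall c u v w, (N u < +oo)%E -> (N v < +oo)%E -> (N w < +oo)%E ->
    ip (c *: u + v) w = c * ip u w + ip v w ;
  hilb_ip_ge0 : forall v, (N v < +oo)%E -> 0 <= ip v v ;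
  hilb_K : 1 <= K ;
  hilb_le_ip : forall v, (N v < +oo)%E -> (N v <= (K * Num.sqrt (ip v v))%:E)%E ;
  hilb_ip_le : forall v, (N v < +oo)%E -> ((Num.sqrt (ip v v))%:E <= K%:E * N v)%E ;
  hilb_separable : exists d : nat -> W, (forall n, (N (d n) < +oo)%E) /\
    forall v, (N v < +oo)%E -> forall eps : R, 0 < eps ->
      exists n, (N (v - d n)%R < eps%:E)%E ;
  hilb_complete : forall u : nat -> W, (forall n, (N (u n) < +oo)%E) ->
    (forall eps : R, 0 < eps -> exists n0, forall n k, (n0 <= n)%N -> (n0 <= k)%N ->
       (N (u n - u k)%R < eps%:E)%E) ->
    exists2 v, (N v < +oo)%E & forall eps : R, 0 < eps ->
      exists n0, forall n, (n0 <= n)%N -> (N (u n - v)%R < eps%:E)%E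
}.

Section Norm.
Variables (R : realType) (W : lmodType R) (N : W -> \bar R) (ip : W -> W -> R) (K : R).
Hypothesis hN : hilb N ip K.
Local Notation fin v := (N v < +oo)%E.

Lemma finV v : fin v -> N v = (fine (N v))%:E.
Proof. by move=> fv; rewrite fineK// ge0_fin_numE// (hilb_ge0 hN). Qed.

Lemma fin0 : fin 0. Proof. by rewrite (hilb0 hN). Qed.

Lemma finD u v : fin u -> fin v -> fin (u + v).
Proof. by move=> fu fv; apply: le_lt_trans (hilbD hN u v) _; rewrite lte_add_pinfty. Qed.

Lemma finZ c v : fin v -> fin (c *: v).
Proof.
move=> fv; apply: le_lt_trans (hilbZ hN c fv) _.
by rewrite (finV fv) -EFinM ltry.
Qed.

Lemma finN v : fin v -> fin (- v).
Proof. by rewrite -scaleN1r; apply: finZ. Qed.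

Lemma finB u v : fin u -> fin v -> fin (u - v).
Proof. by move=> fu fv; apply/finD/finN. Qed.

Lemma fin_sum (I : Type) (r : seq I) (Q : pred I) (F : I -> W) :
  (forall i, Q i -> fin (F i)) -> fin (\sum_(i <- r | Q i) F i).
Proof. by move=> FF; elim/big_ind: _ => //; [exact: fin0|exact: finD]. Qed.

Lemma norm_opp v : N (- v) = N v.
Proof.
have h w : fin w -> (N (- w)%R <= N w)%E.
  by move=> fw; rewrite -scaleN1r; apply: le_trans (hilbZ hN _ fw) _; rewrite normrN1 mul1e.
have [fv|nfv] := boolP (fin v).
  apply/eqP; rewrite eq_le h//=.
  by rewrite -{1}[v]opprK h// finN.
have [fv'|nfv'] := boolP (fin (- v)).
  by move: nfv; rewrite -[v]opprK finN.
by move: nfv nfv'; rewrite -!leNgt !leye_eq => /eqP -> /eqP ->.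
Qed.

Lemma norm_distC u v : N (u - v) = N (v - u).
Proof. by rewrite -norm_opp opprB. Qed.

Lemma norm_dist_triangle w u v : (N (u - v)%R <= N (u - w)%R + N (w - v)%R)%E.
Proof. by rewrite -[u in X in (N X <= _)%E](subrK w) -addrA (hilbD hN). Qed.

Lemma norm_le_dist u v : (N u <= N (u - v)%R + N v)%E.
Proof. by rewrite -[u in X in (X <= _)%E](subrK v) (hilbD hN). Qed.

(** The Hilbert norm, as opposed to the given norm [N]. Expansions of squares hold for it exactly,
    while [N] is what the statements measure; on vectors of finite norm the two differ by the factor
    [K]. *)
Definition qn v := Num.sqrt (ip v v).

Lemma qn_ge0 v : 0 <= qn v. Proof. exact: sqrtr_ge0. Qed.

Lemma qn_sqr v : fin v -> qn v ^+ 2 = ip v v.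
Proof. by move=> fv; rewrite sqr_sqrtr// (hilb_ip_ge0 hN). Qed.

Lemma norm_le_qn v : fin v -> fine (N v) <= K * qn v.
Proof. by move=> fv; have := hilb_le_ip hN fv; rewrite {1}(finV fv) lee_fin. Qed.

Lemma qn_le_norm v : fin v -> qn v <= K * fine (N v).
Proof. by move=> fv; have := hilb_ip_le hN fv; rewrite (finV fv) -EFinM lee_fin. Qed.

Lemma ipDl u v w : fin u -> fin v -> fin w -> ip (u + v) w = ip u w + ip v w.
Proof. by move=> *; rewrite -{1}[u]scale1r (hilb_ip_lin hN)// mul1r. Qed.

Lemma ip0l w : fin w -> ip 0 w = 0.
Proof.
move=> fw; have := @ipDl 0 0 w fin0 fin0 fw.
by rewrite addr0 => /eqP; rewrite -subr_eq subrr => /eqP.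
Qed.

Lemma ipZl c u w : fin u -> fin w -> ip (c *: u) w = c * ip u w.
Proof.
by move=> fu fw; rewrite -[c *: u]addr0 (hilb_ip_lin hN)// ?ip0l ?addr0//; exact: fin0.
Qed.

Lemma ipNl u w : fin u -> fin w -> ip (- u) w = - ip u w.
Proof. by move=> *; rewrite -scaleN1r ipZl// mulN1r. Qed.

Lemma ipBl u v w : fin u -> fin v -> fin w -> ip (u - v) w = ip u w - ip v w.
Proof. by move=> fu fv fw; rewrite ipDl ?ipNl//; exact: finN. Qed.

Lemma ipDr u v w : fin u -> fin v -> fin w -> ip w (u + v) = ip w u + ip w v.
Proof.
move=> fu fv fw; rewrite (hilb_ipC hN) ?ipDl//; last exact: finD.
by rewrite (hilb_ipC hN fu)// (hilb_ipC hN fv).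
Qed.

Lemma ipZr c u w : fin u -> fin w -> ip w (c *: u) = c * ip w u.
Proof.
move=> fu fw; rewrite (hilb_ipC hN) ?ipZl//; last exact: finZ.
by rewrite (hilb_ipC hN fu).
Qed.

Lemma ipNr u w : fin u -> fin w -> ip w (- u) = - ip w u.
Proof. by move=> *; rewrite -scaleN1r ipZr// mulN1r. Qed.

Lemma ipBr u v w : fin u -> fin v -> fin w -> ip w (u - v) = ip w u - ip w v.
Proof. by move=> fu fv fw; rewrite ipDr ?ipNr//; exact: finN. Qed.

Lemma qn_sqrD u v : fin u -> fin v ->
  qn (u + v) ^+ 2 = qn u ^+ 2 + 2 * ip u v + qn v ^+ 2.
Proof.
move=> fu fv; have fuv := finD fu fv.
rewrite !qn_sqr// ipDl// !ipDr// (hilb_ipC hN fv fu); ring.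
Qed.

Lemma qnZ c v : fin v -> qn (c *: v) = `|c| * qn v.
Proof.
move=> fv; rewrite /qn ipZl ?ipZr//; last exact: finZ.
by rewrite mulrA sqrtrM ?sqr_ge0 -?expr2 ?sqrtr_sqr// sqr_ge0.
Qed.

Lemma qnN v : fin v -> qn (- v) = qn v.
Proof. by move=> fv; rewrite -scaleN1r qnZ// normrN1 mul1r. Qed.

Lemma cauchy_schwarz u v : fin u -> fin v -> `|ip u v| <= qn u * qn v.
Proof.
have key x y : fin x -> fin y -> ip x y <= qn x * qn y.
  move=> fx fy; have [y0|y0] := eqVneq (qn y) 0.
    have -> : y = 0.
      apply: (hilb_eq0 hN); apply/eqP; rewrite eq_le (hilb_ge0 hN) andbT.
      by apply: le_trans (hilb_le_ip hN fy) _; rewrite -/(qn y) y0 mulr0.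
    by rewrite (hilb_ipC hN) ?ip0l ?mulr_ge0 ?qn_ge0//; exact: fin0.
  have [x0|x0] := eqVneq (qn x) 0.
    have -> : x = 0.
      apply: (hilb_eq0 hN); apply/eqP; rewrite eq_le (hilb_ge0 hN) andbT.
      by apply: le_trans (hilb_le_ip hN fx) _; rewrite -/(qn x) x0 mulr0.
    by rewrite ip0l ?mulr_ge0 ?qn_ge0.
  have px : 0 < qn x by rewrite lt_def x0 qn_ge0.
  have py : 0 < qn y by rewrite lt_def y0 qn_ge0.
  have fy' : fin (- (qn x *: y)) by exact/finN/finZ.
  (* Expanding this square gives 2 |x| |y| (|x| |y| - <x, y>) >= 0, and both norms are positive
     here. *)
  have := sqr_ge0 (qn (qn y *: x - qn x *: y)).
  rewrite qn_sqrD ?qnN ?qnZ//; try (by do ?[exact: finZ|exact: finN]).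
  rewrite ipNr ?ipZl ?ipZr//; try exact: finZ.
  rewrite !ger0_norm ?qn_ge0// => h.
  have {h} h : 0 <= (qn x * qn y) * (qn x * qn y - ip x y) by nra.
  have pp : 0 < qn x * qn y by exact: mulr_gt0.
  by move: h; rewrite pmulr_rge0// subr_ge0.
move=> fu fv; rewrite ler_norml key// andbT lerNl -ipNl//.
by apply: le_trans (key _ _ _ _) _; rewrite ?qnN//; exact: finN.
Qed.

Lemma qnD u v : fin u -> fin v -> qn (u + v) <= qn u + qn v.
Proof.
move=> fu fv; rewrite -(@ler_pXn2r _ 2) ?nnegrE ?addr_ge0 ?qn_ge0//.
rewrite qn_sqrD// sqrrD; have := cauchy_schwarz fu fv.
rewrite ler_norml => /andP[_]; lra.
Qed.

Lemma qn_le_dist u v : fin u -> fin v -> qn u <= qn v + qn (u - v).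
Proof.
move=> fu fv; rewrite -[u in X in X <= _](subrK v) addrC.
by apply: qnD => //; exact: finB.
Qed.

Lemma qn0 : qn 0 = 0. Proof. by rewrite /qn ip0l ?sqrtr0//; exact: fin0. Qed.

End Norm.

(** * Functions with countably many values and Borel measurability *)

Section Steps.
Variables (R : realType) (W : lmodType R) (N : R -> W -> \bar R) (g : R).
Variables (ip : W -> W -> R) (K : R).
Hypothesis hN : hilb (N g) ip K.
Variables (J : Type) (D : set J) (G : set (set J)).
Hypothesis sG : sigma_algebra D G.
Local Notation fin v := (N g v < +oo)%E.

(** Countably many values rather than finitely many, so that the approximation can be uniform. The
    coding by an index with measurable level sets and a table of values lets any map that keeps
    norms finite, measurable or not, act on the table. *)
Definition step (f : J -> W) := exists (k : J -> nat) (v : nat -> W),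
  [/\ forall i, G (D `&` k @^-1` [set i]), forall i, fin (v i) & f = v \o k].

Lemma step_count (I : countType) (k : J -> I) (v : I -> W) :
  (forall i, G (D `&` k @^-1` [set i])) -> (forall i, fin (v i)) -> step (v \o k).
Proof.
move=> Gk fv.
exists (pickle \o k), (fun n => if unpickle n is Some i then v i else 0).
split.
- move=> n; case: (pselect (exists i : I, pickle i = n)) => [[i <-]|ni].
    have -> : D `&` (pickle \o k) @^-1` [set pickle i] = D `&` k @^-1` [set i]; last exact: Gk.
    apply/seteqP; split=> j [Dj] /=; last by move=> ->.
    by move=> /(pcan_inj (@pickleK I)).
  have -> : D `&` (pickle \o k) @^-1` [set n] = set0; last by case: sG.
  by apply/seteqP; split=> j // [_ /= kj]; apply: ni; exists (k j).
- by move=> n; case: unpickle => [i|]; [exact: fv|exact: (fin0 hN)].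
- by apply/funext => j /=; rewrite pickleK.
Qed.

Lemma step_preimage (I : countType) (k : J -> I) (A : set I) :
  (forall i, G (D `&` k @^-1` [set i])) -> G (D `&` k @^-1` A).
Proof.
move=> Gk; have -> : D `&` k @^-1` A = \bigcup_(i in A) (D `&` k @^-1` [set i]).
  apply/seteqP; split=> [j [Dj Aj]|j [i Ai [Dj ki]]]; first by exists (k j).
  by split=> //; rewrite /preimage /= ki.
by apply: (sigma_bigcup_count sG) => i _; exact: Gk.
Qed.

Lemma step_pair (I1 I2 : countType) (k1 : J -> I1) (k2 : J -> I2) :
  (forall i, G (D `&` k1 @^-1` [set i])) -> (forall i, G (D `&` k2 @^-1` [set i])) ->
  forall i, G (D `&` (fun j => (k1 j, k2 j)) @^-1` [set i]).
Proof.
move=> G1 G2 [i1 i2].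
have -> : D `&` (fun j => (k1 j, k2 j)) @^-1` [set (i1, i2)] =
  D `&` (k1 @^-1` [set i1] `&` k2 @^-1` [set i2]).
  by apply/seteqP; split=> j [Dj] /=; [move=> [-> ->]|move=> [-> ->]].
exact: sigma_setI.
Qed.

Lemma step_fun2 (f1 f2 : J -> W) (phi : W -> W -> W) :
  (forall u v, fin u -> fin v -> fin (phi u v)) ->
  step f1 -> step f2 -> step (fun j => phi (f1 j) (f2 j)).
Proof.
move=> fphi [k1 [v1 [G1 F1 ->]]] [k2 [v2 [G2 F2 ->]]].
apply: (@step_count (nat * nat)%type (fun j => (k1 j, k2 j))
   (fun i => phi (v1 i.1) (v2 i.2))).
  exact: step_pair.
by move=> i; exact: fphi.
Qed.

Lemma step_cst v : fin v -> step (fun=> v).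
Proof.
move=> fv; exists (fun=> 0%N), (fun=> v); split=> // i.
have [->|i0] := eqVneq i 0%N.
  have -> : D `&` (fun=> 0%N) @^-1` [set 0%N] = D by apply/seteqP; split=> [j []|j].
  exact: sigma_dom.
have -> : D `&` (fun=> 0%N) @^-1` [set i] = set0; last by case: sG.
by apply/seteqP; split=> j // [_ /= /esym/eqP]; rewrite (negbTE i0).
Qed.

Lemma step_fin f j : step f -> fin (f j).
Proof. by move=> [k [v [_ fv ->]]] /=. Qed.

(** The factor 2 is that of the geometric tail: the powers 2^-k with k >= n add up to 2 * 2^-n. *)
Lemma eps_small (eps : R) : 0 < eps -> exists n, 2 * (2 ^+ n)^-1 < eps.
Proof.
move=> e0; exists (Num.bound (2 * eps^-1)).
rewrite ltr_pdivrMr ?exprn_gt0// mulrC -ltr_pdivrMr//.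
apply: (lt_trans (archi_boundP _)); first by rewrite mulr_ge0// invr_ge0 ltW.
by rewrite -natrX ltr_nat ltn_expl.
Qed.

(** The preimage of an open set [U] is the countable union of the events that the n-th approximation
    falls into the set [Un n] of vectors whose ball of radius 2^-n lies in [U]. No measurability of
    [Un n] is involved, since a step function pulls back every set to a measurable one. *)
Lemma step_approx (f : J -> W) :
  (forall eps : R, 0 < eps -> exists2 h, step h &
     forall j, D j -> (N g (f j - h j)%R < eps%:E)%E) ->
  borel_on N g D G f.
Proof.
move=> H; split.
  move=> j Dj; have [h sh fh] := H 1 ltr01.
  apply: le_lt_trans (norm_le_dist hN (f j) (h j)) _.
  rewrite lte_add_pinfty ?(step_fin j sh)//.
  exact: lt_trans (fh j Dj) (ltry _).
move=> U oU.
have /choice[h Hh] : forall n, exists h, step h /\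
    forall j, D j -> (N g (f j - h j)%R < ((2 ^+ n)^-1)%:E)%E.
  move=> n; have [|h sh fh] := H (2 ^+ n)^-1; first by rewrite invr_gt0 exprn_gt0.
  by exists h.
pose Un n v := forall u, (N g (u - v)%R < ((2 ^+ n)^-1)%:E)%E -> U u.
have -> : D `&` f @^-1` U = \bigcup_n (D `&` h n @^-1` (Un n)).
  apply/seteqP; split=> [j [Dj Uj]|j [n _ [Dj Unj]]]; last first.
    by split=> //; apply: Unj; apply: (Hh n).2.
  have [|eps eps0 Ueps] := oU _ Uj.
    apply: le_lt_trans (norm_le_dist hN (f j) (h 0%N j)) _.
    rewrite lte_add_pinfty ?(step_fin j (Hh 0%N).1)//.
    exact: lt_trans ((Hh 0%N).2 j Dj) (ltry _).
  have [n hn] := eps_small eps0.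
  exists n => //; split=> // u hu; apply: Ueps.
  apply: le_lt_trans (norm_dist_triangle hN (h n j) _ _) _.
  apply: lt_trans (_ : (2 * (2 ^+ n)^-1)%:E < _)%E; last by rewrite lte_fin.
  rewrite mulr_natl mulr2n EFinD; apply: lteD => //.
  by rewrite (norm_distC hN); exact: (Hh n).2.
apply: (sigma_bigcup sG) => n.
have [k [v [Gk _ ->]]] := (Hh n).1.
by rewrite comp_preimage; apply: step_preimage.
Qed.

Lemma gopen_ball v (r : R) : gopen N g [set u | (N g (u - v)%R < r%:E)%E].
Proof.
move=> u /= uv fu.
have f0 : fin (u - v) by exact: lt_trans uv (ltry _).
exists (r - fine (N g (u - v))).
  by rewrite subr_gt0 -lte_fin -(finV hN f0).
move=> w wu; apply: le_lt_trans (norm_dist_triangle hN u _ _) _.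
rewrite (finV hN f0) -lteBrDr//.
Qed.

(** By separability: each point of [D] is sent to the first vector of a dense sequence within [eps]
    of its value. *)
Lemma borel_step (f : J -> W) : borel_on N g D G f ->
  forall eps : R, 0 < eps -> exists2 h, step h &
     forall j, D j -> (N g (f j - h j)%R < eps%:E)%E.
Proof.
move=> [ff bf] eps eps0; have [d [fd dd]] := hilb_separable hN.
pose Q j i := (N g (f j - d i)%R < eps%:E)%E.
pose k j := xget 0%N [set i | Q j i /\ forall l, (l < i)%N -> ~ Q j l].
have kP j : D j -> Q j (k j) /\ forall l, (l < k j)%N -> ~ Q j l.
  move=> Dj; rewrite /k; case: xgetP => [i -> //|].
  have [i0 Qi0] := dd _ (ff j Dj) _ eps0.
  have ex : exists i, `[< Q j i >] by exists i0; apply/asboolP.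
  move/(_ (ex_minn ex)) => []; case: ex_minnP => i /asboolP Qi mi.
  by split=> // l li /asboolP /mi; rewrite leqNgt li.
have GQ i : G (D `&` [set j | Q j i]) by exact: (bf _ (gopen_ball (v:=d i) (r:=eps))).
exists (d \o k); last by move=> j /kP[].
exists k, d; split=> // i.
have -> : D `&` k @^-1` [set i] =
    D `&` ([set j | Q j i] `&` ~` (\bigcup_(l in [set l | (l < i)%N]) (D `&` [set j | Q j l]))).
  apply/seteqP; split=> [j [Dj /= kj]|j [Dj [Qi nQ]]].
    have [Qk mk] := kP j Dj; rewrite -kj; split=> //; split=> //.
    by move=> [l /= lk [_ Ql]]; exact: mk lk Ql.
  split=> //=; have [Qk mk] := kP j Dj.
  case: (ltngtP (k j) i) => // lt; exfalso; last exact: mk lt Qi.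
  by apply: nQ; exists (k j).
apply: (sigma_setI sG) => //; apply: (sigma_setC sG).
have -> : D `&` \bigcup_(l in [set l | (l < i)%N]) (D `&` [set j | Q j l]) =
    \bigcup_(l in [set l | (l < i)%N]) (D `&` [set j | Q j l]).
  by rewrite setIidr// => j [l _ []].
by apply: (sigma_bigcup_count sG) => l _; exact: GQ.
Qed.

(** The subtracted term makes the bound an exact partial sum of the geometric series, which is what
    closes the induction. *)
Lemma telescope_bound (f_ : nat -> J -> W) q j :
  (forall n, (q <= n)%N -> (N g (f_ n.+1 j - f_ n j)%R <= ((2 ^+ n)^-1)%:E)%E) ->
  forall n p, (q <= n)%N ->
    (N g (f_ (n + p)%N j - f_ n j)%R <= (2 * (2 ^+ n)^-1 - 2 * (2 ^+ (n + p))^-1)%:E)%E.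
Proof.
move=> H n p qn; elim: p => [|p IH].
  by rewrite addn0 !subrr (hilb0 hN).
apply: le_trans (norm_dist_triangle hN (f_ (n + p)%N j) _ _) _.
rewrite addnS; apply: le_trans (leeD (H _ _) IH) _.
  by rewrite (leq_trans qn)// leq_addr.
rewrite -EFinD lee_fin exprS invfM; lra.
Qed.

(** The set where the increments are below 2^-n from [q] on is measurable, because two step
    functions are jointly indexed by a countable type. On the union of these sets the sequence is
    Cauchy; elsewhere the limit is set to 0, so that it is defined everywhere. *)
Lemma step_limit (f_ : nat -> J -> W) : (forall n, step (f_ n)) ->
  exists2 f, borel_on N g D G f & forall j, D j ->
    (exists q, forall n, (q <= n)%N ->
       (N g (f_ n.+1 j - f_ n j)%R <= ((2 ^+ n)^-1)%:E)%E) ->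
    forall eps : R, 0 < eps -> exists n0, forall n, (n0 <= n)%N ->
      (N g (f_ n j - f j)%R < eps%:E)%E.
Proof.
move=> sf.
pose A n j := (N g (f_ n.+1 j - f_ n j)%R <= ((2 ^+ n)^-1)%:E)%E.
pose C q j := forall n, (q <= n)%N -> A n j.
have GA n : G (D `&` [set j | A n j]).
  have [k1 [v1 [G1 _ e1]]] := sf n.+1; have [k2 [v2 [G2 _ e2]]] := sf n.
  have := step_preimage [set i | (N g (v1 i.1 - v2 i.2)%R <= ((2 ^+ n)^-1)%:E)%E]
    (step_pair G1 G2).
  by rewrite /A e1 e2.
have GC q : G (D `&` [set j | C q j]).
  have -> : [set j | C q j] = \bigcap_n [set j | (q <= n)%N -> A n j].
    by apply/seteqP; split=> [j Cj n _ /=|j Cj n]; [exact: Cj|exact: Cj].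
  apply: (sigma_bigcap sG) => n; have [qn|nqn] := leqP q n.
    have -> : [set j | true -> A n j] = [set j | A n j]; last exact: GA.
    by apply/seteqP; split=> j /=; [apply|].
  have -> : [set j | false -> A n j] = setT by apply/seteqP; split.
  by rewrite setIT; exact: (sigma_dom sG).
pose lim_at j v := fin v /\ forall q, C q j -> forall n, (q <= n)%N ->
   (N g (f_ n j - v)%R <= (2 * (2 ^+ n)^-1)%:E)%E.
have limP j q : C q j -> exists v, lim_at j v.
  move=> Cj.
  have [n|eps e0|v fv lv] := @hilb_complete _ _ _ _ _ hN (fun n => f_ n j).
  - exact: step_fin (sf n).
  - have [n0 hn0] := eps_small (divr_gt0 e0 (ltr0n _ 2)).
    exists (maxn q n0) => n k; rewrite !geq_max => /andP[qn n0n] /andP[qk n0k].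
    apply: le_lt_trans (norm_dist_triangle hN (f_ (maxn q n0) j) _ _) _.
    have B l : (maxn q n0 <= l)%N ->
        (N g (f_ l j - f_ (maxn q n0) j)%R < (eps / 2)%:E)%E.
      move=> hl; rewrite -(subnKC hl).
      apply: le_lt_trans (telescope_bound Cj _ _) _; first exact: leq_maxl.
      rewrite lte_fin; apply: le_lt_trans hn0.
      apply: (@le_trans _ _ (2 * (2 ^+ maxn q n0)^-1)).
        by rewrite gerBl mulr_ge0// invr_ge0 exprn_ge0.
      by rewrite ler_pM2l// lef_pV2 ?posrE ?exprn_gt0// ler_eXn2l ?ltr1n// leq_maxr.
    apply: lt_le_trans (_ : (eps / 2 + eps / 2)%:E <= _)%E; last by rewrite -splitr.
    rewrite EFinD; apply: lteD; first by apply: B; rewrite geq_max qn.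
    by rewrite (norm_distC hN) B// geq_max qk.
  exists v; split=> // q' Cq' n qn; apply/lee_addgt0Pr => e e0.
  have [n0 hn0] := lv _ e0.
  apply: le_trans (norm_dist_triangle hN (f_ (n + n0)%N j) _ _) _.
  apply: leeD; last by rewrite ltW// hn0// leq_addl.
  rewrite (norm_distC hN); apply: le_trans (telescope_bound Cq' _ qn) _.
  by rewrite lee_fin gerBl mulr_ge0// invr_ge0 exprn_ge0.
pose good j := exists q, C q j.
pose f j := if `[< good j >] then xget 0 [set v | lim_at j v] else 0.
have fP j : good j -> lim_at j (f j).
  move=> gj; rewrite /f; case: asboolP => // _.
  case: xgetP => [v _ //|]; case: gj => q /limP[v hv] /(_ v); contradiction.
exists f; last first.
  move=> j Dj [q Cq] eps e0; have [n0 hn0] := eps_small e0.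
  exists (maxn q n0) => n; rewrite geq_max => /andP[qn n0n].
  have [_ h] := fP j (ex_intro _ q Cq).
  apply: le_lt_trans (h q Cq n qn) _; rewrite lte_fin.
  apply: le_lt_trans hn0.
  rewrite ler_pM2l// lef_pV2 ?posrE ?exprn_gt0// ler_eXn2l ?ltr1n//.
(* At distance [p] past the first index [qj] from which convergence is fast, the sequence is within
   [eps] of its limit. This diagonal choice is again a step function, indexed by [qj] and by the
   index of the value taken. *)
apply: step_approx => eps e0; have [p hp] := eps_small e0.
have /choice[k /choice[v kv]] := sf.
pose Q q j := C q j /\ forall l, (l < q)%N -> ~ C l j.
pose qj j := xget 0%N [set q | Q q j].
have qP j : good j -> Q (qj j) j.
  move=> [q0 Cq0]; rewrite /qj; case: xgetP => [i _ //|].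
  have ex : exists i, `[< C i j >] by exists q0; apply/asboolP.
  move/(_ (ex_minn ex)) => []; case: ex_minnP => i /asboolP Qi mi.
  by split=> // l li /asboolP /mi; rewrite leqNgt li.
pose idx j : option (nat * nat) :=
  if `[< good j >] then Some (qj j, k (qj j + p)%N j) else None.
pose val (o : option (nat * nat)) := if o is Some i then v (i.1 + p)%N i.2 else 0.
exists (val \o idx).
  apply: step_count; last first.
    move=> [i|] /=; last exact: (fin0 hN).
    by case: (kv (i.1 + p)%N).
  have Ggood : G (D `&` [set j | good j]).
    have -> : D `&` [set j | good j] = \bigcup_q (D `&` [set j | C q j]).
      by apply/seteqP; split=> [j [Dj [q Cq]]|j [q _ [Dj Cq]]]; [exists q|split=> //; exists q].
    exact: (sigma_bigcup sG).
  move=> [[q i]|]; last first.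
    have -> : D `&` idx @^-1` [set None] = D `&` ~` [set j | good j].
      apply/seteqP; split=> j [Dj] /=; rewrite /idx; case: asboolP => //.
    exact: (sigma_setC sG).
  have -> : D `&` idx @^-1` [set Some (q, i)] =
     D `&` (([set j | C q j] `&` ~` (\bigcup_(l in [set l | (l < q)%N]) (D `&` [set j | C l j])))
            `&` k (q + p)%N @^-1` [set i]).
    apply/seteqP; split=> j [Dj] /=; rewrite /idx; case: asboolP => // gj.
    - move=> [<- <-]; split=> //; split=> //; have [h1 h2] := qP j gj; split=> //.
      by move=> [l /= /h2 h [_]].
    - move=> [[Cq nC] ki]; have [h1 h2] := qP j gj.
      have -> : qj j = q.
        case: (ltngtP (qj j) q) => // lt; exfalso; last exact: h2 lt Cq.
        by apply: nC; exists (qj j).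
      by rewrite ki.
    - by move=> [[Cq _] _]; exfalso; apply: gj; exists q.
  apply: (sigma_setI sG); last by case: (kv (q + p)%N).
  apply: (sigma_setI sG) => //; apply: (sigma_setC sG).
  have -> : D `&` \bigcup_(l in [set l | (l < q)%N]) (D `&` [set j | C l j]) =
      \bigcup_(l in [set l | (l < q)%N]) (D `&` [set j | C l j]).
    by rewrite setIidr// => j [l _ []].
  by apply: (sigma_bigcup_count sG) => l _; exact: GC.
move=> j Dj; rewrite /= /idx; case: asboolP => [gj|ngj] /=.
  have [h1 _] := qP j gj; have [_ h] := fP j gj.
  have [_ _ /(congr1 (@^~ j)) /= <-] := kv (qj j + p)%N.
  rewrite (norm_distC hN); apply: le_lt_trans (h _ h1 _ (leq_addr _ _)) _.
  rewrite lte_fin; apply: le_lt_trans hp.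
  by rewrite ler_pM2l// lef_pV2 ?posrE ?exprn_gt0// ler_eXn2l ?ltr1n// leq_addl.
by rewrite /f; case: asboolP => // _; rewrite subrr (hilb0 hN) lte_fin.
Qed.

End Steps.
Lemma step_map2 (R : realType) (W1 W2 W3 : lmodType R)
    (N1 : R -> W1 -> \bar R) (N2 : R -> W2 -> \bar R) (N3 : R -> W3 -> \bar R)
    (g1 g2 g3 : R) (ip : W3 -> W3 -> R) (K : R) (h3 : hilb (N3 g3) ip K)
    (J : Type) (D : set J) (G : set (set J)) (sG : sigma_algebra D G)
    (phi : W1 -> W2 -> W3) (f1 : J -> W1) (f2 : J -> W2) :
  (forall u v, (N1 g1 u < +oo)%E -> (N2 g2 v < +oo)%E -> (N3 g3 (phi u v) < +oo)%E) ->
  step N1 g1 D G f1 -> step N2 g2 D G f2 ->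
  step N3 g3 D G (fun j => phi (f1 j) (f2 j)).
Proof.
move=> fphi [k1 [v1 [G1 F1 ->]]] [k2 [v2 [G2 F2 ->]]].
apply: (@step_count R W3 N3 g3 ip K h3 J D G sG (nat * nat)%type (fun j => (k1 j, k2 j))
   (fun i => phi (v1 i.1) (v2 i.2))).
  exact: step_pair.
by move=> i; exact: fphi.
Qed.

(** * Random variables modulo null sets and their moments *)

Section CompleteProbability.
Variables (R : realType) (d : measure_display) (Omega : measurableType d).
Variables (P : probability Omega R).

(** With the null sets in [G], a change on a null set preserves measurability, and almost sure
    limits may be redefined off a set of full measure. *)
Record complete_sigma (G : set (set Omega)) : Prop := CompleteSigma {
  complete_sigmaP : sigma_algebra setT G ;
  complete_sigma_meas : G `<=` measurable ;
  complete_sigma_null : P.-negligible `<=` G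
}.

Lemma ae2 (Q1 Q2 Q : Omega -> Prop) : {ae P, forall w, Q1 w} -> {ae P, forall w, Q2 w} ->
  (forall w, Q1 w -> Q2 w -> Q w) -> {ae P, forall w, Q w}.
Proof. by move=> h1 h2 H; apply: filterS2 h1 h2. Qed.

Lemma ae1 (Q1 Q : Omega -> Prop) : {ae P, forall w, Q1 w} ->
  (forall w, Q1 w -> Q w) -> {ae P, forall w, Q w}.
Proof. by move=> h1 H; apply: filterS h1. Qed.

Lemma ae_preimage (G : set (set Omega)) (V : Type) (f f' : Omega -> V) (U : set V) :
  complete_sigma G -> {ae P, forall w, f w = f' w} -> G (f' @^-1` U) -> G (f @^-1` U).
Proof.
move=> [sG Gm Gn] e Gf.
pose E := [set w | f w = f' w].
have Gc A : A `<=` ~` E -> G A.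
  by move=> AE; apply: Gn; apply: (negligibleS AE); exact: e.
have -> : f @^-1` U = (setT `&` (f' @^-1` U `&` ~` (~` E))) `|` (f @^-1` U `&` ~` E).
  rewrite setCK setTI; apply/seteqP; split=> w /=.
    by move=> Uf; case: (pselect (E w)) => Ew; [left; rewrite -[f' w]Ew|right].
  by move=> [[Uf Ew]|[]//]; rewrite [f w]Ew.
apply: (sigma_setU sG); last by apply: Gc => w [].
apply: (sigma_setI sG); first by rewrite setTI.
by apply: (sigma_setC sG); rewrite setTI; apply: Gc.
Qed.

Lemma ae_measurable (d' : measure_display) (V : measurableType d') (f f' : Omega -> V)
    (G : set (set Omega)) : complete_sigma G ->
  {ae P, forall w, f w = f' w} -> measurable_fun setT f' -> measurable_fun setT f.
Proof.
move=> cG e mf' _ U mU; rewrite setTI.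
have cm : complete_sigma (measurable : set (set Omega)).
  split=> //; last by move=> A nA; apply: (complete_sigma_meas cG); apply: (complete_sigma_null cG).
  split=> [|A mA|A mA]; [exact: measurable0|by rewrite setTD; exact: measurableC|exact: bigcupT_measurable].
by apply: (ae_preimage cm e); rewrite -[X in measurable X]setTI; exact: mf'.
Qed.

Lemma complete_measurable (G : set (set Omega)) : complete_sigma G ->
  complete_sigma (measurable : set (set Omega)).
Proof.
move=> cG; split=> //; last first.
  by move=> A nA; apply: (complete_sigma_meas cG); apply: (complete_sigma_null cG).
split=> [|A mA|A mA]; [exact: measurable0|by rewrite setTD; exact: measurableC|exact: bigcupT_measurable].
Qed.

Section OneNorm.
Variables (W : lmodType R) (N : R -> W -> \bar R) (g : R) (ip : W -> W -> R) (K : R).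
Hypothesis hN : hilb (N g) ip K.
Local Notation fin v := (N g v < +oo)%E.
Local Notation rv := (random_var P N g).
Implicit Types (G : set (set Omega)) (xi zeta : Omega -> W).

Lemma rv_ae G xi zeta : aeeq P zeta xi -> rv G xi -> rv G zeta.
Proof. by move=> e [xi' b e']; exists xi' => //; apply: ae2 e e' _ => w -> ->. Qed.

Lemma rv_sub G G' xi : G `<=` G' -> rv G xi -> rv G' xi.
Proof.
move=> GG [xi' [f b] e]; exists xi' => //; split=> // U oU; apply: GG; exact: b.
Qed.

Lemma rv_fin G xi : rv G xi -> {ae P, forall w, fin (xi w)}.
Proof. by move=> [xi' [f _] e]; apply: ae1 e _ => w ->; exact: f. Qed.

Lemma rv_borel G xi : complete_sigma G -> rv G xi -> (forall w, fin (xi w)) ->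
  borel_on N g setT G xi.
Proof.
move=> cG [xi' [_ b] e] f; split=> // U oU; rewrite setTI.
by apply: (ae_preimage cG e); rewrite -[X in G X]setTI; exact: b.
Qed.

(** This criterion does not mention open sets, so Lipschitz images of random variables can be
    treated by acting on the approximations. *)
Lemma rvP G xi : complete_sigma G -> rv G xi <->
  (forall eps : R, 0 < eps -> exists2 h, step N g setT G h &
     {ae P, forall w, (N g (xi w - h w)%R < eps%:E)%E}).
Proof.
move=> cG; have sG := complete_sigmaP cG; split.
  move=> [xi' b e] eps e0; have [h sh hh] := borel_step hN sG b e0.
  by exists h => //; apply: ae1 e _ => w ->; exact: hh.
move=> H; have H' n : exists h, step N g setT G h /\
    {ae P, forall w, (N g (xi w - h w)%R < ((2 ^+ n)^-1)%:E)%E}.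
  have [|h sh hh] := H (2 ^+ n)^-1; first by rewrite invr_gt0 exprn_gt0.
  by exists h.
have [h hP] := choice H'.
(* All the approximations are good on one set [Q] of full measure, which belongs to [G] by
   completeness; the version of [xi] is 0 outside it. *)
have := ae_foralln (fun n => (hP n).2).
set Q := fun w => _ => aeQ.
pose f w := if `[< Q w >] then xi w else 0.
exists f; last by apply: ae1 aeQ _ => w Qw; rewrite /f asboolT.
apply: (step_approx hN sG) => eps e0.
have [n hn] := eps_small e0.
exists (fun w => if `[< Q w >] then h n w else 0).
  have [k [v [Gk fv hE]]] := (hP n).1.
  pose idx w := if `[< Q w >] then Some (k w) else None.
  have -> : (fun w => if `[< Q w >] then h n w else 0) =
      (fun o => if o is Some i then v i else 0) \o idx.
    by apply/funext => w /=; rewrite /idx hE; case: asboolP.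
  apply: (step_count hN sG); last by move=> [i|] //; exact: (fin0 hN).
  have GQ : G (setT `&` Q).
    rewrite -[Q]setCK; apply: (sigma_setC sG); rewrite setTI.
    exact: (complete_sigma_null cG).
  move=> [i|].
    have -> : [set: Omega] `&` idx @^-1` [set Some i] = setT `&` (Q `&` k @^-1` [set i]).
      rewrite /idx; apply/seteqP; split=> w [_] /=; case: asboolP => //.
        by move=> ? [->].
      by move=> _ [_ ->].
      by move=> ? [].
    exact: (sigma_setI sG).
  have -> : [set: Omega] `&` idx @^-1` [set None] = setT `&` ~` Q.
    by rewrite /idx; apply/seteqP; split=> w [_] /=; case: asboolP.
  exact: (sigma_setC sG).
move=> w _; rewrite /f; case: asboolP => [Qw|_]; last by rewrite subrr (hilb0 hN) lte_fin.
apply: lt_trans (Qw n) _; rewrite lte_fin; apply: le_lt_trans hn.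
by rewrite ler_peMl// ?invr_ge0 ?exprn_ge0// ler1n.
Qed.

Lemma step_rv G h : complete_sigma G -> step N g setT G h -> rv G h.
Proof.
move=> cG sh; exists h; last exact: aeW.
apply: (step_approx hN (complete_sigmaP cG)) => eps e0; exists h => // j _.
by rewrite subrr (hilb0 hN) lte_fin.
Qed.

Lemma rv_cst G v : complete_sigma G -> fin v -> rv G (fun=> v).
Proof. by move=> cG fv; apply: step_rv => //; exact: (step_cst (complete_sigmaP cG) fv). Qed.

Lemma rv_measurable G xi (phi : W -> \bar R) : complete_sigma G ->
  (forall r : R, gopen N g [set v | (phi v < r%:E)%E]) -> rv G xi ->
  measurable_fun setT (phi \o xi).
Proof.
move=> cG oU [xi' [_ b] e].
apply: (@ae_measurable _ _ _ (phi \o xi') G cG); first by apply: ae1 e _ => w /= ->.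
move=> mT; apply: (measurability _ (ErealGenInftyO.measurableE R)) => //.
move=> _ [_ [r ->] <-].
have -> : (phi \o xi') @^-1` `]-oo, r%:E[%classic =
    xi' @^-1` [set v | (phi v < r%:E)%E].
  by apply/seteqP; split=> w /=; rewrite in_itv.
by apply: (complete_sigma_meas cG); exact: b.
Qed.

Lemma rv_measurable_norm G xi : complete_sigma G -> rv G xi ->
  measurable_fun setT (N g \o xi).
Proof.
move=> cG; apply: rv_measurable => // r.
have <- : [set u | (N g (u - 0)%R < r%:E)%E] = [set v | (N g v < r%:E)%E].
  by apply/seteqP; split=> v /=; rewrite subr0.
exact: (gopen_ball hN).
Qed.

Lemma rv_measurable_qn G xi : complete_sigma G -> rv G xi ->
  measurable_fun setT (EFin \o (qn ip \o xi)).
Proof.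
move=> cG; apply: (@rv_measurable _ _ (EFin \o qn ip)) => // r v /=; rewrite lte_fin => vr fv.
have K0 : 0 < K by apply: lt_le_trans (hilb_K hN).
exists ((r - qn ip v) / K); first by rewrite divr_gt0// subr_gt0.
move=> u uv; rewrite /= lte_fin.
have fuv : fin (u - v) by exact: lt_trans uv (ltry _).
have fu : fin u by rewrite -(subrK v u); exact: (finD hN).
apply: le_lt_trans (qn_le_dist hN fu fv) _; rewrite -ltrBrDl.
apply: le_lt_trans (qn_le_norm hN fuv) _.
by rewrite mulrC -ltr_pdivlMr// -lte_fin -(finV hN fuv).
Qed.

End OneNorm.

Section Map2.
Variables (W1 W2 W3 : lmodType R).
Variables (N1 : R -> W1 -> \bar R) (N2 : R -> W2 -> \bar R) (N3 : R -> W3 -> \bar R).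
Variables (g1 g2 g3 : R) (ip1 : W1 -> W1 -> R) (ip2 : W2 -> W2 -> R) (ip3 : W3 -> W3 -> R).
Variables (K1 K2 K3 : R).
Hypotheses (h1 : hilb (N1 g1) ip1 K1) (h2 : hilb (N2 g2) ip2 K2) (h3 : hilb (N3 g3) ip3 K3).

(** Sums, multiples and images under bounded operators are all instances of this statement. *)
Lemma rv_map2 (G : set (set Omega)) (phi : W1 -> W2 -> W3) (C : R)
    (xi1 : Omega -> W1) (xi2 : Omega -> W2) : complete_sigma G ->
  (forall u v, (N1 g1 u < +oo)%E -> (N2 g2 v < +oo)%E -> (N3 g3 (phi u v) < +oo)%E) ->
  (forall u u' v v', (N1 g1 u < +oo)%E -> (N1 g1 u' < +oo)%E ->
     (N2 g2 v < +oo)%E -> (N2 g2 v' < +oo)%E ->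
     (N3 g3 (phi u v - phi u' v')%R <= C%:E * (N1 g1 (u - u')%R + N2 g2 (v - v')%R))%E) ->
  random_var P N1 g1 G xi1 -> random_var P N2 g2 G xi2 ->
  random_var P N3 g3 G (fun w => phi (xi1 w) (xi2 w)).
Proof.
move=> cG fphi lphi r1 r2; apply/(rvP h3 _ cG) => eps e0.
(* The tolerance is going to be divided by the Lipschitz constant, on whose sign nothing is
   assumed. *)
have C0 : 0 < Num.max C 1 by rewrite lt_max ltr01 orbT.
pose e1 := eps / (2 * Num.max C 1); have e10 : 0 < e1 by rewrite divr_gt0// mulr_gt0.
have [k1 s1 H1] := (rvP h1 xi1 cG).1 r1 _ e10.
have [k2 s2 H2] := (rvP h2 xi2 cG).1 r2 _ e10.
exists (fun w => phi (k1 w) (k2 w)).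
  exact: (step_map2 h3 (complete_sigmaP cG) fphi s1 s2).
have f1 := rv_fin r1; have f2 := rv_fin r2.
have ff : {ae P, forall w, (N1 g1 (xi1 w) < +oo)%E /\ (N2 g2 (xi2 w) < +oo)%E} by apply: ae2 f1 f2 _.
have HH : {ae P, forall w, (N1 g1 (xi1 w - k1 w)%R < e1%:E)%E /\ (N2 g2 (xi2 w - k2 w)%R < e1%:E)%E}.
  by apply: ae2 H1 H2 _.
apply: ae2 ff HH _ => w [F1 F2] [L1 L2].
apply: le_lt_trans (lphi _ _ _ _ F1 (step_fin w s1) F2 (step_fin w s2)) _.
apply: (@le_lt_trans _ _ ((Num.max C 1)%:E * (N1 g1 (xi1 w - k1 w)%R + N2 g2 (xi2 w - k2 w)%R))%E).
  apply: lee_wpmul2r; first by rewrite adde_ge0 ?(hilb_ge0 h1) ?(hilb_ge0 h2).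
  by rewrite lee_fin le_max lexx.
apply: (@lt_le_trans _ _ ((Num.max C 1)%:E * (e1%:E + e1%:E))%E).
  by rewrite lte_pmul2l//; apply: lteD.
rewrite -EFinD -EFinM lee_fin /e1.
have -> : Num.max C 1 * (eps / (2 * Num.max C 1) + eps / (2 * Num.max C 1)) = eps by field; rewrite gt_eqF.
by [].
Qed.
End Map2.

Section RvLinear.
Variables (W : lmodType R) (N : R -> W -> \bar R) (g : R) (ip : W -> W -> R) (K : R).
Hypothesis hN : hilb (N g) ip K.
Local Notation rv := (random_var P N g).
Implicit Types (G : set (set Omega)) (xi zeta : Omega -> W).

Lemma rv_add G xi zeta : complete_sigma G -> rv G xi -> rv G zeta ->
  rv G (fun w => xi w + zeta w).
Proof.
move=> cG; apply: (rv_map2 hN hN hN (C := 1) cG); first by move=> *; exact: (finD hN).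
by move=> u u' v v' *; rewrite mul1e opprD addrACA (hilbD hN).
Qed.

Lemma rv_op (W' : lmodType R) (N' : R -> W' -> \bar R) (g' : R) (ip' : W' -> W' -> R)
    (K' : R) (h' : hilb (N' g') ip' K') (T : W -> W') (C : R) G xi :
  complete_sigma G -> (forall u v, T (u - v) = T u - T v) ->
  (forall u, (N g u < +oo)%E -> (N' g' (T u) <= C%:E * N g u)%E) ->
  rv G xi -> random_var P N' g' G (fun w => T (xi w)).
Proof.
move=> cG TB Tb r.
apply: (rv_map2 hN hN h' (phi := fun u _ => T u) (C := `|C|) cG _ _ r r).
  move=> u v fu _; apply: le_lt_trans (Tb _ fu) _.
  by rewrite (finV hN fu) -EFinM ltry.
move=> u u' v v' fu fu' _ _; rewrite -TB.
apply: le_trans (Tb _ (finB hN fu fu')) _.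
apply: (@le_trans _ _ (`|C|%:E * N g (u - u')%R)%E).
  by apply: lee_wpmul2r; rewrite ?(hilb_ge0 hN)// lee_fin ler_norm.
by apply: lee_wpmul2l; rewrite ?lee_fin// leeDl// (hilb_ge0 hN).
Qed.

Lemma rv_scale G c xi : complete_sigma G -> rv G xi -> rv G (fun w => c *: xi w).
Proof.
move=> cG; apply: (rv_op hN (C := `|c|) cG); first by move=> u v; rewrite scalerBr.
by move=> u; exact: (hilbZ hN).
Qed.

Lemma rv_opp G xi : complete_sigma G -> rv G xi -> rv G (fun w => - xi w).
Proof.
move=> cG r; apply: rv_ae (rv_scale (-1) cG r).
by apply: aeW => w; rewrite scaleN1r.
Qed.

Lemma rv_subr G xi zeta : complete_sigma G -> rv G xi -> rv G zeta ->
  rv G (fun w => xi w - zeta w).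
Proof. by move=> cG r1 r2; apply: rv_add => //; exact: rv_opp. Qed.


Lemma step_rv_dist G xi : complete_sigma G -> rv G xi -> forall eps : R, 0 < eps ->
  exists h, [/\ step N g setT G h, rv G h &
    {ae P, forall w, (N g (xi w - h w)%R < eps%:E)%E}].
Proof.
move=> cG r eps e0; have [h sh hh] := (rvP hN xi cG).1 r _ e0.
by exists h; split=> //; exact: (step_rv hN).
Qed.

End RvLinear.

Lemma powR_le (m x y : R) : 0 <= m -> 0 <= x -> x <= y -> x `^ m <= y `^ m.
Proof.
by move=> m0 x0 xy; apply: ge0_ler_powR; rewrite ?nnegrE//; exact: le_trans xy.
Qed.

Lemma poweR_le (m : R) (x y : \bar R) : 0 <= m -> (0 <= x)%E -> (x <= y)%E ->
  (x `^ m <= y `^ m)%E.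
Proof.
move=> m0 x0 xy; apply: gt0_ler_poweR => //; rewrite in_itv/= leey andbT//.
exact: le_trans xy.
Qed.

Lemma limn_einf_ge (u : nat -> \bar R) (r : \bar R) :
  (exists n0, forall n, (n0 <= n)%N -> (r <= u n)%E) -> (r <= limn_einf u)%E.
Proof.
move=> [n0 H]; rewrite limn_einf_lim (cvg_lim _ (@cvg_einfs_sup _ u))//.
apply: (@le_trans _ _ (einfs u n0)); last by apply: ereal_sup_ubound; exists n0.
by apply: le_ereal_inf_tmp => _ [k /= nk <-]; exact: H.
Qed.

Lemma limn_einf_le (u : nat -> \bar R) (r : \bar R) :
  (forall n, (u n <= r)%E) -> (limn_einf u <= r)%E.
Proof.
move=> H; rewrite limn_einf_lim (cvg_lim _ (@cvg_einfs_sup _ u))//.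
apply: ge_ereal_sup => _ [n _ <-].
by apply: le_trans (H n); apply: ereal_inf_lbound; exists n => /=.
Qed.

Lemma Lnorm_le (m : R) (f1 f2 : Omega -> \bar R) : 0 < m ->
  measurable_fun setT f1 -> measurable_fun setT f2 ->
  (forall w, (0 <= f1 w)%E) -> (forall w, (0 <= f2 w)%E) ->
  {ae P, forall w, (f1 w <= f2 w)%E} -> (Lnorm P m%:E f1 <= Lnorm P m%:E f2)%E.
Proof.
move=> m0 mf1 mf2 f10 f20 le; rewrite unlock /Lnorm.
have pm (f : Omega -> \bar R) : measurable_fun setT f -> measurable_fun setT (fun w => `|f w : \bar R| `^ m)%E.
  by move=> mf; exact: (measurableT_comp (measurable_poweR m) (measurableT_comp (@abse_measurable R setT) mf)).
apply: poweR_le.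
- by rewrite invr_ge0 ltW.
- by apply: integral_ge0 => w _; exact: poweR_ge0.
apply: ae_ge0_le_integral => //; try by [exact: pm|move=> w _; exact: poweR_ge0].
apply: ae1 le _ => w le _; rewrite !gee0_abs//.
by apply: poweR_le => //; exact: ltW.
Qed.

Lemma Lnorm_scale (m C : R) (f : Omega -> \bar R) : 0 < m -> 0 <= C ->
  measurable_fun setT f -> (forall w, (0 <= f w)%E) ->
  Lnorm P m%:E (fun w => C%:E * f w)%E = (C%:E * Lnorm P m%:E f)%E.
Proof.
move=> m0 C0 mf f0; rewrite unlock /Lnorm.
have pm : measurable_fun setT (fun w => `|f w : \bar R| `^ m)%E.
  exact: (measurableT_comp (measurable_poweR m) (measurableT_comp (@abse_measurable R setT) mf)).
under eq_integral => w _ do rewrite abseM gee0_abs ?lee_fin// poweRM ?lee_fin ?abse_ge0//.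
rewrite ge0_integralZl//; last 2 first.
- by move=> w _; exact: poweR_ge0.
- exact: poweR_ge0.
rewrite poweRM ?poweR_ge0//; last by apply: integral_ge0 => w _; exact: poweR_ge0.
by rewrite -poweRrM mulfV ?gt_eqF// poweRe1// lee_fin.
Qed.

(** Reduction to Minkowski's inequality for real functions: the values are almost surely finite, so
    passing to [fine] changes none of the norms. *)
Lemma LnormD (m : R) (f1 f2 : Omega -> \bar R) : 1 <= m ->
  measurable_fun setT f1 -> measurable_fun setT f2 ->
  (forall w, (0 <= f1 w)%E) -> (forall w, (0 <= f2 w)%E) ->
  {ae P, forall w, (f1 w < +oo)%E} -> {ae P, forall w, (f2 w < +oo)%E} ->
  (Lnorm P m%:E (fun w => f1 w + f2 w) <= Lnorm P m%:E f1 + Lnorm P m%:E f2)%E.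
Proof.
move=> m1 mf1 mf2 f10 f20 l1 l2.
have m0 : 0 < m by exact: lt_le_trans m1.
have mfin (f : Omega -> \bar R) : measurable_fun setT f -> measurable_fun setT (fun w => fine (f w : \bar R)).
  by move=> mf; exact: (measurableT_comp (fine_measurable measurableT) mf).
have mEfin (f : Omega -> \bar R) : measurable_fun setT f -> measurable_fun setT (fun w => (fine (f w : \bar R))%:E).
  by move=> mf; apply: measurableT_comp => //; exact: mfin.
have E f : (forall w, (0 <= f w)%E) -> {ae P, forall w, (f w < +oo)%E} ->
    measurable_fun setT f ->
    Lnorm P m%:E f = Lnorm P m%:E (EFin \o (fun w => fine (f w))).
  move=> f0 l mf; apply/eqP; rewrite eq_le; apply/andP; split.
    apply: Lnorm_le => //; [exact: mEfin|by move=> w; rewrite lee_fin fine_ge0|].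
    by apply: ae1 l _ => w lw; rewrite /= fineK// ge0_fin_numE.
  apply: Lnorm_le => //; [exact: mEfin|by move=> w; rewrite lee_fin fine_ge0|].
  by apply: ae1 l _ => w lw; rewrite /= fineK// ge0_fin_numE.
rewrite (E f1)// (E f2)//; apply: le_trans (minkowski_EFin P (mfin _ mf1) (mfin _ mf2) m1).
rewrite le_eqVlt; apply/orP; left; apply/eqP; apply/eqP; rewrite eq_le; apply/andP; split.
  apply: Lnorm_le => //.
  - exact: emeasurable_funD.
  - by apply: measurableT_comp => //; apply: measurable_funD; exact: mfin.
  - by move=> w; rewrite adde_ge0.
  - by move=> w; rewrite lee_fin/= addr_ge0// fine_ge0.
  by apply: ae2 l1 l2 _ => w h1 h2; rewrite /= EFinD !fineK// ge0_fin_numE.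
apply: Lnorm_le => //.
- by apply: measurableT_comp => //; apply: measurable_funD; exact: mfin.
- exact: emeasurable_funD.
- by move=> w; rewrite lee_fin/= addr_ge0// fine_ge0.
- by move=> w; rewrite adde_ge0.
by apply: ae2 l1 l2 _ => w h1 h2; rewrite /= EFinD !fineK// ge0_fin_numE.
Qed.

Section MomentBounds.
Variables (m : R).
Hypothesis m1 : 1 <= m.
Let m0 : 0 < m. Proof. exact: lt_le_trans m1. Qed.

(* [mb N g G xi c]: xi is G-measurable and its norm in L^m(H_g) is at most c. *)
Definition mb (W : lmodType R) (N : R -> W -> \bar R) (g : R) (G : set (set Omega))
    (xi : Omega -> W) (c : R) :=
  random_var P N g G xi /\ (mnorm P N m g xi <= c%:E)%E.

Section OneSpace.
Variables (W : lmodType R) (N : R -> W -> \bar R) (g : R) (ip : W -> W -> R) (K : R).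
Hypothesis hN : hilb (N g) ip K.
Local Notation fin v := (N g v < +oo)%E.
Local Notation rv := (random_var P N g).
Local Notation nm := (mnorm P N m g).
Local Notation mbd := (mb N g).
Implicit Types (G : set (set Omega)) (xi zeta : Omega -> W).

Lemma mnorm_ge0 xi : (0 <= nm xi)%E. Proof. exact: Lnorm_ge0. Qed.

Lemma mb_ge0 G xi c : mbd G xi c -> 0 <= c.
Proof. by move=> [_ h]; rewrite -lee_fin; exact: le_trans (mnorm_ge0 xi) h. Qed.

Lemma mb_rv G xi c : mbd G xi c -> rv G xi. Proof. by case. Qed.

Lemma mb_le G xi c c' : c <= c' -> mbd G xi c -> mbd G xi c'.
Proof. by move=> cc [r h]; split=> //; apply: le_trans h _; rewrite lee_fin. Qed.

Lemma mb_sub G G' xi c : G `<=` G' -> mbd G xi c -> mbd G' xi c.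
Proof. by move=> GG [r h]; split=> //; exact: rv_sub r. Qed.

Lemma mnorm_dom (W' : lmodType R) (N' : R -> W' -> \bar R) (g' : R) (ip' : W' -> W' -> R)
    (K' : R) (h' : hilb (N' g') ip' K') (C : R) G xi (zeta : Omega -> W') :
  complete_sigma G -> rv G xi -> random_var P N' g' G zeta -> 0 <= C ->
  {ae P, forall w, (N g (xi w) <= C%:E * N' g' (zeta w))%E} ->
  (nm xi <= C%:E * mnorm P N' m g' zeta)%E.
Proof.
move=> cG r1 r2 C0 le; rewrite /mnorm -Lnorm_scale//.
- apply: Lnorm_le => //.
  + exact: (rv_measurable_norm hN cG r1).
  + by apply: emeasurable_funM => //; exact: (rv_measurable_norm h' cG r2).
  + by move=> w; exact: (hilb_ge0 hN).
  + by move=> w; rewrite mule_ge0 ?lee_fin// (hilb_ge0 h').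
- exact: (rv_measurable_norm h' cG r2).
- by move=> w; exact: (hilb_ge0 h').
Qed.

Lemma mb_ae G xi zeta c : complete_sigma G -> aeeq P zeta xi -> mbd G xi c -> mbd G zeta c.
Proof.
move=> cG e [r h]; have r' := rv_ae e r; split=> //.
apply: le_trans h; rewrite -[leRHS]mul1e; apply: (mnorm_dom hN cG) => //.
by apply: ae1 e _ => w ->; rewrite mul1e.
Qed.

Lemma mb_op (W' : lmodType R) (N' : R -> W' -> \bar R) (g' : R) (ip' : W' -> W' -> R)
    (K' : R) (h' : hilb (N' g') ip' K') (T : W' -> W) (C : R) G (zeta : Omega -> W') c :
  complete_sigma G -> (forall u v, T (u - v) = T u - T v) ->
  (forall u, (N' g' u < +oo)%E -> (N g (T u) <= C%:E * N' g' u)%E) -> 0 <= C ->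
  mb N' g' G zeta c -> mbd G (fun w => T (zeta w)) (C * c).
Proof.
move=> cG TB Tb C0 [r h]; have r' := rv_op h' hN cG TB Tb r; split=> //.
apply: (@le_trans _ _ (C%:E * mnorm P N' m g' zeta)%E).
  apply: (mnorm_dom h' cG) => //.
  by apply: ae1 (rv_fin r) _ => w; exact: Tb.
by rewrite EFinM lee_wpmul2l// lee_fin.
Qed.

Lemma mb_add G xi zeta c c' : complete_sigma G -> mbd G xi c -> mbd G zeta c' ->
  mbd G (fun w => xi w + zeta w) (c + c').
Proof.
move=> cG [r h] [r' h']; have rr := rv_add hN cG r r'; split=> //.
rewrite EFinD; apply: le_trans (leeD h h'); rewrite /mnorm.
apply: (@le_trans _ _ (Lnorm P m%:E (fun w => N g (xi w) + N g (zeta w))%E)).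
  apply: Lnorm_le => //.
  - exact: (rv_measurable_norm hN cG rr).
  - by apply: emeasurable_funD; [exact: (rv_measurable_norm hN cG r)|exact: (rv_measurable_norm hN cG r')].
  - by move=> w; exact: (hilb_ge0 hN).
  - by move=> w; rewrite adde_ge0// (hilb_ge0 hN).
  - by apply: aeW => w; exact: (hilbD hN).
apply: LnormD => //.
- exact: (rv_measurable_norm hN cG r).
- exact: (rv_measurable_norm hN cG r').
- by move=> w; exact: (hilb_ge0 hN).
- by move=> w; exact: (hilb_ge0 hN).
- exact: rv_fin r.
- exact: rv_fin r'.
Qed.

Lemma mb_scale G xi c a : complete_sigma G -> mbd G xi c -> mbd G (fun w => a *: xi w) (`|a| * c).
Proof.
move=> cG; apply: (mb_op hN (T := fun v => a *: v) cG) => //.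
  by move=> u v; rewrite scalerBr.
by move=> u; exact: (hilbZ hN).
Qed.

Lemma mb_opp G xi c : complete_sigma G -> mbd G xi c -> mbd G (fun w => - xi w) c.
Proof.
move=> cG h; have := mb_scale (-1) cG h; rewrite normrN1 mul1r; apply: mb_ae => //.
by apply: aeW => w; rewrite scaleN1r.
Qed.

Lemma mb_subr G xi zeta c c' : complete_sigma G -> mbd G xi c -> mbd G zeta c' ->
  mbd G (fun w => xi w - zeta w) (c + c').
Proof. by move=> cG h h'; apply: mb_add => //; exact: mb_opp. Qed.

Lemma mb0 G : complete_sigma G -> mbd G (fun=> 0) 0.
Proof.
move=> cG; split; first by apply: (rv_cst hN cG); exact: (fin0 hN).
rewrite /mnorm -[leRHS](@Lnorm0 _ _ _ P m%:E) ?gt_eqF//.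
apply: Lnorm_le => //; try by move=> w; rewrite (hilb0 hN).
  by apply: aeW => w; rewrite (hilb0 hN).
Qed.

Lemma mb_sum G n (F : nat -> Omega -> W) (c : nat -> R) : complete_sigma G ->
  (forall i, (i < n)%N -> mbd G (F i) (c i)) ->
  mbd G (fun w => \sum_(i < n) F i w) (\sum_(i < n) c i).
Proof.
move=> cG; elim: n => [|n IH] H.
  rewrite big_ord0; apply: mb_ae (mb0 cG) => //.
  by apply: aeW => w; rewrite big_ord0.
rewrite big_ord_recr /=; apply: mb_ae (mb_add cG (IH _) (H n _)) => //.
  by apply: aeW => w; rewrite big_ord_recr.
by move=> i i_n; apply: H; rewrite ltnS ltnW.
Qed.

Lemma mb_eq0 G xi : complete_sigma G -> (forall eps : R, 0 < eps -> mbd G xi eps) ->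
  aeeq P xi (fun=> 0).
Proof.
move=> cG H; have r := mb_rv (H 1 ltr01).
have : nm xi = 0%E.
  apply/eqP; rewrite eq_le mnorm_ge0 andbT; apply/lee_addgt0Pr => e e0.
  by rewrite add0e; case: (H e e0).
move=> /(Lnorm_eq0_eq0 (rv_measurable_norm hN cG r)); rewrite lte_fin => /(_ m0).
move=> h; apply: ae1 h _ => w; move=> /(_ I) /= h; exact: (hilb_eq0 hN).
Qed.

Lemma mnorm_leP G xi c : complete_sigma G -> rv G xi -> 0 <= c ->
  (nm xi <= c%:E)%E <-> (\int[P]_w (N g (xi w) `^ m) <= (c `^ m)%:E)%E.
Proof.
move=> cG r c0; rewrite /mnorm.
have e : (Lnorm P m%:E (fun w => N g (xi w)) `^ m = \int[P]_w (N g (xi w) `^ m))%E.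
  rewrite poweR_Lnorm ?gt_eqF//; apply: eq_integral => w _.
  by rewrite gee0_abs// (hilb_ge0 hN).
rewrite -e -poweR_EFin; split=> h.
  by apply: poweR_le => //; [exact: ltW|exact: Lnorm_ge0].
have := @poweR_le m^-1 _ _ _ _ h.
rewrite -!poweRrM mulfV ?gt_eqF// !poweRe1 ?lee_fin ?Lnorm_ge0//; apply.
  by rewrite invr_ge0 ltW.
exact: poweR_ge0.
Qed.

Lemma mb_int G xi c : complete_sigma G -> mbd G xi c ->
  (\int[P]_w (N g (xi w) `^ m) <= (c `^ m)%:E)%E.
Proof. by move=> cG h; apply/(mnorm_leP cG (mb_rv h) (mb_ge0 h)); case: h. Qed.

Lemma measurable_norm_pow G xi : complete_sigma G -> rv G xi ->
  measurable_fun setT (fun w => N g (xi w) `^ m)%E.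
Proof.
move=> cG r; have := measurableT_comp (measurable_poweR m) (rv_measurable_norm hN cG r).
by [].
Qed.

Definition ncvg (x : nat -> W) (y : W) := forall eps : R, 0 < eps ->
  exists n0, forall n, (n0 <= n)%N -> (N g (x n - y)%R < eps%:E)%E.

(** Fatou's lemma, once the m-th power of the norm is known to be lower semicontinuous along the
    almost sure limit. *)
Lemma mb_fatou G (x : nat -> Omega -> W) y c : complete_sigma G -> rv G y ->
  {ae P, forall w, ncvg (x ^~ w) (y w)} -> (forall n, mbd G (x n) c) -> mbd G y c.
Proof.
move=> cG ry xy H; split=> //; have c0 := mb_ge0 (H 0%N).
apply/(mnorm_leP cG ry c0).
have mx n := measurable_norm_pow cG (mb_rv (H n)).
apply: (@le_trans _ _ (\int[P]_w limn_einf (fun n => N g (x n w) `^ m))%E).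
  apply: ae_ge0_le_integral => //.
  - by move=> w _; exact: poweR_ge0.
  - exact: measurable_norm_pow ry.
  - by move=> w _; apply: limn_einf_ge; exists 0%N => n _; exact: poweR_ge0.
  - under eq_fun do rewrite -[limn_einf _]oppeK -limn_esupN.
    apply: measurableT_comp => //; apply: measurable_fun_limn_esup => n.
    exact: measurableT_comp.
  apply: ae2 (rv_fin ry) xy _ => w fy cy _.
  have [y0|y0] := eqVneq (N g (y w)) 0%E.
    rewrite y0 poweR0r ?gt_eqF//; apply: limn_einf_ge; exists 0%N => n _; exact: poweR_ge0.
  have ry0 : 0 < fine (N g (y w)).
    by rewrite fine_gt0// lt_def y0 (hilb_ge0 hN).
  rewrite (finV hN fy) poweR_EFin; set A := fine _ `^ m.
  have A0 : 0 < A by exact: powR_gt0.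
  apply/lee_addgt0Pr => e e0.
  pose ep := Num.min (1/2) (e / A).
  have ep0 : 0 < ep by rewrite lt_min; apply/andP; split; [lra|exact: divr_gt0].
  have ep1 : ep <= 1/2 by rewrite ge_min lexx.
  have epA : ep * A <= e by rewrite -ler_pdivlMr// ge_min lexx orbT.
  (* This [l] < 1 is chosen so that l^m = 1 - ep. Eventually N(x_n) >= l N(y), hence N(x_n)^m >= (1
     - ep) N(y)^m, and [ep] is small enough for the loss to be at most [e]. *)
  pose l := (1 - ep) `^ m^-1.
  have lm : l `^ m = 1 - ep by rewrite -powRrM mulVf ?gt_eqF// powRr1//; lra.
  have l1 : l < 1.
    rewrite ltNge; apply/negP => l1; have : 1 `^ m <= l `^ m := powR_le (ltW m0) ler01 l1.
    rewrite powR1 lm; lra.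
  have [|n0 hn0] := cy ((1 - l) * fine (N g (y w))); first by rewrite mulr_gt0// subr_gt0.
  apply: (@le_trans _ _ ((1 - ep) * A + e)%:E); first by rewrite lee_fin; lra.
  rewrite EFinD; apply: leeD => //.
  apply: limn_einf_ge; exists n0 => n n0n.
  rewrite -lm /A -powRM ?powR_ge0 ?fine_ge0 ?(hilb_ge0 hN)// -poweR_EFin.
  apply: poweR_le; [exact: ltW|by rewrite lee_fin mulr_ge0 ?powR_ge0// ltW|].
  have fxy : fin (y w - x n w) by rewrite (norm_distC hN); exact: lt_trans (hn0 n n0n) (ltry _).
  have := norm_le_dist hN (y w) (x n w).
  have : (N g (y w - x n w)%R < ((1 - l) * fine (N g (y w)))%:E)%E by rewrite (norm_distC hN); exact: hn0.
  rewrite (finV hN fy) (finV hN fxy); have [fx|nfx] := boolP (fin (x n w)).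
    rewrite (finV hN fx) -EFinD !lee_fin lte_fin; lra.
  by move=> _ _; move: nfx; rewrite -leNgt leye_eq => /eqP ->; rewrite leey.
apply: le_trans (fatou P measurableT mx _) _; first by move=> n w _; exact: poweR_ge0.
by apply: limn_einf_le => n; exact: (mb_int cG (H n)).
Qed.


(** Borel-Cantelli: by Markov's inequality the event N(x_n) > 2^-n has probability at most (4^-n /
    2^-n)^m <= 2^-n, which is summable. *)
Lemma mb_fast G (x : nat -> Omega -> W) : complete_sigma G ->
  (forall n, mbd G (x n) (4 ^+ n)^-1) ->
  {ae P, forall w, exists q, forall n, (q <= n)%N -> (N g (x n w) <= ((2 ^+ n)^-1)%:E)%E}.
Proof.
move=> cG H.
pose a n : R := (2 ^+ n)^-1 `^ m.
have a0 n : 0 < a n by rewrite powR_gt0// invr_gt0 exprn_gt0.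
pose f n w := (N g (x n w) `^ m)%E.
have mf n : measurable_fun [set: Omega] (f n : Omega -> \bar R).
  exact: measurable_norm_pow (mb_rv (H n)).
pose A n := [set: Omega] `&` [set w | ((a n)%:E <= `|f n w|)%E].
have mA n : measurable (A n).
  by apply: emeasurable_fun_c_infty => //; apply: measurableT_comp => //; exact: mf.
have PA n : (P (A n) <= ((2 ^+ n)^-1)%:E)%E.
  have : ((a n)%:E * P (A n) <= \int[P]_w `|f n w|)%E := le_integral_abse P measurableT (mf n) (a0 n).
  have e : (\int[P]_w `|f n w| = \int[P]_w f n w)%E.
    by apply: eq_integral => w _; rewrite gee0_abs// poweR_ge0.
  rewrite e => /le_trans /(_ (mb_int cG (H n))).
  have fA : P (A n) \is a fin_num by exact: fin_num_measure.
  rewrite -(fineK fA) -EFinM !lee_fin.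
  have -> : (4 ^+ n)^-1 = (2 ^+ n)^-1 * (2 ^+ n)^-1 :> R.
    by rewrite -invfM -exprMn; congr ((_ ^+ _)^-1); rewrite -natrM.
  rewrite powRM ?invr_ge0 ?exprn_ge0// -/(a n) ler_pM2l// => /le_trans; apply.
  rewrite /a; apply: ge1r_powR => //; rewrite invr_gt0 exprn_gt0//= invf_le1 ?exprn_gt0//.
  by rewrite exprn_ege1// ler1n.
have S : (\sum_(n <oo) P (A n) < +oo)%E.
  apply: (@le_lt_trans _ _ (\sum_(n <oo) (2 / (2 ^ n.+1)%:R)%:E)%E).
    apply: lee_nneseries => [n _ _|n _]; first exact: measure_ge0.
    apply: le_trans (PA n) _; rewrite lee_fin natrX exprS invfM mulrA mulfV ?mul1r//.
  by apply: le_lt_trans (epsilon_trick0 xpredT _) (ltry _).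
have L := lim_sup_set_cvg0 mA S.
apply: (@negligibleS _ _ _ _ (lim_sup_set A)); last first.
  apply/negligibleP => //; apply: bigcap_measurable => // k _.
  exact: bigcup_measurable.
move=> w /= nq; apply: contrapT => /existsNP[q] /not_implyP[_ nA].
apply: nq; exists q => n qn; rewrite leNgt; apply/negP => lt.
apply: nA; exists n => //; split=> //=; rewrite gee0_abs ?poweR_ge0// -poweR_EFin.
by apply: poweR_le; rewrite ?ltW// lee_fin invr_ge0 exprn_ge0.
Qed.

Lemma mb_bound G xi c : complete_sigma G -> rv G xi -> 0 <= c ->
  {ae P, forall w, (N g (xi w) <= c%:E)%E} -> mbd G xi c.
Proof.
move=> cG r c0 le; split=> //; apply/(mnorm_leP cG r c0).
apply: (@le_trans _ _ (\int[P]_w (c `^ m)%:E)%E); last first.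
  by rewrite integral_cst// [X in (_ * X)%E](@probability_setT _ _ _ P) mule1.
apply: ae_ge0_le_integral => //.
- by move=> w _; exact: poweR_ge0.
- exact: measurable_norm_pow r.
- by move=> w _; rewrite lee_fin powR_ge0.
apply: ae1 le _ => w le _; rewrite -poweR_EFin; apply: poweR_le => //; first exact: ltW.
exact: (hilb_ge0 hN).
Qed.

Lemma ncvg_unique (x : nat -> W) (y z : W) : ncvg x y -> ncvg x z -> y = z.
Proof.
move=> xy xz; apply/eqP; rewrite -subr_eq0; apply/eqP; apply: (hilb_eq0 hN).
apply/eqP; rewrite eq_le (hilb_ge0 hN) andbT; apply/lee_addgt0Pr => e e0; rewrite add0e.
have [|n1 h1] := xy (e / 2); first exact: divr_gt0.
have [|n2 h2] := xz (e / 2); first exact: divr_gt0.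
apply: le_trans (norm_dist_triangle hN (x (maxn n1 n2)) _ _) _.
rewrite (splitr e) EFinD leeD//; first by rewrite (norm_distC hN) ltW// h1// leq_maxl.
by rewrite ltW// h2// leq_maxr.
Qed.

(* Rapid L^m convergence of simple approximations gives one version, measurable
   in all the variables, of the limit at every parameter [j]. *)
Lemma joint_version (dJ : measure_display) (J : measurableType dJ) (D : set J)
    (A : J -> Omega -> W) : measurable D -> complete_sigma measurable ->
  (forall n, exists (k : J -> nat) (z : nat -> Omega -> W),
     (forall i, measurable (D `&` k @^-1` [set i])) /\
     forall i, rv measurable (z i) /\
       forall j, D j -> k j = i -> mbd measurable (fun w => A j w - z i w) (8 ^+ n.+1)^-1) ->
  exists2 A' : J -> Omega -> W,
    borel_on N g (D `*` setT) (measurable : set (set (J * Omega)%type))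
       (fun p : J * Omega => A' p.1 p.2) &
    forall j, D j -> aeeq P (A j) (A' j).
Proof.
move=> mD cm /choice[k /choice[z H]].
have sm := complete_sigmaP cm.
have e80 n : 0 < (8 ^+ n.+1)^-1 :> R by rewrite invr_gt0 exprn_gt0.
have H' n i : exists p : (Omega -> nat) * (nat -> W),
   [/\ forall l, measurable (p.1 @^-1` [set l]), forall l, fin (p.2 l) &
    {ae P, forall w, (N g (z n i w - p.2 (p.1 w))%R < ((8 ^+ n.+1)^-1)%:E)%E}].
  have [h [[kk [v [Gk fv ->]]] _ hh]] := step_rv_dist hN cm ((H n).2 i).1 (e80 n).
  by exists (kk, v); split=> // l; rewrite -[X in measurable X]setTI.
have /choice[h hP] : forall n, exists h : nat -> (Omega -> nat) * (nat -> W), forall i,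
   [/\ forall l, measurable ((h i).1 @^-1` [set l]), forall l, fin ((h i).2 l) &
    {ae P, forall w, (N g (z n i w - (h i).2 ((h i).1 w))%R < ((8 ^+ n.+1)^-1)%:E)%E}].
  by move=> n; have [h hh] := choice (H' n); exists h.
pose f n (p : J * Omega) := (h n (k n p.1)).2 ((h n (k n p.1)).1 p.2).
have sD : sigma_algebra (D `*` [set: Omega]) (measurable : set (set (J * Omega)%type)).
  split=> [|B mB|B mB]; [exact: measurable0| |exact: bigcupT_measurable].
  by apply: measurableD => //; exact: measurableX.
have sf n : step N g (D `*` [set: Omega]) (measurable : set (set (J * Omega)%type)) (f n).
  apply: (@step_count _ _ _ _ _ _ hN _ _ _ sD (nat * nat)%type
     (fun p => (k n p.1, (h n (k n p.1)).1 p.2)) (fun i => (h n i.1).2 i.2)).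
    move=> [i l].
    have -> : (D `*` [set: Omega]) `&`
        (fun p : J * Omega => (k n p.1, (h n (k n p.1)).1 p.2)) @^-1` [set (i, l)] =
        (D `&` k n @^-1` [set i]) `*` ((h n i).1 @^-1` [set l]).
      apply/seteqP; split=> -[j w] /=; first by move=> [[Dj _] [<- <-]].
      by move=> [[Dj ->] ->].
    by apply: measurableX; [exact: (H n).1|case: (hP n i)].
  by move=> [i l]; case: (hP n i).
have [A' bA' limA'] := step_limit hN sD sf.
exists (fun j w => A' (j, w)).
  by have -> : (fun p : J * Omega => A' (p.1, p.2)) = A' by apply/funext => -[].
move=> j Dj.
have rf n : rv measurable (fun w => f n (j, w)).
  have [ml fl _] := hP n (k n j); apply: (step_rv hN cm).
  exists (h n (k n j)).1, (h n (k n j)).2; split=> // l.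
  by rewrite setTI.
have bf n : mbd measurable (fun w => f n (j, w) - A j w) (2 * (8 ^+ n.+1)^-1).
  have [rz bz] := (H n).2 (k n j).
  have bA := bz j Dj erefl; have [_ _ ah] := hP n (k n j).
  have zf : mbd measurable (fun w => z n (k n j) w - f n (j, w)) (8 ^+ n.+1)^-1.
    apply: mb_bound => //; first exact: (rv_subr hN).
    by apply: ae1 ah _ => w /ltW.
  rewrite mulr_natl mulr2n; apply: mb_ae (mb_opp cm (mb_add cm bA zf)) => //.
  by apply: aeW => w; rewrite addrA subrK opprB.
(* The tolerance 8^-(n+1) is tuned to this: the errors of two successive approximations then add up
   to at most 4^-n, the rate at which [mb_fast] gives almost sure convergence. *)
have e8 n : (2 : R) * (8 ^+ n.+1)^-1 <= (4 ^+ n)^-1 / 4.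
  rewrite exprS invfM (_ : 8 ^+ n = 4 ^+ n * 2 ^+ n :> R); last by rewrite -exprMn -natrM.
  rewrite invfM.
  have h2 : (2 ^+ n)^-1 <= 1 :> R by rewrite invf_le1 ?exprn_gt0// exprn_ege1// ler1n.
  have h4 : 0 <= (4 ^+ n)^-1 :> R by rewrite invr_ge0 exprn_ge0.
  nra.
have b1 n : mbd measurable (fun w => f n (j, w) - A j w) (4 ^+ n)^-1.
  apply: mb_le (bf n); apply: le_trans (e8 n) _.
  by rewrite ler_pdivrMr// ler_peMr// ?invr_ge0 ?exprn_ge0// ler1n.
have b2 n : mbd measurable (fun w => f n.+1 (j, w) - f n (j, w)) (4 ^+ n)^-1.
  apply: (@mb_le _ _ ((2 * (8 ^+ n.+2)^-1) + (2 * (8 ^+ n.+1)^-1))).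
    apply: (@le_trans _ _ ((4 ^+ n.+1)^-1 / 4 + (4 ^+ n)^-1 / 4)); first exact: lerD.
    have h4 : 0 <= (4 ^+ n)^-1 :> R by rewrite invr_ge0 exprn_ge0.
    rewrite exprS invfM; lra.
  apply: mb_ae (mb_subr cm (bf n.+1) (bf n)) => //.
  by apply: aeW => w; rewrite opprB addrA subrK.
apply: ae2 (mb_fast cm b1) (mb_fast cm b2) _ => w [q1 h1] h2.
apply: (@ncvg_unique (fun n => f n (j, w))).
  move=> eps e0; have [n0 hn0] := eps_small e0; exists (maxn q1 n0) => n.
  rewrite geq_max => /andP[qn n0n]; apply: le_lt_trans (h1 n qn) _; rewrite lte_fin.
  apply: le_lt_trans hn0; apply: (@le_trans _ _ (2 ^+ n0)^-1).
    by rewrite lef_pV2 ?posrE ?exprn_gt0// ler_eXn2l ?ltr1n.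
  by rewrite ler_peMl// ?invr_ge0 ?exprn_ge0// ler1n.
exact: (limA' (j, w)).
Qed.

(** A rapidly converging subsequence, replaced by nearby step functions, has an almost sure limit.
    The bound [r n] is inherited by the limit through Fatou's lemma along that subsequence, so no
    constant is lost. *)
Lemma mb_complete G (x : nat -> Omega -> W) (r : nat -> R) : complete_sigma G ->
  (forall eps : R, 0 < eps -> exists n0, forall n, (n0 <= n)%N -> r n < eps) ->
  (forall n, rv G (x n)) ->
  (forall n k, (n <= k)%N -> mbd G (fun w => x k w - x n w) (r n)) ->
  exists2 y, rv G y & forall n, mbd G (fun w => y w - x n w) (r n).
Proof.
move=> cG r0 rx bx; have sG := complete_sigmaP cG.
have /choice[p0 hp0] : forall n, exists n0, forall k, (n0 <= k)%N -> r k < (8 ^+ n.+1)^-1.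
  by move=> n; apply: r0; rewrite invr_gt0 exprn_gt0.
(* A strictly increasing sequence with p n >= p0 n, so that each term of the subsequence may be
   compared with all the later ones. *)
pose p n := (\sum_(i < n.+1) (p0 i).+1)%N.
have pS n : (p n < p n.+1)%N.
  by rewrite /p [X in (_ < X)%N]big_ord_recr/= addnS ltnS leq_addr.
have pn n : (n <= p n)%N by elim: n => // n IH; exact: leq_ltn_trans (pS n).
have p0n n : (p0 n <= p n)%N by rewrite /p big_ord_recr/= (leq_trans _ (leq_addl _ _)).
have pmono n k : (n <= k)%N -> (p n <= p k)%N.
  by move/subnKC <-; elim: (k - n)%N => [|l IH]; rewrite ?addn0// addnS (leq_trans IH)// ltnW.
have e80 n : 0 < (8 ^+ n.+1)^-1 :> R by rewrite invr_gt0 exprn_gt0.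
have /choice[h hP] := fun n => step_rv_dist hN cG (rx (p n)) (e80 n).
have sh n : step N g setT G (h n) by case: (hP n).
have [y by_ ly] := step_limit hN sG sh.
have ry : rv G y by exists y => //; exact: aeW.
have bh n : mbd G (fun w => x (p n) w - h n w) (8 ^+ n.+1)^-1.
  have [_ rh ah] := hP n.
  apply: mb_bound => //; [exact: (rv_subr hN)|].
  by apply: ae1 ah _ => w /ltW.
have b2 n : mbd G (fun w => h n.+1 w - h n w) (4 ^+ n)^-1.
  apply: (@mb_le _ _ (- - (8 ^+ n.+2)^-1 + ((8 ^+ n.+1)^-1 + (8 ^+ n.+1)^-1))).
    rewrite opprK [in X in X + _]exprS [in X in _ + (X + _)]exprS [in X in _ + (_ + X)]exprS.
    rewrite [in X in X + _]exprS (_ : 8 ^+ n = 4 ^+ n * 2 ^+ n :> R); last by rewrite -exprMn -natrM.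
    rewrite !invfM.
    have h2 : (2 ^+ n)^-1 <= 1 :> R by rewrite invf_le1 ?exprn_gt0// exprn_ege1// ler1n.
    have h4 : 0 <= (4 ^+ n)^-1 :> R by rewrite invr_ge0 exprn_ge0.
    nra.
  rewrite opprK; apply: mb_ae (mb_add cG (mb_opp cG (bh n.+1)) (mb_add cG (mb_le (ltW (hp0 n _ (p0n n))) (bx _ _ (ltnW (pS n)))) (bh n))) => //.
  by apply: aeW => w; rewrite opprB !addrA !subrK.
have ah : {ae P, forall w, forall n, (N g (x (p n) w - h n w)%R < ((8 ^+ n.+1)^-1)%:E)%E}.
  by apply: ae_foralln => n; case: (hP n).
have cv : {ae P, forall w, ncvg (fun n => x (p n) w) (y w)}.
  apply: ae2 (mb_fast cG b2) ah _ => w cw aw eps e0.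
  have [|n1 hn1] := ly w I cw (eps / 2); first exact: divr_gt0.
  have [n2 hn2] := eps_small (divr_gt0 e0 (ltr0n _ 2)).
  exists (maxn n1 n2) => n; rewrite geq_max => /andP[n1n n2n].
  apply: le_lt_trans (norm_dist_triangle hN (h n w) _ _) _.
  rewrite (splitr eps) EFinD; apply: lteD; last exact: hn1.
  apply: lt_trans (aw n) _; rewrite lte_fin; apply: le_lt_trans hn2.
  apply: (@le_trans _ _ (2 ^+ n2)^-1); last by rewrite ler_peMl// ?invr_ge0 ?exprn_ge0// ler1n.
  rewrite lef_pV2 ?posrE ?exprn_gt0//; apply: (@le_trans _ _ (2 ^+ n.+1)).
    by rewrite ler_eXn2l ?ltr1n// ltnW.
  by rewrite lerXn2r ?nnegrE// ler_nat.
exists y => // n.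
apply: (mb_fatou cG (x := fun l w => x (p (l + n)%N) w - x n w)); first exact: (rv_subr hN).
  apply: ae1 cv _ => w cw eps e0; have [n0 hn0] := cw eps e0.
  exists n0 => l n0l; rewrite opprB addrA subrK; apply: hn0.
  by rewrite (leq_trans n0l)// leq_addr.
by move=> l; apply: bx; rewrite (leq_trans _ (pn _))// leq_addl.
Qed.

End OneSpace.
End MomentBounds.
End CompleteProbability.

(** * Conditional expectation *)
Lemma ecvg0P (R : realType) (T : Type) (F : set_system T) (FF : Filter F) (u : T -> \bar R) :
  (forall x, (0 <= u x)%E) ->
  u x @[x --> F] --> 0%E <-> forall eps : R, 0 < eps -> \forall x \near F, (u x < eps%:E)%E.
Proof.
move=> u0; split.
  move=> /fine_cvgP[fu /cvgrPdist_lt cu] eps e0.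
  near=> x; have fx : u x \is a fin_num by near: x.
  rewrite -(fineK fx) lte_fin.
  have : `|0 - (fine \o u) x| < eps by near: x; exact: cu.
  by rewrite sub0r normrN /= ger0_norm ?fine_ge0.
move=> H; apply/fine_cvgP; split.
  by apply: filterS (H 1 ltr01) => x lt; rewrite ge0_fin_numE//; exact: lt_trans lt (ltry _).
apply/cvgrPdist_lt => eps e0; apply: filterS (H eps e0) => x lt.
have fx : u x \is a fin_num by rewrite ge0_fin_numE//; exact: lt_trans lt (ltry _).
by rewrite sub0r normrN /= ger0_norm ?fine_ge0// -lte_fin fineK.
Unshelve. all: by end_near.
Qed.

Lemma ecvg0_nat (R : realType) (u : nat -> \bar R) : (forall n, (0 <= u n)%E) ->
  u n @[n --> \oo] --> 0%E <->
  forall eps : R, 0 < eps -> exists n0, forall n, (n0 <= n)%N -> (u n < eps%:E)%E.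
Proof.
move=> u0; rewrite ecvg0P//; split=> H eps e0; have [n0 h] := H eps e0.
  by exists n0.
by exists n0.
Qed.


Lemma powR_superadd (R : realType) (m x y : R) : 1 <= m -> 0 <= x -> 0 <= y ->
  x `^ m + y `^ m <= (x + y) `^ m.
Proof.
move=> m1 x0 y0; have m0 : 0 < m by exact: lt_le_trans m1.
have e z : 0 <= z -> z `^ m = z * z `^ (m - 1) by move=> z0; rewrite mulr_powRB1.
rewrite (e x)// (e y)// (e (x + y)) ?addr_ge0// mulrDl; apply: lerD.
  by apply: ler_wpM2l => //; apply: powR_le => //; [rewrite subr_ge0|rewrite lerDl].
by apply: ler_wpM2l => //; apply: powR_le => //; [rewrite subr_ge0|rewrite lerDr].
Qed.

Section RealIntegrals.
Variables (R : realType) (d : measure_display) (Omega : measurableType d).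
Variables (P : probability Omega R).
Implicit Types (f h a b c : Omega -> R).

Lemma integrable_dom f h : measurable_fun setT f -> measurable_fun setT h ->
  {ae P, forall w, `|f w| <= h w} -> (\int[P]_w (h w)%:E < +oo)%E ->
  P.-integrable setT (EFin \o f).
Proof.
move=> mf mh le hoo; apply/integrableP; split; first exact: measurableT_comp.
apply: le_lt_trans hoo.
apply: (@le_trans _ _ (\int[P]_w `|(h w)%:E|)%E).
  apply: ae_ge0_le_integral => //.
  - by apply: measurableT_comp => //; exact: measurableT_comp.
  - by apply: measurableT_comp => //; exact: measurableT_comp.
  by apply: ae1 le _ => w le _ /=; rewrite lee_fin (le_trans le)// ler_norm.
rewrite le_eqVlt; apply/orP; left; apply/eqP; apply: ae_eq_integral => //.
- by apply: measurableT_comp => //; exact: measurableT_comp.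
- exact: measurableT_comp.
by apply: ae1 le _ => w le _ /=; rewrite ger0_norm// (le_trans _ le).
Qed.

(** Drops from a pointwise bound a term of zero mean, in practice an inner product with a
    conditionally centred variable. The integral of [b] is allowed to be infinite. *)
Lemma int_le_orth a b c : measurable_fun setT a -> measurable_fun setT b ->
  P.-integrable setT (EFin \o c) -> (\int[P]_w (c w)%:E = 0)%E ->
  (forall w, 0 <= a w) -> (forall w, 0 <= b w) ->
  {ae P, forall w, a w <= b w + c w} ->
  (\int[P]_w (a w)%:E <= \int[P]_w (b w)%:E)%E.
Proof.
move=> ma mb ic c0 a0 b0 le.
have [->|boo] := eqVneq (\int[P]_w (b w)%:E)%E +oo%E; first by rewrite leey.
have ib : P.-integrable setT (EFin \o b).
  apply: (integrable_dom mb mb); first by apply: aeW => w; rewrite ger0_norm.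
  by rewrite ltey.
have mc : measurable_fun setT c.
  have := measurable_int P ic => /(measurableT_comp (fine_measurable measurableT)).
  by [].
have mbc : measurable_fun setT (fun w => b w + c w) by exact: measurable_funD.
have mabs : measurable_fun setT (fun w => (`|b w + c w|)%:E).
  by apply: measurableT_comp => //; exact: measurableT_comp.
apply: (@le_trans _ _ (\int[P]_w (`|b w + c w|)%:E)%E).
  apply: ae_ge0_le_integral => //.
  - by move=> w _; rewrite lee_fin.
  - exact: measurableT_comp.
  by apply: ae1 le _ => w le _; rewrite lee_fin (le_trans le)// ler_norm.
have -> : (\int[P]_w (`|b w + c w|)%:E = \int[P]_w ((EFin \o b) w + (EFin \o c) w))%E.
  apply: ae_eq_integral => //.
    by apply: emeasurable_funD; exact: measurableT_comp.
  by apply: ae1 le _ => w le _ /=; rewrite ger0_norm// (le_trans (a0 w)).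
by rewrite integralD// [X in (_ + X)%E]c0 adde0.
Qed.

Lemma integral_scale f (x : R) : P.-integrable setT (EFin \o f) ->
  (\int[P]_w (x * f w)%:E = x%:E * \int[P]_w (f w)%:E)%E.
Proof. by move=> i; rewrite -integralZl. Qed.

Lemma integral_addr f h : P.-integrable setT (EFin \o f) -> P.-integrable setT (EFin \o h) ->
  (\int[P]_w (f w + h w)%:E = \int[P]_w (f w)%:E + \int[P]_w (h w)%:E)%E.
Proof. by move=> i j; rewrite -integralD. Qed.

End RealIntegrals.

Section Inner.
Variables (R : realType) (d : measure_display) (Omega : measurableType d).
Variables (P : probability Omega R).
Variables (W : lmodType R) (N : R -> W -> \bar R) (g : R) (ip : W -> W -> R) (K : R).
Hypothesis hN : hilb (N g) ip K.
Local Notation fin v := (N g v < +oo)%E.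
Local Notation rv := (random_var P N g).
Local Notation q := (qn ip).
Local Notation cs := (complete_sigma P).
Implicit Types (G : set (set Omega)) (xi zeta : Omega -> W).

Lemma qn_meas G xi : cs G -> rv G xi -> measurable_fun setT (q \o xi).
Proof.
move=> cG r; have := measurableT_comp (fine_measurable measurableT) (rv_measurable_qn hN cG r).
by [].
Qed.

(** By polarization, from the measurability of the norm. *)
Lemma ip_meas G xi zeta : cs G -> rv G xi -> rv G zeta ->
  measurable_fun setT (fun w => ip (xi w) (zeta w)).
Proof.
move=> cG r1 r2.
have mq zz : rv G zz -> measurable_fun setT (fun w => q (zz w) ^+ 2).
  by move=> rz; apply: (measurable_funX 2); exact: (qn_meas cG rz).
have mh := measurable_funM (measurable_cst (2^-1 : R))
  (measurable_funB (measurable_funB (mq _ (rv_add hN cG r1 r2)) (mq _ r1)) (mq _ r2)).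
apply: ae_measurable cG _ mh; apply: ae2 (rv_fin r1) (rv_fin r2) _ => w f1 f2.
by rewrite /= (qn_sqrD hN f1 f2); field.
Qed.

(* The weak form of E[xi | G] = 0. *)
Definition orth G xi := forall B, G B -> forall v, fin v ->
  (\int[P]_(w in B) (ip v (xi w))%:E = 0)%E.

(** On each of the countably many level sets of [f] the left factor is a fixed vector; integrability
    of the product justifies the summation over these sets. *)
Lemma orth_step G f xi : cs G -> step N g setT G f -> rv measurable xi ->
  P.-integrable setT (EFin \o (fun w => ip (f w) (xi w))) -> orth G xi ->
  (\int[P]_w (ip (f w) (xi w))%:E = 0)%E.
Proof.
move=> cG [k [v [Gk fv ->]]] rx ix ox.
have U : [set: Omega] = \bigcup_i k @^-1` [set i].
  by apply/seteqP; split=> // w _; exists (k w).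
have mk i : measurable (k @^-1` [set i]).
  by apply: (complete_sigma_meas cG); rewrite -[X in G X]setTI.
rewrite U integral_bigcup//; last 2 first.
- by apply/trivIsetP => i j _ _ ij; apply/seteqP; split=> w //= [-> /eqP]; rewrite (negbTE ij).
- by rewrite -U.
apply: eseries0 => i _ _; rewrite -[RHS](ox (k @^-1` [set i]) _ (v i) (fv i)).
  by apply: eq_integral => w; rewrite inE/= => ->.
by rewrite -[X in G X]setTI.
Qed.

Lemma orth_sub G G' xi : G' `<=` G -> orth G xi -> orth G' xi.
Proof. by move=> GG o B GB; apply: o; exact: GG. Qed.

Lemma orth_ae G xi zeta : cs G -> rv measurable xi -> aeeq P zeta xi -> orth G xi -> orth G zeta.
Proof.
move=> cG rx e ox B GB v fv; rewrite -[RHS](ox B GB v fv).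
have cm := complete_measurable cG.
have mB := complete_sigma_meas cG GB.
have mv zz : rv measurable zz -> measurable_fun B (EFin \o (fun w => ip v (zz w))).
  move=> rz; apply: measurableT_comp => //.
  apply: measurable_funTS; apply: (ip_meas cm) => //; exact: (rv_cst hN cm fv).
apply: ae_eq_integral => //; [exact: (mv _ (rv_ae e rx))|exact: mv|].
by apply: ae1 e _ => w -> _.
Qed.

Section Exponent.
Variable (m : R).
Hypothesis m1 : 1 <= m.
Let m0 : 0 < m. Proof. exact: lt_le_trans m1. Qed.
Local Notation mbd := (mb P m N g).

Lemma K0 : 0 < K. Proof. exact: lt_le_trans (hilb_K hN). Qed.

Lemma qpow_meas G xi (p : R) : cs G -> rv G xi -> measurable_fun setT (fun w => q (xi w) `^ p).
Proof.
by move=> cG r; exact: (measurableT_comp (measurable_powR p) (qn_meas cG r)).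
Qed.

Lemma mb_qn_int G xi c : cs G -> mbd G xi c ->
  (\int[P]_w (q (xi w) `^ m)%:E <= ((K * c) `^ m)%:E)%E.
Proof.
move=> cG h; have r := mb_rv h; have c0 := mb_ge0 h.
rewrite powRM ?(ltW K0)// EFinM; apply: le_trans (_ : _ <= (K `^ m)%:E * _)%E _; last first.
  by apply: lee_wpmul2l (mb_int m1 hN cG h); rewrite lee_fin powR_ge0.
rewrite -ge0_integralZl//; last 3 first.
- exact: (measurable_norm_pow m hN cG r).
- by move=> w _; exact: poweR_ge0.
- by rewrite lee_fin powR_ge0.
apply: ae_ge0_le_integral => //.
- by move=> w _; rewrite lee_fin powR_ge0.
- by apply: measurableT_comp => //; exact: qpow_meas r.
- by move=> w _; rewrite mule_ge0 ?lee_fin ?powR_ge0 ?poweR_ge0.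
- by apply: emeasurable_funM => //; exact: (measurable_norm_pow m hN cG r).
apply: ae1 (rv_fin r) _ => w fw _.
rewrite (finV hN fw) poweR_EFin -EFinM lee_fin -powRM ?fine_ge0 ?(hilb_ge0 hN) ?(ltW K0)//.
by apply: powR_le; [exact: ltW|exact: qn_ge0|exact: (qn_le_norm hN)].
Qed.

Lemma qn_int_mb G xi c : cs G -> rv G xi -> 0 <= c ->
  (\int[P]_w (q (xi w) `^ m)%:E <= (c `^ m)%:E)%E -> mbd G xi (K * c).
Proof.
move=> cG r c0 h; split=> //; apply/(mnorm_leP m1 hN cG r); first by rewrite mulr_ge0// ltW// K0.
rewrite powRM ?(ltW K0)// EFinM; apply: le_trans (lee_wpmul2l _ h); last by rewrite lee_fin powR_ge0.
rewrite -ge0_integralZl//; last 3 first.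
- by apply: measurableT_comp => //; exact: qpow_meas r.
- by move=> w _; rewrite lee_fin powR_ge0.
- by rewrite lee_fin powR_ge0.
apply: ae_ge0_le_integral => //.
- by move=> w _; rewrite poweR_ge0.
- exact: (measurable_norm_pow m hN cG r).
- by move=> w _; rewrite mule_ge0 ?lee_fin ?powR_ge0.
- by apply: emeasurable_funM => //; apply: measurableT_comp => //; exact: qpow_meas r.
apply: ae1 (rv_fin r) _ => w fw _.
rewrite (finV hN fw) poweR_EFin -EFinM lee_fin -powRM ?qn_ge0 ?(ltW K0)//.
by apply: powR_le; [exact: ltW|rewrite fine_ge0// (hilb_ge0 hN)|exact: (norm_le_qn hN)].
Qed.

(** Lets an estimate be proved first on step functions at distance [eps], with any error linear in
    [eps]. *)
Lemma mb_eps G xi c (D : R) : 0 <= D -> 0 <= c -> (forall eps : R, 0 < eps -> mbd G xi (c + D * eps)) ->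
  mbd G xi c.
Proof.
move=> D0 c0 H; split; first exact: mb_rv (H 1 ltr01).
apply/lee_addgt0Pr => e e0.
have d0 : 0 < D + 1 by rewrite ltr_wpDl.
have [|_ h] := H (e / (D + 1)); first exact: divr_gt0.
apply: le_trans h _; rewrite -EFinD lee_fin lerD2l mulrCA ler_piMr ?ltW//.
by rewrite ltr_pdivrMr// mul1r ltrDl.
Qed.

End Exponent.

Lemma mb_exponent_bound G (m m' : R) xi c : 1 <= m' -> m' <= m -> cs G ->
  mb P m N g G xi c -> mb P m' N g G xi ((1 + c `^ m) `^ m'^-1).
Proof.
move=> m1 mm cG h; have r := mb_rv h; have m0 : 0 < m' by exact: lt_le_trans m1.
have c0 := mb_ge0 h.
split=> //.
apply/(mnorm_leP m1 hN cG r); first exact: powR_ge0.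
rewrite -powRrM mulVf ?gt_eqF// powRr1 ?addr_ge0 ?powR_ge0// EFinD.
apply: (@le_trans _ _ (\int[P]_w (1 + N g (xi w) `^ m))%E); last first.
  rewrite ge0_integralD//; last 2 first.
  - by move=> w _; exact: poweR_ge0.
  - exact: (measurable_norm_pow _ hN cG r).
  rewrite integral_cst// [X in (_ * X)%E](@probability_setT _ _ _ P) mule1 leeD2l//.
  exact: (mb_int (le_trans m1 mm) hN cG h).
apply: ae_ge0_le_integral => //.
- by move=> w _; exact: poweR_ge0.
- exact: (measurable_norm_pow _ hN cG r).
- by move=> w _; rewrite adde_ge0// poweR_ge0.
- by apply: emeasurable_funD => //; exact: (measurable_norm_pow _ hN cG r).
apply: ae1 (rv_fin r) _ => w fw _; rewrite (finV hN fw) !poweR_EFin -EFinD lee_fin.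
set t := fine _; have t0 : 0 <= t by rewrite fine_ge0// (hilb_ge0 hN).
have [t1|t1] := leP t 1.
  have : t `^ m' <= 1 `^ m' by apply: powR_le => //; exact: ltW.
  rewrite powR1; have := powR_ge0 t m; lra.
have : t `^ m' <= t `^ m by apply: ler_powR => //; exact: ltW.
lra.
Qed.

Lemma mb_exponent G (m m' : R) xi c : 1 <= m' -> m' <= m -> cs G ->
  mb P m N g G xi c -> exists c', mb P m' N g G xi c'.
Proof. by move=> m1 mm cG b; exists ((1 + c `^ m) `^ m'^-1); exact: mb_exponent_bound b. Qed.

(** After scaling to c = 1 the constant of [mb_exponent_bound] becomes 2^(1/m') <= 2; scaling back
    makes the bound linear in [c], as approximation arguments require. *)
Lemma mb_exponent_le G (m m' : R) xi c : 1 <= m' -> m' <= m -> cs G -> 0 < c ->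
  mb P m N g G xi c -> mb P m' N g G xi (2 * c).
Proof.
move=> m1 mm cG c0 b; have m1' := le_trans m1 mm.
have b1 := mb_scale m1' hN c^-1 cG b.
rewrite gtr0_norm ?invr_gt0// mulVf ?gt_eqF// in b1.
have := mb_exponent_bound m1 mm cG b1; rewrite powR1 => b2.
have := mb_scale m1 hN c cG b2; rewrite gtr0_norm// mulrC => b3.
apply: (mb_ae m1 hN cG _ (mb_le _ b3)); first by apply: aeW => w; rewrite scalerA mulfV ?scale1r// gt_eqF.
apply: ler_wpM2r; first exact: ltW.
rewrite -[leRHS]powRr1//; apply: ler_powR; first by rewrite lerDl.
by rewrite invf_le1// (lt_le_trans _ m1).
Qed.

Lemma mb1_qn_int G xi c : cs G -> mb P 1 N g G xi c ->
  (\int[P]_w (q (xi w))%:E <= (K * c)%:E)%E.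
Proof.
move=> cG h; rewrite (eq_integral (fun w => (q (xi w) `^ 1)%:E)); last first.
  by move=> w _; rewrite powRr1 ?qn_ge0.
apply: le_trans (mb_qn_int (lexx 1) cG h) _.
by rewrite powRr1// mulr_ge0 ?(ltW K0)// (mb_ge0 h).
Qed.

Lemma powR_sub2 (m t : R) : 2 <= m -> 0 <= t -> t `^ (m - 2) * t ^+ 2 = t `^ m.
Proof.
move=> m2 t0; have [->|t1] := eqVneq t 0.
  by rewrite expr0n/= mulr0 powR0// gt_eqF//; lra.
by rewrite -powR_mulrn// -powRD ?t1 ?implybT// subrK.
Qed.

Lemma powR_sub1 (m t : R) : 2 <= m -> 0 <= t -> t `^ (m - 2) * t = t `^ (m - 1).
Proof.
move=> m2 t0; have -> : m - 2 = (m - 1) - 1 by ring.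
by rewrite mulrC mulr_powRB1// subr_gt0; apply: lt_le_trans m2; rewrite ltr1n.
Qed.

Section Contraction.
Variable (m : R).
Hypothesis m2 : 2 <= m.
Let m1 : 1 <= m. Proof. by apply: le_trans m2; rewrite ler1n. Qed.
Let m0 : 0 < m. Proof. exact: lt_le_trans m1. Qed.
Local Notation mbd := (mb P m N g).

(** Young's inequality with 1/2 in front of u^m, so that this term can be absorbed in the left-hand
    side of the duality estimate below. *)
Lemma young_half (u t : R) : 0 <= u -> 0 <= t ->
  u `^ (m - 1) * t <= 2^-1 * u `^ m + 2^-1 * (2 * t) `^ m.
Proof.
move=> u0 t0; have e z : 0 <= z -> z `^ m = z * z `^ (m - 1) by move=> z0; rewrite mulr_powRB1.
have [ut|ut] := leP (2 * t) u.
  apply: (@le_trans _ _ (2^-1 * u `^ m)); last by rewrite lerDl mulr_ge0 ?powR_ge0 ?invr_ge0.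
  rewrite (e u)// mulrA mulrC ler_wpM2r ?powR_ge0//; lra.
apply: (@le_trans _ _ (2^-1 * (2 * t) `^ m)); last by rewrite lerDr mulr_ge0 ?powR_ge0 ?invr_ge0.
rewrite (e (2 * t)) ?mulr_ge0// mulrA mulrA mulVf// mul1r mulrC ler_wpM2l//.
by apply: powR_le => //; [rewrite subr_ge0|exact: ltW].
Qed.

(** Duality: the weak identity is tested on |f|^(m-2) f, where [f] is a step function close to
    [zeta], and Young's inequality is used pointwise in place of Hölder's. Passing from [N] to the
    Hilbert norm and back costs K^2. Of the factor 4, one 2 comes from absorbing half of |f|^m, the
    other from bounding a sum of two terms by twice the larger. *)
Lemma condexp_contraction G xi zeta c : cs G -> rv G zeta ->
  (exists c', mb P 1 N g measurable zeta c') -> mbd measurable xi c ->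
  orth G (fun w => zeta w - xi w) -> mbd G zeta (4 * K ^+ 2 * c).
Proof.
move=> cG rz [c1 bz] bx ox; have cm := complete_measurable cG; have sG := complete_sigmaP cG.
have K0' := ltW K0; have c0 := mb_ge0 bx; have rx := mb_rv bx.
have [c2 bx1] := mb_exponent (lexx 1) m1 cm bx.
have bzx := mb_subr (lexx 1) hN cm bz bx1.
have rzx := mb_rv bzx.
apply: (mb_eps (D := 4 * K ^+ 2 + 1)).
- by rewrite addr_ge0// mulr_ge0// sqr_ge0.
- by rewrite mulr_ge0// mulr_ge0// sqr_ge0.
move=> eps e0; have [f [sf rf af]] := step_rv_dist hN cG rz e0.
suff bf : mbd G f (K * (4 * K * c + 4 * K * eps)).
  have bd : mbd G (fun w => zeta w - f w) eps.
    apply: (mb_bound m1 hN cG) => //; [exact: (rv_subr hN)|exact: ltW|].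
    by apply: ae1 af _ => w /ltW.
  apply: (@mb_le _ _ _ _ _ _ _ _ _ _ (K * (4 * K * c + 4 * K * eps) + eps)); first by lra.
  apply: (mb_ae m1 hN cG _ (mb_add m1 hN cG bf bd)).
  by apply: aeW => w; rewrite addrC subrK.
(* Truncation bounds the test function, so that its product with a variable of L^1 is integrable:
   beyond the first moment nothing is known of [zeta] yet. Fatou's lemma removes the truncation. *)
pose x (n : nat) w := if q (f w) <= n%:R then f w else 0.
apply: (mb_fatou m1 hN cG (x := x)) => //.
  apply: aeW => w e' e'0; exists (Num.bound (q (f w))) => n hn.
  rewrite /x ifT ?subrr ?(hilb0 hN)//.
  by apply: le_trans (ltW (archi_boundP (qn_ge0 _ _))) _; rewrite ler_nat.
move=> n; pose phi u := if q u <= n%:R then q u `^ (m - 2) *: u else 0.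
have sx : step N g setT G (x n).
  apply: (step_fun2 hN sG (phi := fun u _ => if q u <= n%:R then u else 0) _ sf sf).
  by move=> u v fu _; case: ifP => // _; exact: (fin0 hN).
have sphi : step N g setT G (fun w => phi (f w)).
  apply: (step_fun2 hN sG (phi := fun u _ => phi u) _ sf sf).
  by move=> u v fu _; rewrite /phi; case: ifP => _; [exact: (finZ hN)|exact: (fin0 hN)].
have rphi := step_rv hN cG sphi.
have rx' := step_rv hN cG sx.
apply: (qn_int_mb m1 cG rx'); first by rewrite addr_ge0// !mulr_ge0// ltW.
pose C w := ip (phi (f w)) (zeta w - xi w).
have mC : measurable_fun setT C.
  by apply: (ip_meas cm _ rzx); exact: rv_sub (complete_sigma_meas cG) rphi.
have iC : P.-integrable setT (EFin \o C).
  apply: (@integrable_dom _ _ _ _ _ (fun w => n%:R `^ (m - 1) * q (zeta w - xi w)) mC).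
  - by apply: measurable_funM => //; exact: (qn_meas cm rzx).
  - apply: ae1 (rv_fin rzx) _ => w fw.
    rewrite /C /phi; case: ifP => qn_; last first.
      by rewrite (ip0l hN fw) normr0 mulr_ge0 ?powR_ge0 ?qn_ge0.
    have ff := step_fin w sf.
    apply: le_trans (cauchy_schwarz hN (finZ hN _ ff) fw) _.
    apply: ler_wpM2r; first exact: qn_ge0.
    rewrite (qnZ hN)// ger0_norm ?powR_ge0// powR_sub1 ?qn_ge0//.
    by apply: powR_le => //; [rewrite subr_ge0|exact: qn_ge0].
  - under eq_integral do rewrite EFinM.
    rewrite ge0_integralZl//; last 2 first.
    + by apply: measurableT_comp => //; exact: (qn_meas cm rzx).
    + by move=> w _; rewrite lee_fin qn_ge0.
    apply: (@le_lt_trans _ _ ((n%:R `^ (m - 1))%:E * (K * (c1 + c2))%:E)%E).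
      by apply: lee_wpmul2l; [rewrite lee_fin powR_ge0|exact: (mb1_qn_int cm bzx)].
    by rewrite -EFinM ltry.
have C0 : (\int[P]_w (C w)%:E = 0)%E by exact: orth_step cG sphi rzx iC ox.
pose b w := (4 * q (xi w)) `^ m + (4 * K * eps) `^ m.
have mb4 : measurable_fun setT (fun w => (4 * q (xi w)) `^ m).
  by apply: (measurableT_comp (measurable_powR m)); apply: measurable_funM => //; exact: (qn_meas cm rx).
apply: (@le_trans _ _ (\int[P]_w (b w)%:E)%E).
  apply: (@int_le_orth _ _ _ _ _ _ (fun w => 2 * C w)).
  - exact: (qpow_meas _ cG rx').
  - exact: measurable_funD.
  - have -> : EFin \o (fun w => 2 * C w) = (fun w => 2%:E * (EFin \o C) w)%E by [].
    exact: integrableZl.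
  - by rewrite integral_scale// C0 mule0.
  - by move=> w; exact: powR_ge0.
  - by move=> w; rewrite addr_ge0 ?powR_ge0.
  apply: ae2 af (ae2 (rv_fin rz) (rv_fin rx) (fun w => @conj _ _)) _ => w fzw [fz fx].
  have ff := step_fin w sf; have fzx := finB hN fz fx; have ffz := finB hN ff fz.
  rewrite /x /C /phi /b; case: ifP => _; last first.
    rewrite (qn0 hN) (ip0l hN fzx) powR0 ?gt_eqF// mulr0 addr0 addr_ge0 ?powR_ge0//.
  set u := q (f w); have u0 : 0 <= u := qn_ge0 _ _.
  set t := q (xi w) + K * eps; have t0 : 0 <= t by rewrite addr_ge0 ?qn_ge0 ?mulr_ge0// ltW.
  have qfz : q (f w - zeta w) <= K * eps.
    apply: le_trans (qn_le_norm hN ffz) _; apply: ler_wpM2l => //.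
    by rewrite -lee_fin -(finV hN ffz) (norm_distC hN) ltW.
  have E : u `^ m = u `^ (m - 2) * (ip (f w) (f w - zeta w) + ip (f w) (zeta w - xi w) + ip (f w) (xi w)).
    rewrite !(ipBr hN)// -powR_sub2// /u (qn_sqr hN ff); congr (_ * _); ring.
  have c1' := cauchy_schwarz hN ff ffz; have c2' := cauchy_schwarz hN ff fx.
  have le1 : u `^ m <= u `^ (m - 1) * t + ip (u `^ (m - 2) *: f w) (zeta w - xi w).
    rewrite E (ipZl hN)// -powR_sub1// /t.
    have h1 : ip (f w) (f w - zeta w) <= u * (K * eps).
      by apply: le_trans (ler_norm _) _; apply: le_trans c1' _; exact: ler_wpM2l.
    have h2 : ip (f w) (xi w) <= u * q (xi w) by apply: le_trans (ler_norm _) _.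
    have p0 := powR_ge0 u (m - 2).
    nra.
  have y := young_half u0 t0.
  have t2 : (2 * t) `^ m <= (4 * q (xi w)) `^ m + (4 * K * eps) `^ m.
    have [le|le] := leP (K * eps) (q (xi w)).
      apply: (@le_trans _ _ ((4 * q (xi w)) `^ m)); last by rewrite lerDl powR_ge0.
      by apply: powR_le; rewrite ?(ltW m0)// ?mulr_ge0// /t; lra.
    apply: (@le_trans _ _ ((4 * K * eps) `^ m)); last by rewrite lerDr powR_ge0.
    by apply: powR_le; rewrite ?(ltW m0)// ?mulr_ge0// /t; lra.
  lra.
under eq_integral do rewrite EFinD.
rewrite ge0_integralD//; last 3 first.
- by move=> w _; rewrite lee_fin powR_ge0.
- exact: measurableT_comp.
- by move=> w _; rewrite lee_fin powR_ge0.
rewrite integral_cst// [X in (_ + _ * X)%E](@probability_setT _ _ _ P) mule1.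
apply: (@le_trans _ _ (((4 * K * c) `^ m)%:E + ((4 * K * eps) `^ m)%:E)%E); last first.
  by rewrite -EFinD lee_fin powR_superadd// !mulr_ge0// ltW.
rewrite leeD2r//; under eq_integral do rewrite powRM ?qn_ge0// EFinM.
rewrite ge0_integralZl//; last 2 first.
- by apply: measurableT_comp => //; exact: (qpow_meas _ cm rx).
- by move=> w _; rewrite lee_fin powR_ge0.
rewrite -mulrA powRM ?mulr_ge0// EFinM; apply: lee_wpmul2l; first by rewrite lee_fin powR_ge0.
exact: (mb_qn_int m1 cm bx).
Qed.

End Contraction.

Local Notation L2 := (mb P 2 N g).
Let le12 : 1 <= 2 :> R. Proof. by rewrite ler1n. Qed.

Definition mean (f : Omega -> R) := fine (\int[P]_w (f w)%:E).

Lemma meanE (f : Omega -> R) : P.-integrable setT (EFin \o f) ->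
  (\int[P]_w (f w)%:E = (mean f)%:E)%E.
Proof. by move=> i; rewrite fineK//; exact: (integrable_fin_num measurableT i). Qed.

Lemma mean_lin (f h : Omega -> R) (t : R) : P.-integrable setT (EFin \o f) ->
  P.-integrable setT (EFin \o h) -> mean (fun w => f w + t * h w) = mean f + t * mean h.
Proof.
move=> i_f ih; have ith : P.-integrable setT (EFin \o (fun w => t * h w)).
  have -> : EFin \o (fun w => t * h w) = (fun w => t%:E * (EFin \o h) w)%E by [].
  exact: integrableZl.
by rewrite {1}/mean integral_addr// integral_scale// !meanE// -EFinM -EFinD.
Qed.

Lemma mean_ae (f h : Omega -> R) : measurable_fun setT f -> measurable_fun setT h ->
  {ae P, forall w, f w = h w} -> mean f = mean h.
Proof.
move=> mf mh e; congr fine; apply: ae_eq_integral => //; try exact: measurableT_comp.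
by apply: ae1 e _ => w -> _.
Qed.

Lemma sqr_int G xi c : cs G -> L2 G xi c ->
  (\int[P]_w (q (xi w) ^+ 2)%:E <= ((K * c) ^+ 2)%:E)%E.
Proof.
move=> cG b; have := mb_qn_int le12 cG b.
under eq_integral do rewrite powR_mulrn ?qn_ge0//.
by rewrite powR_mulrn// mulr_ge0 ?(ltW K0)// (mb_ge0 b).
Qed.

Lemma sqr_integrable G xi c : cs G -> L2 G xi c ->
  P.-integrable setT (EFin \o (fun w => q (xi w) ^+ 2)).
Proof.
move=> cG b; have mq : measurable_fun setT (fun w => q (xi w) ^+ 2).
  by apply: (measurable_funX 2); exact: (qn_meas cG (mb_rv b)).
apply: (integrable_dom mq mq); first by apply: aeW => w; rewrite ger0_norm ?sqr_ge0.
exact: le_lt_trans (sqr_int cG b) (ltry _).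
Qed.

Lemma ip_integrable G xi zeta c c' : cs G -> L2 G xi c -> L2 G zeta c' ->
  P.-integrable setT (EFin \o (fun w => ip (xi w) (zeta w))).
Proof.
move=> cG b b'.
have mq zz cc : L2 G zz cc -> measurable_fun setT (fun w => q (zz w) ^+ 2).
  by move=> bb; apply: (measurable_funX 2); exact: (qn_meas cG (mb_rv bb)).
apply: (integrable_dom (h := fun w => q (xi w) ^+ 2 + q (zeta w) ^+ 2)).
- exact: (ip_meas cG (mb_rv b) (mb_rv b')).
- by apply: measurable_funD; [exact: mq b|exact: mq b'].
- apply: ae2 (rv_fin (mb_rv b)) (rv_fin (mb_rv b')) _ => w f f'.
  apply: le_trans (cauchy_schwarz hN f f') _.
  have := sqr_ge0 (q (xi w) - q (zeta w)); have := qn_ge0 ip (xi w).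
  have := qn_ge0 ip (zeta w); nra.
- under eq_integral do rewrite EFinD.
  rewrite ge0_integralD//; try (by move=> w _; rewrite lee_fin sqr_ge0);
    try (by apply: measurableT_comp => //; [exact: mq b|exact: mq b']).
    by apply: lte_add_pinfty; [exact: le_lt_trans (sqr_int cG b) (ltry _)|exact: le_lt_trans (sqr_int cG b') (ltry _)].
  by apply: measurableT_comp => //; exact: mq b.
by apply: measurableT_comp => //; exact: mq b'.
Qed.

Lemma mean_sqr_expand G xi zeta c c' (t : R) : cs G -> L2 G xi c -> L2 G zeta c' ->
  mean (fun w => q (xi w - t *: zeta w) ^+ 2) =
  mean (fun w => q (xi w) ^+ 2) - 2 * t * mean (fun w => ip (xi w) (zeta w)) +
    t ^+ 2 * mean (fun w => q (zeta w) ^+ 2).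
Proof.
move=> cG b b'.
have i1 := sqr_integrable cG b; have i2 := ip_integrable cG b b'.
have i3 := sqr_integrable cG b'.
have mq zz : rv G zz -> measurable_fun setT (fun w => q (zz w) ^+ 2).
  by move=> rz; apply: (measurable_funX 2); exact: (qn_meas cG rz).
have i12 : P.-integrable setT (EFin \o (fun w => q (xi w) ^+ 2 + (- (2 * t)) * ip (xi w) (zeta w))).
  have -> : EFin \o (fun w => q (xi w) ^+ 2 + (- (2 * t)) * ip (xi w) (zeta w)) =
     (fun w => (EFin \o (fun w => (q (xi w) ^+ 2)%R)) w +
      (- (2 * t))%:E * (EFin \o (fun w => ip (xi w) (zeta w))) w)%E by [].
  by apply: integrableD => //; exact: integrableZl.
rewrite -mulNr -(mean_lin _ i1 i2) -(mean_lin _ i12 i3); apply: mean_ae.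
- by apply: mq; apply: (rv_subr hN) => //; [exact: mb_rv b|apply: (rv_scale hN) => //; exact: mb_rv b'].
- apply: measurable_funD; first apply: measurable_funD.
  + exact: mq (mb_rv b).
  + by apply: measurable_funM => //; exact: (ip_meas cG (mb_rv b) (mb_rv b')).
  + by apply: measurable_funM => //; exact: mq (mb_rv b').
apply: ae2 (rv_fin (mb_rv b)) (rv_fin (mb_rv b')) _ => w f f'.
have ft := finN hN (finZ hN t f').
rewrite (qn_sqrD hN f ft) (qnN hN (finZ hN t f')) (qnZ hN)// (ipNr hN (finZ hN t f') f) (ipZr hN)//.
by rewrite exprMn real_normK ?num_real//; ring.
Qed.

Lemma mean_ge0 (f : Omega -> R) : (forall w, 0 <= f w) -> 0 <= mean f.
Proof. by move=> f0; apply: fine_ge0; apply: integral_ge0 => w _; rewrite lee_fin. Qed.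

Lemma mean_sqr_mb G xi c e : cs G -> L2 G xi c -> 0 <= e ->
  mean (fun w => q (xi w) ^+ 2) <= e ^+ 2 -> L2 G xi (K * e).
Proof.
move=> cG b e0 h; apply: (qn_int_mb le12 cG (mb_rv b) e0).
under eq_integral do rewrite powR_mulrn ?qn_ge0//.
by rewrite powR_mulrn// (meanE (sqr_integrable cG b)) lee_fin.
Qed.

Lemma orth_mean G xi c : cs G -> L2 measurable xi c ->
  (forall B v, G B -> fin v ->
     mean (fun w => ip (xi w) (if `[< B w >] then v else 0)) = 0) -> orth G xi.
Proof.
move=> cG b H B GB v fv; have cm := complete_measurable cG.
have rB : rv measurable (fun w => if `[< B w >] then v else 0).
  apply: (rv_sub (complete_sigma_meas cG)); apply: (step_rv hN cG).
  apply: (@step_count _ _ _ _ _ _ hN _ _ _ (complete_sigmaP cG) bool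
    (fun w => `[< B w >]) (fun b => if b then v else 0)); last first.
    by move=> [] //; exact: (fin0 hN).
  have E : B = [set: Omega] `&` (fun w => `[< B w >]) @^-1` [set true].
    by apply/seteqP; split=> w /=; [move=> Bw; split=> //; apply/asboolP|move=> [_ /asboolP]].
  have E' : [set: Omega] `&` ~` B = [set: Omega] `&` (fun w => `[< B w >]) @^-1` [set false].
    by apply/seteqP; split=> w /= [_ h]; split=> //; [apply/asboolPn|move/asboolPn: h].
  move=> [|]; first by rewrite -E.
  by rewrite -E'; apply: (sigma_setC (complete_sigmaP cG)); rewrite setTI.
have bB : L2 measurable (fun w => if `[< B w >] then v else 0) (fine (N g v)).
  apply: (mb_bound le12 hN cm rB); first by rewrite fine_ge0// (hilb_ge0 hN).
  apply: aeW => w; case: ifP => _; first by rewrite (finV hN fv).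
  by rewrite (hilb0 hN) lee_fin fine_ge0// (hilb_ge0 hN).
have := H B v GB fv; have i := ip_integrable cm b bB.
move=> h; have {}h : (\int[P]_w (ip (xi w) (if `[< B w >] then v else 0))%:E = 0)%E.
  by rewrite (meanE i) h.
rewrite -[RHS]h integral_mkcond; apply: ae_eq_integral => //.
- apply/(measurable_restrictT _ (complete_sigma_meas cG GB)); apply: measurable_funTS.
  apply: measurableT_comp => //; apply: (ip_meas cm) => //; [exact: (rv_cst hN cm fv)|exact: mb_rv b].
- by apply: measurableT_comp => //; exact: (ip_meas cm (mb_rv b) rB).
apply: ae1 (rv_fin (mb_rv b)) _ => w fw _; rewrite patchE.
case: asboolP => Bw; first by rewrite mem_set// (hilb_ipC hN).
by rewrite memNset// (hilb_ipC hN fw) ?(ip0l hN fw)//; exact: (fin0 hN).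
Qed.

(** The arithmetic by which a limit of a minimizing sequence is a minimizer. [A] is the energy of an
    approximation, [Y] the squared distance to the limit and [B] the cross term; the positivity of
    one more square, dilated by 1/p, bounds [B] from below. *)
Lemma quadratic_gap (I C e A B Y p : R) : 0 <= I -> 0 <= C -> 0 < p -> p <= 1 ->
  2 * p * (I + 2 + 2 * C) < e -> A < I + p ^+ 4 -> Y <= C * p ^+ 4 ->
  0 <= A + 2 * (p^-1 * B) + p^-1 ^+ 2 * Y -> A - 2 * B + Y <= I + e.
Proof.
move=> I0 C0 p0 p1 hn hA hY hq.
have {}hq : 0 <= p * A + 2 * B + Y / p.
  have := mulr_ge0 (ltW p0) hq; congr (_ <= _); field; exact: lt0r_neq0.
have Yp : Y / p <= C * p ^+ 3.
  rewrite ler_pdivrMr//; apply: le_trans hY _; rewrite le_eqVlt; apply/orP; left; apply/eqP; ring.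
have q4 : p ^+ 4 <= p by rewrite exprS ler_piMr ?exprn_ile1// ltW.
have q3 : p ^+ 3 <= p by rewrite exprS ler_piMr ?exprn_ile1// ltW.
have pA : p * A <= p * (I + 1).
  by rewrite ler_pM2l//; apply: ltW; apply: lt_le_trans hA _; rewrite lerD2l (le_trans q4).
have Cq3 : C * p ^+ 3 <= C * p by exact: ler_wpM2l.
have Cq4 : C * p ^+ 4 <= C * p by exact: ler_wpM2l.
nra.
Qed.

(** Orthogonal projection in L^2 onto the [G]-measurable variables, by minimizing the distance to
    [xi]. The excess 16^-n of the minimizing sequence becomes a distance of order 4^-n, which is
    summable. *)
Lemma condexp_exists G xi c : cs G -> L2 measurable xi c ->
  exists2 zeta, (exists c', L2 G zeta c') & orth G (fun w => zeta w - xi w).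
Proof.
move=> cG bx; have cm := complete_measurable cG.
have up zz cc : L2 G zz cc -> L2 measurable zz cc by apply: mb_sub; exact: (complete_sigma_meas cG).
pose E2 zz := mean (fun w => q (zz w) ^+ 2).
have E20 zz : 0 <= E2 zz by apply: mean_ge0 => w; rewrite sqr_ge0.
pose S := [set e : R | exists zz cc, L2 G zz cc /\ e = E2 (fun w => xi w - zz w)].
have infS : has_inf S.
  split; first by exists (E2 (fun w => xi w - 0)), (fun=> 0), 0; split=> //; exact: (mb0 le12 hN cG).
  by exists 0 => _ [zz [cc [_ ->]]].
have Slb zz cc : L2 G zz cc -> inf S <= E2 (fun w => xi w - zz w).
  by move=> h; apply: ge_inf; [case: infS|exists zz, cc].
have /choice[z hz] : forall n, exists zz, exists2 cc, L2 G zz cc &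
    E2 (fun w => xi w - zz w) < inf S + (16 ^+ n)^-1.
  move=> n; have [|_ [zz [cc [h ->]]] lt] := @inf_adherent _ S (16 ^+ n)^-1 _ infS.
    by rewrite invr_gt0 exprn_gt0.
  by exists zz, cc.
have bxz n : exists cc, L2 measurable (fun w => xi w - z n w) cc.
  by have [cc h _] := hz n; exists (c + cc); apply: (mb_subr le12 hN cm bx); exact: up.
have e4 n : (16 ^+ n)^-1 = (4 ^+ n)^-1 ^+ 2 :> R.
  by rewrite exprVn -exprM mulnC exprM; congr ((_ ^+ _)^-1); rewrite -natrX.
(* Parallelogram identity: the midpoint of z_n and z_k cannot have energy below the infimum, so the
   mean square of z_k - z_n is at most 4 * 16^-n. *)
have bzz n k : (n <= k)%N -> L2 G (fun w => z k w - z n w) (K * (2 * (4 ^+ n)^-1)).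
  move=> nk; have [ck hk lk] := hz k; have [cn hn ln] := hz n.
  have bd := mb_subr le12 hN cG hk hn; have [cc bn] := bxz n.
  apply: (mean_sqr_mb cG bd); first by rewrite mulr_ge0// invr_ge0 exprn_ge0.
  have x1 := mean_sqr_expand 1 cm bn (up _ _ bd).
  have x2 := mean_sqr_expand 2^-1 cm bn (up _ _ bd).
  have b2 : L2 G (fun w => z n w + 2^-1 *: (z k w - z n w)) (cn + `|2^-1| * (ck + cn)).
    by apply: (mb_add le12 hN cG hn); exact: (mb_scale le12 hN _ cG bd).
  have l2 := Slb _ _ b2.
  have y1 : E2 (fun w => xi w - z k w) = mean (fun w => q (xi w - z n w - 1 *: (z k w - z n w)) ^+ 2).
    by congr mean; apply/funext => w; rewrite scale1r opprB addrA subrK.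
  have y2 : E2 (fun w => xi w - (z n w + 2^-1 *: (z k w - z n w))) =
      mean (fun w => q (xi w - z n w - 2^-1 *: (z k w - z n w)) ^+ 2).
    by congr mean; apply/funext => w; rewrite opprD addrA.
  rewrite y1 x1 in lk; rewrite y2 x2 in l2.
  have ek : (16 ^+ k)^-1 <= (16 ^+ n)^-1 :> R.
    by rewrite lef_pV2 ?posrE ?exprn_gt0// ler_eXn2l ?ltr1n.
  move: ln lk l2; rewrite /E2 exprMn -e4.
  move: (mean _) (mean _) (mean _) => A B C; lra.
have rz n : rv G (z n) by have [cc h _] := hz n; exact: mb_rv h.
have [|zeta rzeta hzeta] := mb_complete le12 hN cG _ rz bzz.
  move=> eps e0; have [n0 hn0] := eps_small (divr_gt0 e0 K0).
  exists n0 => n n0n; rewrite mulrC -ltr_pdivlMr ?K0//; apply: le_lt_trans hn0.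
  rewrite ler_pM2l// lef_pV2 ?posrE ?exprn_gt0//; apply: (@le_trans _ _ (2 ^+ n)).
    by rewrite ler_eXn2l ?ltr1n.
  by rewrite lerXn2r ?nnegrE// ler_nat.
have [cz bz] : exists cc, L2 G zeta cc.
  have [cc h _] := hz 0%N; exists (K * (2 * (4 ^+ 0)^-1) + cc).
  by apply: (mb_ae le12 hN cG _ (mb_add le12 hN cG (hzeta 0%N) h)); apply: aeW => w; rewrite subrK.
exists zeta; first by exists cz.
have bxz' : L2 measurable (fun w => xi w - zeta w) (c + cz) by apply: (mb_subr le12 hN cm bx); exact: up.
(* The infimum is attained at the limit. The dilation by 2^n of the error, which is of order 4^-n,
   still vanishes; this is the role of p = 2^-n in [quadratic_gap]. *)
have minz : E2 (fun w => xi w - zeta w) <= inf S.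
  apply/ler_addgt0Pr => e e0.
  have I0 : 0 <= inf S by apply: lb_le_inf; [case: infS|move=> _ [zz [cc [_ ->]]]].
  pose C := 4 * K ^+ 4; have C0 : 0 <= C by rewrite mulr_ge0// exprn_ge0// ltW// K0.
  have D0 : 0 < inf S + 2 + 2 * C.
    by rewrite (@lt_le_trans _ _ 2)// -addrA [inf S + _]addrC -addrA lerDl addr_ge0// mulr_ge0.
  have [n hn] := eps_small (divr_gt0 e0 D0).
  have [cn bn] := bxz n; have bd := hzeta n; have [cc h lt] := hz n.
  have e1 := mean_sqr_expand 1 cm bn (up _ _ bd).
  have e2 := mean_sqr_expand (- 2 ^+ n) cm bn (up _ _ bd).
  have y1 : E2 (fun w => xi w - zeta w) = mean (fun w => q (xi w - z n w - 1 *: (zeta w - z n w)) ^+ 2).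
    by congr mean; apply/funext => w; rewrite scale1r opprB addrA subrK.
  have e20 : 0 <= mean (fun w => q (xi w - z n w - (- 2 ^+ n) *: (zeta w - z n w)) ^+ 2).
    by apply: mean_ge0 => w; rewrite sqr_ge0.
  have Y1 : mean (fun w => q (zeta w - z n w) ^+ 2) <= C * (16 ^+ n)^-1.
    have := sqr_int cG bd; rewrite (meanE (sqr_integrable cG bd)) lee_fin => /le_trans; apply.
    by rewrite e4 /C le_eqVlt; apply/orP; left; apply/eqP; ring.
  have p16 : (16 ^+ n)^-1 = (2 ^+ n)^-1 ^+ 4 :> R.
    by rewrite exprVn -exprM mulnC exprM; congr ((_ ^+ _)^-1); rewrite -natrX.
  rewrite y1 e1 mulr1 expr1n mul1r.
  apply: (@quadratic_gap _ C _ _ _ _ (2 ^+ n)^-1) => //.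
  - by rewrite invf_le1 ?exprn_gt0// exprn_ege1// ler1n.
  - by rewrite -ltr_pdivlMr.
  - by rewrite -p16.
  - by rewrite -p16.
  - by rewrite invrK; move: e20; rewrite e2 sqrrN mulrN mulNr opprK -mulrA.
apply: (orth_mean cG).
  by apply: (mb_subr le12 hN cm _ bx); exact: up bz.
move=> B v GB fv.
have sB : step N g setT G (fun w => if `[< B w >] then v else 0).
  apply: (@step_count _ _ _ _ _ _ hN _ _ _ (complete_sigmaP cG) bool
    (fun w => `[< B w >]) (fun b => if b then v else 0)); last first.
    by move=> [] //; exact: (fin0 hN).
  have E : B = [set: Omega] `&` (fun w => `[< B w >]) @^-1` [set true].
    by apply/seteqP; split=> w /=; [move=> Bw; split=> //; apply/asboolP|move=> [_ /asboolP]].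
  have E' : [set: Omega] `&` ~` B = [set: Omega] `&` (fun w => `[< B w >]) @^-1` [set false].
    by apply/seteqP; split=> w /= [_ h]; split=> //; [apply/asboolPn|move/asboolPn: h].
  move=> [|]; first by rewrite -E.
  by rewrite -E'; apply: (sigma_setC (complete_sigmaP cG)); rewrite setTI.
set y := fun w => if `[< B w >] then v else 0 in sB *.
have ry := step_rv hN cG sB.
have bB : L2 G y (fine (N g v)).
  apply: (mb_bound le12 hN cG ry); first by rewrite fine_ge0// (hilb_ge0 hN).
  apply: aeW => w; rewrite /y; case: ifP => _; first by rewrite (finV hN fv).
  by rewrite (hilb0 hN) lee_fin fine_ge0// (hilb_ge0 hN).
(* First variation: moving the minimizer by t y cannot decrease the energy. As this holds for every
   real [t], the linear term must vanish. *)
have key t : 2 * t * mean (fun w => ip (xi w - zeta w) (y w)) <= t ^+ 2 * mean (fun w => q (y w) ^+ 2).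
  have := mean_sqr_expand t cm bxz' (up _ _ bB).
  have := Slb _ _ (mb_add le12 hN cG bz (mb_scale le12 hN t cG bB)).
  have -> : E2 (fun w => xi w - (zeta w + t *: y w)) = mean (fun w => q (xi w - zeta w - t *: y w) ^+ 2).
    by congr mean; apply/funext => w; rewrite opprD addrA.
  by move=> /[swap] ->; move: minz; rewrite /E2; move: (mean _) (mean _) (mean _) => a b c0; lra.
have -> : mean (fun w => ip (zeta w - xi w) (y w)) = - mean (fun w => ip (xi w - zeta w) (y w)).
  have i := ip_integrable cm bxz' (up _ _ bB).
  have i0 : P.-integrable setT (EFin \o (fun _ : Omega => 0 : R)) by exact: integrable0.
  have := mean_lin (-1) i0 i; rewrite {2}/mean integral0 add0r mulN1r => <-.
  apply: mean_ae.
  - apply: (ip_meas cm); last exact: mb_rv (up _ _ bB).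
    by apply: (rv_subr hN cm); [exact: mb_rv (up _ _ bz)|exact: mb_rv bx].
  - apply: measurable_funD => //; apply: measurable_funM => //.
    exact: (ip_meas cm (mb_rv bxz') (mb_rv (up _ _ bB))).
  apply: ae2 (rv_fin (mb_rv bxz')) (rv_fin ry) _ => w f1 f2.
  by rewrite add0r mulN1r -(ipNl hN)// opprB.
move: key; set e := mean (fun w => ip (xi w - zeta w) (y w)); set Y := mean _ => key.
have Y0 : 0 <= Y by apply: mean_ge0 => w; rewrite sqr_ge0.
apply/eqP; rewrite oppr_eq0; apply/eqP.
have Y1 : 0 < Y + 1 by rewrite ltr_wpDl.
(* The optimal t would be e / Y, but [Y] may be 0. *)
have := key (e / (Y + 1)).
have -> : 2 * (e / (Y + 1)) * e = 2 * (Y + 1) * (e / (Y + 1)) ^+ 2 by field; exact: lt0r_neq0.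
set t := e / (Y + 1) => h.
have t0 : t ^+ 2 <= 0 by have := sqr_ge0 t; nra.
have : t == 0 by rewrite -sqrf_eq0 eq_le t0 sqr_ge0.
by rewrite mulf_eq0 invr_eq0 (gt_eqF Y1) orbF => /eqP.
Qed.

(** * Bochner integrals and the weak form of conditional expectation *)

Implicit Types f : Omega -> W.

Lemma simple_range f : simple_fun N g f ->
  exists s : seq W, [/\ uniq s, forall w, f w \in s, forall x, x \in s -> fin x &
    forall B, simple_integral P B f = \sum_(x <- s) fine (P (B `&` f @^-1` [set x])) *: x].
Proof.
move=> [/finite_seqP[s0 rs] ff _]; pose s := undup s0.
have rs' : range f = [set` s] by rewrite rs; apply/seteqP; split=> x /=; rewrite mem_undup.
exists s; split; first exact: undup_uniq.
- by move=> w; have: (range f) (f w); [by exists w|rewrite rs'].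
- by move=> x xs; have : [set` s] x by []; rewrite -rs' => -[w _ <-].
- move=> B; rewrite /simple_integral rs' -fsbig_seq//; exact: undup_uniq.
Qed.

Lemma simple_integral_fun f B (phi : W -> R) (s : seq W) : simple_fun N g f -> measurable B ->
  uniq s -> (forall w, f w \in s) ->
  (\int[P]_(w in B) (phi (f w))%:E =
   (\sum_(x <- s) fine (P (B `&` f @^-1` [set x])) * phi x)%R%:E)%E.
Proof.
move=> [_ ff mf] mB us ws.
have -> : (\int[P]_(w in B) (phi (f w))%:E =
    \int[P]_(w in B) (\sum_(x <- s) (phi x)%:E * (\1_(f @^-1` [set x]) w)%:E))%E.
  apply: eq_integral => w _; rewrite (big_rem _ (ws w))/= indicE mem_set//= mule1.
  rewrite big_seq big1 ?adde0// => x; rewrite mem_rem_uniq// inE => /andP[xf _].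
  by rewrite indicE memNset ?mule0//= => /esym/eqP; rewrite (negbTE xf).
have iI x : P.-integrable B (EFin \o \1_(f @^-1` [set x])).
  by apply: (integrableS measurableT) => //; apply: integrable_indic.
rewrite integral_sum//; last first.
  by move=> x; apply: integrableZl => //; exact: (iI x).
rewrite -sumEFin; apply: eq_bigr => x _.
rewrite (integralZl mB (iI x)) [X in (_ * X)%E](integral_indic P mB (mf x)).
rewrite mulrC EFinM setIC fineK//.
by apply: fin_num_measure; exact: measurableI.
Qed.

Lemma simple_bounded f : simple_fun N g f -> exists2 M : R, 0 <= M & forall w, (N g (f w) <= M%:E)%E.
Proof.
move=> sf; have [s [us ws fs _]] := simple_range sf.
exists (\sum_(x <- s) fine (N g x)).
  by apply: sumr_ge0 => x _; rewrite fine_ge0// (hilb_ge0 hN).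
move=> w; rewrite (finV hN (fs _ (ws w))) lee_fin (big_rem _ (ws w))/= lerDl.
by apply: sumr_ge0 => x _; rewrite fine_ge0// (hilb_ge0 hN).
Qed.

Lemma simple_step f : simple_fun N g f -> step N g setT measurable f.
Proof.
move=> sf; have [s [us ws fs _]] := simple_range sf; have [_ ff mf] := sf.
exists (fun w => index (f w) s), (fun i => nth 0 s i); split.
- move=> i; rewrite setTI; have [si|si] := ltnP i (size s).
    have -> : (fun w => index (f w) s) @^-1` [set i] = f @^-1` [set nth 0 s i].
      apply/seteqP; split=> w /= h; first by rewrite -h nth_index.
      by rewrite h index_uniq.
    exact: mf.
  have -> : (fun w => index (f w) s) @^-1` [set i] = set0; last exact: measurable0.
  by apply/seteqP; split=> w //= h; move: (ws w); rewrite -index_mem h ltnNge si.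
- move=> i; have [si|si] := ltnP i (size s); last by rewrite nth_default// (fin0 hN).
  by apply: fs; exact: mem_nth.
- by apply/funext => w /=; rewrite nth_index.
Qed.

Lemma simple_integral_fin f B : simple_fun N g f -> fin (simple_integral P B f).
Proof.
move=> sf; have [s [us ws fs ->]] := simple_range sf.
by rewrite big_seq; apply: (fin_sum hN) => x /fs; exact: (finZ hN).
Qed.

Lemma simple_integral_ip f B v : simple_fun N g f -> measurable B -> fin v ->
  (ip v (simple_integral P B f))%:E = (\int[P]_(w in B) (ip v (f w))%:E)%E.
Proof.
move=> sf mB fv; have [s [us ws fs ->]] := simple_range sf.
rewrite (simple_integral_fun _ sf mB us ws); congr EFin.
have: {subset s <= s} by [].
elim: {1 3 4}s => [_|x t IH tS].
  by rewrite !big_nil (hilb_ipC hN) ?(ip0l hN)//; exact: (fin0 hN).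
rewrite !big_cons (ipDr hN)//; last 2 first.
- by apply/(finZ hN)/fs/tS; rewrite inE eqxx.
- by rewrite big_seq; apply: (fin_sum hN) => y yt; apply/(finZ hN)/fs/tS; rewrite inE yt orbT.
rewrite (ipZr hN) ?IH//; first by move=> y yt; apply: tS; rewrite inE yt orbT.
by apply/fs/tS; rewrite inE eqxx.
Qed.

Hypothesis cm : cs measurable.

Lemma ip_int_integrable xi c v B : mb P 1 N g measurable xi c -> fin v -> measurable B ->
  P.-integrable B (EFin \o (fun w => ip v (xi w))).
Proof.
move=> b fv mB; apply: (integrableS measurableT) => //.
have rx := mb_rv b.
apply: (integrable_dom (h := fun w => q v * q (xi w))).
- exact: (ip_meas cm (rv_cst hN cm fv) rx).
- by apply: measurable_funM => //; exact: (qn_meas cm rx).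
- by apply: ae1 (rv_fin rx) _ => w fw; exact: (cauchy_schwarz hN).
under eq_integral do rewrite EFinM.
rewrite ge0_integralZl//; last 3 first.
- by apply: measurableT_comp => //; exact: (qn_meas cm rx).
- by move=> w _; rewrite lee_fin qn_ge0.
- by rewrite lee_fin qn_ge0.
apply: (@le_lt_trans _ _ ((q v)%:E * (K * c)%:E)%E); last by rewrite -EFinM ltry.
by apply: lee_wpmul2l; [rewrite lee_fin qn_ge0|exact: (mb1_qn_int cm b)].
Qed.

Lemma ip_int_bound xi c v B (e : R) : mb P 1 N g measurable xi c -> fin v -> measurable B ->
  (\int[P]_(w in B) N g (xi w) <= e%:E)%E ->
  `|fine (\int[P]_(w in B) (ip v (xi w))%:E)| <= q v * (K * e).
Proof.
move=> b fv mB le; have i := ip_int_integrable b fv mB; have rx := mb_rv b.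
have fi := integrable_fin_num mB i.
rewrite -lee_fin -fine_abse// fineK ?abse_fin_num//.
apply: le_trans (le_abse_integral P mB _) _; first exact: measurable_int i.
apply: (@le_trans _ _ (\int[P]_(w in B) ((q v * K)%:E * N g (xi w)))%E).
  apply: ae_ge0_le_integral => //.
  - by apply: measurableT_comp => //; exact: measurable_int i.
  - by move=> w _; rewrite mule_ge0 ?(hilb_ge0 hN)// lee_fin mulr_ge0 ?qn_ge0// ltW// K0.
  - apply: emeasurable_funM => //; apply: measurable_funTS.
    exact: (rv_measurable_norm hN cm rx).
  apply: ae1 (rv_fin rx) _ => w fw _ /=; rewrite (finV hN fw) -EFinM lee_fin.
  apply: le_trans (cauchy_schwarz hN fv fw) _; rewrite -mulrA.
  by apply: ler_wpM2l; [exact: qn_ge0|exact: (qn_le_norm hN)].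
rewrite ge0_integralZl//; last 3 first.
- by apply: measurable_funTS; exact: (rv_measurable_norm hN cm rx).
- by move=> w _; exact: (hilb_ge0 hN).
- by rewrite lee_fin mulr_ge0 ?qn_ge0// ltW// K0.
by rewrite mulrA [leRHS]EFinM; apply: lee_wpmul2l => //; rewrite lee_fin mulr_ge0 ?qn_ge0// ltW// K0.
Qed.

Lemma mb1P xi c : rv measurable xi -> 0 <= c ->
  mb P 1 N g measurable xi c <-> (\int[P]_w N g (xi w) <= c%:E)%E.
Proof.
move=> r c0.
have e : (\int[P]_w (N g (xi w) `^ 1) = \int[P]_w N g (xi w))%E.
  by apply: eq_integral => w _; rewrite poweRe1// (hilb_ge0 hN).
split=> h; first by have := mb_int (lexx 1) hN cm h; rewrite e powRr1.
by split=> //; apply/(mnorm_leP (lexx 1) hN cm r c0); rewrite e powRr1.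
Qed.

Lemma simple_mb1 f : simple_fun N g f -> exists c, mb P 1 N g measurable f c.
Proof.
move=> sf; have [M M0 hM] := simple_bounded sf; exists M.
by apply: (mb_bound (lexx 1) hN cm) => //; [exact: (step_rv hN cm (simple_step sf))|exact: aeW].
Qed.

Lemma ip_int_sub xi zeta c c' v B : mb P 1 N g measurable xi c -> mb P 1 N g measurable zeta c' ->
  fin v -> measurable B ->
  fine (\int[P]_(w in B) (ip v (xi w - zeta w))%:E) =
  fine (\int[P]_(w in B) (ip v (xi w))%:E) - fine (\int[P]_(w in B) (ip v (zeta w))%:E).
Proof.
move=> b b' fv mB; have i := ip_int_integrable b fv mB; have i' := ip_int_integrable b' fv mB.
rewrite -fineB; [|exact: (integrable_fin_num mB i)|exact: (integrable_fin_num mB i')].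
congr fine; rewrite -integralB//; apply: ae_eq_integral => //.
- have bb := mb_subr (lexx 1) hN cm b b'; exact: measurable_int (ip_int_integrable bb fv mB).
- by apply: emeasurable_funB; [exact: measurable_int i|exact: measurable_int i'].
apply: ae2 (rv_fin (mb_rv b)) (rv_fin (mb_rv b')) _ => w f1 f2 _ /=.
by rewrite (ipBr hN).
Qed.

Lemma bochner_L1 xi I : bochner P N g setT xi I -> exists c, mb P 1 N g measurable xi c.
Proof.
move=> [rx [f [sf cf _]]].
have nn n : (0 <= \int[P]_(w in setT) N g (xi w - f n w)%R)%E.
  by apply: integral_ge0 => w _; exact: (hilb_ge0 hN).
have [n0 /(_ n0 (leqnn _)) h] := (ecvg0_nat nn).1 cf 1 ltr01.
have [c b] := simple_mb1 (sf n0).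
have rd := rv_subr hN cm rx (mb_rv b).
have bd : mb P 1 N g measurable (fun w => xi w - f n0 w) 1 by apply/mb1P => //; exact: ltW.
exists (1 + c); apply: (mb_ae (lexx 1) hN cm _ (mb_add (lexx 1) hN cm bd b)).
by apply: aeW => w; rewrite subrK.
Qed.

(** The inner products determine a Bochner integral, so equalities of such integrals reduce to
    equalities of real integrals. *)
Lemma bochner_ip xi I c B : measurable B -> mb P 1 N g measurable xi c -> bochner P N g B xi I ->
  fin I /\ forall v, fin v -> ip v I = fine (\int[P]_(w in B) (ip v (xi w))%:E).
Proof.
move=> mB b [rx [f [sf cf cI]]].
have nn n : (0 <= \int[P]_(w in B) N g (xi w - f n w)%R)%E.
  by apply: integral_ge0 => w _; exact: (hilb_ge0 hN).
have nI n : (0 <= N g (simple_integral P B (f n) - I)%R)%E by exact: (hilb_ge0 hN).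
have fI : fin I.
  have [n0 /(_ n0 (leqnn _)) h] := (ecvg0_nat nI).1 cI 1 ltr01.
  apply: le_lt_trans (norm_le_dist hN I (simple_integral P B (f n0))) _.
  rewrite lte_add_pinfty ?(simple_integral_fin _ (sf n0))// (norm_distC hN).
  exact: lt_trans h (ltry _).
split=> // v fv; apply/eqP; rewrite -subr_eq0 -normr_eq0 eq_le normr_ge0 andbT.
apply/ler_addgt0Pr => e e0; rewrite add0r.
have C0 : 0 < 2 * (q v * K + 1) by rewrite mulr_gt0// ltr_wpDl// mulr_ge0 ?qn_ge0// ltW// K0.
have e'0 := divr_gt0 e0 C0; set e' := e / _ in e'0.
have [n1 h1] := (ecvg0_nat nn).1 cf _ e'0; have [n2 h2] := (ecvg0_nat nI).1 cI _ e'0.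
pose n := maxn n1 n2.
have {}h1 := h1 n (leq_maxl _ _); have {}h2 := h2 n (leq_maxr _ _).
have [cn bn] := simple_mb1 (sf n); have fs := simple_integral_fin B (sf n).
have bd := mb_subr (lexx 1) hN cm b bn.
have A1 : `|ip v I - ip v (simple_integral P B (f n))| <= q v * (K * e').
  rewrite -(ipBr hN)//; apply: le_trans (cauchy_schwarz hN fv (finB hN fI fs)) _.
  apply: ler_wpM2l; first exact: qn_ge0.
  apply: le_trans (qn_le_norm hN (finB hN fI fs)) _.
  apply: ler_wpM2l; first exact: ltW K0.
  by rewrite -lee_fin -(finV hN (finB hN fI fs)) (norm_distC hN) ltW.
have A2 : `|fine (\int[P]_(w in B) (ip v (xi w))%:E) - ip v (simple_integral P B (f n))| <= q v * (K * e').
  have -> : ip v (simple_integral P B (f n)) = fine (\int[P]_(w in B) (ip v (f n w))%:E).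
    by rewrite -(simple_integral_ip (sf n) mB fv).
  by rewrite -(ip_int_sub b bn fv mB); apply: (ip_int_bound bd fv mB); exact: ltW.
have E : e = 2 * (q v * K + 1) * e' by rewrite /e' mulrCA mulfV ?mulr1// gt_eqF.
apply: le_trans (ler_distD (ip v (simple_integral P B (f n))) _ _) _.
rewrite [X in _ + X]distrC; apply: le_trans (lerD A1 A2) _.
rewrite E; nra.
Qed.


Lemma simple_trunc h (p : nat) (k : Omega -> nat) (v : nat -> W) :
  (forall i, measurable (k @^-1` [set i])) -> (forall i, fin (v i)) -> h = v \o k ->
  simple_fun N g (fun w => if (k w < p)%N then h w else 0).
Proof.
move=> mk fv ->; split.
- apply: (@sub_finite_set _ _ [set` 0 :: [seq v i | i <- iota 0 p]]); last exact: finite_seq.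
  move=> _ [w _ <-] /=; case: ifP => kp; last by rewrite inE eqxx.
  by rewrite inE map_f ?orbT// mem_iota.
- by move=> w; case: ifP => _; [exact: fv|exact: (fin0 hN)].
move=> x; pose A := [set i | (if (i < p)%N then v i else 0) = x].
have -> : (fun w => if (k w < p)%N then (v \o k) w else 0) @^-1` [set x] = k @^-1` A by [].
rewrite -[X in measurable X]setTI.
by apply: (step_preimage (complete_sigmaP cm)) => i; rewrite setTI.
Qed.

(** A step function within 2^-n of [xi] may have infinitely many values; keeping only the first [p]
    of them, with [p] given by dominated convergence, yields a simple function. *)
Lemma bochner_exists xi c B : measurable B -> mb P 1 N g measurable xi c ->
  exists I, bochner P N g B xi I.
Proof.
move=> mB b; have rx := mb_rv b.
have H n : exists f : Omega -> W, simple_fun N g f /\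
    (\int[P]_(w in B) N g (xi w - f w)%R <= (2 * (2 ^+ n)^-1)%:E)%E.
  have e0 : 0 < (2 ^+ n)^-1 :> R by rewrite invr_gt0 exprn_gt0.
  have [h [[k [v [Gk fv hE]]] rh ah]] := step_rv_dist hN cm rx e0.
  have mk i : measurable (k @^-1` [set i]) by rewrite -[X in measurable X]setTI.
  pose t p w := if (k w < p)%N then h w else 0.
  have st p : simple_fun N g (t p) by exact: simple_trunc mk fv hE.
  have rt p : rv measurable (t p) by exact: (step_rv hN cm (simple_step (st p))).
  have bh : mb P 1 N g measurable (fun w => xi w - h w) (2 ^+ n)^-1.
    apply: (mb_bound (lexx 1) hN cm (rv_subr hN cm rx rh) (ltW e0)).
    by apply: ae1 ah _ => w /ltW.
  have bh' : mb P 1 N g measurable h (c + (2 ^+ n)^-1).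
    apply: (mb_ae (lexx 1) hN cm _ (mb_subr (lexx 1) hN cm b bh)).
    by apply: aeW => w; rewrite opprB addrCA subrr addr0.
  have mh := rv_measurable_norm hN cm rh.
  have ih : P.-integrable B (N g \o h).
    apply: (integrableS measurableT) => //; apply/integrableP; split=> //.
    under eq_integral do rewrite /= gee0_abs ?(hilb_ge0 hN)//.
    by apply: le_lt_trans ((mb1P rh (mb_ge0 bh')).1 bh') (ltry _).
  have mht p : measurable_fun B (fun w => N g (h w - t p w)%R).
    by apply: measurable_funTS; exact: (rv_measurable_norm hN cm (rv_subr hN cm rh (rt p))).
  have cv w : B w -> N g (h w - t p w)%R @[p --> \oo] --> 0%E.
    move=> _; apply/ecvg0_nat; first by move=> p; exact: (hilb_ge0 hN).
    move=> e e1; exists (k w).+1 => p kp; rewrite /= /t kp subrr (hilb0 hN) lte_fin//.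
  have dom p w : B w -> (`|N g (h w - t p w)%R| <= (N g \o h) w)%E.
    move=> _; rewrite /= gee0_abs ?(hilb_ge0 hN)// /t; case: ifP => _; last by rewrite subr0.
    by rewrite subrr (hilb0 hN) (hilb_ge0 hN).
  have [_ _] := dominated_convergence mB mht (measurable_cst 0%E) (aeW P cv) ih
    (aeW P (fun w p Bw => dom p w Bw)).
  rewrite integral0 => /ecvg0_nat; case/(_ _ _ e0).
    by move=> p; apply: integral_ge0 => w _; exact: (hilb_ge0 hN).
  move=> p /(_ p (leqnn _)) lp; exists (t p); split=> //.
  have mxt : measurable_fun B (fun w => N g (xi w - t p w)%R).
    by apply: measurable_funTS; exact: (rv_measurable_norm hN cm (rv_subr hN cm rx (rt p))).
  have mxh : measurable_fun [set: Omega] (fun w => N g (xi w - h w)%R).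
    exact: (rv_measurable_norm hN cm (rv_subr hN cm rx rh)).
  apply: (@le_trans _ _ (\int[P]_(w in B) (N g (xi w - h w)%R + N g (h w - t p w)%R))%E).
    apply: ge0_le_integral => //.
    - by move=> w _; exact: (hilb_ge0 hN).
    - by apply: emeasurable_funD => //; exact: measurable_funTS.
    - by move=> w _; exact: (norm_dist_triangle hN).
  rewrite ge0_integralD//; last 3 first.
  - by move=> w _; exact: (hilb_ge0 hN).
  - exact: measurable_funTS.
  - by move=> w _; exact: (hilb_ge0 hN).
  rewrite mulr_natl mulr2n EFinD; apply: leeD; last exact: ltW.
  apply: le_trans ((mb1P (mb_rv bh) (mb_ge0 bh)).1 bh).
  by apply: ge0_subset_integral => // w _; exact: (hilb_ge0 hN).
have [f hf] := choice H.
have sf n := (hf n).1.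
pose u n := simple_integral P B (f n).
have fu n : fin (u n) by exact: simple_integral_fin.
have bd n : exists c', mb P 1 N g measurable (fun w => xi w - f n w) c'.
  by have [c' b'] := simple_mb1 (sf n); exists (c + c'); exact: (mb_subr (lexx 1) hN cm b b').
have key n v : fin v -> `|fine (\int[P]_(w in B) (ip v (xi w))%:E) - ip v (u n)| <=
    q v * (K * (2 * (2 ^+ n)^-1)).
  move=> fv; have [c' b'] := simple_mb1 (sf n); have [c'' b''] := bd n.
  have -> : ip v (u n) = fine (\int[P]_(w in B) (ip v (f n w))%:E).
    by rewrite -(simple_integral_ip (sf n) mB fv).
  by rewrite -(ip_int_sub b b' fv mB); apply: (ip_int_bound b'' fv mB); exact: (hf n).2.
(* [key] compares the inner products with [u n] and [u k] to one and the same integral; tested on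
   their difference it bounds the norm of that difference. *)
have cu n k : qn ip (u n - u k) <= K * (2 * (2 ^+ n)^-1) + K * (2 * (2 ^+ k)^-1).
  set z := u n - u k; have fz : fin z by exact: (finB hN).
  have [->|z0] := eqVneq (q z) 0.
    by rewrite addr_ge0// mulr_ge0 ?(ltW K0)// mulr_ge0// invr_ge0 exprn_ge0.
  have pz : 0 < q z by rewrite lt_def z0 qn_ge0.
  rewrite -(ler_pM2l pz) -expr2 (qn_sqr hN fz) {2}/z (ipBr hN)// mulrDr.
  have := key n z fz; have := key k z fz; rewrite !ler_norml => /andP[a1 a2] /andP[b1 b2].
  lra.
have small e : 0 < e -> exists n0, forall n, (n0 <= n)%N -> K * (K * (2 * (2 ^+ n)^-1)) < e.
  move=> e0; have KK : 0 < K * K by rewrite mulr_gt0 ?K0.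
  have [n0 hn0] := eps_small (divr_gt0 e0 KK).
  exists n0 => n nn; rewrite mulrA mulrC -ltr_pdivlMr//; apply: le_lt_trans hn0.
  by rewrite ler_pM2l// lef_pV2 ?posrE ?exprn_gt0// ler_eXn2l ?ltr1n.
have [|I fI hI] := hilb_complete hN fu.
  move=> e e0; have [n0 hn0] := small (e / 2) (divr_gt0 e0 (ltr0n _ 2)).
  exists n0 => n k n0n n0k; rewrite (finV hN (finB hN (fu n) (fu k))) lte_fin.
  apply: le_lt_trans (norm_le_qn hN (finB hN (fu n) (fu k))) _.
  apply: le_lt_trans (ler_wpM2l (ltW K0) (cu n k)) _.
  by rewrite mulrDr (splitr e) ltrD// hn0.
exists I; split=> //; exists f; split=> //.
  apply/ecvg0_nat; first by move=> n; apply: integral_ge0 => w _; exact: (hilb_ge0 hN).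
  move=> e e0; have [n0 hn0] := eps_small e0; exists n0 => n nn.
  apply: le_lt_trans (hf n).2 _; rewrite lte_fin; apply: le_lt_trans hn0.
  by rewrite ler_pM2l// lef_pV2 ?posrE ?exprn_gt0// ler_eXn2l ?ltr1n.
by apply/ecvg0_nat; first by move=> n; exact: (hilb_ge0 hN).
Qed.

(** The bridge between the definition of conditional expectation and its weak form; everything about
    conditional expectations is proved on the right-hand side. *)
Lemma is_condexpP G xi zeta : cs G ->
  is_condexp P N g G xi zeta <->
  [/\ rv G zeta, exists c, mb P 1 N g measurable xi c,
      exists c, mb P 1 N g measurable zeta c & orth G (fun w => zeta w - xi w)].
Proof.
move=> cG; split.
  move=> [rz H]; have [I [bI bI']] := H setT (sigma_dom (complete_sigmaP cG)).
  have [c bx] := bochner_L1 bI; have [c' bz] := bochner_L1 bI'.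
  split=> //; [by exists c|by exists c'|] => B GB v fv.
  have mB := complete_sigma_meas cG GB.
  have [J [bJ bJ']] := H B GB.
  have [_ h1] := bochner_ip mB bx bJ; have [_ h2] := bochner_ip mB bz bJ'.
  have bd := mb_subr (lexx 1) hN cm bz bx.
  rewrite -[LHS]fineK; last exact: (integrable_fin_num mB (ip_int_integrable bd fv mB)).
  by rewrite (ip_int_sub bz bx fv mB) -h1// -h2// subrr.
move=> [rz [c bx] [c' bz] o]; split=> // B GB; have mB := complete_sigma_meas cG GB.
have [I bI] := bochner_exists mB bx; have [I' bI'] := bochner_exists mB bz.
exists I; split=> //; suff -> : I = I' by [].
have [fI h1] := bochner_ip mB bx bI; have [fI' h2] := bochner_ip mB bz bI'.
have fd := finB hN fI fI'.
apply/eqP; rewrite -subr_eq0; apply/eqP/(hilb_eq0 hN)/eqP; rewrite eq_le (hilb_ge0 hN) andbT.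
apply: le_trans (hilb_le_ip hN fd) _; rewrite (_ : ip _ _ = 0) ?sqrtr0 ?mulr0//.
rewrite (ipBr hN fI fI' fd) h1// h2//.
have := ip_int_sub bz bx fd mB; rewrite (o B GB _ fd) /= => /esym /eqP.
by rewrite subr_eq0 => /eqP ->; rewrite subrr.
Qed.

End Inner.

(** The Bochner integral of [xi] over an event of [G] is 0, since its inner product with itself
    vanishes. The operator commutes with integrals of simple functions and, being bounded, with
    their limits; no adjoint has to be constructed. *)
Lemma orth_op (R : realType) (d : measure_display) (Omega : measurableType d)
    (P : probability Omega R) (W W' : lmodType R) (N : R -> W -> \bar R) (g : R)
    (ip : W -> W -> R) (K : R) (hN : hilb (N g) ip K)
    (N' : R -> W' -> \bar R) (g' : R) (ip' : W' -> W' -> R) (K' : R) (h' : hilb (N' g') ip' K')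
    (T : {linear W -> W'}) (C : R) (G : set (set Omega)) (xi : Omega -> W) c :
  complete_sigma P G -> 0 <= C ->
  (forall u, (N g u < +oo)%E -> (N' g' (T u) <= C%:E * N g u)%E) ->
  mb P 1 N g measurable xi c -> orth P N g ip G xi ->
  orth P N' g' ip' G (fun w => T (xi w)).
Proof.
move=> cG C0 Tb b o B GB v fv; have cm := complete_measurable cG.
have mB := complete_sigma_meas cG GB.
have [I bI] := bochner_exists hN cm mB b.
have [fI hI] := bochner_ip hN cm mB b bI.
have I0 : I = 0.
  apply/(hilb_eq0 hN)/eqP; rewrite eq_le (hilb_ge0 hN) andbT.
  apply: le_trans (hilb_le_ip hN fI) _; rewrite (_ : ip I I = 0) ?sqrtr0 ?mulr0//.
  by rewrite hI// o.
have [_ [f [sf cf cI]]] := bI; rewrite {}I0 in cI.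
have bT : mb P 1 N' g' measurable (fun w => T (xi w)) (C * c).
  by apply: (mb_op (lexx 1) h' hN cm _ Tb C0 b) => u u'; rewrite linearB.
have iT := ip_int_integrable h' cm bT fv mB.
rewrite -[LHS]fineK; last exact: (integrable_fin_num mB iT).
congr EFin; apply/eqP; rewrite -normr_eq0 eq_le normr_ge0 andbT.
apply/ler_addgt0Pr => e e0; rewrite add0r.
have nn n : (0 <= \int[P]_(w in B) N g (xi w - f n w)%R)%E.
  by apply: integral_ge0 => w _; exact: (hilb_ge0 hN).
have nI n : (0 <= N g (simple_integral P B (f n) - 0)%R)%E by exact: (hilb_ge0 hN).
have C1 : 0 < 2 * (qn ip' v * K' * C + 1).
  by rewrite mulr_gt0// ltr_wpDl// mulr_ge0// mulr_ge0 ?qn_ge0// ltW// (K0 h').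
have e'0 := divr_gt0 e0 C1; set e' := e / _ in e'0.
have [n1 h1] := (ecvg0_nat nn).1 cf _ e'0; have [n2 h2] := (ecvg0_nat nI).1 cI _ e'0.
pose n := maxn n1 n2.
have {}h1 := h1 n (leq_maxl _ _); have {}h2 := h2 n (leq_maxr _ _).
rewrite subr0 in h2.
have [cn bn] := simple_mb1 hN cm (sf n); have fs := simple_integral_fin P hN B (sf n).
have bd := mb_subr (lexx 1) hN cm b bn.
have bTd := mb_op (lexx 1) h' hN cm (fun u u' => linearB T u u') Tb C0 bd.
have bTn := mb_op (lexx 1) h' hN cm (fun u u' => linearB T u u') Tb C0 bn.
have E1 : fine (\int[P]_(w in B) (ip' v (T (f n w)))%:E) = ip' v (T (simple_integral P B (f n))).
  have [s [us ws fs' ->]] := simple_range P (sf n).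
  rewrite (simple_integral_fun P (fun x => ip' v (T x)) (sf n) mB us ws)/=.
  have fT x : x \in s -> (N' g' (T x) < +oo)%E.
    move=> /fs' fx; apply: le_lt_trans (Tb _ fx) _; by rewrite (finV hN fx) -EFinM ltry.
  have: {subset s <= s} by [].
  elim: {1 3 4}s => [_|x t IH tS].
    by rewrite !big_nil linear0 (hilb_ipC h') ?(ip0l h')//; exact: (fin0 h').
  rewrite !big_cons linearD linearZ (ipDr h')//; last 2 first.
  - by apply/(finZ h')/fT/tS; rewrite inE eqxx.
  - rewrite linear_sum big_seq; apply: (fin_sum h') => y yt; rewrite linearZ.
    by apply/(finZ h')/fT/tS; rewrite inE yt orbT.
  rewrite (ipZr h') ?IH//; first by move=> y yt; apply: tS; rewrite inE yt orbT.
  by apply/fT/tS; rewrite inE eqxx.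
have fTs : (N' g' (T (simple_integral P B (f n))) < +oo)%E.
  by apply: le_lt_trans (Tb _ fs) _; rewrite (finV hN fs) -EFinM ltry.
have A1 : `|ip' v (T (simple_integral P B (f n)))| <= qn ip' v * (K' * (C * e')).
  apply: le_trans (cauchy_schwarz h' fv fTs) _; apply: ler_wpM2l; first exact: qn_ge0.
  apply: le_trans (qn_le_norm h' fTs) _; apply: ler_wpM2l; first exact: ltW (K0 h').
  rewrite -lee_fin -(finV h' fTs); apply: le_trans (Tb _ fs) _.
  by rewrite EFinM; apply: lee_wpmul2l; [rewrite lee_fin|exact: ltW].
have A2 : `|fine (\int[P]_(w in B) (ip' v (T (xi w)))%:E) - ip' v (T (simple_integral P B (f n)))|
    <= qn ip' v * (K' * (C * e')).
  rewrite -E1 -(ip_int_sub h' cm bT bTn fv mB).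
  have bT' := mb_subr (lexx 1) h' cm bT bTn.
  apply: (ip_int_bound h' cm bT' fv mB).
  apply: (@le_trans _ _ (\int[P]_(w in B) (C%:E * N g (xi w - f n w)%R))%E).
    apply: ae_ge0_le_integral => //.
    - by move=> w _; exact: (hilb_ge0 h').
    - by apply: measurable_funTS; exact: (rv_measurable_norm h' cm (mb_rv bT')).
    - by move=> w _; rewrite mule_ge0 ?(hilb_ge0 hN)// lee_fin.
    - by apply: emeasurable_funM => //; apply: measurable_funTS; exact: (rv_measurable_norm hN cm (mb_rv bd)).
    by apply: ae1 (rv_fin (mb_rv bd)) _ => w fw _; rewrite -linearB; exact: Tb.
  rewrite ge0_integralZl//; last 2 first.
  - by apply: measurable_funTS; exact: (rv_measurable_norm hN cm (mb_rv bd)).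
  - by move=> w _; exact: (hilb_ge0 hN).
  by rewrite EFinM; apply: lee_wpmul2l; [rewrite lee_fin|exact: ltW].
have E : e = 2 * (qn ip' v * K' * C + 1) * e' by rewrite /e' mulrCA mulfV ?mulr1// gt_eqF.
rewrite -[X in `|X|](subrK (ip' v (T (simple_integral P B (f n))))).
apply: le_trans (ler_normD _ _) _; apply: le_trans (lerD A2 A1) _.
rewrite E; nra.
Qed.

Section Condexp.
Variables (R : realType) (d : measure_display) (Omega : measurableType d).
Variables (P : probability Omega R).
Variables (W : lmodType R) (N : R -> W -> \bar R) (g : R) (ip : W -> W -> R) (K : R).
Hypothesis hN : hilb (N g) ip K.
Variable m : R.
Hypothesis m2 : 2 <= m.
Let m1 : 1 <= m. Proof. by apply: le_trans m2; rewrite ler1n. Qed.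
Local Notation mbd := (mb P m N g).
Local Notation cs := (complete_sigma P).
Implicit Types (G : set (set Omega)) (xi zeta : Omega -> W).

Lemma mb_L1 G xi c : cs G -> mbd G xi c -> exists c', mb P 1 N g measurable xi c'.
Proof.
move=> cG b; have cm := complete_measurable cG.
apply: (mb_exponent hN (lexx 1) m1 cm); apply: mb_sub b; exact: (complete_sigma_meas cG).
Qed.

Lemma orthB G xi zeta c c' : cs G -> mbd measurable xi c -> mbd measurable zeta c' ->
  orth P N g ip G xi -> orth P N g ip G zeta -> orth P N g ip G (fun w => xi w - zeta w).
Proof.
move=> cG bx bz ox oz B GB v fv; have cm := complete_measurable cG.
have [c1 b1] := mb_L1 cm bx; have [c2 b2] := mb_L1 cm bz.
have mB := complete_sigma_meas cG GB.
have bd := mb_subr (lexx 1) hN cm b1 b2.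
rewrite -[LHS]fineK; last exact: (integrable_fin_num mB (ip_int_integrable hN cm bd fv mB)).
by rewrite (ip_int_sub hN cm b1 b2 fv mB) ox// oz// subrr.
Qed.

(** Since m >= 2 the variable is in L^2, where a conditional expectation exists; hence the version
    picked by [condexp] is one, and the L^m bound follows from [condexp_contraction]. *)
Lemma condexpP G xi c : cs G -> mbd measurable xi c ->
  mbd G (condexp P N g G xi) (4 * K ^+ 2 * c) /\
  orth P N g ip G (fun w => condexp P N g G xi w - xi w).
Proof.
move=> cG bx; have cm := complete_measurable cG.
have [c1 b1] := mb_L1 cm bx.
have [c2 b2] : exists c', mb P 2 N g measurable xi c'.
  by apply: (mb_exponent hN _ m2 cm bx); rewrite ler1n.
have [zeta [cz bz] oz] := condexp_exists hN cG b2.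
have ex : is_condexp P N g G xi zeta.
  apply/(is_condexpP hN cm _ _ cG); split=> //; [exact: mb_rv bz|by exists c1|].
  apply: (mb_exponent hN (lexx 1) _ cm (mb_sub (complete_sigma_meas cG) bz)); by rewrite ler1n.
have : is_condexp P N g G xi (condexp P N g G xi) by apply: xgetPex; exists zeta.
move=> /(is_condexpP hN cm _ _ cG)[rz _ Lz oz']; split=> //.
exact: (condexp_contraction hN m2 cG rz Lz bx oz').
Qed.

Lemma orth_unique G zeta zeta' c c' : cs G -> mbd G zeta c -> mbd G zeta' c' ->
  orth P N g ip G (fun w => zeta w - zeta' w) -> aeeq P zeta zeta'.
Proof.
move=> cG bz bz' o; have cm := complete_measurable cG.
have bd := mb_sub (complete_sigma_meas cG) (mb_subr m1 hN cG bz bz').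
have rd := rv_subr hN cG (mb_rv bz) (mb_rv bz').
have b0 : mbd G (fun w => zeta w - zeta' w) 0.
  rewrite -(mulr0 (4 * K ^+ 2)); apply: (condexp_contraction hN m2 cG rd _ (mb0 m1 hN cm)).
    exact: mb_L1 cm bd.
  apply: (orth_ae hN cG _ _ o); first exact: mb_rv bd.
  by apply: aeW => w; rewrite subr0.
have := mb_eq0 m1 hN cG (fun eps e0 => mb_le (ltW e0) b0).
by move=> h; apply: ae1 h _ => w /eqP; rewrite subr_eq0 => /eqP.
Qed.

Lemma condexp_eq G xi zeta c c' : cs G -> mbd measurable xi c -> mbd G zeta c' ->
  orth P N g ip G (fun w => zeta w - xi w) -> aeeq P (condexp P N g G xi) zeta.
Proof.
move=> cG bx bz oz; have cm := complete_measurable cG.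
have [b o] := condexpP cG bx.
have up zz cc : mbd G zz cc -> mbd measurable zz cc by apply: mb_sub; exact: (complete_sigma_meas cG).
apply: (orth_unique cG b bz).
have b1 := mb_subr m1 hN cm (up _ _ b) bx; have b2 := mb_subr m1 hN cm (up _ _ bz) bx.
have ob := orthB cG b1 b2 o oz.
apply: (orth_ae hN cG _ _ ob); first exact: mb_rv (mb_subr m1 hN cm b1 b2).
by apply: aeW => w; rewrite opprB addrA subrK.
Qed.

End Condexp.

(** * A martingale inequality *)

Section PowerInequality.
Variable R : realType.
Implicit Types (p r z u v : R).

(** Young's inequality for the product z * 1 with exponent [p] and its conjugate; the case p = 1 has
    no conjugate exponent. *)
Lemma bernoulli_powR p z : 1 <= p -> 0 <= z -> 1 + p * (z - 1) <= z `^ p.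
Proof.
move=> p1 z0; have [->|pn1] := eqVneq p 1; first by rewrite powRr1//; lra.
have p1' : 1 < p by rewrite lt_def pn1.
have p0 : 0 < p by exact: lt_trans p1'.
have q0 : 0 < (1 - p^-1)^-1 by rewrite invr_gt0 subr_gt0 invf_lt1.
have pq : p^-1 + ((1 - p^-1)^-1)^-1 = 1 by rewrite invrK addrC subrK.
have := @conjugate_powR R z 1 p (1 - p^-1)^-1 z0 ler01 p0 q0 pq.
rewrite powR1 mulr1 mul1r invrK => h.
have : p * z <= p * (z `^ p / p + (1 - p^-1)) by rewrite ler_pM2l.
rewrite mulrDr mulrCA mulfV ?gt_eqF// mulr1 mulrBr mulfV ?gt_eqF// mulr1; lra.
Qed.

(** A Lipschitz bound of z^r at 1. The factor z - 1 on both sides lets a single inequality cover z <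
    1 and z > 1. *)
Lemma powR_lipschitz r : 0 <= r -> forall z, 0 < z -> z <= 3 ->
  (z `^ r - 1) * (z - 1) <= (r * 3 `^ r + r + 1) * (z - 1) ^+ 2.
Proof.
move=> r0 z z0 z3.
have A0 : 0 <= r * 3 `^ r by rewrite mulr_ge0// powR_ge0.
have [z1|z1] := leP 1 z.
  suff h : z `^ r - 1 <= (r * 3 `^ r + r + 1) * (z - 1).
    by rewrite expr2 mulrA; apply: ler_wpM2r; rewrite ?subr_ge0.
  have [r1|r1] := leP r 1.
    have : z `^ r <= z by exact: ler1_powR.
    nra.
  have := bernoulli_powR (ltW r1) (ltW (_ : 0 < z^-1)); rewrite invr_gt0 => /(_ z0) h.
  have zr : 0 < z `^ r by rewrite powR_gt0.
  have e1 : z^-1 `^ r * z `^ r = 1 by rewrite -powRM ?invr_ge0 ?ltW// mulVf ?gt_eqF// powR1.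
  have e2 : z `^ r = z * z `^ (r - 1) by rewrite mulr_powRB1//; [exact: ltW|exact: lt_trans r1].
  have h2 : z `^ r * (1 + r * (z^-1 - 1)) <= 1.
    by rewrite -[leRHS]e1 [leRHS]mulrC ler_pM2l.
  have e3 : z `^ r * (z^-1 - 1) = - (z `^ (r - 1) * (z - 1)).
    by rewrite e2; field; exact: lt0r_neq0.
  have h3 : z `^ (r - 1) <= 3 `^ r.
    apply: le_trans (_ : z `^ r <= _); first by apply: ler_powR => //; rewrite gerBl.
    by apply: powR_le => //; exact: ltW.
  have h4 : z `^ r <= 1 + r * (z `^ (r - 1) * (z - 1)).
    have : z `^ r * (1 + r * (z^-1 - 1)) = z `^ r - r * (z `^ (r - 1) * (z - 1)).
      by rewrite mulrDr mulr1 mulrCA e3 mulrN.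
    lra.
  have h5 : r * (z `^ (r - 1) * (z - 1)) <= r * 3 `^ r * (z - 1).
    by rewrite mulrA; apply: ler_wpM2r; rewrite ?subr_ge0//; apply: ler_wpM2l.
  nra.
have h : 1 - z `^ r <= (r + 1) * (1 - z).
  have [r1|r1] := leP r 1.
    have : z <= z `^ r by apply: ger1_powR => //; rewrite z0 ltW.
    nra.
  have := bernoulli_powR (ltW r1) (ltW z0); lra.
have -> : (z `^ r - 1) * (z - 1) = (1 - z `^ r) * (1 - z) by ring.
have -> : (z - 1) ^+ 2 = (1 - z) * (1 - z) by ring.
rewrite mulrA; apply: ler_wpM2r; first by rewrite subr_ge0 ltW.
apply: le_trans h _; apply: ler_wpM2r; first by rewrite subr_ge0 ltW.
by rewrite -addrA lerDr.
Qed.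

(** Bernoulli's inequality at 1/z gives z^p <= 1 + p z^(p-1) (z - 1), where [powR_lipschitz]
    replaces z^(p-1) by 1 at a quadratic cost. The range z <= 3 contains the squared ratio of |x +
    y| to |x| when |y| < |x| / 2. *)
Lemma powR_taylor p : 1 <= p -> exists2 C : R, 0 <= C & forall z, 0 < z -> z <= 3 ->
  z `^ p <= 1 + p * (z - 1) + C * (z - 1) ^+ 2.
Proof.
move=> p1; have p0 : 0 < p by exact: lt_le_trans p1.
have r0 : 0 <= p - 1 by rewrite subr_ge0.
exists (p * ((p - 1) * 3 `^ (p - 1) + (p - 1) + 1)).
  by rewrite mulr_ge0 ?(ltW p0)// addr_ge0// addr_ge0// mulr_ge0// powR_ge0.
move=> z z0 z3; have L := powR_lipschitz r0 z0 z3.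
have := bernoulli_powR p1 (ltW (_ : 0 < z^-1)); rewrite invr_gt0 => /(_ z0) h.
have zr : 0 < z `^ p by rewrite powR_gt0.
have e1 : z^-1 `^ p * z `^ p = 1 by rewrite -powRM ?invr_ge0 ?ltW// mulVf ?gt_eqF// powR1.
have e2 : z `^ p = z * z `^ (p - 1) by rewrite mulr_powRB1//; exact: ltW.
have h2 : z `^ p * (1 + p * (z^-1 - 1)) <= 1.
  by rewrite -[leRHS]e1 [leRHS]mulrC ler_pM2l.
have e3 : z `^ p * (z^-1 - 1) = - (z `^ (p - 1) * (z - 1)).
  by rewrite e2; field; exact: lt0r_neq0.
have h4 : z `^ p <= 1 + p * (z `^ (p - 1) * (z - 1)).
  have : z `^ p * (1 + p * (z^-1 - 1)) = z `^ p - p * (z `^ (p - 1) * (z - 1)).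
    by rewrite mulrDr mulr1 mulrCA e3 mulrN.
  lra.
have : p * ((z `^ (p - 1) - 1) * (z - 1)) <= p * (((p - 1) * 3 `^ (p - 1) + (p - 1) + 1) * (z - 1) ^+ 2).
  by rewrite ler_pM2l.
lra.
Qed.

(* In a Hilbert space, [a], [b], [c] and [s] stand for |x|, |y|, <x, y> and |x + y|. *)
Lemma norm_power_expansion (m : R) : 2 <= m -> exists2 C : R, 0 <= C &
  forall a b c s : R, 0 <= a -> 0 <= b -> `|c| <= a * b -> 0 <= s ->
    s ^+ 2 = a ^+ 2 + 2 * c + b ^+ 2 ->
    s `^ m <= a `^ m + m * (a `^ (m - 2) * c) + C * (a `^ (m - 2) * b ^+ 2 + b `^ m).
Proof.
move=> m2; have p1 : 1 <= m / 2 by rewrite ler_pdivlMr// mul1r.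
have m0 : 0 < m by exact: lt_le_trans m2.
have m1 : 0 <= m - 1 by rewrite subr_ge0; apply: le_trans m2; rewrite ler1n.
have [C1 C10 T] := powR_taylor p1.
(* The first two terms serve the case a <= 2 b, the last two the case a > 2 b, where 7 bounds the
   square of (2 y + y^2) / y. *)
exists (3 `^ m + m * 2 `^ (m - 1) + m + 7 * C1).
  by rewrite !addr_ge0 ?powR_ge0 ?mulr_ge0 ?powR_ge0// ltW.
move=> a b c s a0 b0 cab s0 sE; move: cab; rewrite ler_norml => /andP[c1 c2].
have am := powR_ge0 a (m - 2); have bm := powR_ge0 b m; have am' := powR_ge0 a m.
have m20 := powR_ge0 2 (m - 1); have m30 := powR_ge0 3 m.
have e1 : a `^ (m - 2) * a = a `^ (m - 1) by exact: powR_sub1.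
have e2 : a `^ (m - 2) * a ^+ 2 = a `^ m by exact: powR_sub2.
(* If a <= 2 b there is nothing to expand: all terms are comparable with b^m. *)
have [ab|ab] := leP a (2 * b).
  have sb : s <= 3 * b.
    have h1 : s ^+ 2 <= (3 * b) ^+ 2 by rewrite sE; nra.
    by move: h1; rewrite ler_pXn2r// nnegrE mulr_ge0.
  have h1 : s `^ m <= 3 `^ m * b `^ m.
    by rewrite -powRM//; apply: powR_le => //; exact: ltW.
  have h2 : - (m * 2 `^ (m - 1) * b `^ m) <= m * (a `^ (m - 2) * c).
    rewrite lerNl -mulrN -mulrA ler_pM2l// -mulrN.
    apply: (@le_trans _ _ (a `^ (m - 1) * b)).
      by rewrite -e1 -mulrA; apply: ler_wpM2l => //; lra.
    have -> : b `^ m = b `^ (m - 1) * b by rewrite mulrC mulr_powRB1.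
    by rewrite mulrA -powRM//; apply: ler_wpM2r => //; exact: powR_le.
  have ab2 : 0 <= a `^ (m - 2) * b ^+ 2 by rewrite mulr_ge0// sqr_ge0.
  have X : 0 <= m + 7 * C1 by rewrite addr_ge0 ?mulr_ge0// ltW.
  have Y : 0 <= (3 `^ m + m * 2 `^ (m - 1) + m + 7 * C1) * (a `^ (m - 2) * b ^+ 2).
    by rewrite mulr_ge0// !addr_ge0 ?mulr_ge0// ltW.
  have Z : 0 <= (m + 7 * C1) * b `^ m by rewrite mulr_ge0.
  lra.
have a00 : 0 < a by apply: le_lt_trans ab; rewrite mulr_ge0.
(* Relative to |x|^2, the squared norm of the sum is z = 1 + 2 x + y^2 with y < 1/2; the Taylor
   bound with exponent m / 2 is applied to it. *)
pose z := (s / a) ^+ 2; pose x := c / a ^+ 2; pose y := b / a.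
have a2 : 0 < a ^+ 2 by rewrite exprn_gt0.
have y0 : 0 <= y by rewrite divr_ge0.
have y1 : 2 * y < 1 by rewrite /y mulrA ltr_pdivrMr// mul1r.
have x1 : x <= y by rewrite /x /y ler_pdivrMr// expr2 mulrA divfK ?gt_eqF// mulrC.
have x2 : - y <= x by rewrite /x /y lerNl -mulNr ler_pdivrMr// expr2 mulrA divfK ?gt_eqF// [b * a]mulrC lerNl.
have zE : z = 1 + 2 * x + y ^+ 2.
  by rewrite /z expr_div_n sE /x /y; field; exact: lt0r_neq0.
have z0 : 0 < z by rewrite zE; nra.
have z3 : z <= 3 by rewrite zE; nra.
have zp : a `^ m * z `^ (m / 2) = s `^ m.
  rewrite /z -powR_mulrn ?divr_ge0// -powRrM.
  have -> : 2%:R * (m / 2) = m by field.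
  by rewrite -powRM ?divr_ge0// mulrCA mulfV ?mulr1// gt_eqF.
have := T z z0 z3.
have -> : z - 1 = 2 * x + y ^+ 2 by rewrite zE; ring.
move=> h; have {}h : s `^ m <= a `^ m * (1 + m / 2 * (2 * x + y ^+ 2) + C1 * (2 * x + y ^+ 2) ^+ 2).
  by rewrite -zp; exact: ler_wpM2l.
have q : (2 * x + y ^+ 2) ^+ 2 <= 7 * y ^+ 2.
  have : - (2 * y + y ^+ 2) <= 2 * x + y ^+ 2 <= 2 * y + y ^+ 2 by apply/andP; split; nra.
  by move=> /andP[]; nra.
have f1 : a `^ m * x = a `^ (m - 2) * c by rewrite -e2 /x; field; exact: lt0r_neq0.
have f2 : a `^ m * y ^+ 2 = a `^ (m - 2) * b ^+ 2 by rewrite -e2 /y; field; exact: lt0r_neq0.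
have q2 : C1 * (a `^ m * (2 * x + y ^+ 2) ^+ 2) <= C1 * (7 * (a `^ (m - 2) * b ^+ 2)).
  apply: ler_wpM2l => //; rewrite -f2 [leRHS]mulrCA; exact: ler_wpM2l.
have ab2 : 0 <= a `^ (m - 2) * b ^+ 2 by rewrite mulr_ge0// sqr_ge0.
have E : a `^ m * (1 + m / 2 * (2 * x + y ^+ 2) + C1 * (2 * x + y ^+ 2) ^+ 2) =
  a `^ m + m * (a `^ (m - 2) * c) + m / 2 * (a `^ (m - 2) * b ^+ 2) +
  C1 * (a `^ m * (2 * x + y ^+ 2) ^+ 2).
  by rewrite -f1 -f2; field.
rewrite {}E in h; apply: le_trans h _.
have Y : 0 <= (3 `^ m + m * 2 `^ (m - 1) + m / 2) * (a `^ (m - 2) * b ^+ 2).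
  by rewrite mulr_ge0// !addr_ge0 ?mulr_ge0 ?divr_ge0// ltW.
have Z : 0 <= (3 `^ m + m * 2 `^ (m - 1) + m + 7 * C1) * b `^ m.
  by rewrite mulr_ge0// !addr_ge0 ?mulr_ge0// ltW.
lra.
Qed.

End PowerInequality.

(** The average of two lower bounds: Bernoulli's inequality, which produces the mixed term, and
    superadditivity, which produces v^p. *)
Lemma powR_quadratic_growth (R : realType) (p u v : R) : 1 <= p -> 0 <= u -> 0 <= v ->
  u `^ p + p / 2 * (u `^ (p - 1) * v) + v `^ p / 2 <= (u + v) `^ p.
Proof.
move=> p1 u0 v0; have p0 : 0 < p by exact: lt_le_trans p1.
have h2 : u `^ p + v `^ p <= (u + v) `^ p by exact: powR_superadd.
suff h1 : u `^ p + p * (u `^ (p - 1) * v) <= (u + v) `^ p by lra.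
have [->|un] := eqVneq u 0.
  rewrite add0r powR0 ?gt_eqF// add0r.
  have [->|pn] := eqVneq p 1; first by rewrite subrr powRr0 !mul1r powRr1.
  by rewrite powR0 ?subr_eq0// mul0r mulr0 powR_ge0.
have u1 : 0 < u by rewrite lt_def un.
have e : u + v = u * (1 + v / u) by rewrite mulrDr mulr1 mulrCA mulfV ?mulr1// gt_eqF.
have vu : 0 <= v / u by rewrite divr_ge0// ltW.
have h0 : 0 <= 1 + v / u by rewrite addr_ge0.
rewrite e powRM//.
have := bernoulli_powR p1 h0; rewrite [1 + v / u - 1]addrC addKr => h.
have := powR_gt0 p u1 => up; have : u `^ p * (1 + p * (v / u)) <= u `^ p * (1 + v / u) `^ p.
  by rewrite ler_pM2l.
apply: le_trans; rewrite mulrDr mulr1 lerD2l.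
have -> : u `^ p = u * u `^ (p - 1) by rewrite mulr_powRB1//; exact: ltW.
rewrite le_eqVlt; apply/orP; left; apply/eqP; field; exact: lt0r_neq0.
Qed.

(** Young's inequality at free scales. When [x] and [y] bound the L^m norms of [u] and [v], each
    term on the right integrates to at most x^(m-2) y^2, with the homogeneity of the left-hand
    side. *)
Lemma mixed_power_le (R : realType) (m x y u v : R) : 2 <= m -> 0 < x -> 0 < y -> 0 <= u -> 0 <= v ->
  u `^ (m - 2) * v ^+ 2 <=
  x `^ (m - 2) * y ^+ 2 * (x `^ m)^-1 * u `^ m + x `^ (m - 2) * y ^+ 2 * (y `^ m)^-1 * v `^ m.
Proof.
move=> m2 x0 y0 u0 v0; have m0 : 0 <= m by apply: le_trans m2.
have hu : u `^ (m - 2) * v ^+ 2 = x `^ (m - 2) * y ^+ 2 * ((u / x) `^ (m - 2) * (v / y) ^+ 2).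
  have -> : u `^ (m - 2) = x `^ (m - 2) * (u / x) `^ (m - 2).
    rewrite -powRM ?(ltW x0) ?divr_ge0 ?(ltW x0)//.
    by rewrite mulrCA mulfV ?mulr1// gt_eqF.
  by field; exact: lt0r_neq0.
have e z c : 0 < z -> 0 <= c -> (z `^ m)^-1 * c `^ m = (c / z) `^ m.
  move=> z0 c0; rewrite powRM ?invr_ge0 ?(ltW z0)// mulrC; congr (_ * _).
  by rewrite -powRN -powR_inv1 ?ltW// -powRrM mulN1r.
rewrite {}hu; move: (x `^ (m - 2) * y ^+ 2) (mulr_ge0 (powR_ge0 x (m - 2)) (sqr_ge0 y)) => B B0.
rewrite -[B / _ * _]mulrA -[B / y `^ m * _]mulrA !e// -mulrDr; apply: ler_wpM2l => //.
set s := u / x; set t := v / y; have s0 : 0 <= s by rewrite divr_ge0// ltW.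
have t0 : 0 <= t by rewrite divr_ge0// ltW.
have [st|st] := leP s t.
  apply: le_trans (_ : t `^ m <= _); last by rewrite lerDr powR_ge0.
  rewrite -[leRHS]powR_sub2//; apply: ler_wpM2r; first exact: sqr_ge0.
  by apply: powR_le; rewrite ?subr_ge0.
apply: le_trans (_ : s `^ m <= _); last by rewrite lerDl powR_ge0.
rewrite -[leRHS]powR_sub2//; apply: ler_wpM2l; first exact: powR_ge0.
by rewrite ler_pXn2r// ltW.
Qed.

Section MartingaleSums.
Variables (R : realType) (m : R).
Hypothesis m2 : 2 <= m.
Let m1 : 1 <= m. Proof. by apply: le_trans m2; rewrite ler1n. Qed.
Let m0 : 0 < m. Proof. exact: lt_le_trans m1. Qed.
Variable C : R.
Hypothesis C0 : 0 <= C.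
Hypothesis expansion : forall a b c s : R, 0 <= a -> 0 <= b -> `|c| <= a * b -> 0 <= s ->
  s ^+ 2 = a ^+ 2 + 2 * c + b ^+ 2 ->
  s `^ m <= a `^ m + m * (a `^ (m - 2) * c) + C * (a `^ (m - 2) * b ^+ 2 + b `^ m).
Local Notation kappa := (4 * C + 1).

Variables (d : measure_display) (Omega : measurableType d) (P : probability Omega R).
Variables (W : lmodType R) (N : R -> W -> \bar R) (g : R) (ip : W -> W -> R).
Hypothesis hN : hilb (N g) ip 1.
Local Notation mbd := (mb P m N g).
Local Notation cs := (complete_sigma P).
Local Notation q := (qn ip).
Implicit Types (G : set (set Omega)).

(** After integration of the expansion the cross term vanishes, and x^m + C (2 x^(m-2) y^2 + y^m)
    remains. By [powR_quadratic_growth] with exponent m / 2 it is at most (x^2 + kappa y^2)^(m/2) as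
    soon as half of kappa is at least 2 C; the additional 1 ensures kappa <= kappa^(m/2). *)
Lemma martingale_step G (f dl : Omega -> W) x y : cs G -> step N g setT G f ->
  0 < x -> 0 < y -> mbd G f x -> mbd measurable dl y -> orth P N g ip G dl ->
  forall s, 0 <= s -> x ^+ 2 + kappa * y ^+ 2 <= s ^+ 2 ->
  mbd measurable (fun w => f w + dl w) s.
Proof.
have aux z1 z2 q1 q2 q3 q4 q5 : C * (q1 * q4) <= C * (z1 * q2 + z2 * q3) ->
  q2 + m * (q1 * q5) + C * (q1 * q4 + q3) <=
  (1 + C * z1) * q2 + C * (z2 + 1) * q3 + m * (q1 * q5) by lra.
move=> cG sf x0 y0 bf bd od s s0 xys; have cm := complete_measurable cG.
have bf' := mb_sub (complete_sigma_meas cG) bf.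
have ff w : (N g (f w) < +oo)%E by exact: (step_fin _ sf).
have fd := rv_fin (mb_rv bd).
have rfd : random_var P N g measurable (fun w => f w + dl w).
  exact: (rv_add hN cm (mb_rv bf') (mb_rv bd)).
rewrite -[s]mul1r; apply: (qn_int_mb hN m1 cm rfd s0).
have mq := qpow_meas hN m cm (mb_rv bf'); have mdq := qpow_meas hN m cm (mb_rv bd).
(* The cross term of the expansion is m <h, dl>. As [h] is again a step function for [G],
   orthogonality applies to it. *)
pose h w := q (f w) `^ (m - 2) *: f w.
have sh : step N g setT G h.
  have [k [v [Gk fv fE]]] := sf; exists k, (fun i => q (v i) `^ (m - 2) *: v i).
  by split=> // [i|]; [exact: (finZ hN)|rewrite /h fE].
have rh := step_rv hN cG sh; have rh' := rv_sub (complete_sigma_meas cG) rh.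
have If := mb_qn_int hN m1 cm bf'; rewrite mul1r in If.
have Id := mb_qn_int hN m1 cm bd; rewrite mul1r in Id.
have iq z c : mbd measurable z c -> P.-integrable setT (EFin \o (fun w => q (z w) `^ m)).
  move=> bz; apply: (integrable_dom (h := fun w => q (z w) `^ m)).
  - exact: (qpow_meas hN m cm (mb_rv bz)).
  - exact: (qpow_meas hN m cm (mb_rv bz)).
  - by apply: aeW => w; rewrite ger0_norm// powR_ge0.
  by apply: le_lt_trans (mb_qn_int hN m1 cm bz) _; rewrite ltry.
have ic : P.-integrable setT (EFin \o (fun w => ip (h w) (dl w))).
  apply: (integrable_dom (h := fun w => q (f w) `^ m + (2 * q (dl w)) `^ m)).
  - exact: (ip_meas hN cm rh' (mb_rv bd)).
  - apply: measurable_funD; first exact: mq.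
    rewrite (_ : (fun w => _) = (fun w => 2 `^ m * q (dl w) `^ m)); last first.
      by apply/funext => w; rewrite powRM// qn_ge0.
    by apply: measurable_funM => //; exact: mdq.
  - apply: ae1 fd _ => w fdw.
    rewrite /h (ipZl hN)// normrM ger0_norm ?powR_ge0//.
    apply: le_trans (_ : q (f w) `^ (m - 2) * (q (f w) * q (dl w)) <= _).
      by apply: ler_wpM2l; [exact: powR_ge0|exact: (cauchy_schwarz hN)].
    rewrite mulrA powR_sub1 ?qn_ge0//.
    apply: le_trans (young_half m2 (qn_ge0 _ _) (qn_ge0 _ _)) _.
    have := powR_ge0 (q (f w)) m; have := powR_ge0 (2 * q (dl w)) m; lra.
  have -> : (\int[P]_w (q (f w) `^ m + (2 * q (dl w)) `^ m)%:E =
             \int[P]_w (q (f w) `^ m + 2 `^ m * q (dl w) `^ m)%:E)%E.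
    by apply: eq_integral => w _; rewrite powRM// qn_ge0.
  rewrite integral_addr; [|exact: (iq _ _ bf')|].
    rewrite integral_scale; last exact: (iq _ _ bd).
    apply: lte_add_pinfty; first by apply: le_lt_trans If _; rewrite ltry.
    apply: lte_mul_pinfty; rewrite ?lee_fin ?powR_ge0//.
    by apply: le_lt_trans Id _; rewrite ltry.
  have := iq _ _ bd => /(integrableZl measurableT (2 `^ m)).
  by apply: eq_integrable => // w _; rewrite /= EFinM.
have c0 := orth_step cG sh (mb_rv bd) ic od.
pose e1 := x `^ (m - 2) * y ^+ 2 * (x `^ m)^-1; pose e2 := x `^ (m - 2) * y ^+ 2 * (y `^ m)^-1.
have e10 : 0 <= e1 by rewrite !mulr_ge0 ?invr_ge0 ?powR_ge0// ltW.
have e20 : 0 <= e2 by rewrite !mulr_ge0 ?invr_ge0 ?powR_ge0// ltW.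
have [k1 k1E] : exists k1, k1 = 1 + C * e1 by exists (1 + C * e1).
have [k2 k2E] : exists k2, k2 = C * (e2 + 1) by exists (C * (e2 + 1)).
have k10 : 0 <= k1 by rewrite k1E addr_ge0// mulr_ge0.
have k20 : 0 <= k2 by rewrite k2E mulr_ge0// addr_ge0.
have I1 : P.-integrable setT (EFin \o (fun w => k1 * q (f w) `^ m)).
  have := iq _ _ bf' => /(integrableZl measurableT k1).
  by apply: eq_integrable => // w _; rewrite /= EFinM.
have I2 : P.-integrable setT (EFin \o (fun w => k2 * q (dl w) `^ m)).
  have := iq _ _ bd => /(integrableZl measurableT k2).
  by apply: eq_integrable => // w _; rewrite /= EFinM.
apply: le_trans (_ : \int[P]_w (k1 * q (f w) `^ m + k2 * q (dl w) `^ m)%:E <= _)%E.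
  apply: (int_le_orth (c := fun w => m * ip (h w) (dl w))).
  - exact: (qpow_meas hN m cm rfd).
  - exact: (measurable_funD (measurable_funM (measurable_cst k1) mq) (measurable_funM (measurable_cst k2) mdq)).
  - have := integrableZl measurableT m ic; by apply: eq_integrable => // w _; rewrite /= EFinM.
  - by rewrite integral_scale// c0 mule0.
  - by move=> w; exact: powR_ge0.
  - by move=> w; rewrite addr_ge0// mulr_ge0// ?powR_ge0.
  apply: ae1 fd _ => w fdw.
  have cs' := cauchy_schwarz hN (ff w) fdw.
  have := expansion (qn_ge0 _ _) (qn_ge0 _ _) cs' (qn_ge0 _ _) (qn_sqrD hN (ff w) fdw).
  have := mixed_power_le m2 x0 y0 (qn_ge0 ip (f w)) (qn_ge0 ip (dl w)).
  rewrite -/e1 -/e2 /h (ipZl hN)// => h1 h2; apply: le_trans h2 _.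
  have := ler_wpM2l C0 h1; rewrite k1E k2E.
  exact: aux.
rewrite (integral_addr I1 I2) (integral_scale _ (iq _ _ bf')) (integral_scale _ (iq _ _ bd)).
apply: le_trans (_ : (k1 * x `^ m + k2 * y `^ m)%:E <= _)%E.
  by rewrite EFinD !EFinM; apply: leeD; apply: lee_wpmul2l; rewrite ?lee_fin.
have xm : 0 < x `^ m by rewrite powR_gt0.
have ym : 0 < y `^ m by rewrite powR_gt0.
have E1 : e1 * x `^ m = x `^ (m - 2) * y ^+ 2 by rewrite /e1 divfK ?gt_eqF.
have E2 : e2 * y `^ m = x `^ (m - 2) * y ^+ 2 by rewrite /e2 divfK ?gt_eqF.
rewrite lee_fin k1E k2E.
have -> : (1 + C * e1) * x `^ m + C * (e2 + 1) * y `^ m =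
    x `^ m + C * (2 * (x `^ (m - 2) * y ^+ 2) + y `^ m).
  transitivity (x `^ m + C * (e1 * x `^ m) + C * (e2 * y `^ m) + C * y `^ m); first by ring.
  by rewrite E1 E2; ring.
have p1 : 1 <= m / 2 by rewrite ler_pdivlMr// mul1r.
have ka : 1 <= kappa by rewrite lerDr mulr_ge0.
have x20 : 0 <= x ^+ 2 by exact: sqr_ge0.
have y20 : 0 <= kappa * y ^+ 2 by rewrite mulr_ge0 ?sqr_ge0// ltW// (lt_le_trans _ ka).
have pw z r : 0 <= z -> (z ^+ 2) `^ r = z `^ (2 * r).
  by move=> z0; rewrite -powR_mulrn// -powRrM.
have half : 2 * (m / 2) = m by field.
have := powR_quadratic_growth p1 x20 y20.
have -> : (x ^+ 2) `^ (m / 2) = x `^ m by rewrite pw ?(ltW x0)// half.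
have -> : (x ^+ 2) `^ (m / 2 - 1) = x `^ (m - 2).
  by rewrite pw ?(ltW x0)//; congr (_ `^ _); field.
have -> : (kappa * y ^+ 2) `^ (m / 2) = kappa `^ (m / 2) * y `^ m.
  rewrite powRM ?sqr_ge0 ?pw ?(ltW y0) ?half//.
  by apply: ltW; exact: lt_le_trans ka.
have kp : kappa <= kappa `^ (m / 2).
  by rewrite -[leLHS]powRr1; [exact: ler_powR|exact: le_trans ka].
have : (x ^+ 2 + kappa * y ^+ 2) `^ (m / 2) <= s `^ m.
  rewrite -[in leRHS]half -pw//; apply: powR_le => //; first exact: le_trans p1.
  by rewrite addr_ge0.
have xy : 0 <= x `^ (m - 2) * y ^+ 2 by rewrite mulr_ge0 ?powR_ge0 ?sqr_ge0.
move=> h1 h2; apply: le_trans h1; apply: le_trans h2.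
have h3 : kappa * y `^ m <= kappa `^ (m / 2) * y `^ m by apply: ler_wpM2r => //; exact: ltW.
have h4 : kappa * (x `^ (m - 2) * y ^+ 2) <= m / 2 * (kappa * (x `^ (m - 2) * y ^+ 2)).
  by rewrite ler_peMl// mulr_ge0// ltW// (lt_le_trans _ ka).
have -> : m / 2 / 2 * (x `^ (m - 2) * (kappa * y ^+ 2)) =
  m / 2 * (kappa * (x `^ (m - 2) * y ^+ 2)) / 2 by ring.
have := ltW ym; have := mulr_ge0 C0 xy; have := mulr_ge0 C0 (ltW ym); lra.
Qed.

(** Step functions at distance [eps] reduce this to [martingale_step]; enlarging [x] and [y] by
    [eps] also makes them positive, as the scales there must be. *)
Lemma martingale_add G (xi dl : Omega -> W) x y : cs G ->
  mbd G xi x -> mbd measurable dl y -> orth P N g ip G dl ->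
  forall s, 0 <= s -> x ^+ 2 + kappa * y ^+ 2 <= s ^+ 2 ->
  mbd measurable (fun w => xi w + dl w) s.
Proof.
move=> cG bx bd od s s0 xys; have cm := complete_measurable cG.
have ka : 1 <= kappa by rewrite lerDr mulr_ge0.
have x0 := mb_ge0 bx; have y0 := mb_ge0 bd.
apply: (mb_eps (D := 2 + kappa)) => //; first by rewrite addr_ge0// ltW// (lt_le_trans _ ka).
move=> eps e0; have [h [sh rh ah]] := step_rv_dist hN cG (mb_rv bx) e0.
have bxh : mbd G (fun w => xi w - h w) eps.
  apply: (mb_bound m1 hN cG (rv_subr hN cG (mb_rv bx) rh) (ltW e0)).
  by apply: ae1 ah _ => w /ltW.
have bh : mbd G h (x + eps).
  apply: (mb_ae m1 hN cG _ (mb_subr m1 hN cG bx bxh)).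
  by apply: aeW => w; rewrite opprB addrC subrK.
have sx : x <= s.
  rewrite -(ler_pXn2r (n := 2))// ?nnegrE//; apply: le_trans xys; rewrite lerDl mulr_ge0 ?sqr_ge0//.
  by apply: ltW; exact: lt_le_trans ka.
have sy : y <= s.
  rewrite -(ler_pXn2r (n := 2))// ?nnegrE//; apply: le_trans xys; have := sqr_ge0 x; have := sqr_ge0 y; nra.
have b1 : mbd measurable (fun w => h w + dl w) (s + (1 + kappa) * eps).
  apply: (@martingale_step G h dl (x + eps) (y + eps)) => //.
  - by rewrite ltr_wpDl.
  - by rewrite ltr_wpDl.
  - by apply: mb_le bd; rewrite lerDl ltW.
  - by rewrite addr_ge0// mulr_ge0 ?(ltW e0)// addr_ge0// ltW// (lt_le_trans _ ka).
  have : 0 <= eps * (s - x) by rewrite mulr_ge0 ?subr_ge0// ltW.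
  have : 0 <= kappa * (eps * (s - y)).
    by apply: mulr_ge0; [exact: le_trans ka|rewrite mulr_ge0 ?subr_ge0// ltW].
  have : 0 <= kappa * eps ^+ 2 by apply: mulr_ge0; [exact: le_trans ka|exact: sqr_ge0].
  have : 0 <= kappa * (kappa * eps ^+ 2).
    by do 2 (apply: mulr_ge0; first exact: le_trans ka); exact: sqr_ge0.
  lra.
apply: (mb_ae m1 hN cm _ (mb_le _ (mb_add m1 hN cm b1 (mb_sub (complete_sigma_meas cG) bxh)))).
  by apply: aeW => w; rewrite addrAC [h w + _]addrC subrK.
lra.
Qed.

(** The squared bounds simply add up along the induction. This is where the Hilbert constant must be
    1: each step estimates anew the whole partial sum, and a larger factor would be raised to the
    number of increments. *)
Lemma martingale_sum n (G : nat -> set (set Omega)) (dl : nat -> Omega -> W) (y : nat -> R) :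
  (forall i, (i <= n)%N -> cs (G i)) ->
  (forall i j, (i <= j)%N -> (j <= n)%N -> G i `<=` G j) ->
  (forall i, (i < n)%N -> mbd (G i.+1) (dl i) (y i)) ->
  (forall i, (i < n)%N -> orth P N g ip (G i) (dl i)) ->
  forall s, 0 <= s -> kappa * (\sum_(i < n) y i ^+ 2) <= s ^+ 2 ->
  mbd (G n) (fun w => \sum_(i < n) dl i w) s.
Proof.
have ka : 1 <= kappa by rewrite lerDr mulr_ge0.
elim: n => [|n IH] cG mG bd od s s0 hs.
  have := mb_le s0 (mb0 m1 hN (cG _ (leqnn _))).
  by apply: (mb_ae m1 hN (cG _ (leqnn _))); apply: aeW => w; rewrite big_ord0.
pose S2 := kappa * (\sum_(i < n) y i ^+ 2).
have S20 : 0 <= S2.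
  by apply: mulr_ge0; [exact: le_trans ka|apply: sumr_ge0 => i _; exact: sqr_ge0].
have b1 : mbd (G n) (fun w => \sum_(i < n) dl i w) (Num.sqrt S2).
  apply: IH; rewrite ?sqrtr_ge0 ?sqr_sqrtr//.
  - by move=> i ni; apply: cG; exact: leqW.
  - by move=> i j ij jn; apply: mG => //; exact: leqW.
  - by move=> i ni; apply: bd; exact: leqW.
  - by move=> i ni; apply: od; exact: leqW.
have cn := cG _ (leqnn n.+1); have cn' := cG _ (leqnSn n).
have rs : random_var P N g (G n.+1) (fun w => \sum_(i < n.+1) dl i w).
  apply: (rv_ae _ (rv_add hN cn (rv_sub (mG _ _ (leqnSn n) (leqnn _)) (mb_rv b1)) (mb_rv (bd _ (ltnSn n))))).
  by apply: aeW => w; rewrite big_ord_recr.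
split=> //; have [_] : mbd measurable (fun w => (\sum_(i < n) dl i w) + dl n w) s.
  apply: (martingale_add cn' b1 (mb_sub (complete_sigma_meas cn) (bd _ (ltnSn n))) (od _ (ltnSn n))) => //.
  by rewrite sqr_sqrtr// -mulrDr; move: hs; rewrite big_ord_recr.
by rewrite (_ : (fun w => _) = (fun w => \sum_(i < n.+1) dl i w))//; apply/funext => w; rewrite big_ord_recr.
Qed.

End MartingaleSums.

Lemma martingale_bound (R : realType) (m : R) : 2 <= m -> exists2 kappa : R, 1 <= kappa &
  forall (d : measure_display) (Omega : measurableType d) (P : probability Omega R)
    (W : lmodType R) (N : R -> W -> \bar R) (g : R) (ip : W -> W -> R), hilb (N g) ip 1 ->
  forall n (G : nat -> set (set Omega)) (dl : nat -> Omega -> W) (y : nat -> R),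
  (forall i, (i <= n)%N -> complete_sigma P (G i)) ->
  (forall i j, (i <= j)%N -> (j <= n)%N -> G i `<=` G j) ->
  (forall i, (i < n)%N -> mb P m N g (G i.+1) (dl i) (y i)) ->
  (forall i, (i < n)%N -> orth P N g ip (G i) (dl i)) ->
  forall s, 0 <= s -> kappa * (\sum_(i < n) y i ^+ 2) <= s ^+ 2 ->
  mb P m N g (G n) (fun w => \sum_(i < n) dl i w) s.
Proof.
move=> m2; have [C C0 hC] := norm_power_expansion m2.
exists (4 * C + 1); first by rewrite lerDr mulr_ge0.
by move=> *; apply: (martingale_sum m2 C0 hC) => //; eassumption.
Qed.

(** * Norms of the scale and the propagator *)

Section HilbertScale.
Variables (R : realType) (H : monotone_family R).
Local Notation hn := (@hnorm R H).

Lemma hnorm_incl g (u : hspace H g) : hn g (hincl H g u) = `|u|%:E.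
Proof.
rewrite /hnorm (_ : [set u0 | _] = [set u]) ?image_set1 ?ereal_inf1//.
by apply/seteqP; split=> v /= => [/hincl_inj|->].
Qed.

Lemma hnorm_fin g v : (hn g v < +oo)%E -> exists u, v = hincl H g u.
Proof.
move=> fv; apply: contrapT => nv; move: fv; rewrite /hnorm.
rewrite (_ : [set u0 | _] = set0) ?image_set0 ?ereal_inf0//.
by apply/seteqP; split=> // u /= uv; apply: nv; exists u.
Qed.

Lemma hnorm_incl_fin g (u : hspace H g) : (hn g (hincl H g u) < +oo)%E.
Proof. by rewrite hnorm_incl ltry. Qed.

Definition hpre g (v : ambient H) : hspace H g := xget 0 [set u | hincl H g u = v].

Lemma hpreK g (u : hspace H g) : hpre g (hincl H g u) = u.
Proof.
apply: (@hincl_inj _ H g); rewrite /hpre.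
by case: xgetP => // /(_ u) /=; case.
Qed.

Definition hip g (u v : ambient H) : R := hinner (hpre g u) (hpre g v).

(** The constant is 1, as required by the martingale inequality. *)
Lemma hnorm_hilb g : hilb (hn g) (hip g) 1.
Proof.
have ge0 v : (0 <= hn g v)%E by apply: le_ereal_inf_tmp => _ [u _ <-].
have notfin v : ~ (hn g v < +oo)%E -> hn g v = +oo%E.
  by move=> /negP; rewrite -leNgt leye_eq => /eqP.
have innerC (u v : hspace H g) : hinner u v = hinner v u by exact: hinner_sym.
split=> //.
- by rewrite -(linear0 (hincl H g)) hnorm_incl normr0.
- move=> u v; have [fu|/notfin ->] := pselect (hn g u < +oo)%E; last first.
    by rewrite addye ?leey// gt_eqF// (lt_le_trans _ (ge0 v))// ltNyr.
  have [fv|/notfin ->] := pselect (hn g v < +oo)%E; last first.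
    by rewrite addey ?leey// gt_eqF// (lt_le_trans _ (ge0 u))// ltNyr.
  have [x ->] := hnorm_fin fu; have [y ->] := hnorm_fin fv.
  by rewrite -linearD !hnorm_incl -EFinD lee_fin ler_normD.
- move=> c v /hnorm_fin[x ->]; by rewrite -linearZ !hnorm_incl -EFinM lee_fin normrZ.
- move=> v v0; have /hnorm_fin[x xv] : (hn g v < +oo)%E by rewrite v0 ltry.
  by move: v0; rewrite xv hnorm_incl => -[] /normr0_eq0 ->; rewrite linear0.
- by move=> u v _ _; exact: innerC.
- move=> c u v w /hnorm_fin[x ->] /hnorm_fin[y ->] /hnorm_fin[z ->].
  by rewrite /hip -linearZ -linearD !hpreK hinner_linear.
- by move=> v /hnorm_fin[x ->]; rewrite /hip hpreK hinner_norm sqr_ge0.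
- by move=> v /hnorm_fin[x ->]; rewrite /hip hpreK hnorm_incl hinner_norm sqrtr_sqr normr_id mul1r.
- by move=> v /hnorm_fin[x ->]; rewrite /hip hpreK hnorm_incl hinner_norm sqrtr_sqr normr_id mul1e.
- have [D /countable_injP[f finj] Dd] := hspace_separable H g.
  exists (fun n => hincl H g (xget 0 [set u | D u /\ f u = n])); split.
    by move=> n; exact: hnorm_incl_fin.
  move=> v /hnorm_fin[x ->] eps e0.
  have [|] := Dd (ball x eps) _ (ball_open x eps).
    by exists x; exact: ballxx.
  move=> y [xy Dy]; exists (f y).
  have -> : xget 0 [set u | D u /\ f u = f y] = y.
    case: xgetP => [z -> [Dz fz]|/(_ y)/=]; last by case.
    by apply: finj; rewrite ?inE.
  by rewrite -linearB hnorm_incl lte_fin; rewrite -ball_normE /= in xy.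
- move=> u fu cu.
  have [x xu] := choice (fun n => hnorm_fin (fu n)).
  have cx : cauchy (x @ \oo).
    apply: cauchy_exP => eps e0; have [n0 hn0] := cu _ e0; exists (x n0).
    exists n0 => // n /= nn; rewrite -ball_normE /=.
    by have := hn0 n0 n (leqnn _) nn; rewrite !xu -linearB hnorm_incl lte_fin.
  have /cvg_ex[l xl] : cvg (x @ \oo) by exact: cauchy_cvg.
  exists (hincl H g l); first exact: hnorm_incl_fin.
  move=> eps e0; have /cvgrPdist_lt/(_ _ e0)[n0 _ hn0] := xl.
  exists n0 => n nn; rewrite xu -linearB hnorm_incl lte_fin distrC; exact: hn0.
Qed.

End HilbertScale.

(** * Operator norms on tuples of vectors *)

Section OperatorNorm.
Variables (R : realType) (W : lmodType R) (N : R -> W -> \bar R) (g : R).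
Variables (ip : W -> W -> R) (K : R).
Hypothesis hN : hilb (N g) ip K.
Variable e : nat.
Local Notation Ne := (opnorm (e := e) N g).
Implicit Types (A B : {ffun 'I_e -> W}) (x : 'rV[R]_e).

Lemma eucl_ge0 p q (M : 'M[R]_(p, q)) : 0 <= eucl M. Proof. exact: sqrtr_ge0. Qed.

Lemma entry_le_eucl p q (M : 'M[R]_(p, q)) i j : `|M i j| <= eucl M.
Proof.
rewrite -sqrtr_sqr; apply: ler_wsqrtr.
rewrite (bigD1 i)//= (bigD1 j)//= -addrA lerDl addr_ge0// sumr_ge0// => [k _|k _].
  exact: sqr_ge0.
by apply: sumr_ge0 => l _; exact: sqr_ge0.
Qed.

Lemma lappD A B x : lapp (A + B) x = lapp A x + lapp B x.
Proof. by rewrite /lapp -big_split; apply: eq_bigr => i _; rewrite ffunE scalerDr. Qed.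

Lemma lappZ c A x : lapp (c *: A) x = c *: lapp A x.
Proof. by rewrite /lapp scaler_sumr; apply: eq_bigr => i _; rewrite ffunE scalerA mulrC -scalerA. Qed.

Lemma lappB A B x : lapp (A - B) x = lapp A x - lapp B x.
Proof. by rewrite lappD -[- B]scaleN1r lappZ scaleN1r. Qed.

Lemma lappDr A x y : lapp A (x + y) = lapp A x + lapp A y.
Proof. by rewrite /lapp -big_split; apply: eq_bigr => i _; rewrite mxE scalerDl. Qed.

Lemma lapp_col A i : lapp A (delta_mx 0 i) = A i.
Proof.
rewrite /lapp (bigD1 i)//= mxE !eqxx scale1r big1 ?addr0// => j ji.
by rewrite mxE eqxx (negPf ji) scale0r.
Qed.

Lemma norm_lapp_le A x : (N g (lapp A x) <= \sum_(i < e) (`|x 0%R i|)%:E * N g (A i))%E.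
Proof.
rewrite /lapp; elim/big_ind2 : _ => [|v r v' r' h h'|i _].
- by rewrite (hilb0 hN).
- by apply: le_trans (hilbD hN _ _) _; exact: leeD.
have [fA|] := pselect (N g (A i) < +oo)%E; first exact: (hilbZ hN).
move=> /negP; rewrite -leNgt leye_eq => /eqP ->.
have [->|xi] := eqVneq (x 0 i) 0; first by rewrite scale0r (hilb0 hN) normr0 mul0e.
by rewrite gt0_muley ?leey// lte_fin normr_gt0.
Qed.

Lemma opnorm_le_sum A : (Ne A <= \sum_(i < e) N g (A i))%E.
Proof.
apply: ub_ereal_sup => _ [x /= x1 <-]; apply: le_trans (norm_lapp_le _ _) _.
apply: lee_sum => i _; rewrite -[leRHS]mul1e; apply: lee_wpmul2r; first exact: (hilb_ge0 hN).
by rewrite lee_fin; apply: le_trans x1; exact: entry_le_eucl.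
Qed.

Lemma opnorm_col A i : (N g (A i) <= Ne A)%E.
Proof.
apply: ereal_sup_ubound; exists (delta_mx 0 i); last by rewrite lapp_col.
rewrite /= /eucl big_ord_recl big_ord0 addr0 (bigD1 i)//= mxE !eqxx big1 => [|j ji].
  by rewrite addr0 expr1n sqrtr1.
by rewrite mxE eqxx (negPf ji) expr0n.
Qed.

Lemma opnorm_finP A : (Ne A < +oo)%E <-> forall i, (N g (A i) < +oo)%E.
Proof.
split=> [fA i|fA]; first exact: le_lt_trans (opnorm_col A i) fA.
apply: le_lt_trans (opnorm_le_sum A) _.
by rewrite (eq_bigr (fun i => (fine (N g (A i)))%:E)) ?sumEFin ?ltry// => i _; exact: (finV hN).
Qed.

Lemma norm_lapp A x : (Ne A < +oo)%E -> (N g (lapp A x) <= (e%:R * eucl x)%:E * Ne A)%E.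
Proof.
move=> fA; apply: le_trans (norm_lapp_le _ _) _.
apply: le_trans (_ : \sum_(i < e) (eucl x)%:E * Ne A <= _)%E.
  apply: lee_sum => i _; apply: lee_pmul.
  - by rewrite lee_fin.
  - exact: (hilb_ge0 hN).
  - by rewrite lee_fin; exact: entry_le_eucl.
  - exact: opnorm_col.
have A0 : (0 <= Ne A)%E.
  apply: le_trans (ereal_sup_ubound _); last by exists 0; [rewrite /= /eucl !big1 ?sqrtr0// => *; rewrite ?big1// => *; rewrite mxE expr0n|reflexivity].
  exact: (hilb_ge0 hN).
have FA : Ne A \is a fin_num by rewrite ge0_fin_numE.
rewrite -(fineK FA); under eq_bigr do rewrite -EFinM.
by rewrite sumEFin -EFinM lee_fin sumr_const card_ord -mulrA mulr_natl.
Qed.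

(** The Hilbert-Schmidt product. The operator norm does not come from an inner product, but with
    finitely many columns it is equivalent to the norm of this one. *)
Definition opip A B : R := \sum_(i < e) ip (A i) (B i).

(** Sums over the columns cost at most a factor [e]; its successor is taken because the constant has
    to be at least 1 also when e = 0. The lemma can be iterated, which covers H_g^(e x e). *)
Lemma opnorm_hilb : hilb Ne opip (e.+1%:R * K).
Proof.
have K0 : 0 <= K by apply: le_trans (hilb_K hN).
have e1 : 1 <= e.+1%:R :> R by rewrite ler1n.
have el : e%:R <= e.+1%:R :> R by rewrite ler_nat.
have ge0 A : (0 <= Ne A)%E.
  apply: le_trans (ereal_sup_ubound _); last by exists 0; [rewrite /= /eucl !big1 ?sqrtr0// => *; rewrite ?big1// => *; rewrite mxE expr0n|reflexivity].
  exact: (hilb_ge0 hN).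
split=> //.
- apply/eqP; rewrite eq_le ge0 andbT; apply: le_trans (opnorm_le_sum _) _.
  by rewrite big1// => i _; rewrite ffunE (hilb0 hN).
- move=> A B; apply: ub_ereal_sup => _ [x x1 <-]; rewrite lappD.
  by apply: le_trans (hilbD hN _ _) _; apply: leeD; apply: ereal_sup_ubound; exists x.
- move=> c A fA; apply: ub_ereal_sup => _ [x x1 <-]; rewrite lappZ.
  have fl : (N g (lapp A x) < +oo)%E.
    by apply: le_lt_trans fA; apply: ereal_sup_ubound; exists x.
  apply: le_trans (hilbZ hN c fl) _; apply: lee_wpmul2l; first by rewrite lee_fin.
  by apply: ereal_sup_ubound; exists x.
- move=> A A0; apply/ffunP => i; rewrite ffunE; apply: (hilb_eq0 hN).
  by apply/eqP; rewrite eq_le (hilb_ge0 hN) andbT -A0 opnorm_col.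
- by move=> A B /opnorm_finP fA /opnorm_finP fB; apply: eq_bigr => i _; rewrite (hilb_ipC hN).
- move=> c A B C /opnorm_finP fA /opnorm_finP fB /opnorm_finP fC.
  rewrite /opip mulr_sumr -big_split; apply: eq_bigr => i _.
  by rewrite !ffunE (hilb_ip_lin hN).
- by move=> A /opnorm_finP fA; apply: sumr_ge0 => i _; exact: (hilb_ip_ge0 hN).
- by apply: le_trans (hilb_K hN) _; rewrite ler_peMl.
- move=> A /opnorm_finP fA; apply: le_trans (opnorm_le_sum _) _.
  apply: le_trans (_ : \sum_(i < e) (K * Num.sqrt (opip A A))%:E <= _)%E.
    apply: lee_sum => i _; apply: le_trans (hilb_le_ip hN (fA i)) _.
    rewrite lee_fin ler_wpM2l// ler_wsqrtr// /opip (bigD1 i)//= lerDl.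
    by apply: sumr_ge0 => j _; exact: (hilb_ip_ge0 hN).
  rewrite sumEFin lee_fin sumr_const card_ord -mulrA -[leLHS]mulr_natl; apply: ler_wpM2r => //.
  by rewrite mulr_ge0// sqrtr_ge0.
- move=> A FA; have /opnorm_finP fA := FA.
  have nA : Ne A = (fine (Ne A))%:E by rewrite fineK// ge0_fin_numE.
  rewrite nA -EFinM lee_fin.
  have h i : ip (A i) (A i) <= (K * fine (Ne A)) ^+ 2.
    rewrite -(qn_sqr hN (fA i)) ler_sqr ?nnegrE ?qn_ge0 ?mulr_ge0 ?fine_ge0//.
    rewrite -lee_fin; apply: le_trans (hilb_ip_le hN (fA i)) _.
    by rewrite EFinM -nA; apply: lee_wpmul2l; [rewrite lee_fin|exact: opnorm_col].
  have M0 : 0 <= K * fine (Ne A) by rewrite mulr_ge0// fine_ge0.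
  rewrite -mulrA.
  have -> : e.+1%:R * (K * fine (Ne A)) = Num.sqrt ((e.+1%:R * (K * fine (Ne A))) ^+ 2).
    by rewrite sqrtr_sqr ger0_norm// mulr_ge0.
  apply: ler_wsqrtr.
  apply: le_trans (_ : \sum_(i < e) (K * fine (Ne A)) ^+ 2 <= _).
    by apply: ler_sum => i _; exact: h.
  rewrite sumr_const card_ord -[leLHS]mulr_natl [leRHS]exprMn; apply: ler_wpM2r; first exact: sqr_ge0.
  by apply: le_trans el _; rewrite expr2 ler_peMl// ltW// ltr0n.
- have [dn [fd hd]] := hilb_separable hN.
  exists (fun n => if unpickle n is Some k then [ffun i => dn ((k : {ffun 'I_e -> nat}) i)] else 0); split.
    move=> n; case: unpickle => [k|]; apply/opnorm_finP => i; rewrite ffunE//.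
    exact: (fin0 hN).
  move=> A /opnorm_finP fA eps e0.
  have e'0 : 0 < eps / e.+1%:R by rewrite divr_gt0// ltr0n.
  have [k hk] := choice (fun i => hd _ (fA i) _ e'0).
  exists (pickle [ffun i => k i]); rewrite pickleK.
  apply: le_lt_trans (opnorm_le_sum _) _.
  apply: le_lt_trans (_ : \sum_(i < e) (eps / e.+1%:R)%:E < _)%E.
    by apply: lee_sum => i _; rewrite !ffunE ltW.
  rewrite sumEFin lte_fin sumr_const card_ord -[ltLHS]mulr_natl mulrA ltr_pdivrMr ?ltr0n//.
  by rewrite mulrC ltr_pM2l// ltr_nat.
- move=> u fu cu.
  have lim (i : 'I_e) : exists x : W, (N g x < +oo)%E /\ forall eps : R, 0 < eps ->
      exists n0, forall n, (n0 <= n)%N -> (N g (u n i - x)%R < eps%:E)%E.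
    have [||x fx hx] := hilb_complete hN (u := fun n => u n i).
    - by move=> n; have /opnorm_finP := fu n.
    - move=> eps e0; have [n0 h0] := cu _ e0; exists n0 => n k nn nk.
      apply: le_lt_trans (h0 n k nn nk).
      by have := opnorm_col (u n - u k) i; rewrite !ffunE.
    by exists x.
  have [v hv] := choice lim.
  exists [ffun i => v i]; first by apply/opnorm_finP => i; rewrite ffunE; have [] := hv i.
  move=> eps e0; have e'0 : 0 < eps / e.+1%:R by rewrite divr_gt0// ltr0n.
  have [k hk] := choice (fun i => (hv i).2 _ e'0).
  exists (\max_(i < e) k i)%N => n kn.
  apply: le_lt_trans (opnorm_le_sum _) _.
  apply: le_lt_trans (_ : \sum_(i < e) (eps / e.+1%:R)%:E < _)%E.
    apply: lee_sum => i _; rewrite !ffunE ltW//; apply: hk.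
    exact: leq_trans (leq_bigmax i) kn.
  rewrite sumEFin lte_fin sumr_const card_ord -[ltLHS]mulr_natl mulrA ltr_pdivrMr ?ltr0n//.
  by rewrite mulrC ltr_pM2l// ltr_nat.
Qed.

End OperatorNorm.

Section DoubleOperatorNorm.
Variables (R : realType) (W : lmodType R) (N : R -> W -> \bar R) (g : R).
Variables (ip : W -> W -> R) (K : R).
Hypothesis hN : hilb (N g) ip K.
Variable e : nat.
Local Notation Ne := (opnorm (e := e) N).
Local Notation Nee := (opnorm (e := e) (opnorm (e := e) N)).
Implicit Types (A B : {ffun 'I_e -> {ffun 'I_e -> W}}) (M : 'M[R]_e).

Lemma lapp2B A B M : lapp2 (A - B) M = lapp2 A M - lapp2 B M.
Proof.
rewrite /lapp2 -sumrB; apply: eq_bigr => i _; rewrite -sumrB; apply: eq_bigr => j _.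
by rewrite !ffunE scalerBr.
Qed.

Lemma lapp2Dr A M M' : lapp2 A (M + M') = lapp2 A M + lapp2 A M'.
Proof.
rewrite /lapp2 -big_split; apply: eq_bigr => i _; rewrite -big_split; apply: eq_bigr => j _.
by rewrite mxE scalerDl.
Qed.

Lemma lapp2_tensor A (x z : 'rV[R]_e) : lapp2 A (x^T *m z) = lapp (lapp A x) z.
Proof.
rewrite /lapp2 exchange_big /lapp; apply: eq_bigr => j _.
rewrite sum_ffunE scaler_sumr; apply: eq_bigr => i _.
by rewrite !mxE big_ord_recl big_ord0 addr0 mxE ffunE scalerA mulrC.
Qed.

Lemma norm_lapp2 A M : (Nee g A < +oo)%E ->
  (N g (lapp2 A M) <= (e%:R ^+ 2 * eucl M)%:E * Nee g A)%E.
Proof.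
move=> fA; have hNe := opnorm_hilb hN e.
have fA1 i : (Ne g (A i) < +oo)%E by exact: (opnorm_finP hNe A).1.
have -> : lapp2 A M = \sum_i lapp (A i) (row i M).
  by rewrite /lapp2 /lapp; apply: eq_bigr => i _; apply: eq_bigr => j _; rewrite mxE.
have re i : eucl (row i M) <= eucl M.
  apply: ler_wsqrtr; rewrite big_ord_recl big_ord0 addr0 [leRHS](bigD1 i)//=.
  under eq_bigr do rewrite mxE.
  by rewrite lerDl sumr_ge0// => k _; apply: sumr_ge0 => l _; exact: sqr_ge0.
apply: le_trans (_ : \sum_(i < e) (e%:R * eucl M)%:E * Nee g A <= _)%E.
  elim/big_ind2 : _ => [|v r v' r' h h'|i _].
  - by rewrite (hilb0 hN).
  - by apply: le_trans (hilbD hN _ _) _; exact: leeD.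
  apply: le_trans (norm_lapp hN _ (fA1 i)) _; apply: lee_pmul.
  - by rewrite lee_fin mulr_ge0// eucl_ge0.
  - exact: (hilb_ge0 hNe).
  - by rewrite lee_fin ler_wpM2l.
  - exact: opnorm_col.
rewrite (finV (opnorm_hilb hNe e) fA); under eq_bigr do rewrite -EFinM.
rewrite sumEFin -EFinM lee_fin sumr_const card_ord -[leLHS]mulr_natl.
by rewrite expr2 !mulrA.
Qed.

End DoubleOperatorNorm.

(** * Embedding, interpolation and smoothing with explicit constants *)

Section PropagatorBounds.
Variables (R : realType) (H : monotone_family R).
Local Notation hn := (@hnorm R H).

Lemma embedding_bound g1 g2 : g1 <= g2 -> exists2 C : R, 1 <= C &
  forall v, (hn g2 v < +oo)%E -> (hn g1 v <= C%:E * hn g2 v)%E.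
Proof.
move=> g12; have [C hC] := hspace_embedding H g12.
exists (Num.max 1 C); first by rewrite le_max lexx.
move=> v /hnorm_fin[u ->]; have [|u1 _ u1E] := @hspace_nested _ H _ _ g12 (hincl H g2 u).
  by exists u.
rewrite -{1}u1E !hnorm_incl -EFinM lee_fin; apply: le_trans (hC _ _ u1E) _.
by apply: ler_wpM2r => //; rewrite le_max lexx orbT.
Qed.

(** An additive form of interpolation, which passes to operator norms and to L^m by the triangle
    inequality. The weights are such that the powers of [T] cancel in the product p^(g3-g2)
    q^(g2-g1), which is at most (p + q)^(g3-g1). *)
Lemma interpolation_bound g1 g2 g3 : g1 <= g2 -> g2 <= g3 -> g1 < g3 ->
  exists2 C : R, 1 <= C & forall (T : R) v, 0 < T -> (hn g3 v < +oo)%E ->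
  (hn g2 v <= C%:E * ((T `^ (g1 - g2))%:E * hn g1 v + (T `^ (g3 - g2))%:E * hn g3 v))%E.
Proof.
move=> g12 g23 g13; have [C0 hC0] := hspace_interpolation H g12 g23.
have D0 : 0 < g3 - g1 by rewrite subr_gt0.
pose C := Num.max 1 C0; have C1 : 1 <= C by rewrite le_max lexx.
have C00 : 0 <= C by exact: le_trans C1.
exists (C `^ (g3 - g1)^-1).
  by rewrite -[leLHS](powRr0 C); apply: ler_powR => //; rewrite invr_ge0 ltW.
move=> T v T0 fv; have [v0|v0] := eqVneq (hn g3 v) 0%E.
  rewrite (hilb_eq0 (hnorm_hilb H g3) v0) !(hilb0 (hnorm_hilb H _)).
  by rewrite !mule0 adde0 mule0.
have [u3 u3E] := hnorm_fin fv; rewrite {}u3E in v0 fv *.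
have [|u2 _ u2E] := @hspace_nested _ H _ _ g23 (hincl H g3 u3); first by exists u3.
have [|u1 _ u1E] := @hspace_nested _ H _ _ (ltW g13) (hincl H g3 u3); first by exists u3.
have n2 : hn g2 (hincl H g3 u3) = `|u2|%:E by rewrite -u2E hnorm_incl.
have n1 : hn g1 (hincl H g3 u3) = `|u1|%:E by rewrite -u1E hnorm_incl.
rewrite n2 n1 hnorm_incl.
suff : `|u2| <= C `^ (g3 - g1)^-1 * (T `^ (g1 - g2) * `|u1| + T `^ (g3 - g2) * `|u3|).
  by rewrite -lee_fin EFinM EFinD !EFinM.
set p := T `^ (g1 - g2) * `|u1|; set q := T `^ (g3 - g2) * `|u3|.
have p0 : 0 <= p by rewrite mulr_ge0 ?powR_ge0.
have q0 : 0 < q.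
  rewrite mulr_gt0 ?powR_gt0//; rewrite hnorm_incl in v0.
  by rewrite lt_def normr_ge0 andbT; apply: contra_neq v0 => ->.
have TT x y : T `^ x * T `^ y = T `^ (x + y) by rewrite powRD//; apply/implyP; rewrite (gt_eqF T0).
have pq : `|u1| `^ (g3 - g2) * `|u3| `^ (g2 - g1) = p `^ (g3 - g2) * q `^ (g2 - g1).
  rewrite !powRM ?powR_ge0// -!powRrM mulrACA TT.
  have -> : (g1 - g2) * (g3 - g2) + (g3 - g2) * (g2 - g1) = 0 by ring.
  by rewrite powRr0 mul1r.
have pq0 : 0 < p + q by rewrite ltr_wpDl.
have h : `|u2| `^ (g3 - g1) <= (C `^ (g3 - g1)^-1 * (p + q)) `^ (g3 - g1).
  apply: le_trans (hC0 _ _ _ u1E u2E) _.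
  rewrite powRM ?powR_ge0 ?(ltW pq0)// -powRrM mulVf ?gt_eqF// powRr1// -mulrA pq.
  apply: le_trans (_ : C * (p `^ (g3 - g2) * q `^ (g2 - g1)) <= _).
    by apply: ler_wpM2r; rewrite ?mulr_ge0 ?powR_ge0// le_max lexx orbT.
  apply: ler_wpM2l => //.
  have -> : g3 - g1 = (g3 - g2) + (g2 - g1) by ring.
  rewrite [leRHS]powRD; last by rewrite (gt_eqF pq0) implybT.
  by apply: ler_pM; rewrite ?powR_ge0//; apply: powR_le; rewrite ?subr_ge0 ?lerDl ?lerDr// ltW.
rewrite leNgt; apply/negP => lt; move: h; rewrite leNgt => /negP; apply.
by apply: gt0_ltr_powR; rewrite // nnegrE ?mulr_ge0 ?powR_ge0 ?(ltW pq0).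
Qed.

Section Propagator.
Variables (T0 : R) (S : propagator H T0).
Local Notation prop := (prop S).

Lemma prop_bound g : exists2 C : R, 1 <= C & forall s t v, 0 <= s -> s <= t -> t <= T0 ->
  (hn g v < +oo)%E -> (hn g (prop s t v) <= C%:E * hn g v)%E.
Proof.
have [|C hC] := prop_smoothing S (lexx g); first by rewrite lerDl.
exists (Num.max 1 C); first by rewrite le_max lexx.
move=> s t v s0; rewrite le_eqVlt => /orP[/eqP <- sT fv|st tT /hnorm_fin[u ->]].
  rewrite prop_id ?s0//; rewrite -[leLHS]mul1e; apply: lee_wpmul2r; first exact: (hilb_ge0 (hnorm_hilb H g)).
  by rewrite lee_fin le_max lexx.
apply: le_trans (hC s t u _) _; first by split.
rewrite subrr powRr0 mulr1 hnorm_incl -EFinM lee_fin; apply: ler_wpM2r => //.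
by rewrite le_max lexx orbT.
Qed.

Let smoothing1 g1 g2 : g1 <= g2 -> g2 <= g1 + 1 -> exists2 C : R, 1 <= C &
  forall s t v, 0 <= s -> s < t -> t <= T0 -> (hn g1 v < +oo)%E ->
  (hn g2 (prop s t v) <= (C * (t - s) `^ (g1 - g2))%:E * hn g1 v)%E.
Proof.
move=> g12 g21; have [C hC] := prop_smoothing S g12 g21.
exists (Num.max 1 C); first by rewrite le_max lexx.
move=> s t v s0 st tT /hnorm_fin[u ->].
apply: le_trans (hC s t u _) _; first by split.
rewrite hnorm_incl -EFinM lee_fin; apply: ler_wpM2r => //; apply: ler_wpM2r; first exact: powR_ge0.
by rewrite le_max lexx orbT.
Qed.

(** Two smoothings of half the gain are composed at the midpoint of [s, t]. A gain above 1 is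
    needed, because eta ranges up to a + b + b', which may be as large as 3/2. *)
Lemma smoothing_bound g1 g2 : g1 <= g2 -> g2 <= g1 + 2 -> exists2 C : R, 1 <= C &
  forall s t v, 0 <= s -> s < t -> t <= T0 -> (hn g1 v < +oo)%E ->
  (hn g2 (prop s t v) <= (C * (t - s) `^ (g1 - g2))%:E * hn g1 v)%E.
Proof.
move=> g12 g21; pose gm := (g1 + g2) / 2.
have [C1 C11 h1] := @smoothing1 g1 gm ltac:(rewrite /gm; lra) ltac:(rewrite /gm; lra).
have [C2 C21 h2] := @smoothing1 gm g2 ltac:(rewrite /gm; lra) ltac:(rewrite /gm; lra).
have C10 : 0 <= C1 by exact: le_trans C11. have C20 : 0 <= C2 by exact: le_trans C21.
exists (C1 * C2 * 2 `^ (g2 - g1)).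
  have l2 : 1 <= 2 `^ (g2 - g1).
    by rewrite -[leLHS](powRr0 2); apply: ler_powR; rewrite ?subr_ge0// ler1n.
  by rewrite !mulr_ege1.
move=> s t v s0 st tT fv; pose u := (s + t) / 2.
have su : s < u by rewrite /u; lra.
have ut : u < t by rewrite /u; lra.
rewrite -(prop_comp S s0 (ltW su) (ltW ut) tT).
have uT : u <= T0 by exact: le_trans (ltW ut) tT.
have u0 : 0 <= u by exact: le_trans s0 (ltW su).
have e1 : u - s = 2^-1 * (t - s) by rewrite /u; field.
have e2 : t - u = 2^-1 * (t - s) by rewrite /u; field.
have ts0 : 0 < t - s by rewrite subr_gt0.
have k1 := h1 s u v s0 su uT fv.
have fu : (hn gm (prop s u v) < +oo)%E.
  by apply: le_lt_trans k1 _; rewrite (finV (hnorm_hilb H g1) fv) -EFinM ltry.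
apply: le_trans (h2 u t _ u0 ut tT fu) _.
apply: le_trans (_ : (C2 * (t - u) `^ (gm - g2))%:E * ((C1 * (u - s) `^ (g1 - gm))%:E * hn g1 v) <= _)%E.
  by apply: lee_wpmul2l => //; rewrite lee_fin mulr_ge0// powR_ge0.
rewrite muleA -EFinM; apply: lee_wpmul2r; first exact: (hilb_ge0 (hnorm_hilb H g1)).
have E : (2^-1 * (t - s)) `^ (gm - g2) * (2^-1 * (t - s)) `^ (g1 - gm) =
    2 `^ (g2 - g1) * (t - s) `^ (g1 - g2).
  have h0 : 2^-1 * (t - s) != 0 by rewrite mulf_neq0 ?invr_eq0 ?pnatr_eq0// gt_eqF.
  rewrite -powRD ?h0 ?implybT// powRM ?(ltW ts0)//.
  have -> : gm - g2 + (g1 - gm) = g1 - g2 by ring.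
  by congr (_ * _); rewrite -powR_inv1// -powRrM; congr (_ `^ _); ring.
rewrite lee_fin e1 e2 mulrACA E [C2 * C1]mulrC !mulrA.
by rewrite lexx.
Qed.

Lemma regularity_bound g1 g2 : g1 <= g2 -> g2 <= g1 + 1 -> exists2 C : R, 1 <= C &
  forall s t v, 0 <= s -> s <= t -> t <= T0 -> (hn g2 v < +oo)%E ->
  (hn g1 (prop s t v - v) <= (C * (t - s) `^ (g2 - g1))%:E * hn g2 v)%E.
Proof.
move=> g12 g21; have [C hC] := prop_regularity S g12 g21.
exists (Num.max 1 C); first by rewrite le_max lexx.
have C1 : 0 <= Num.max 1 C by rewrite le_max ler01.
move=> s t v s0; rewrite le_eqVlt => /orP[/eqP <- sT fv|st tT /hnorm_fin[u ->]].
  rewrite prop_id ?s0// subrr (hilb0 (hnorm_hilb H g1)) mule_ge0//.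
    by rewrite lee_fin mulr_ge0// powR_ge0.
  exact: (hilb_ge0 (hnorm_hilb H g2)).
apply: le_trans (hC s t u _) _; first by split.
rewrite hnorm_incl -EFinM lee_fin; apply: ler_wpM2r => //; apply: ler_wpM2r; first exact: powR_ge0.
by rewrite le_max lexx orbT.
Qed.

End Propagator.

End PropagatorBounds.

(** * Stochastic sewing *)

Lemma geometric_small (R : realType) (c q eps : R) : 0 <= c -> 0 <= q -> q < 1 -> 0 < eps ->
  exists n0, forall n, (n0 <= n)%N -> c * q ^+ n < eps.
Proof.
move=> c0 q0 q1 e0.
have : (fun n => c * q ^+ n) @ \oo --> (0 : R).
  by rewrite -[X in _ --> X](mulr0 c); apply: cvgMr; apply: cvg_expr; rewrite ger0_norm.
move=> /cvgrPdist_lt/(_ _ e0)[n0 _ h]; exists n0 => n nn.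
by have := h n nn; rewrite sub0r normrN ger0_norm// mulr_ge0// exprn_ge0.
Qed.

Lemma geometric_sum_le (R : realType) (c q : R) n k : 0 <= c -> 0 <= q -> q < 1 ->
  \sum_(i < k) c * q ^+ (n + i) <= c * q ^+ n / (1 - q).
Proof.
move=> c0 q0 q1; have p : 0 < 1 - q by rewrite subr_gt0.
rewrite ler_pdivlMr//.
have -> : (\sum_(i < k) c * q ^+ (n + i)) * (1 - q) = c * q ^+ n * (1 - q ^+ k).
  elim: k => [|k IH]; first by rewrite big_ord0 mul0r expr0 subrr mulr0.
  by rewrite big_ord_recr/= mulrDl IH exprD exprS; ring.
by rewrite ler_piMr// ?mulr_ge0 ?exprn_ge0// gerBl exprn_ge0.
Qed.

(** Bundled so that a constant can be quantified before the horizon, the probability space and the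
    filtration; the bound [T0] is all that it may depend on. *)
Record stochastic_basis (R : realType) (T0 : R) := StochasticBasis {
  horizon : R ;
  horizon_gt0 : 0 < horizon ;
  horizon_le : horizon <= T0 ;
  sb_display : measure_display ;
  sb_space : measurableType sb_display ;
  sb_prob : probability sb_space R ;
  sb_filt : R -> set (set sb_space) ;
  sb_complete : forall t, 0 <= t -> t <= horizon -> complete_sigma sb_prob (sb_filt t) ;
  sb_mono : forall s t, 0 <= s -> s <= t -> t <= horizon -> sb_filt s `<=` sb_filt t
}.

Section Decomposition.
Variables (R : realType) (H : monotone_family R) (T0 : R) (S : propagator H T0).
Variable m : R.
Hypothesis m2 : 2 <= m.
Let m1 : 1 <= m. Proof. by apply: le_trans m2; rewrite ler1n. Qed.
Local Notation hn := (@hnorm R H).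
Local Notation basis := (stochastic_basis T0).
Local Notation Om B := (sb_space B).
Local Notation F := (@sb_filt R T0 _).
Local Notation hip := (@hip R H).
Local Notation hH := (hnorm_hilb H).
Local Notation prop := (prop S).
Implicit Types (B : basis).
Local Notation mbh B g G xi c := (mb (sb_prob B) m hn g G xi c).
Local Notation orthh B g G xi := (orth (sb_prob B) hn g (hip g) G xi).
Local Notation T B := (horizon B).

Lemma sb_meas B : complete_sigma (sb_prob B) measurable.
Proof.
exact: (complete_measurable (sb_complete (lexx 0) (ltW (horizon_gt0 B)))).
Qed.

Lemma orth_lim B g G (x : nat -> Om B -> ambient H) y (r : nat -> R) :
  complete_sigma (sb_prob B) G ->
  (forall eps : R, 0 < eps -> exists n0, forall n, (n0 <= n)%N -> r n < eps) ->
  (exists c, mbh B g measurable y c) ->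
  (forall n, mbh B g measurable (fun w => y w - x n w) (r n)) ->
  (forall n, orthh B g G (x n)) -> orthh B g G y.
Proof.
move=> cG r0 [cy by_] bx ox C GC v fv; have cm := sb_meas B.
have mC := complete_sigma_meas cG GC.
have [cy1 by1] := mb_L1 (hH g) m2 cm by_.
have iy := ip_int_integrable (hH g) cm by1 fv mC.
rewrite -[LHS]fineK; last exact: (integrable_fin_num mC iy).
congr EFin; apply/eqP; rewrite -normr_eq0 eq_le normr_ge0 andbT.
apply/ler_addgt0Pr => e e0; rewrite add0r.
have q0 : 0 < 2 * qn (hip g) v + 1 by rewrite ltr_wpDl// mulr_ge0// qn_ge0.
have [n0 hn0] := r0 _ (divr_gt0 e0 q0).
have rn := ltW (hn0 n0 (leqnn _)).
have b1 := mb_exponent_le (hH g) (lexx 1) m1 cm (divr_gt0 e0 q0) (mb_le rn (bx n0)).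
have [cx bx1] : exists c, mb (sb_prob B) 1 hn g measurable (x n0) c.
  have := mb_subr (lexx 1) (hH g) cm by1 b1 => b; eexists.
  apply: (mb_ae (lexx 1) (hH g) cm _ b); apply: aeW => w; by rewrite subKr.
have := ip_int_sub (hH g) cm by1 bx1 fv mC; rewrite ox// subr0 => <-.
apply: le_trans (ip_int_bound (hH g) cm b1 fv mC (e := 2 * (e / (2 * qn (hip g) v + 1))) _) _.
  have := (mb1P (hH g) cm (mb_rv b1) (mb_ge0 b1)).1 b1; apply: le_trans.
  apply: ge0_subset_integral => //; last by move=> w _; exact: (hilb_ge0 (hH g)).
  exact: (rv_measurable_norm (hH g) cm (mb_rv b1)).
have := qn_ge0 (hip g) v; move: (qn _ v) q0 => q q0 q1.
by rewrite mul1r [2 * _]mulrA [q * _]mulrA ler_pdivrMr//; nra.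
Qed.

(* A sum of such terms over a partition is estimated by the triangle inequality for
   the drifts [D], and in square mean for the martingale increments [M], which may
   therefore be of lower order in the length of the intervals. *)
Definition decomp B gD gM s u (E : Om B -> ambient H) rD rM := exists D M,
  [/\ aeeq (sb_prob B) E (fun w => D w + M w), mbh B gD (F u) D rD,
      mbh B gM (F u) M rM & orthh B gM (F s) M].

Lemma decomp_le B gD gM s u E rD rM rD' rM' : rD <= rD' -> rM <= rM' ->
  @decomp B gD gM s u E rD rM -> @decomp B gD gM s u E rD' rM'.
Proof. by move=> hD hM [D [M [e bD bM o]]]; exists D, M; split=> //; apply: mb_le; eassumption. Qed.

Lemma decomp_ae B gD gM s u E E' rD rM : aeeq (sb_prob B) E' E ->
  @decomp B gD gM s u E rD rM -> @decomp B gD gM s u E' rD rM.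
Proof.
move=> ee [D [M [e bD bM o]]]; exists D, M; split=> //.
by apply: ae2 ee e _ => w ->.
Qed.

Lemma decomp0 B gD gM s u : 0 <= s -> s <= u -> u <= T B -> @decomp B gD gM s u (fun=> 0) 0 0.
Proof.
move=> s0 su uT; have cu := sb_complete (le_trans s0 su) uT.
exists (fun=> 0), (fun=> 0); split; first by apply: aeW => w; rewrite addr0.
- exact: (mb0 m1 (hH gD) cu).
- exact: (mb0 m1 (hH gM) cu).
move=> C FC v fv; apply: integral0_eq => w _.
by rewrite (hilb_ipC (hH gM) fv (fin0 (hH gM))) (ip0l (hH gM)).
Qed.

Lemma orth_add B g s u (M M' : Om B -> ambient H) r r' : 0 <= s -> s <= u -> u <= T B ->
  mbh B g (F u) M r -> mbh B g (F u) M' r' ->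
  orthh B g (F s) M -> orthh B g (F s) M' -> orthh B g (F s) (fun w => M w + M' w).
Proof.
move=> s0 su uT b b' o o'; have cs := sb_complete s0 (le_trans su uT).
have cu := sb_complete (le_trans s0 su) uT.
have up x c : mbh B g (F u) x c -> mbh B g measurable x c by apply: mb_sub; exact: (complete_sigma_meas cu).
have bN := mb_opp m1 (hH g) (sb_meas B) (up _ _ b').
have oN : orthh B g (F s) (fun w => - M' w).
  move=> C FC v fv.
  have := orthB (hH g) m2 cs (mb0 m1 (hH g) (sb_meas B)) (up _ _ b').
  move=> /(_ _ o' C FC v fv); under eq_integral do rewrite sub0r; apply.
  move=> C' FC' v' fv'; apply: integral0_eq => w _.
  by rewrite (hilb_ipC (hH g) fv' (fin0 (hH g))) (ip0l (hH g)).
have := orthB (hH g) m2 cs (up _ _ b) bN o oN => h C FC v fv.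
by have := h C FC v fv; under eq_integral do rewrite opprK.
Qed.

Lemma orth_sum B g s u n (M : nat -> Om B -> ambient H) (r : nat -> R) : 0 <= s -> s <= u -> u <= T B ->
  (forall i, (i < n)%N -> mbh B g (F u) (M i) (r i)) ->
  (forall i, (i < n)%N -> orthh B g (F s) (M i)) -> orthh B g (F s) (fun w => \sum_(i < n) M i w).
Proof.
move=> s0 su uT; elim: n => [|n IH] b o.
  move=> C FC v fv; apply: integral0_eq => w _; rewrite big_ord0.
  by rewrite (hilb_ipC (hH g) fv (fin0 (hH g))) (ip0l (hH g)).
have cu := sb_complete (le_trans s0 su) uT.
have bs := mb_sum m1 (hH g) cu (fun i ni => b i (leqW ni)).
have os := IH (fun i ni => b i (leqW ni)) (fun i ni => o i (leqW ni)).
have := orth_add s0 su uT bs (b n (ltnSn n)) os (o n (ltnSn n)) => h C FC v fv.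
by rewrite -[RHS](h C FC v fv); apply: eq_integral => w _; rewrite big_ord_recr.
Qed.

Lemma decomp_add B gD gM s u E E' rD rM rD' rM' : 0 <= s -> s <= u -> u <= T B ->
  @decomp B gD gM s u E rD rM -> @decomp B gD gM s u E' rD' rM' ->
  @decomp B gD gM s u (fun w => E w + E' w) (rD + rD') (rM + rM').
Proof.
move=> s0 su uT [D [M [e bD bM o]]] [D' [M' [e' bD' bM' o']]].
have cu := sb_complete (le_trans s0 su) uT.
exists (fun w => D w + D' w), (fun w => M w + M' w); split.
- by apply: ae2 e e' _ => w -> ->; rewrite addrACA.
- exact: (mb_add m1 (hH gD) cu bD bD').
- exact: (mb_add m1 (hH gM) cu bM bM').
exact: (orth_add s0 su uT bM bM' o o').
Qed.

Lemma decomp_opp B gD gM s u E rD rM : 0 <= s -> s <= u -> u <= T B ->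
  @decomp B gD gM s u E rD rM -> @decomp B gD gM s u (fun w => - E w) rD rM.
Proof.
move=> s0 su uT [D [M [e bD bM o]]]; have cu := sb_complete (le_trans s0 su) uT.
have cs := sb_complete s0 (le_trans su uT).
exists (fun w => - D w), (fun w => - M w); split.
- by apply: ae1 e _ => w ->; rewrite opprD.
- exact: (mb_opp m1 (hH gD) cu bD).
- exact: (mb_opp m1 (hH gM) cu bM).
have [c bM1] := mb_L1 (hH gM) m2 (sb_meas B) (mb_sub (complete_sigma_meas cu) bM).
apply: (@orth_op _ _ _ _ _ _ _ _ _ _ (hH gM) _ _ _ _ (hH gM) (-%R : {linear ambient H -> ambient H}) 1 _ _ _ cs ler01 _ bM1 o).
by move=> v _; rewrite mul1e (norm_opp (hH gM)).
Qed.

Lemma decomp_widen B gD gM s s' u u' E rD rM : 0 <= s' -> s' <= s -> s <= u -> u <= u' -> u' <= T B ->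
  @decomp B gD gM s u E rD rM -> @decomp B gD gM s' u' E rD rM.
Proof.
move=> s0 ss su uu uT [D [M [e bD bM o]]].
have sT : s <= T B by exact: le_trans su (le_trans uu uT).
have Fu := sb_mono (le_trans s0 (le_trans ss su)) uu uT.
exists D, M; split=> //; [exact: mb_sub bD|exact: mb_sub bM|].
by apply: orth_sub o; exact: sb_mono.
Qed.

Lemma mb_embedding g g' : g <= g' -> exists2 C : R, 1 <= C & forall B G (xi : Om B -> ambient H) c,
  complete_sigma (sb_prob B) G -> mbh B g' G xi c -> mbh B g G xi (C * c).
Proof.
move=> gg; have [C C1 hC] := embedding_bound H gg; exists C => // B G xi c cG b.
by apply: (mb_op m1 (hH g) (hH g') cG (T := id) _ hC _ b) => //; exact: le_trans C1.
Qed.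

Lemma orth_embedding B g g' s (xi : Om B -> ambient H) c : g <= g' -> 0 <= s -> s <= T B ->
  mbh B g' measurable xi c -> orthh B g' (F s) xi -> orthh B g (F s) xi.
Proof.
move=> gg s0 sT b o; have [C C1 hC] := embedding_bound H gg.
have [c' b1] := mb_L1 (hH g') m2 (sb_meas B) b.
apply: (@orth_op _ _ _ _ _ _ _ _ _ _ (hH g') _ _ _ _ (hH g) (idfun : {linear ambient H -> ambient H}) C _ _ _ (sb_complete s0 sT) _ hC b1 o).
exact: le_trans C1.
Qed.

Lemma decomp_mb g gD gM : g <= gD -> g <= gM -> exists2 C : R, 1 <= C &
  forall B s u E rD rM, 0 <= u -> u <= T B ->
  @decomp B gD gM s u E rD rM -> mbh B g (F u) E (C * (rD + rM)).
Proof.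
move=> hD hM; have [C1 C11 h1] := mb_embedding hD; have [C2 C21 h2] := mb_embedding hM.
exists (C1 + C2); first by rewrite -[1]addr0 lerD// (le_trans _ C21).
move=> B s u E rD rM u0 uT [D [M [e bD bM o]]]; have cu := sb_complete u0 uT.
have := mb_add m1 (hH g) cu (h1 _ _ _ _ cu bD) (h2 _ _ _ _ cu bM).
move=> /(mb_ae m1 (hH g) cu e); apply: mb_le.
have := mb_ge0 bD; have := mb_ge0 bM; nra.
Qed.

Lemma decomp_map B gD gM gD' gM' u t cD cM : u <= t -> t <= T B -> 0 <= u -> 0 <= cD -> 0 <= cM ->
  (forall v, (hn gD v < +oo)%E -> (hn gD' (prop u t v) <= cD%:E * hn gD v)%E) ->
  (forall v, (hn gM v < +oo)%E -> (hn gM' (prop u t v) <= cM%:E * hn gM v)%E) ->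
  forall s E rD rM, 0 <= s -> s <= u -> @decomp B gD gM s u E rD rM ->
  @decomp B gD' gM' s u (fun w => prop u t (E w)) (cD * rD) (cM * rM).
Proof.
move=> ut tT u0 cD0 cM0 hD hM s E rD rM s0 su [D [M [e bD bM o]]].
have uT := le_trans ut tT; have cu := sb_complete u0 uT.
have cs := sb_complete s0 (le_trans su uT).
exists (fun w => prop u t (D w)), (fun w => prop u t (M w)); split.
- by apply: ae1 e _ => w ->; rewrite linearD.
- by apply: (mb_op m1 (hH gD') (hH gD) cu _ hD cD0 bD) => v v'; exact: linearB.
- by apply: (mb_op m1 (hH gM') (hH gM) cu _ hM cM0 bM) => v v'; exact: linearB.
have [c bM1] := mb_L1 (hH gM) m2 (sb_meas B) (mb_sub (complete_sigma_meas cu) bM).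
exact: (orth_op (hH gM) (hH gM') cs cM0 hM bM1 o).
Qed.

(** Drifts and martingale parts are Cauchy in different spaces, so they are summed separately.
    Orthogonality to F_s passes to the limit, hence the remainders of the series are decomposed as
    well. *)
Lemma decomp_series B gD gM s t (E : nat -> Om B -> ambient H) cD cM q :
  0 <= s -> s <= t -> t <= T B -> 0 <= q -> q < 1 -> 0 <= cD -> 0 <= cM ->
  (forall n, @decomp B gD gM s t (E n) (cD * q ^+ n) (cM * q ^+ n)) ->
  exists x, forall n, @decomp B gD gM s t (fun w => x w - \sum_(i < n) E i w)
     (cD * q ^+ n / (1 - q)) (cM * q ^+ n / (1 - q)).
Proof.
move=> s0 st tT q0 q1 cD0 cM0 hE; have ct := sb_complete (le_trans s0 st) tT.
have cs := sb_complete s0 (le_trans st tT).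
have [D hD] := choice hE; have {hE hD}[M hDM] := choice hD.
have p : 0 < 1 - q by rewrite subr_gt0.
have small c : 0 <= c -> forall eps : R, 0 < eps ->
    exists n0, forall n, (n0 <= n)%N -> c * q ^+ n / (1 - q) < eps.
  move=> c0 eps e0; have [n0 h] := geometric_small (divr_ge0 c0 (ltW p)) q0 q1 e0.
  by exists n0 => n nn; rewrite mulrAC; exact: h.
have part g (X : nat -> Om B -> ambient H) c : 0 <= c ->
    (forall n, mbh B g (F t) (X n) (c * q ^+ n)) ->
    exists2 y, random_var (sb_prob B) hn g (F t) y &
      forall n, mbh B g (F t) (fun w => y w - \sum_(i < n) X i w) (c * q ^+ n / (1 - q)).
  move=> c0 bX.
  apply: (mb_complete m1 (hH g) ct (x := fun n w => \sum_(i < n) X i w) (small _ c0)).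
    by move=> n; have := mb_sum m1 (hH g) ct (fun i (_ : (i < n)%N) => bX i) => /mb_rv.
  move=> n k /subnKC <-; apply: mb_le (geometric_sum_le n (k - n) c0 q0 q1) _.
  have := mb_sum m1 (hH g) ct (fun i (_ : (i < k - n)%N) => bX (n + i)%N).
  apply: (mb_ae m1 (hH g) ct); apply: aeW => w.
  by rewrite big_split_ord/= addrAC subrr add0r.
have [y ry hy] := part gD D cD cD0 (fun n => let: And4 _ b _ _ := hDM n in b).
have [z rz hz] := part gM M cM cM0 (fun n => let: And4 _ _ b _ := hDM n in b).
have oM n : orthh B gM (F s) (M n) by case: (hDM n).
have bM n : mbh B gM (F t) (M n) (cM * q ^+ n) by case: (hDM n).
have bz : mbh B gM (F t) z (cM * q ^+ 0 / (1 - q)).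
  have := hz 0%N; apply: (mb_ae m1 (hH gM) ct); apply: aeW => w.
  by rewrite big_ord0 subr0.
have up x c : mbh B gM (F t) x c -> mbh B gM measurable x c.
  by apply: mb_sub; exact: (complete_sigma_meas ct).
have os n : orthh B gM (F s) (fun w => \sum_(i < n) M i w).
  by apply: (orth_sum (r := fun n => cM * q ^+ n) s0 st tT).
have oz : orthh B gM (F s) z.
  apply: (orth_lim cs (small _ cM0) (x := fun n w => \sum_(i < n) M i w)) => //.
  - by exists (cM * q ^+ 0 / (1 - q)); exact: up.
  - by move=> n; exact: up.
exists (fun w => y w + z w) => n.
exists (fun w => y w - \sum_(i < n) D i w), (fun w => z w - \sum_(i < n) M i w); split=> //.
- have ea : {ae sb_prob B, forall w, forall n, E n w = D n w + M n w}.
    by apply: ae_foralln => i; case: (hDM i).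
  apply: ae1 ea _ => w ew; under eq_bigr do rewrite ew.
  by rewrite big_split/= opprD addrACA.
have bs := mb_sum m1 (hH gM) ct (fun i (_ : (i < n)%N) => bM i).
exact: (orthB (hH gM) m2 cs (up _ _ bz) (up _ _ bs) oz (os n)).
Qed.

End Decomposition.

(** One factor of each length is kept for the telescoping sum, the other rho - 1 are bounded by the
    mesh. *)
Lemma power_sum_le (R : realType) (c : nat -> R) n (h rho : R) : 1 <= rho ->
  (forall i, (i < n)%N -> c i <= c i.+1) -> (forall i, (i < n)%N -> c i.+1 - c i <= h) ->
  \sum_(i < n) (c i.+1 - c i) `^ rho <= h `^ (rho - 1) * (c n - c 0%N).
Proof.
move=> r1; elim: n => [|n IH] cm ch; first by rewrite big_ord0 subrr mulr0.
rewrite big_ord_recr/=; have -> : c n.+1 - c 0%N = (c n - c 0%N) + (c n.+1 - c n) by ring.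
rewrite mulrDr lerD// ?IH// => [i ni|i ni|]; [exact/cm/leqW|exact/ch/leqW|].
have l0 : 0 <= c n.+1 - c n by rewrite subr_ge0 cm.
rewrite -(@mulr_powRB1 _ (_ - _) rho)//; last exact: lt_le_trans r1.
rewrite mulrC; apply: ler_wpM2r => //; apply: powR_le => //; rewrite ?subr_ge0//.
exact: ch.
Qed.

Section Sewing.
Variables (R : realType) (H : monotone_family R) (T0 : R) (S : propagator H T0).
Variable m : R.
Hypothesis m2 : 2 <= m.
Let m1 : 1 <= m. Proof. by apply: le_trans m2; rewrite ler1n. Qed.
Local Notation hn := (@hnorm R H).
Local Notation basis := (stochastic_basis T0).
Local Notation Om B := (sb_space B).
Local Notation F := (@sb_filt R T0 _).
Local Notation hip := (@hip R H).
Local Notation hH := (hnorm_hilb H).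
Local Notation prop := (prop S).
Implicit Types (B : basis).
Local Notation mbh B g G xi c := (mb (sb_prob B) m hn g G xi c).
Local Notation orthh B g G xi := (orth (sb_prob B) hn g (hip g) G xi).
Local Notation T B := (horizon B).
Local Notation decomp := (decomp m).

Variables (g0 g1 k p : R).
Hypothesis g01 : g0 <= g1.
Hypothesis k1 : 1 < k.
Hypothesis p2 : 1 < 2 * p.

(** The martingale parts are increments for the filtration at the points c_i: the i-th one is
    measurable at c_(i+1) and orthogonal to F at c_i, and the deterministic propagators preserve
    both facts. Their squares have order 2 p > 1, which gives a positive power of the mesh. The free
    point v_i in each cell is where a partition is refined, or the right end of the cell. *)
Lemma decomp_sum : exists2 C : R, 1 <= C & forall B (Q h t : R) n (c v : nat -> R)
    (E : nat -> Om B -> ambient H),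
  0 <= Q -> 0 <= c 0%N -> c n <= t -> t <= T B ->
  (forall i, (i < n)%N -> c i <= v i <= c i.+1) ->
  (forall i, (i < n)%N -> c i.+1 - c i <= h) ->
  (forall i, (i < n)%N -> decomp g0 g1 (c i) (v i) (E i)
     (Q * (c i.+1 - c i) `^ k) (Q * (c i.+1 - c i) `^ p)) ->
  decomp g0 g1 (c 0%N) t (fun w => \sum_(i < n) prop (v i) t (E i w))
    (C * Q * (h `^ (k - 1) * (c n - c 0%N)))
    (C * Q * Num.sqrt (h `^ (2 * p - 1) * (c n - c 0%N))).
Proof.
have [kappa ka bdg] := martingale_bound m2.
have [C0 C01 hC0] := prop_bound S g0; have [C1 C11 hC1] := prop_bound S g1.
have k0 : 0 < kappa by exact: lt_le_trans ka.
have C00 : 0 <= C0 by exact: le_trans C01.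
have C10 : 0 <= C1 by exact: le_trans C11.
have sk : 1 <= Num.sqrt kappa by rewrite -sqrtr1; exact: ler_wsqrtr.
pose C := C0 + Num.sqrt kappa * C1.
have CC0 : C0 <= C by rewrite lerDl mulr_ge0// sqrtr_ge0.
have CC1 : Num.sqrt kappa * C1 <= C by rewrite lerDr.
exists C; first exact: le_trans CC0.
move=> B Q h t n c v E Q0 c0 cnt tT cv ch hE.
have t0T : t <= T0 by exact: le_trans tT (horizon_le B).
have cS i : (i < n)%N -> c i <= c i.+1 by move=> ni; have /andP[/le_trans] := cv i ni; apply.
have cm i j : (i <= j)%N -> (j <= n)%N -> c i <= c j.
  move/subnKC <-; elim: (j - i)%N => [|l IH]; rewrite ?addn0// addnS => ln.
  by apply: le_trans (IH (ltnW ln)) (cS _ ln).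
have cp i : (i <= n)%N -> 0 <= c i by move=> ni; apply: le_trans c0 (cm _ _ _ ni).
have cT i : (i <= n)%N -> c i <= t by move=> ni; apply: le_trans (cm _ _ ni (leqnn _)) cnt.
have hc i : (i <= n)%N -> complete_sigma (sb_prob B) (F (c i)).
  by move=> ni; apply: sb_complete; [exact: cp|exact: le_trans (cT _ ni) tT].
pose l i := c i.+1 - c i.
have l0 i : (i < n)%N -> 0 <= l i by move=> ni; rewrite subr_ge0 cS.
have hE' i : exists DM, (i < n)%N -> let: (D, M) := DM in
  [/\ aeeq (sb_prob B) (fun w => prop (v i) t (E i w)) (fun w => D w + M w),
      mbh B g0 (F (c i.+1)) D (C0 * (Q * l i `^ k)),
      mbh B g1 (F (c i.+1)) M (C1 * (Q * l i `^ p)) & orthh B g1 (F (c i)) M].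
  have [ni|ni] := ltnP i n; last by exists ((fun=> 0), (fun=> 0)).
  have /andP[v1 v2] := cv i ni.
  have vt := le_trans v2 (cT _ ni); have v0 := le_trans (cp i (ltnW ni)) v1.
  have [D [M [e bD bM o]]] := decomp_map m2 vt tT v0 C00 C10
    (fun x => hC0 _ _ x v0 vt t0T) (fun x => hC1 _ _ x v0 vt t0T) (cp i (ltnW ni)) v1 (hE i ni).
  have Fv : @sb_filt R T0 B (v i) `<=` sb_filt (c i.+1).
    by apply: sb_mono => //; exact: le_trans (cT _ ni) tT.
  by exists (D, M) => _; split=> //; exact: mb_sub Fv _.
have [DM hDM] := choice hE'.
have h0 : (0 < n)%N -> 0 <= h by move=> n0; apply: le_trans (l0 _ n0) (ch _ n0).
have ct := sb_complete (le_trans (cp n (leqnn _)) cnt) tT.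
have Ft i : (i <= n)%N -> @sb_filt R T0 B (c i) `<=` sb_filt t by move=> ni; apply: sb_mono (cp _ ni) (cT _ ni) tT.
exists (fun w => \sum_(i < n) (DM i).1 w), (fun w => \sum_(i < n) (DM i).2 w); split.
- have ea : {ae sb_prob B, forall w, forall i, (i < n)%N ->
      prop (v i) t (E i w) = (DM i).1 w + (DM i).2 w}.
    apply: ae_foralln => i; have [ni|ni] := ltnP i n; last by apply: aeW.
    by have := hDM i ni; case: (DM i) => D M [e _ _ _]; apply: ae1 e _ => w ->.
  apply: ae1 ea _ => w ew; rewrite -big_split/=; apply: eq_bigr => i _; exact: ew.
- have bD i : (i < n)%N -> mbh B g0 (F t) ((DM i).1) (C0 * (Q * l i `^ k)).
    move=> ni; have := hDM i ni; case: (DM i) => D M [_ bD _ _].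
    by apply: mb_sub bD; exact: Ft.
  apply: mb_le (mb_sum m1 (hH g0) ct bD).
  rewrite -mulr_sumr -mulr_sumr mulrA; apply: ler_pM.
  + by rewrite mulr_ge0.
  + by apply: sumr_ge0 => i _; exact: powR_ge0.
  + exact: ler_wpM2r.
  by apply: power_sum_le => //; exact: ltW.
- have bM i : (i < n)%N -> mbh B g1 (F (c i.+1)) ((DM i).2) (C1 * (Q * l i `^ p)).
    by move=> ni; have := hDM i ni; case: (DM i) => D M [].
  have oM i : (i < n)%N -> orthh B g1 (F (c i)) ((DM i).2).
    by move=> ni; have := hDM i ni; case: (DM i) => D M [].
  apply: mb_sub (Ft n (leqnn _)) _.
  apply: (bdg _ _ _ _ _ _ _ (hH g1) n (fun i => F (c i)) (fun i => (DM i).2) (fun i => C1 * (Q * l i `^ p))) => //.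
  + move=> i j ij jn; apply: sb_mono (cp _ (leq_trans ij jn)) (cm _ _ ij jn) (le_trans (cT _ jn) tT).
  + by rewrite !mulr_ge0 ?sqrtr_ge0// (le_trans C00).
  have sp : \sum_(i < n) (l i) `^ (2 * p) <= h `^ (2 * p - 1) * (c n - c 0%N).
    by apply: power_sum_le => //; exact: ltW.
  have hs0 : 0 <= h `^ (2 * p - 1) * (c n - c 0%N).
    by rewrite mulr_ge0 ?powR_ge0// subr_ge0 cm.
  have -> : \sum_(i < n) (C1 * (Q * l i `^ p)) ^+ 2 = (C1 * Q) ^+ 2 * \sum_(i < n) (l i) `^ (2 * p).
    rewrite mulr_sumr; apply: eq_bigr => i _.
    by rewrite mulrA exprMn -[(l i `^ p) ^+ 2]powR_mulrn ?powR_ge0// -powRrM [p * _]mulrC.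
  rewrite mulrA [leRHS]exprMn sqr_sqrtr//; apply: ler_pM => //.
  + by rewrite mulr_ge0 ?sqr_ge0// ltW.
  + by apply: sumr_ge0 => i _; exact: powR_ge0.
  rewrite -[X in X * _](sqr_sqrtr (ltW k0)) -exprMn mulrA ler_sqr ?nnegrE.
  + exact: ler_wpM2r.
  + by rewrite !mulr_ge0// sqrtr_ge0.
  by rewrite mulr_ge0// (le_trans C00).
apply: (@orth_sum _ _ _ _ m2 B g1 (c 0%N) t n (fun i => (DM i).2) (fun i => C1 * (Q * l i `^ p)) c0 (le_trans (cm _ _ (leq0n _) (leqnn _)) cnt) tT).
  move=> i ni; have := hDM i ni; case: (DM i) => D M [_ _ bM _].
  by apply: mb_sub bM; exact: Ft.
move=> i ni; have := hDM i ni; case: (DM i) => D M [_ _ _ o]; apply: orth_sub o.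
by apply: sb_mono c0 (cm _ _ (leq0n _) (ltnW ni)) _; exact: le_trans (cT _ (ltnW ni)) tT.
Qed.


(** Partitions of [s, t] are cut out of one dyadic grid of the horizon by this projection. The grids
    of adjacent intervals then fit together, at the price of degenerate cells, on which the germ
    vanishes. *)
Definition clamp (s t x : R) : R := Num.min t (Num.max s x).

Lemma clamp_ge s t x : s <= t -> s <= clamp s t x.
Proof. by move=> st; rewrite le_min st le_max lexx. Qed.

Lemma clamp_le s t x : clamp s t x <= t.
Proof. by rewrite ge_min lexx. Qed.

Lemma clamp_mono s t x y : x <= y -> clamp s t x <= clamp s t y.
Proof.
move=> xy; rewrite le_min ge_min lexx/= ge_min; apply/orP; right.
by rewrite ge_max !le_max lexx xy orbT.
Qed.

Lemma clamp_lip s t x y : x <= y -> clamp s t y - clamp s t x <= y - x.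
Proof.
move=> xy; rewrite lerBlDr /clamp addr_minr le_min; apply/andP; split; rewrite ge_min; apply/orP.
  by left; rewrite lerDr subr_ge0.
right; rewrite ge_max addr_maxr !le_max; apply/andP; split; apply/orP.
  by left; rewrite lerDr subr_ge0.
by right; rewrite subrK.
Qed.

Lemma clamp_low s t x : s <= t -> x <= s -> clamp s t x = s.
Proof. by move=> st xs; rewrite /clamp; rewrite (max_idPl xs); apply/min_idPr. Qed.

Lemma clamp_high s t x : t <= x -> clamp s t x = t.
Proof. by move=> tx; apply/min_idPl; rewrite le_max tx orbT. Qed.

Lemma sum_pairs (V : zmodType) (f : nat -> V) n :
  \sum_(j < n.*2) f j = \sum_(i < n) (f i.*2 + f i.*2.+1).
Proof.
elim: n => [|n IH]; first by rewrite !big_ord0.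
by rewrite doubleS 2!big_ord_recr/= IH big_ord_recr/= addrA.
Qed.

(** For a grid coarser than [s, t], where the clamped points equal [s] up to the index [j] and [t]
    after it. *)
Lemma sum_two_cells (V : zmodType) (f : R -> R -> V) (c : nat -> R) (s t : R) j n :
  f s s = 0 -> f t t = 0 -> c 0%N = s -> (forall i, (i < j)%N -> c i = s) ->
  (forall i, (j < i)%N -> c i = t) -> (j <= n)%N -> c n = t ->
  \sum_(i < n) f (c i) (c i.+1) = f s (c j) + f (c j) t.
Proof.
move=> fs ft c0 cs ct jn cn.
have h M : \sum_(i < M) f (c i) (c i.+1) =
    if (M <= j)%N then f s (c M) else f s (c j) + f (c j) (c M).
  elim: M => [|M IH]; first by rewrite big_ord0 leq0n c0 fs.
  rewrite big_ord_recr/= IH; have [Mj|jM|Mj] := ltngtP M j.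
  - by rewrite cs// fs add0r.
  - by rewrite (ct _ jM) (ct _ (leqW jM)) ft addr0.
  - by rewrite Mj.
rewrite h cn; case: leqP => // nj.
have -> : j = n by apply/eqP; rewrite eqn_leq jn nj.
by rewrite cn ft addr0.
Qed.

(** The defect of additivity is taken at the intermediate time [u], before the propagator from [u]
    to [t] acts, so that the smoothing of the latter remains available. *)
Record germ_bounds B (A : R -> R -> Om B -> ambient H) (Q : R) : Prop := GermBounds {
  germ_diag : forall t w, 0 <= t -> t <= T B -> A t t w = 0 ;
  germ_bracket : forall s u t, 0 <= s -> s <= u -> u <= t -> t <= T B ->
    decomp g0 g1 s u (fun w => prop s u (A s t w - A s u w) - A u t w)
      (Q * (t - s) `^ k) (Q * (t - s) `^ p)
}.

Definition grid_mesh B n : R := T B / 2 ^+ n.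
Definition grid B s t n i : R := clamp s t (i%:R * grid_mesh B n).

Definition dyadic_sum B (A : R -> R -> Om B -> ambient H) s t n w : ambient H :=
  \sum_(i < 2 ^ n) prop (grid B s t n i) t (A (grid B s t n i) (grid B s t n i.+1) w).

Lemma mesh_gt0 B n : 0 < grid_mesh B n.
Proof. by rewrite divr_gt0 ?exprn_gt0// horizon_gt0. Qed.

Lemma grid_step B s t n i : 0 <= grid B s t n i.+1 - grid B s t n i <= grid_mesh B n.
Proof.
have m0 := ltW (mesh_gt0 B n).
have ii : i%:R * grid_mesh B n <= i.+1%:R * grid_mesh B n by rewrite ler_wpM2r// ler_nat.
rewrite subr_ge0 clamp_mono//=; apply: le_trans (clamp_lip _ _ ii) _.
by rewrite -mulrBl -natrB// subSnn mul1r.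
Qed.

Lemma grid0 B s t n : 0 <= s -> s <= t -> grid B s t n 0 = s.
Proof. by move=> s0 st; rewrite /grid mul0r clamp_low. Qed.

Lemma grid_end B s t n : t <= T B -> grid B s t n (2 ^ n) = t.
Proof.
move=> tT; rewrite /grid clamp_high// /grid_mesh natrX mulrCA mulfV ?mulr1//.
Qed.

Lemma grid_refine B s t n i : grid B s t n i = grid B s t n.+1 i.*2.
Proof.
rewrite /grid /grid_mesh; congr clamp.
by rewrite exprS -muln2 natrM; field; rewrite expf_neq0 ?pnatr_eq0.
Qed.

Lemma grid_in B s t n i : 0 <= s -> s <= t -> 0 <= grid B s t n i /\ grid B s t n i <= t.
Proof. by move=> s0 st; split; [exact: le_trans s0 (clamp_ge _ st)|exact: clamp_le]. Qed.

Lemma bracket_map B (A : R -> R -> Om B -> ambient H) r v u t w : 0 <= r -> r <= v -> v <= t -> t <= T B ->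
  prop v t (prop r v (A r u w - A r v w) - A v u w) =
  prop r t (A r u w) - prop r t (A r v w) - prop v t (A v u w).
Proof.
move=> r0 rv vt tT; by rewrite !linearB/= !(prop_comp S r0 rv vt (le_trans tT (horizon_le B))).
Qed.

(** Passing from level n to n + 1 inserts one point in each cell, and changes the sum by minus the
    defects at these points. *)
Lemma dyadic_refine : exists2 C : R, 1 <= C &
  forall B (A : R -> R -> Om B -> ambient H) Q, @germ_bounds B A Q -> 0 <= Q ->
  forall s t n, 0 <= s -> s <= t -> t <= T B ->
  decomp g0 g1 s t (fun w => @dyadic_sum B A s t n.+1 w - @dyadic_sum B A s t n w)
    (C * Q * (grid_mesh B n `^ (k - 1) * (t - s)))
    (C * Q * Num.sqrt (grid_mesh B n `^ (2 * p - 1) * (t - s))).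
Proof.
have [C C1 hC] := decomp_sum; exists C => // B A Q gA Q0 s t n s0 st tT.
have st0 := le_trans s0 st.
have gr i : grid B s t n i <= grid B s t n.+1 i.*2.+1 <= grid B s t n i.+1.
  rewrite (grid_refine B s t n i) (grid_refine B s t n i.+1) doubleS -subr_ge0 -[X in _ && X]subr_ge0.
  by have /andP[-> _] := grid_step B s t n.+1 i.*2; have /andP[-> _] := grid_step B s t n.+1 i.*2.+1.
have := hC B Q (grid_mesh B n) t (2 ^ n)%N (grid B s t n) (fun i => grid B s t n.+1 i.*2.+1)
  (fun i w => prop (grid B s t n i) (grid B s t n.+1 i.*2.+1)
      (A (grid B s t n i) (grid B s t n i.+1) w - A (grid B s t n i) (grid B s t n.+1 i.*2.+1) w) -
      A (grid B s t n.+1 i.*2.+1) (grid B s t n i.+1) w) Q0.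
rewrite grid0// grid_end// => /(_ s0 (lexx t) tT) h.
have {}h := h (fun i _ => gr i) (fun i _ => let: conj _ b := andP (grid_step B s t n i) in b).
have {}h : decomp g0 g1 s t _ _ _ := h (fun i _ => germ_bracket gA (proj1 (grid_in B n i s0 st))
  (proj1 (andP (gr i))) (proj2 (andP (gr i))) (le_trans (proj2 (grid_in B n i.+1 s0 st)) tT)).
apply: decomp_ae (decomp_opp m2 s0 st tT h); apply: aeW => w.
rewrite /dyadic_sum expnS mul2n (sum_pairs (fun i => prop (grid B s t n.+1 i) t (A (grid B s t n.+1 i) (grid B s t n.+1 i.+1) w))).
rewrite -sumrB -sumrN; apply: eq_bigr => i _.
have [gi0 git] := grid_in B n i s0 st; have /andP[gr1 gr2] := gr i.
rewrite bracket_map//; last exact: le_trans gr2 (grid_in B n i.+1 s0 st).2.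
by rewrite -doubleS -!(grid_refine B s t n) !opprB [RHS]addrCA addrA.
Qed.

(** For additivity in the limit: the sums differ by the defects at [u], and their bound tends to 0
    with the mesh. *)
Lemma dyadic_concat : exists2 C : R, 1 <= C &
  forall B (A : R -> R -> Om B -> ambient H) Q, @germ_bounds B A Q -> 0 <= Q ->
  forall s u t n, 0 <= s -> s <= u -> u <= t -> t <= T B ->
  decomp g0 g1 s t (fun w => @dyadic_sum B A s t n w -
      prop u t (@dyadic_sum B A s u n w) - @dyadic_sum B A u t n w)
    (C * Q * (grid_mesh B n `^ (k - 1) * (t - s)))
    (C * Q * Num.sqrt (grid_mesh B n `^ (2 * p - 1) * (t - s))).
Proof.
have [C C1 hC] := decomp_sum; exists C => // B A Q gA Q0 s u t n s0 su ut tT.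
have st := le_trans su ut; have u0 := le_trans s0 su.
(* Only the cell containing [u] is really cut. Cutting the other cells at an end point, where the
   defect is 0, lets [decomp_sum] treat all cells alike. *)
pose c := grid B s t n; pose v i := clamp (c i) (c i.+1) u.
have cc i : c i <= c i.+1 by have /andP[] := grid_step B s t n i; rewrite subr_ge0.
have cv i : c i <= v i <= c i.+1 by rewrite clamp_ge ?clamp_le.
have := hC B Q (grid_mesh B n) t (2 ^ n)%N c v
  (fun i w => prop (c i) (v i) (A (c i) (c i.+1) w - A (c i) (v i) w) - A (v i) (c i.+1) w) Q0.
rewrite /c grid0// grid_end// -/c => /(_ s0 (lexx t) tT) h.
have {}h := h (fun i _ => cv i) (fun i _ => let: conj _ b := andP (grid_step B s t n i) in b).
have {}h : decomp g0 g1 s t _ _ _ := h (fun i _ => germ_bracket gA (proj1 (grid_in B n i s0 st))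
  (proj1 (andP (cv i))) (proj2 (andP (cv i))) (le_trans (proj2 (grid_in B n i.+1 s0 st)) tT)).
apply: decomp_ae h; apply: aeW => w.
rewrite /dyadic_sum linear_sum/= -!sumrB; apply: eq_bigr => i _.
have [ci0 cit] := grid_in B n i s0 st; have [ci0' cit'] := grid_in B n i.+1 s0 st.
rewrite -/(c i) in ci0 cit; rewrite -/(c i.+1) in ci0' cit'.
have /andP[cv1 cv2] := cv i.
rewrite (bracket_map _ _ _ ci0 cv1 (le_trans cv2 cit') tT).
have TT0 := le_trans tT (horizon_le B).
have gu j : grid B s u n j = Num.min u (c j).
  by rewrite /c /grid /clamp minA (min_idPl ut).
have gut j : grid B u t n j = Num.max u (c j).
  rewrite /c /grid; set x := _ * _; have [xu|ux] := leP x u.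
    rewrite (clamp_low ut xu); apply/esym/max_idPl.
    by apply: le_trans (clamp_mono _ _ xu) _; rewrite /clamp (max_idPr su) ge_min lexx orbT.
  have sx : s <= x by exact: le_trans su (ltW ux).
  rewrite /clamp (max_idPr (ltW ux)) (max_idPr sx); apply/esym/max_idPr.
  by rewrite le_min ut ltW.
have dg x : 0 <= x -> x <= t -> A x x w = 0 by move=> x0 xt; apply: (germ_diag gA) => //; exact: (le_trans xt tT).
have du := dg u u0 ut; have d1 := dg _ ci0 cit; have d2 := dg _ ci0' cit'.
rewrite !gu !gut -/(c i) -/(c i.+1) /v.
have [hi|hi] := leP (c i.+1) u.
  have lo := le_trans (cc i) hi.
  rewrite (min_idPr lo) (max_idPl lo) (clamp_high _ hi) du d2 !linear0 !addr0.
  by rewrite (prop_comp S ci0 lo ut TT0).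
have [lo|lo] := leP u (c i).
  by rewrite (clamp_low (cc i) lo) du d1 !linear0 !addr0.
rewrite /clamp (max_idPr (ltW lo)) (min_idPr (ltW hi)).
by rewrite (prop_comp S ci0 (ltW lo) ut TT0).
Qed.

Lemma dyadic_scale B l : 0 < l -> l <= T B -> exists n, l <= grid_mesh B n /\ grid_mesh B n <= 2 * l.
Proof.
move=> l0 lT; have ex : exists n, grid_mesh B n.+1 < l.
  have [] := @geometric_small R (T B) 2^-1 l (ltW (horizon_gt0 B)) _ _ l0.
  - by rewrite invr_ge0.
  - by rewrite invf_lt1// ltr1n.
  by move=> n hn; exists n; have := hn n.+1 (leqnSn n); rewrite exprVn.
have [n hn hm] := ex_minnP ex; exists n; split; last first.
  by move: hn; rewrite /grid_mesh exprS invfM mulrCA; lra.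
case: n hn hm => [|n] hn hm; first by rewrite /grid_mesh expr0 divr1.
by rewrite leNgt; apply/negP => /hm; rewrite ltnn.
Qed.

Lemma grid_mesh_add B n j : grid_mesh B (n + j) = grid_mesh B n * (2^-1) ^+ j.
Proof. by rewrite /grid_mesh exprD invfM mulrA exprVn. Qed.

(** When the mesh is at least t - s, the clamped grid has at most one point inside the interval, and
    a single defect separates the dyadic sum from the germ. *)
Lemma dyadic_start : exists2 C : R, 1 <= C &
  forall B (A : R -> R -> Om B -> ambient H) Q, @germ_bounds B A Q -> 0 <= Q ->
  forall s t n, 0 <= s -> s <= t -> t <= T B -> t - s <= grid_mesh B n ->
  decomp g0 g1 s t (fun w => @dyadic_sum B A s t n w - prop s t (A s t w))
    (C * Q * (t - s) `^ k) (C * Q * (t - s) `^ p).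
Proof.
have [C0 C01 hC0] := prop_bound S g0; have [C1 C11 hC1] := prop_bound S g1.
have C00 : 0 <= C0 by exact: le_trans C01.
have C10 : 0 <= C1 by exact: le_trans C11.
exists (C0 + C1); first by rewrite -[1]addr0 lerD.
move=> B A Q gA Q0 s t n s0 st tT hst; have TT0 := le_trans tT (horizon_le B).
have t0 := le_trans s0 st.
have ex : exists j, s <= j%:R * grid_mesh B n.
  exists (2 ^ n)%N; rewrite /grid_mesh natrX mulrCA mulfV ?mulr1 ?expf_neq0 ?pnatr_eq0//.
  exact: le_trans tT.
(* The first grid point not before [s]: the earlier ones are clamped to [s], and the next one is
   already beyond [t]. *)
have [j hj jm] := ex_minnP ex.
have jn : (j <= 2 ^ n)%N.
  apply: jm; rewrite /grid_mesh natrX mulrCA mulfV ?mulr1 ?expf_neq0 ?pnatr_eq0//.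
  exact: le_trans tT.
pose u := grid B s t n j; have [u0 ut] := grid_in B n j s0 st.
have su : s <= u by exact: clamp_ge.
have Q1 : 0 <= Q * (t - s) `^ k by rewrite mulr_ge0 ?powR_ge0.
have Q2 : 0 <= Q * (t - s) `^ p by rewrite mulr_ge0 ?powR_ge0.
have := decomp_map m2 ut tT u0 C00 C10 (fun x => hC0 _ _ x u0 ut TT0) (fun x => hC1 _ _ x u0 ut TT0)
  s0 su (germ_bracket gA s0 su ut tT).
move=> /(decomp_widen s0 (lexx s) su ut tT)/(decomp_opp m2 s0 st tT)/(decomp_le (rD' := (C0 + C1) * Q * (t - s) `^ k) (rM' := (C0 + C1) * Q * (t - s) `^ p)) h.
apply: decomp_ae (h _ _); first 1 last.
- by rewrite -mulrA ler_wpM2r// lerDl.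
- by rewrite -mulrA ler_wpM2r// lerDr.
apply: aeW => w; rewrite bracket_map//.
rewrite /dyadic_sum (sum_two_cells (f := fun x y => prop x t (A x y w)) (c := grid B s t n) (s := s) (t := t) (j := j)).
- by rewrite -/u !opprB [RHS]addrCA addrA.
- by rewrite (germ_diag gA) ?linear0//; exact: (le_trans st tT).
- by rewrite (germ_diag gA) ?linear0.
- exact: grid0.
- move=> i ij; apply: clamp_low => //; rewrite leNgt; apply/negP => /ltW /jm.
  by rewrite leqNgt ij.
- move=> i ji; apply: clamp_high; apply: le_trans (_ : j.+1%:R * grid_mesh B n <= _).
    by rewrite -natr1 mulrDl mul1r; lra.
  by apply: ler_wpM2r; [exact/ltW/mesh_gt0|rewrite ler_nat].
- by [].
exact: grid_end.
Qed.

Lemma half_powR_lt1 (r : R) : 0 < r -> (2^-1 : R) `^ r < 1.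
Proof.
move=> r0; have : (2^-1 : R) `^ r < 1 `^ r; last by rewrite powR1.
by apply: gt0_ltr_powR; rewrite ?nnegrE ?invr_ge0// invf_lt1// ltr1n.
Qed.

Lemma additivity_error (V : zmodType) (a b c d e f : V) :
  a - (c + e) = a - b - (c - d) - (e - f) + (b - d - f).
Proof.
rewrite !opprB !opprD !addrA [RHS](ACl (1*4*6*(2*7)*(3*8)*(5*9))%AC)/=.
by rewrite addNr !subrr !addr0.
Qed.

Lemma mesh_small B (r c : R) : 0 < r -> 0 <= c -> forall eps : R, 0 < eps ->
  exists n0, forall n, (n0 <= n)%N -> c * grid_mesh B n `^ r < eps.
Proof.
move=> r0 c0 eps e0.
have q1 := half_powR_lt1 r0.
have [n0 h] := geometric_small (mulr_ge0 c0 (powR_ge0 (T B) r)) (powR_ge0 2^-1 r) q1 e0.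
have E n : c * grid_mesh B n `^ r = c * T B `^ r * (2^-1 `^ r) ^+ n.
  rewrite -mulrA; congr (c * _); rewrite /grid_mesh -exprVn powRM; last 2 first.
  - exact: ltW (horizon_gt0 B).
  - by rewrite exprn_ge0// invr_ge0.
  have -> : (2^-1 : R) ^+ n = 2^-1 `^ n%:R by rewrite powR_mulrn ?invr_ge0.
  by rewrite -powRrM [_ * r]mulrC powRrM powR_mulrn// powR_ge0.
by exists n0 => n nn; rewrite E; exact: h.
Qed.

(** The refinements are summed only from the level whose mesh is comparable with t - s. This turns
    powers of the mesh into powers of t - s and makes the bounds homogeneous. *)
Lemma sewing_point : exists2 C : R, 1 <= C &
  forall B (A : R -> R -> Om B -> ambient H) Q, @germ_bounds B A Q -> 0 <= Q ->
  forall s t, 0 <= s -> s <= t -> t <= T B ->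
  exists x, decomp g0 g1 s t (fun w => x w - prop s t (A s t w))
      (C * Q * (t - s) `^ k) (C * Q * (t - s) `^ p) /\
    forall eps : R, 0 < eps -> exists n1, forall n, (n1 <= n)%N ->
      mbh B g0 (F t) (fun w => x w - @dyadic_sum B A s t n w) eps.
Proof.
have [C1 C11 hC1] := dyadic_refine; have [C2 C21 hC2] := dyadic_start.
have [C3 C31 hC3] := @decomp_mb R H T0 m m2 _ _ _ (lexx g0) g01.
have C10 : 0 <= C1 by exact: le_trans C11.
have C20 : 0 <= C2 by exact: le_trans C21.
have C30 : 0 <= C3 by exact: le_trans C31.
(* A common geometric rate: each refinement gains 2^-(k-1) in the drift and 2^-(p-1/2) in the
   martingale part. *)
pose r := Num.min (k - 1) (p - 2^-1).
have r0 : 0 < r by rewrite lt_min subr_gt0 k1 subr_gt0; move: p2; lra.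
have r0' := ltW r0.
pose q := (2^-1 : R) `^ r.
have q0 : 0 <= q by exact: powR_ge0.
have q1 : q < 1 by exact: half_powR_lt1.
have pq : 0 < 1 - q by rewrite subr_gt0.
have k0 : 0 < k - 1 by rewrite subr_gt0.
have p0 : 0 < 2 * p - 1 by rewrite subr_gt0.
pose a1 := 2 `^ (k - 1); pose a2 := Num.sqrt (2 `^ (2 * p - 1)).
have a10 : 0 <= a1 by exact: powR_ge0.
have a20 : 0 <= a2 by exact: sqrtr_ge0.
pose C := C2 + C1 * a1 / (1 - q) + C1 * a2 / (1 - q).
have CC1 : 0 <= C1 * a1 / (1 - q) by rewrite !mulr_ge0// invr_ge0 ltW.
have CC2 : 0 <= C1 * a2 / (1 - q) by rewrite !mulr_ge0// invr_ge0 ltW.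
exists C; first by apply: le_trans C21 _; rewrite /C -addrA lerDl addr_ge0.
move=> B A Q gA Q0 s t s0 st tT.
have [ts|ts] := eqVneq s t.
  rewrite -{t}ts in st tT *; exists (fun=> 0); split.
    apply: (decomp_le _ _ (decomp_ae _ (decomp0 H m2 g0 g1 s0 st tT))).
    - by rewrite !mulr_ge0 ?powR_ge0// !addr_ge0.
    - by rewrite !mulr_ge0 ?powR_ge0// !addr_ge0.
    by apply: aeW => w; rewrite (germ_diag gA)// linear0 subr0.
  move=> eps e0; exists 0%N => n _; have cs := sb_complete s0 tT.
  apply: mb_le (ltW e0) _; apply: (mb_ae m1 (hH g0) cs _ (mb0 m1 (hH g0) cs)).
  apply: aeW => w; rewrite /dyadic_sum big1 ?subrr// => i _.
  have gs j : grid B s s n j = s by rewrite /grid /clamp; apply/min_idPl; rewrite le_max lexx.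
  by rewrite !gs (germ_diag gA)// linear0.
have {ts}l0 : 0 < t - s by rewrite subr_gt0 lt_def eq_sym ts.
have lT : t - s <= T B by apply: le_trans tT; rewrite gerBl.
have [n0 [h1 h2]] := dyadic_scale l0 lT.
set l := t - s in l0 lT h1 h2 *.
have l0' := ltW l0.
have half x j : r <= x -> ((2^-1 : R) ^+ j) `^ x <= q ^+ j.
  move=> rx; rewrite -powR_mulrn ?invr_ge0// -powRrM mulrC powRrM powR_mulrn ?powR_ge0//.
  apply: lerXn2r; rewrite ?nnegrE ?powR_ge0//.
  have half0 : 0 < 2^-1 :> R by rewrite invr_gt0.
  by apply: ger_powR => //; rewrite half0 invf_le1// ler1n.
have mj x j : 0 <= x -> grid_mesh B (n0 + j) `^ x <= (2 * l) `^ x * ((2^-1 : R) ^+ j) `^ x.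
  move=> x0; have hm := ltW (mesh_gt0 B n0).
  rewrite grid_mesh_add powRM ?exprn_ge0 ?invr_ge0//; apply: ler_wpM2r; first exact: powR_ge0.
  by apply: powR_le => //.
have bD j : C1 * Q * (grid_mesh B (n0 + j) `^ (k - 1) * l) <= C1 * Q * a1 * l `^ k * q ^+ j.
  rewrite -!mulrA; do 2 (apply: ler_wpM2l => //).
  apply: le_trans (_ : (2 * l) `^ (k - 1) * q ^+ j * l <= _).
    apply: ler_wpM2r => //; apply: le_trans (mj _ j (ltW k0)) _; apply: ler_wpM2l; first exact: powR_ge0.
    by apply: half; rewrite ge_min lexx.
  rewrite powRM// -/a1 -(@mulr_powRB1 _ l k)//; first by rewrite -!mulrA [l * _]mulrC -!mulrA.
  exact: lt_trans k1.
have bM j : C1 * Q * Num.sqrt (grid_mesh B (n0 + j) `^ (2 * p - 1) * l) <= C1 * Q * a2 * l `^ p * q ^+ j.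
  rewrite -!mulrA; do 2 (apply: ler_wpM2l => //).
  have -> : l `^ p = Num.sqrt (l `^ (2 * p - 1) * l).
    rewrite mulrC mulr_powRB1//; last by move: p0; lra.
    by rewrite [2 * p]mulrC powRrM powR_mulrn ?powR_ge0// sqrtr_sqr ger0_norm// powR_ge0.
  have -> : q ^+ j = Num.sqrt ((q ^+ j) ^+ 2) by rewrite sqrtr_sqr ger0_norm// exprn_ge0.
  rewrite -!sqrtrM ?mulr_ge0 ?powR_ge0//; apply: ler_wsqrtr.
  rewrite [leRHS](_ : _ = 2 `^ (2 * p - 1) * l `^ (2 * p - 1) * (q ^+ j) ^+ 2 * l); last by ring.
  apply: ler_wpM2r => //; apply: le_trans (mj _ j (ltW p0)) _; rewrite powRM//.
  apply: ler_wpM2l; first by rewrite mulr_ge0 ?powR_ge0.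
  have -> : 2 * p - 1 = (p - 2^-1) * 2 by field.
  rewrite powRrM powR_mulrn ?powR_ge0//; apply: lerXn2r; rewrite ?nnegrE ?powR_ge0 ?exprn_ge0//.
  by apply: half; rewrite ge_min lexx orbT.
have cD0 : 0 <= C1 * Q * a1 * l `^ k by rewrite !mulr_ge0 ?powR_ge0.
have cM0 : 0 <= C1 * Q * a2 * l `^ p by rewrite !mulr_ge0 ?powR_ge0.
have [x hx] := decomp_series m2 s0 st tT q0 q1 cD0 cM0
  (fun j => decomp_le (bD j) (bM j) (hC1 B A Q gA Q0 s t (n0 + j)%N s0 st tT)).
have tele j w : \sum_(i < j) (@dyadic_sum B A s t (n0 + i).+1 w - @dyadic_sum B A s t (n0 + i) w) =
    @dyadic_sum B A s t (n0 + j) w - @dyadic_sum B A s t n0 w.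
  elim: j => [|j IH]; first by rewrite big_ord0 addn0 subrr.
  by rewrite big_ord_recr/= IH addnS addrC addrA subrK.
have hx' j : decomp g0 g1 s t (fun w => x w + @dyadic_sum B A s t n0 w - @dyadic_sum B A s t (n0 + j) w)
    (C1 * Q * a1 * l `^ k * q ^+ j / (1 - q)) (C1 * Q * a2 * l `^ p * q ^+ j / (1 - q)).
  by apply: decomp_ae (hx j); apply: aeW => w; rewrite tele opprB addrA.
exists (fun w => x w + @dyadic_sum B A s t n0 w); split.
  apply: (decomp_le _ _ (decomp_ae _ (decomp_add m2 s0 st tT (hx' 0%N) (hC2 B A Q gA Q0 s t n0 s0 st tT h1)))).
  - rewrite expr0 mulr1 -/l.
    have -> : C1 * Q * a1 * l `^ k / (1 - q) + C2 * Q * l `^ k = (C2 + C1 * a1 / (1 - q)) * Q * l `^ k by ring.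
    by rewrite /C; do 2 (apply: ler_wpM2r; rewrite ?powR_ge0//); rewrite lerDl.
  - rewrite expr0 mulr1 -/l.
    have -> : C1 * Q * a2 * l `^ p / (1 - q) + C2 * Q * l `^ p = (C2 + C1 * a2 / (1 - q)) * Q * l `^ p by ring.
    by rewrite /C; do 2 (apply: ler_wpM2r; rewrite ?powR_ge0//); rewrite lerD2r lerDl.
  by apply: aeW => w; rewrite addn0 addrA subrK.
move=> eps e0.
have c30 : 0 <= C3 * (C1 * Q * a1 * l `^ k / (1 - q) + C1 * Q * a2 * l `^ p / (1 - q)).
  by apply: mulr_ge0 => //; apply: addr_ge0; apply: mulr_ge0 => //; rewrite invr_ge0 ltW.
have [n1 hn1] := geometric_small c30 q0 q1 e0.
exists (n0 + n1)%N => n nn; have := hC3 B s t _ _ _ (le_trans s0 st) tT (hx' (n - n0)%N).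
rewrite subnKC; last by rewrite (leq_trans _ nn)// leq_addr.
apply: mb_le; apply: le_trans (ltW (hn1 (n - n0)%N _)); last by rewrite leq_subRL ?(leq_trans _ nn)// leq_addr.
rewrite le_eqVlt; apply/orP; left; apply/eqP; ring.
Qed.

(** A limit is chosen for each pair (s, t) independently; additivity is then checked almost surely,
    by comparison with the dyadic sums of one fine level. *)
Lemma sewing : exists2 C : R, 1 <= C &
  forall B (A : R -> R -> Om B -> ambient H) Q, @germ_bounds B A Q -> 0 <= Q ->
  exists I : R -> R -> Om B -> ambient H,
    (forall s t, 0 <= s -> s <= t -> t <= T B ->
       decomp g0 g1 s t (fun w => I s t w - prop s t (A s t w))
         (C * Q * (t - s) `^ k) (C * Q * (t - s) `^ p)) /\
    (forall s u t, 0 <= s -> s <= u -> u <= t -> t <= T B ->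
       aeeq (sb_prob B) (I s t) (fun w => prop u t (I s u w) + I u t w)).
Proof.
have [C C1 hC] := sewing_point; have [C2 C21 hC2] := dyadic_concat.
have [C3 C31 hC3] := @decomp_mb R H T0 m m2 _ _ _ (lexx g0) g01.
have [C4 C41 hC4] := prop_bound S g0.
exists C => // B A Q gA Q0.
have ex (st : R * R) : exists x, 0 <= st.1 -> st.1 <= st.2 -> st.2 <= T B ->
    decomp g0 g1 st.1 st.2 (fun w => x w - prop st.1 st.2 (A st.1 st.2 w))
      (C * Q * (st.2 - st.1) `^ k) (C * Q * (st.2 - st.1) `^ p) /\
    forall eps : R, 0 < eps -> exists n1, forall n, (n1 <= n)%N ->
      mbh B g0 (F st.2) (fun w => x w - @dyadic_sum B A st.1 st.2 n w) eps.
  have [s0|] := boolP (0 <= st.1); last by exists (fun=> 0).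
  have [s1|] := boolP (st.1 <= st.2); last by exists (fun=> 0).
  have [s2|] := boolP (st.2 <= T B); last by exists (fun=> 0).
  by have [x hx] := hC B A Q gA Q0 _ _ s0 s1 s2; exists x.
have [I hI] := choice ex; exists (fun s t => I (s, t)); split.
  by move=> s t s0 st tT; have [] := hI (s, t) s0 st tT.
move=> s u t s0 su ut tT; have st := le_trans su ut.
have u0 := le_trans s0 su; have uT := le_trans ut tT; have t0 := le_trans s0 st.
have TT0 := le_trans tT (horizon_le B).
have ct := sb_complete t0 tT; have cu := sb_complete u0 uT.
have [_ c1] := hI (s, t) s0 st tT; have [_ c2] := hI (s, u) s0 su uT.
have [_ c3] := hI (u, t) u0 ut tT.
have C30 : 0 <= C3 by exact: le_trans C31.
have C40 : 0 < C4 by exact: lt_le_trans C41.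
have ke : 0 < k - 1 by rewrite subr_gt0.
have pe : 0 < p - 2^-1 by move: p2; lra.
have small (eps : R) : 0 < eps -> mbh B g0 (F t) (fun w => I (s, t) w - (prop u t (I (s, u) w) + I (u, t) w)) eps.
  (* Five errors: the three limits and the two parts of the defect of concatenation. The limit over
     [s, u] is divided by [C4] as well, since the propagator is applied to it. *)
  move=> e0; have e5 : 0 < eps / 5 by rewrite divr_gt0.
  have e54 : 0 < eps / 5 / C4 by rewrite divr_gt0.
  have [n1 h1] := c1 _ e5; have [n2 h2] := c2 _ e54; have [n3 h3] := c3 _ e5.
  have cc1 : 0 <= C3 * (C2 * Q * (t - s)) by rewrite !mulr_ge0 ?subr_ge0// (le_trans _ C21).
  have cc2 : 0 <= C3 * (C2 * Q * Num.sqrt (t - s)) by rewrite !mulr_ge0 ?sqrtr_ge0// (le_trans _ C21).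
  have [n4 h4] := mesh_small B ke cc1 e5.
  have [n5 h5] := mesh_small B pe cc2 e5.
  pose n := maxn n1 (maxn n2 (maxn n3 (maxn n4 n5))).
  have {}h1 : mbh B g0 _ _ _ := h1 n ltac:(by rewrite !leq_max leqnn).
  have {}h2 : mbh B g0 _ _ _ := h2 n ltac:(by rewrite !leq_max leqnn ?orbT).
  have {}h3 : mbh B g0 _ _ _ := h3 n ltac:(by rewrite !leq_max leqnn ?orbT).
  have {}h4 := h4 n ltac:(by rewrite !leq_max leqnn ?orbT).
  have {}h5 := h5 n ltac:(by rewrite !leq_max leqnn ?orbT).
  have b2 := mb_op m1 (hH g0) (hH g0) cu (fun x y => linearB (prop u t) x y)
    (fun x => hC4 _ _ x u0 ut TT0) (ltW C40) h2.
  have bd := hC3 B s t _ _ _ t0 tT (hC2 B A Q gA Q0 s u t n s0 su ut tT).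
  have := mb_add m1 (hH g0) ct (mb_subr m1 (hH g0) ct (mb_subr m1 (hH g0) ct h1
    (mb_sub (sb_mono u0 ut tT) b2)) h3) bd.
  move=> b; apply: (mb_ae m1 (hH g0) ct _ (mb_le _ b)).
    by apply: aeW => w; rewrite linearB/=; exact: additivity_error.
  have -> : C4 * (eps / 5 / C4) = eps / 5 by rewrite mulrCA mulfV ?mulr1// gt_eqF.
  have sq : Num.sqrt (grid_mesh B n `^ (2 * p - 1) * (t - s)) = grid_mesh B n `^ (p - 2^-1) * Num.sqrt (t - s).
    rewrite sqrtrM ?powR_ge0//; congr (_ * _).
    have -> : 2 * p - 1 = (p - 2^-1) * 2 by field.
    by rewrite powRrM powR_mulrn ?powR_ge0// sqrtr_sqr ger0_norm// powR_ge0.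
  rewrite sq mulrDr.
  have -> : C3 * (C2 * Q * (grid_mesh B n `^ (k - 1) * (t - s))) = C3 * (C2 * Q * (t - s)) * grid_mesh B n `^ (k - 1) by ring.
  have -> : C3 * (C2 * Q * (grid_mesh B n `^ (p - 2^-1) * Num.sqrt (t - s))) = C3 * (C2 * Q * Num.sqrt (t - s)) * grid_mesh B n `^ (p - 2^-1) by ring.
  rewrite [leRHS](_ : eps = eps / 5 + eps / 5 + eps / 5 + (eps / 5 + eps / 5)); last by field.
  apply: lerD; first by [].
  by apply: lerD; exact: ltW.
apply: ae1 (mb_eq0 m1 (hH g0) ct small) _ => w /eqP; rewrite subr_eq0 => /eqP; exact.
Qed.

Record sewing_integral B (A I : R -> R -> Om B -> ambient H) (Q : R) : Prop := SewingIntegral {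
  sewing_rest : forall s t, 0 <= s -> s <= t -> t <= T B ->
    decomp g0 g1 s t (fun w => I s t w - prop s t (A s t w)) (Q * (t - s) `^ k) (Q * (t - s) `^ p) ;
  sewing_additive : forall s u t, 0 <= s -> s <= u -> u <= t -> t <= T B ->
    aeeq (sb_prob B) (I s t) (fun w => prop u t (I s u w) + I u t w)
}.

(** By additivity the error of a Riemann sum is the sum of the rests over its intervals. These are
    known at the right end points, which are the points v_i of [decomp_sum] here. *)
Lemma partition_rest : exists2 C : R, 1 <= C &
  forall B (A I : R -> R -> Om B -> ambient H) Q, @sewing_integral B A I Q -> 0 <= Q ->
  forall (h : R) n (c : nat -> R), 0 <= c 0%N -> c n <= T B ->
  (forall i, (i < n)%N -> c i <= c i.+1) -> (forall i, (i < n)%N -> c i.+1 - c i <= h) ->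
  decomp g0 g1 (c 0%N) (c n)
    (fun w => I (c 0%N) (c n) w - \sum_(i < n) prop (c i) (c n) (A (c i) (c i.+1) w))
    (C * Q * (h `^ (k - 1) * (c n - c 0%N)))
    (C * Q * Num.sqrt (h `^ (2 * p - 1) * (c n - c 0%N))).
Proof.
have [C C1 hC] := decomp_sum; exists C => // B A I Q sI Q0 h n c c0 cT cS ch.
have cm i j : (i <= j)%N -> (j <= n)%N -> c i <= c j.
  move/subnKC <-; elim: (j - i)%N => [|l IH]; rewrite ?addn0// addnS => ln.
  by apply: le_trans (IH (ltnW ln)) (cS _ ln).
have cp i : (i <= n)%N -> 0 <= c i by move=> ni; apply: le_trans c0 (cm _ _ _ ni).
have cT' i : (i <= n)%N -> c i <= T B by move=> ni; apply: le_trans (cm _ _ ni (leqnn _)) cT.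
have := hC B Q h (c n) n c (fun i => c i.+1)
  (fun i w => I (c i) (c i.+1) w - prop (c i) (c i.+1) (A (c i) (c i.+1) w)) Q0 c0 (lexx _) cT.
move=> H1; have {}H1 := H1 (fun i ni => introT andP (conj (cS i ni) (lexx _))) ch.
have {}H1 : decomp g0 g1 _ _ _ _ _ := H1 (fun i ni => sewing_rest sI (cp i (ltnW ni)) (cS i ni) (cT' _ ni)).
apply: decomp_ae H1.
have add j : (j <= n)%N -> aeeq (sb_prob B) (I (c 0%N) (c j)) (fun w => I (c 0%N) (c 0%N) w +
    \sum_(i < j) prop (c i.+1) (c j) (I (c i) (c i.+1) w)).
  elim: j => [|j IH] jn; first by apply: aeW => w; rewrite big_ord0 addr0.
  have jn' := ltnW jn.
  have z : aeeq (sb_prob B) (I (c 0%N) (c 0%N)) (fun=> 0).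
    have e := sewing_additive sI c0 (lexx _) (lexx _) (cT' 0%N (leq0n _)).
    apply: ae1 e _ => w /eqP; rewrite prop_id ?c0 ?(le_trans (cT' 0%N (leq0n _)) (horizon_le B))//.
    by rewrite -subr_eq0 opprD addrA subrr sub0r oppr_eq0 => /eqP.
  apply: ae2 (ae2 (IH jn') z (fun w a b => conj a b))
    (sewing_additive sI c0 (cm _ _ (leq0n _) jn') (cS _ jn) (cT' _ jn)) _ => w [-> z0] ->.
  rewrite z0 !add0r linear_sum big_ord_recr/=; congr (_ + _).
    apply: eq_bigr => i _; rewrite (prop_comp S)//.
    - exact: cp (leq_trans (ltn_ord i) jn').
    - exact: cm (ltn_ord i) jn'.
    - exact: cS.
    - exact: le_trans (cT' _ jn) (horizon_le B).
  rewrite prop_id// cp//=; exact: le_trans (cT' _ jn) (horizon_le B).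
have z : aeeq (sb_prob B) (I (c 0%N) (c 0%N)) (fun=> 0).
  have e := sewing_additive sI c0 (lexx _) (lexx _) (cT' 0%N (leq0n _)).
  apply: ae1 e _ => w /eqP; rewrite prop_id ?c0 ?(le_trans (cT' 0%N (leq0n _)) (horizon_le B))//.
  by rewrite -subr_eq0 opprD addrA subrr sub0r oppr_eq0 => /eqP.
apply: ae2 (add n (leqnn _)) z _ => w -> ->; rewrite add0r -sumrB; apply: eq_bigr => i _.
rewrite linearB (prop_comp S)//.
- exact: cp (ltnW (ltn_ord i)).
- exact: cS.
- exact: cm (ltn_ord i) (leqnn _).
exact: le_trans cT (horizon_le B).
Qed.

Lemma rest_error (V : zmodType) (x y a b c : V) : x + y - a = x - b - (a - b - c) + (y - c).
Proof.
rewrite !opprB !addrA [RHS](ACl (1*6*5*(2*4)*(3*7))%AC)/=.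
by rewrite addNr subrr !addr0.
Qed.

Lemma sum_sub_swap (V : zmodType) (a b c : V) : a + b - c = b - (c - a).
Proof. by rewrite opprB [RHS]addrCA addrA. Qed.

(** The rest over [s, u] and the defect at [u] enter through the propagator from [u] to [t], which
    smooths them; only the rest over the shorter interval [u, t] is left untouched. *)
Lemma rest_split B A I Q : @sewing_integral B A I Q -> forall s u t, 0 <= s -> s <= u -> u <= t -> t <= T B ->
  aeeq (sb_prob B) (fun w => I s t w - prop s t (A s t w))
    (fun w => prop u t (I s u w - prop s u (A s u w) - (prop s u (A s t w - A s u w) - A u t w)) +
       (I u t w - prop u t (A u t w))).
Proof.
move=> sI s u t s0 su ut tT; apply: ae1 (sewing_additive sI s0 su ut tT) _ => w ->.
have TT0 := le_trans tT (horizon_le B).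
rewrite [prop u t (_ - _)]linearB (bracket_map _ _ _ s0 su ut tT) linearB/= (prop_comp S s0 su ut TT0).
exact: rest_error.
Qed.

Lemma half_power_le (r x : R) j : r <= x -> ((2^-1 : R) ^+ j) `^ x <= ((2^-1 : R) `^ r) ^+ j.
Proof.
move=> rx; rewrite -powR_mulrn ?invr_ge0// -powRrM mulrC powRrM powR_mulrn ?powR_ge0//.
apply: lerXn2r; rewrite ?nnegrE ?powR_ge0//.
have half0 : 0 < 2^-1 :> R by rewrite invr_gt0.
by apply: ger_powR => //; rewrite half0 invf_le1// ler1n.
Qed.

Lemma half_scale_power (r y z c l Q : R) j : 0 < r -> 0 <= y -> r <= z - y -> 0 <= c -> 0 < l -> 0 <= Q ->
  c * ((2^-1 : R) ^+ j.+1 * l) `^ (- y) *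
    (Q * ((2^-1 : R) ^+ j.+1 * l) `^ z + Q * ((2^-1 : R) ^+ j * l) `^ z) <=
  c * ((2^-1 : R) `^ (- y) * 2) * Q * l `^ (z - y) * ((2^-1 : R) `^ r) ^+ j.
Proof.
move=> r0 y0 ryz c0 l0 Q0; have hj : 0 < (2^-1 : R) ^+ j by rewrite exprn_gt0// invr_gt0.
set u := (2^-1 : R) ^+ j * l; have u0 : 0 < u by rewrite mulr_gt0.
have -> : (2^-1 : R) ^+ j.+1 * l = 2^-1 * u by rewrite exprS -mulrA.
have z0 : 0 <= z by move: (ltW r0) ryz; lra.
have h1 : (2^-1 * u) `^ z <= u `^ z.
  apply: powR_le => //; first by rewrite mulr_ge0 ?invr_ge0// ltW.
  by rewrite ler_piMl ?invf_le1 ?ler1n// ltW.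
have P1 := powR_ge0 (2^-1 : R) (- y); have P2 := powR_ge0 u (- y); have P3 := powR_ge0 u z.
apply: le_trans (_ : c * ((2^-1 : R) `^ (- y) * u `^ (- y)) * (2 * Q * u `^ z) <= _).
  rewrite powRM ?invr_ge0 ?(ltW u0)//; apply: ler_wpM2l; first by rewrite !mulr_ge0.
  by have := ler_wpM2l Q0 h1; lra.
have e : u `^ (- y) * u `^ z = l `^ (z - y) * ((2^-1 : R) ^+ j) `^ (z - y).
  rewrite -powRD; last by rewrite (gt_eqF u0) implybT.
  have -> : - y + z = z - y by rewrite addrC.
  by rewrite /u powRM ?(ltW hj) ?(ltW l0)//; exact: mulrC.
have -> : c * ((2^-1 : R) `^ (- y) * u `^ (- y)) * (2 * Q * u `^ z) =
  c * ((2^-1 : R) `^ (- y) * 2) * Q * (u `^ (- y) * u `^ z) by ring.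
rewrite e mulrA; apply: ler_wpM2l; first by rewrite !mulr_ge0 ?powR_ge0.
exact: half_power_le.
Qed.

(* Iterating [rest_split] at the points [t - 2 ^- j * (t - s)] leaves at each step a
   distance to [t] comparable with the length of the interval, which pays for
   the smoothing by the propagator. *)
Lemma rest_smoothing eta zeta : 0 <= eta -> eta <= 2 -> eta < k -> 0 <= zeta -> zeta <= 2 -> zeta < p ->
  exists2 C : R, 1 <= C & forall B (A I : R -> R -> Om B -> ambient H) Q,
  @germ_bounds B A Q -> @sewing_integral B A I Q -> 0 <= Q ->
  forall s t, 0 <= s -> s <= t -> t <= T B ->
  decomp (g0 + eta) (g1 + zeta) s t (fun w => I s t w - prop s t (A s t w))
    (C * Q * (t - s) `^ (k - eta)) (C * Q * (t - s) `^ (p - zeta)).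
Proof.
move=> eta0 eta2 etak zeta0 zeta2 zetap.
have [C0 C01 hC0] := @smoothing_bound R H T0 S g0 (g0 + eta) ltac:(by rewrite lerDl) ltac:(by rewrite lerD2l).
have [C1 C11 hC1] := @smoothing_bound R H T0 S g1 (g1 + zeta) ltac:(by rewrite lerDl) ltac:(by rewrite lerD2l).
have [C3 C31 hC3] := @decomp_mb R H T0 m m2 g0 g0 g1 (lexx g0) g01.
have [C4 C41 hC4] := @decomp_mb R H T0 m m2 g0 (g0 + eta) (g1 + zeta) ltac:(by rewrite lerDl) ltac:(by rewrite (le_trans g01)// lerDl).
have e0 : g0 - (g0 + eta) = - eta by rewrite opprD addrA subrr sub0r.
have e1 : g1 - (g1 + zeta) = - zeta by rewrite opprD addrA subrr sub0r.
rewrite {}e0 in hC0; rewrite {}e1 in hC1.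
have C00 : 0 <= C0 by exact: le_trans C01.
have C10 : 0 <= C1 by exact: le_trans C11.
have C30 : 0 <= C3 by exact: le_trans C31.
have C40 : 0 <= C4 by exact: le_trans C41.
pose r := Num.min (k - eta) (p - zeta).
have r0 : 0 < r by rewrite lt_min !subr_gt0 etak.
pose q := (2^-1 : R) `^ r.
have q0 : 0 <= q by exact: powR_ge0.
have q1 : q < 1 by exact: half_powR_lt1.
have pq : 0 < 1 - q by rewrite subr_gt0.
pose a0 := (2^-1 : R) `^ (- eta) * 2; pose a1 := (2^-1 : R) `^ (- zeta) * 2.
have a00 : 0 <= a0 by rewrite mulr_ge0// powR_ge0.
have a10 : 0 <= a1 by rewrite mulr_ge0// powR_ge0.
pose C := 1 + C0 * a0 / (1 - q) + C1 * a1 / (1 - q).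
have CC0 : 0 <= C0 * a0 / (1 - q) by rewrite !mulr_ge0// invr_ge0 ltW.
have CC1 : 0 <= C1 * a1 / (1 - q) by rewrite !mulr_ge0// invr_ge0 ltW.
exists C; first by rewrite /C -addrA lerDl addr_ge0.
move=> B A I Q gA sI Q0 s t s0 st tT; have TT0 := le_trans tT (horizon_le B).
have t0 := le_trans s0 st.
have zz x : 0 <= x -> x <= T B -> aeeq (sb_prob B) (fun w => I x x w - prop x x (A x x w)) (fun=> 0).
  move=> x0 xT; apply: ae1 (sewing_additive sI x0 (lexx x) (lexx x) xT) _ => w /eqP.
  rewrite (germ_diag gA)// linear0 subr0 prop_id ?x0 ?(le_trans xT (horizon_le B))//.
  by rewrite -subr_eq0 opprD addrA subrr sub0r oppr_eq0 => /eqP.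
have [ts|ts] := eqVneq s t.
  rewrite -{t}ts in st tT TT0 t0 *.
  apply: (decomp_le _ _ (decomp_ae (zz s s0 tT) (decomp0 H m2 _ _ s0 st tT))).
  - by rewrite !mulr_ge0 ?powR_ge0// !addr_ge0.
  - by rewrite !mulr_ge0 ?powR_ge0// !addr_ge0.
have {ts}l0 : 0 < t - s by rewrite subr_gt0 lt_def eq_sym ts.
set l := t - s in l0 *; have l0' := ltW l0.
pose x j := t - (2^-1) ^+ j * l.
have x0 : x 0%N = s by rewrite /x expr0 mul1r /l opprB addrC subrK.
have xt j : t - x j = (2^-1) ^+ j * l by rewrite /x opprB addrC subrK.
have hj j : 0 < (2^-1 : R) ^+ j by rewrite exprn_gt0.
have xlt j : x j < t by rewrite -subr_gt0 xt mulr_gt0.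
have xd j : x j.+1 - x j = (2^-1) ^+ j.+1 * l by rewrite /x exprS; field.
have xS j : x j <= x j.+1 by rewrite -subr_ge0 xd mulr_ge0// ltW.
have xs j : s <= x j by elim: j => [|j IH]; [rewrite x0|exact: le_trans IH (xS j)].
have xp j : 0 <= x j by exact: le_trans s0 (xs j).
have xT j : x j <= T B by exact: le_trans (ltW (xlt j)) tT.
pose E j w := prop (x j.+1) t (I (x j) (x j.+1) w - prop (x j) (x j.+1) (A (x j) (x j.+1) w) -
   (prop (x j) (x j.+1) (A (x j) t w - A (x j) (x j.+1) w) - A (x j.+1) t w)).
have hE j : decomp (g0 + eta) (g1 + zeta) s t (E j)
    (C0 * a0 * Q * l `^ (k - eta) * q ^+ j) (C1 * a1 * Q * l `^ (p - zeta) * q ^+ j).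
  have d1 := sewing_rest sI (xp j) (xS j) (xT j.+1).
  have d2 := germ_bracket gA (xp j) (xS j) (ltW (xlt j.+1)) tT.
  have d3 := decomp_add m2 (xp j) (xS j) (xT _) d1 (decomp_opp m2 (xp j) (xS j) (xT _) d2).
  have pc c z : 0 <= c -> 0 <= c * (t - x j.+1) `^ z by move=> ?; rewrite mulr_ge0// powR_ge0.
  have := decomp_map m2 (ltW (xlt j.+1)) tT (xp _) (pc _ _ C00) (pc _ _ C10)
    (fun v => hC0 _ _ v (xp j.+1) (xlt j.+1) TT0) (fun v => hC1 _ _ v (xp j.+1) (xlt j.+1) TT0) (xp j) (xS j) d3.
  move=> /(decomp_widen s0 (xs j) (xS j) (ltW (xlt j.+1)) tT); apply: decomp_le; rewrite !xt xd.
  - by apply: half_scale_power => //; rewrite ge_min lexx.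
  - by apply: half_scale_power => //; rewrite ge_min lexx orbT.
have [y hy] := decomp_series m2 s0 st tT q0 q1 (mulr_ge0 (mulr_ge0 (mulr_ge0 C00 a00) Q0) (powR_ge0 l (k - eta)))
  (mulr_ge0 (mulr_ge0 (mulr_ge0 C10 a10) Q0) (powR_ge0 l (p - zeta))) hE.
have split j : aeeq (sb_prob B) (fun w => I s t w - prop s t (A s t w))
    (fun w => \sum_(i < j) E i w + (I (x j) t w - prop (x j) t (A (x j) t w))).
  elim: j => [|j IH]; first by apply: aeW => w; rewrite big_ord0 add0r x0.
  apply: ae2 IH (rest_split sI (xp j) (xS j) (ltW (xlt j.+1)) tT) _ => w -> ->.
  by rewrite big_ord_recr/= addrA.
have ct := sb_complete t0 tT.
have lk : 0 <= l `^ k by exact: powR_ge0.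
have lp : 0 <= l `^ p by exact: powR_ge0.
have lk' : 0 <= l `^ (k - eta) by exact: powR_ge0.
have lp' : 0 <= l `^ (p - zeta) by exact: powR_ge0.
have c30 : 0 <= C3 * (Q * l `^ k + Q * l `^ p) by rewrite mulr_ge0// addr_ge0// mulr_ge0.
have c40 : 0 <= C4 * (C0 * a0 * Q * l `^ (k - eta) / (1 - q) + C1 * a1 * Q * l `^ (p - zeta) / (1 - q)).
  by rewrite mulr_ge0// addr_ge0// mulr_ge0 ?invr_ge0 ?(ltW pq)// !mulr_ge0.
(* The series converges to [y] in the smaller spaces, and the rest over [x_j, t] tends to 0 in H_g0.
   Comparing both in H_g0 identifies [y] with the rest over [s, t]. *)
have small (eps : R) : 0 < eps -> mbh B g0 (F t) (fun w => I s t w - prop s t (A s t w) - y w) eps.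
  move=> eps0; have [j hj'] := geometric_small (addr_ge0 c30 c40) q0 q1 eps0.
  have b1 := hC3 B _ _ _ _ _ t0 tT (sewing_rest sI (xp j) (ltW (xlt j)) tT).
  have b2 := hC4 B _ _ _ _ _ t0 tT (hy j).
  apply: (mb_ae m1 (hH g0) ct _ (mb_le _ (mb_subr m1 (hH g0) ct b1 b2))).
    by apply: ae1 (split j) _ => w ->; exact: sum_sub_swap.
  apply: le_trans (ltW (hj' j (leqnn _))); rewrite mulrDl xt; apply: lerD.
    rewrite -mulrA; apply: ler_wpM2l => //; rewrite mulrDl -!mulrA.
    apply: lerD; apply: ler_wpM2l => //; rewrite powRM ?(ltW (hj j))// mulrC; apply: ler_wpM2l => //.
    - by apply: half_power_le; rewrite ge_min lerBlDr lerDl eta0.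
    - by apply: half_power_le; rewrite ge_min [X in _ || X]lerBlDr lerDl zeta0 orbT.
  rewrite le_eqVlt; apply/orP; left; apply/eqP; ring.
have := hy 0%N; rewrite expr0 !mulr1 => h; apply: (decomp_le _ _ (decomp_ae _ h)).
- have -> : C0 * a0 * Q * l `^ (k - eta) / (1 - q) = C0 * a0 / (1 - q) * Q * l `^ (k - eta) by ring.
  by rewrite /C; do 2 (apply: ler_wpM2r => //); rewrite addrAC lerDr addr_ge0.
- have -> : C1 * a1 * Q * l `^ (p - zeta) / (1 - q) = C1 * a1 / (1 - q) * Q * l `^ (p - zeta) by ring.
  by rewrite /C; do 2 (apply: ler_wpM2r => //); rewrite lerDr addr_ge0.
apply: ae1 (mb_eq0 m1 (hH g0) ct small) _ => w /eqP; rewrite subr_eq0 => /eqP ->.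
by rewrite big_ord0 subr0.
Qed.

End Sewing.

(** * The germ of the rough integral *)

Section OperatorNormMaps.
Variables (R : realType) (W : lmodType R) (N : R -> W -> \bar R).
Variables (ip : R -> W -> W -> R) (K : R -> R).
Hypothesis hN : forall g, hilb (N g) (ip g) (K g).
Variable e : nat.
Local Notation Ne := (opnorm (e := e) N).

(** Evaluation at a fixed [x], named so as to carry the linear structure that [orth_op] expects. *)
Definition lapp_at (x : 'rV[R]_e) (A : {ffun 'I_e -> W}) : W := lapp A x.

Lemma lapp_at_linear x : linear (lapp_at x).
Proof. by move=> c A B; rewrite /lapp_at lappD lappZ. Qed.

HB.instance Definition _ x := GRing.isLinear.Build R {ffun 'I_e -> W} W _ (lapp_at x) (lapp_at_linear x).

Lemma lapp_fin g A x : (Ne g A < +oo)%E -> (N g (lapp A x) < +oo)%E.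
Proof.
move=> fA; apply: le_lt_trans (norm_lapp (hN g) x fA) _.
by rewrite (finV (opnorm_hilb (hN g) e) fA) -EFinM ltry.
Qed.

Lemma opnorm_embedding g1 g2 (C : R) : 0 <= C ->
  (forall v, (N g2 v < +oo)%E -> (N g1 v <= C%:E * N g2 v)%E) ->
  forall A, (Ne g2 A < +oo)%E -> (Ne g1 A <= C%:E * Ne g2 A)%E.
Proof.
move=> C0 h A fA; apply: ub_ereal_sup => _ [x x1 <-].
apply: le_trans (h _ (lapp_fin _ fA)) _; apply: lee_wpmul2l; first by rewrite lee_fin.
by apply: ereal_sup_ubound; exists x.
Qed.

Lemma opnorm_interpolation g1 g2 g3 (C c1 c3 : R) : 0 <= C -> 0 <= c1 -> 0 <= c3 ->
  (forall v, (N g3 v < +oo)%E ->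
     (N g2 v <= C%:E * (c1%:E * N g1 v + c3%:E * N g3 v))%E) ->
  forall A, (Ne g3 A < +oo)%E ->
     (Ne g2 A <= C%:E * (c1%:E * Ne g1 A + c3%:E * Ne g3 A))%E.
Proof.
move=> C0 c10 c30 h A fA; apply: ub_ereal_sup => _ [x x1 <-].
apply: le_trans (h _ (lapp_fin _ fA)) _; apply: lee_wpmul2l; first by rewrite lee_fin.
by apply: leeD; apply: lee_wpmul2l; rewrite ?lee_fin//; apply: ereal_sup_ubound; exists x.
Qed.

End OperatorNormMaps.

Lemma powR_interval (R : realType) (x y l T : R) : 0 <= x -> x <= y -> 0 <= l -> l <= T ->
  l `^ y <= T `^ (y - x) * l `^ x.
Proof.
(* The convention 0^0 = 1 has to be checked apart from the law of exponents. *)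
move=> x0 xy l0 lT; have [->|l1] := eqVneq l 0.
  have [y0|y0] := eqVneq y 0.
    have -> : x = 0 by apply/eqP; rewrite eq_le x0 andbT -y0.
    by rewrite y0 subrr !powRr0 mulr1.
  by rewrite powR0// mulr_ge0 ?powR_ge0.
have l2 : 0 < l by rewrite lt_def l1.
have -> : l `^ y = l `^ (y - x) * l `^ x.
  by rewrite -powRD ?subrK// l1 implybT.
by apply: ler_wpM2r; [exact: powR_ge0|apply: powR_le; rewrite ?subr_ge0].
Qed.

Lemma germ_increment (V : zmodType) (x1 x2 z1 z2 r : V) :
  x1 + x2 + (z1 + (z2 + r)) - (x1 + z1) = x2 + (z2 + r).
Proof.
rewrite opprD !addrA [LHS](ACl (2*4*5*(1*6)*(3*7))%AC)/=.
by rewrite !subrr !addr0.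
Qed.

Lemma bracket_sum (V : zmodType) (Sp Sq Sr p q r y z rho : V) :
  Sp + (Sq + Sr) - (y + z) =
  Sp - p + (Sr - r) + (Sq - q) - rho - (z - q) + (rho - (y - p - r)).
Proof.
rewrite !opprB !opprD !addrA [RHS](ACl (1*5*3*13*9*(12*2)*(11*4)*(8*6)*(10*7))%AC)/=.
by rewrite !subrr !addr0.
Qed.

(** The hypotheses in quantitative form, with real bounds valid for all s <= t, the diagonal
    included. [L] stands for the norm of the rough path and [M] for that of the controlled path. *)
Record rough_bounds (R : realType) (H : monotone_family R) (T0 m : R) (e : nat) (a b b' g : R)
    (B : stochastic_basis T0) (X : R -> 'rV[R]_e) (XX : R -> R -> 'M[R]_e)
    (Y : R -> sb_space B -> {ffun 'I_e -> ambient H})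
    (Y' : R -> sb_space B -> {ffun 'I_e -> {ffun 'I_e -> ambient H}}) (L M : R) : Prop := RoughBounds {
  rb_L : 0 <= L ;
  rb_M : 0 <= M ;
  rb_X : forall s t, 0 <= s -> s <= t -> t <= horizon B -> eucl (incr X s t) <= L * (t - s) `^ a ;
  rb_XX : forall s t, 0 <= s -> s <= t -> t <= horizon B -> eucl (XX s t) <= L * (t - s) `^ (2 * a) ;
  rb_chen : forall s r t, 0 <= s -> s <= r -> r <= t -> t <= horizon B ->
    XX s t - XX s r - XX r t = (incr X s r)^T *m incr X r t ;
  rb_Y : forall t, 0 <= t -> t <= horizon B ->
    mb (sb_prob B) m (opnorm (@hnorm R H)) g (sb_filt t) (Y t) M ;
  rb_dY : forall s t, 0 <= s -> s <= t -> t <= horizon B ->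
    mb (sb_prob B) m (opnorm (@hnorm R H)) (g - b) (sb_filt t)
      (fun w => Y t w - Y s w) (M * (t - s) `^ b) ;
  rb_Y' : forall t, 0 <= t -> t <= horizon B ->
    mb (sb_prob B) m (opnorm (opnorm (@hnorm R H))) (g - b) (sb_filt t) (Y' t) M ;
  rb_dY' : forall s t, 0 <= s -> s <= t -> t <= horizon B ->
    mb (sb_prob B) m (opnorm (opnorm (@hnorm R H))) (g - b - b') (sb_filt t)
      (fun w => Y' t w - Y' s w) (M * (t - s) `^ b') ;
  rb_ER : forall s t, 0 <= s -> s <= t -> t <= horizon B ->
    mb (sb_prob B) m (opnorm (@hnorm R H)) (g - b - b') (sb_filt s)
      (condexp (sb_prob B) (opnorm (@hnorm R H)) (g - b - b') (sb_filt s) (remainder X Y Y' s t))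
      (M * (t - s) `^ (b + b'))
}.

Section RoughGerm.
Variables (R : realType) (H : monotone_family R) (T0 : R) (S : propagator H T0).
Variables (m : R) (e : nat) (a b b' g : R).
Hypothesis m2 : 2 <= m.
Hypothesis a2 : a <= 1 / 2.
Hypothesis b'0 : 0 < b'.
Hypothesis b'b : b' <= b.
Hypothesis ba : b <= a.
Let m1 : 1 <= m. Proof. by apply: le_trans m2; rewrite ler1n. Qed.
Local Notation hn := (@hnorm R H).
Local Notation Ne := (opnorm (e := e) hn).
Local Notation Nee := (opnorm (e := e) Ne).
Local Notation basis := (stochastic_basis T0).
Local Notation Om B := (sb_space B).
Local Notation hH := (hnorm_hilb H).
Local Notation hE := (fun g => opnorm_hilb (hH g) e).
Local Notation hEE := (fun g => opnorm_hilb (opnorm_hilb (hH g) e) e).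
Local Notation T B := (horizon B).
Local Notation K := (e.+1%:R * 1 : R).
Implicit Types (B : basis).

Lemma mb_lapp B h G (A : Om B -> {ffun 'I_e -> ambient H}) x c : complete_sigma (sb_prob B) G ->
  mb (sb_prob B) m Ne h G A c -> mb (sb_prob B) m hn h G (fun w => lapp (A w) x) (e%:R * eucl x * c).
Proof.
move=> cG; apply: (mb_op m1 (hH h) (hE h) cG (T := fun A => lapp A x)).
- by move=> u v; exact: lappB.
- by move=> u fu; exact: (norm_lapp (hH h)).
by rewrite mulr_ge0// eucl_ge0.
Qed.

Lemma mb_lapp' B h G (A : Om B -> {ffun 'I_e -> {ffun 'I_e -> ambient H}}) x c :
  complete_sigma (sb_prob B) G ->
  mb (sb_prob B) m Nee h G A c -> mb (sb_prob B) m Ne h G (fun w => lapp (A w) x) (e%:R * eucl x * c).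
Proof.
move=> cG; apply: (mb_op m1 (hE h) (hEE h) cG (T := fun A => lapp A x)).
- by move=> u v; exact: lappB.
- by move=> u fu; exact: (norm_lapp (hE h)).
by rewrite mulr_ge0// eucl_ge0.
Qed.

Lemma mb_lapp2 B h G (A : Om B -> {ffun 'I_e -> {ffun 'I_e -> ambient H}}) x c :
  complete_sigma (sb_prob B) G ->
  mb (sb_prob B) m Nee h G A c -> mb (sb_prob B) m hn h G (fun w => lapp2 (A w) x) (e%:R ^+ 2 * eucl x * c).
Proof.
move=> cG; apply: (mb_op m1 (hH h) (hEE h) cG (T := fun A => lapp2 A x)).
- by move=> u v; exact: lapp2B.
- by move=> u fu; exact: (norm_lapp2 (hH h)).
by rewrite mulr_ge0 ?eucl_ge0// exprn_ge0.
Qed.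

Lemma mb_embedding_e h h' : h <= h' -> exists2 C : R, 1 <= C & forall B G (xi : Om B -> {ffun 'I_e -> ambient H}) c,
  complete_sigma (sb_prob B) G -> mb (sb_prob B) m Ne h' G xi c -> mb (sb_prob B) m Ne h G xi (C * c).
Proof.
move=> hh; have [C C1 hC] := embedding_bound H hh; exists C => // B G xi c cG bx.
have C0 : 0 <= C by exact: le_trans C1.
by apply: (mb_op m1 (hE h) (hE h') cG (T := id) _ (opnorm_embedding hH C0 hC) C0 bx).
Qed.

Lemma mb_regularity h h' : h <= h' -> h' <= h + 1 -> exists2 C : R, 1 <= C &
  forall B G (xi : Om B -> ambient H) c s t, 0 <= s -> s <= t -> t <= T B ->
  complete_sigma (sb_prob B) G -> mb (sb_prob B) m hn h' G xi c ->
  mb (sb_prob B) m hn h G (fun w => prop S s t (xi w) - xi w) (C * (t - s) `^ (h' - h) * c).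
Proof.
move=> h1 h2; have [C C1 hC] := regularity_bound S h1 h2; exists C => // B G xi c s t s0 st tT cG bx.
have TT0 := le_trans tT (horizon_le B).
apply: (mb_op m1 (hH h) (hH h') cG (T := fun v => prop S s t v - v) _ (fun v => hC s t v s0 st TT0) _ bx).
  by move=> u v; rewrite linearB opprD opprK opprB [v - _]addrC addrACA.
by rewrite mulr_ge0 ?powR_ge0// (le_trans _ C1).
Qed.

Lemma mb_smoothing h h' : h <= h' -> h' <= h + 2 -> exists2 C : R, 1 <= C &
  forall B G (xi : Om B -> ambient H) c s t, 0 <= s -> s < t -> t <= T B ->
  complete_sigma (sb_prob B) G -> mb (sb_prob B) m hn h G xi c ->
  mb (sb_prob B) m hn h' G (fun w => prop S s t (xi w)) (C * (t - s) `^ (h - h') * c).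
Proof.
move=> h1 h2; have [C C1 hC] := smoothing_bound S h1 h2; exists C => // B G xi c s t s0 st tT cG bx.
have TT0 := le_trans tT (horizon_le B).
apply: (mb_op m1 (hH h') (hH h) cG (T := prop S s t) _ (fun v => hC s t v s0 st TT0) _ bx).
  by move=> u v; exact: linearB.
by rewrite mulr_ge0 ?powR_ge0// (le_trans _ C1).
Qed.

Section Data.
Variables (B : basis) (X : R -> 'rV[R]_e) (XX : R -> R -> 'M[R]_e).
Variables (Y : R -> Om B -> {ffun 'I_e -> ambient H}).
Variables (Y' : R -> Om B -> {ffun 'I_e -> {ffun 'I_e -> ambient H}}) (L M : R).
Hypothesis rb : rough_bounds m a b b' g X XX Y Y' L M.

Lemma chen_diag t : 0 <= t -> t <= T B -> XX t t = 0.
Proof.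
move=> t0 tT; have := rb_chen rb t0 (lexx t) (lexx t) tT.
have -> : incr X t t = 0 by rewrite /incr subrr.
rewrite mulmx0 subrr sub0r => /eqP; by rewrite oppr_eq0 => /eqP.
Qed.

Lemma germ_zero t w : 0 <= t -> t <= T B -> germ X XX Y Y' t t w = 0.
Proof.
move=> t0 tT; rewrite /germ chen_diag// /incr subrr /lapp /lapp2 !big1 ?addr0// => i _.
  by rewrite big1// => j _; rewrite mxE scale0r.
by rewrite mxE scale0r.
Qed.

(** Chen's relation splits the second level over [s, t]; its tensor term is Y'_s applied to both
    increments and combines with Y_u - Y_s into the remainder over [s, u]. The vector [rho] is
    arbitrary, and will be the conditional expectation of that remainder. *)
Lemma bracket_identity s u t w rho : 0 <= s -> s <= u -> u <= t -> t <= T B ->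
  prop S s u (germ X XX Y Y' s t w - germ X XX Y Y' s u w) - germ X XX Y Y' u t w =
  (prop S s u (lapp (Y s w) (incr X u t)) - lapp (Y s w) (incr X u t)) +
  (prop S s u (lapp (lapp (Y' s w) (incr X s u)) (incr X u t)) -
     lapp (lapp (Y' s w) (incr X s u)) (incr X u t)) +
  (prop S s u (lapp2 (Y' s w) (XX u t)) - lapp2 (Y' s w) (XX u t)) -
  lapp rho (incr X u t) - lapp2 (Y' u w - Y' s w) (XX u t) +
  lapp (rho - remainder X Y Y' s u w) (incr X u t).
Proof.
move=> s0 su ut tT; rewrite /germ /remainder /delta.
have -> : incr X s t = incr X s u + incr X u t by rewrite /incr [RHS]addrC addrA subrK.
have -> : XX s t = XX s u + (XX u t + (incr X s u)^T *m incr X u t).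
  by rewrite -(rb_chen rb s0 su ut tT) [XX u t + _]addrC subrK addrC subrK.
have lD x y : prop S s u (x + y) = prop S s u x + prop S s u y by exact: linearD.
move: (incr X s u) (incr X u t) => x1 x2.
rewrite !lappDr !lapp2Dr lapp2_tensor germ_increment !lD !lappB lapp2B.
exact: bracket_sum.
Qed.

End Data.
(** All the monomials in the size of the rough path that occur in the defect, absorbed in the factor
    1 + L^2 of the theorem. *)
Lemma square_bounds (L : R) : 0 <= L -> [/\ 1 <= 1 + L ^+ 2, L <= 1 + L ^+ 2, L * L <= 1 + L ^+ 2 & (1 + L) * L <= 2 * (1 + L ^+ 2)].
Proof. by move=> L0; have := sqr_ge0 (L - 1); have := sqr_ge0 L; rewrite !expr2 => ? ?; split; nra. Qed.

Lemma powR_add (l x y : R) : 0 < x + y -> l `^ x * l `^ y = l `^ (x + y).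
Proof. by move=> xy; rewrite powRD// (gt_eqF xy). Qed.

Lemma bracket_drift_le (C1 C2 E c M CM W p1 p2 x1 x2 x3 lk : R) :
  0 <= C1 -> 0 <= C2 -> 0 <= E -> 0 <= M -> 0 <= CM -> 0 <= W -> 0 <= lk -> 0 <= c ->
  p1 * x2 <= W * lk -> p2 * (x2 * x1) <= W * (c * lk) -> p2 * x3 <= W * (c * lk) ->
  C1 * p1 * (E * x2 * M) + C2 * p2 * (E * x2 * (E * x1 * M)) + C2 * p2 * (E ^+ 2 * x3 * M) +
    E * x2 * (M * p1) + E ^+ 2 * x3 * (M * p2) <=
  (1 + (C1 * E + C2 * E ^+ 2 * c + C2 * E ^+ 2 * c + E + E ^+ 2 * c) + CM) * (M * W) * lk.
Proof.
move=> C10 C20 E0 M0 CM0 W0 lk0 c0 h1 h2 h3.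
have q1 := ler_wpM2l (mulr_ge0 (mulr_ge0 C10 E0) M0) h1.
have q2 := ler_wpM2l (mulr_ge0 (mulr_ge0 C20 (sqr_ge0 E)) M0) h2.
have q3 := ler_wpM2l (mulr_ge0 (mulr_ge0 C20 (sqr_ge0 E)) M0) h3.
have q4 := ler_wpM2l (mulr_ge0 E0 M0) h1.
have q5 := ler_wpM2l (mulr_ge0 (sqr_ge0 E) M0) h3.
have q6 : 0 <= (1 + CM) * (M * W) * lk by rewrite !mulr_ge0// addr_ge0.
lra.
Qed.

Lemma bracket_noise_le (E K2 C3 CD M W p x L lk : R) :
  0 <= E -> 0 <= K2 -> 0 <= C3 -> 0 <= CD -> 0 <= M -> 0 <= W -> 0 <= lk ->
  (1 + L) * (p * x) <= 2 * W * lk ->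
  E * x * (K2 * (C3 * (M * (1 + L)) * p) + C3 * (M * (1 + L)) * p) <=
  (1 + CD + E * (K2 + 1) * C3 * 2) * (M * W) * lk.
Proof.
move=> E0 K0 C0 CD0 M0 W0 lk0 h.
have := ler_wpM2l (mulr_ge0 (mulr_ge0 (mulr_ge0 E0 (addr_ge0 K0 ler01)) C0) M0) h.
have : 0 <= (1 + CD) * (M * W) * lk by rewrite !mulr_ge0// addr_ge0.
lra.
Qed.

Local Notation g0 := (g - b - b').
Local Notation g1 := (g - b).
Local Notation k := (a + b + b').

(** Without conditioning the two terms of the remainder need not compensate, and only the order b in
    H_(g-b) is available. The martingale part of the defect inherits it. *)
Lemma remainder_mb : exists2 C : R, 1 <= C & forall B X XX Y Y' L M,
  @rough_bounds R H T0 m e a b b' g B X XX Y Y' L M ->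
  forall s u, 0 <= s -> s <= u -> u <= T B ->
  mb (sb_prob B) m Ne g1 (sb_filt u) (remainder X Y Y' s u) (C * (M * (1 + L)) * (u - s) `^ b).
Proof.
have b0 : 0 < b by exact: lt_le_trans b'b.
pose c := T0 `^ (a - b); have c0 : 0 <= c by exact: powR_ge0.
have E0 : 0 <= e%:R :> R by [].
exists (1 + e%:R * c); first by rewrite lerDl mulr_ge0.
move=> B X XX Y Y' L M rb s u s0 su uT.
have cu := sb_complete (le_trans s0 su) uT.
have bY' := mb_sub (sb_mono s0 su uT) (rb_Y' rb s0 (le_trans su uT)).
apply: mb_le (mb_subr m1 (hE g1) cu (rb_dY rb s0 su uT) (mb_lapp' (incr X s u) cu bY')).
have L0 := rb_L rb; have M0 := rb_M rb.
have l0 : 0 <= u - s by rewrite subr_ge0.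
have lT : u - s <= T0 by have := horizon_le B; lra.
have hX := rb_X rb s0 su uT; have hl := powR_interval (ltW b0) ba l0 lT.
have lb := powR_ge0 (u - s) b.
have : e%:R * eucl (incr X s u) * M <= e%:R * (L * (c * (u - s) `^ b)) * M.
  by apply: ler_wpM2r => //; apply: ler_wpM2l => //; apply: le_trans hX _; apply: ler_wpM2l.
move=> /(lerD (lexx (M * (u - s) `^ b)))/le_trans; apply.
have p1 : 0 <= M * (u - s) `^ b * (e%:R * c) by rewrite !mulr_ge0.
have p2 : 0 <= M * L * (u - s) `^ b by rewrite !mulr_ge0.
lra.
Qed.

(** Orders of the drift in H_(g-b-b'): S - 1 gains b + b' on Y and b' on Y', next to increments of
    order a and 2 a; the conditional remainder contributes b + b' + a and the increment of Y'
    contributes b' + 2 a. All of them are at least a + b + b' because b <= a, the surplus going into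
    powers of [T0]. *)
Lemma rough_germ_bounds : exists2 C : R, 1 <= C & forall B X XX Y Y' L M,
  @rough_bounds R H T0 m e a b b' g B X XX Y Y' L M ->
  germ_bounds S m g0 g1 k (a + b) (germ X XX Y Y') (C * (M * (1 + L ^+ 2))).
Proof.
have b0 : 0 < b by exact: lt_le_trans b'b.
have a0 : 0 < a by exact: lt_le_trans ba.
have g01 : g0 <= g1 by rewrite gerBl ltW.
have i1 : g0 <= g by lra.
have k0 : 0 <= k by rewrite !addr_ge0// ltW.
have kk : k <= 2 * a + b' by move: ba; lra.
have i2 : g <= g0 + 1 by move: a2 ba b'b; lra.
have i3 : g1 <= g0 + 1 by lra.
have [C1 C11 hC1] := mb_regularity i1 i2; have [C2 C21 hC2] := mb_regularity g01 i3.
have [C3 C31 hC3] := remainder_mb.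
have [C4 C41 hC4] := mb_embedding_e g01.
pose E : R := e%:R; have E0 : 0 <= E by [].
pose c := T0 `^ (a - b); have c0 : 0 <= c by exact: powR_ge0.
have C10 : 0 <= C1 by exact: le_trans C11.
have C20 : 0 <= C2 by exact: le_trans C21.
have C30 : 0 <= C3 by exact: le_trans C31.
pose K2 : R := 4 * K ^+ 2; have K20 : 0 <= K2 by rewrite mulr_ge0// sqr_ge0.
pose CD := C1 * E + C2 * E ^+ 2 * c + C2 * E ^+ 2 * c + E + E ^+ 2 * c.
pose CM := E * (K2 + 1) * C3 * 2.
have CD0 : 0 <= CD by rewrite !addr_ge0// !mulr_ge0 ?exprn_ge0.
have CM0 : 0 <= CM by rewrite !mulr_ge0// addr_ge0.
exists (1 + CD + CM); first by rewrite -addrA lerDl addr_ge0.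
move=> B X XX Y Y' L M rb; split=> [t w t0 tT|s u t s0 su ut tT]; first exact: (germ_zero rb).
have L0 := rb_L rb; have M0 := rb_M rb; have [L1 L2 L3 L4] := square_bounds L0.
have uT := le_trans ut tT; have u0 := le_trans s0 su; have sT := le_trans su uT.
have cu := sb_complete u0 uT; have cs := sb_complete s0 sT; have cm := sb_meas B.
have Fsu := sb_mono s0 su uT.
set l := t - s; have st := le_trans su ut; have l0 : 0 <= l by rewrite subr_ge0.
have lT : l <= T0 by have := horizon_le B; rewrite /l; lra.
set x1 := incr X s u; set x2 := incr X u t.
have us z : 0 <= z -> (u - s) `^ z <= l `^ z by move=> z0; apply: powR_le; rewrite ?subr_ge0// lerB.
have tu z : 0 <= z -> (t - u) `^ z <= l `^ z.
  by move=> z0; apply: powR_le; rewrite ?subr_ge0// lerD2l lerN2.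
have hx1 : eucl x1 <= L * l `^ a.
  by apply: le_trans (rb_X rb s0 su uT) _; apply: ler_wpM2l => //; apply: us; exact: ltW.
have hx2 : eucl x2 <= L * l `^ a.
  by apply: le_trans (rb_X rb u0 ut tT) _; apply: ler_wpM2l => //; apply: tu; exact: ltW.
have hxx : eucl (XX u t) <= L * l `^ (2 * a).
  by apply: le_trans (rb_XX rb u0 ut tT) _; apply: ler_wpM2l => //; apply: tu; rewrite mulr_ge0// ltW.
have bY := mb_sub Fsu (rb_Y rb s0 sT); have bY' := mb_sub Fsu (rb_Y' rb s0 sT).
(* the conditional expectation of the remainder, computed in the smaller space *)
pose rho := condexp (sb_prob B) Ne g1 (sb_filt s) (remainder X Y Y' s u).
have bR := hC3 _ _ _ _ _ _ _ rb s u s0 su uT.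
have bRm := mb_sub (complete_sigma_meas cu) bR.
have [brho orho] := condexpP (hE g1) m2 cs bRm.
have brho0 : mb (sb_prob B) m Ne g0 (sb_filt u) rho (M * (u - s) `^ (b + b')).
  apply: mb_sub Fsu _; apply: (mb_ae m1 (hE g0) cs _ (rb_ER rb s0 su uT)).
  have e1 := condexp_eq (hE g0) m2 cs (hC4 _ _ _ _ cm bRm) (hC4 _ _ _ _ cs brho).
  apply: ae1 (e1 _) _ => [|w ->//].
  have [c' b1] := mb_L1 (hE g1) m2 cm (mb_subr m1 (hE g1) cm (mb_sub (complete_sigma_meas cs) brho) bRm).
  have [C5 C51 hC5] := embedding_bound H g01; have C50 : 0 <= C5 by exact: le_trans C51.
  exact: (orth_op (T := idfun) (hE g1) (hE g0) cs C50 (opnorm_embedding hH C50 hC5) b1 orho).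
set W := M * (1 + L ^+ 2) * l `^ k.
have lk : l `^ (2 * a + b') <= c * l `^ k.
  have -> : c = T0 `^ (2 * a + b' - k) by congr (_ `^ _); ring.
  exact: powR_interval.
have la := powR_ge0 l a; have lka := powR_ge0 l k; have l2a := powR_ge0 l (2 * a).
have W0 : 0 <= W by rewrite !mulr_ge0// addr_ge0// sqr_ge0.
exists (fun w => (prop S s u (lapp (Y s w) x2) - lapp (Y s w) x2) +
  (prop S s u (lapp (lapp (Y' s w) x1) x2) - lapp (lapp (Y' s w) x1) x2) +
  (prop S s u (lapp2 (Y' s w) (XX u t)) - lapp2 (Y' s w) (XX u t)) -
  lapp (rho w) x2 - lapp2 (Y' u w - Y' s w) (XX u t)),
  (fun w => lapp (rho w - remainder X Y Y' s u w) x2); split.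
- by apply: aeW => w; rewrite (bracket_identity rb _ (rho w) s0 su ut tT).
- have d1 := hC1 _ _ _ _ s u s0 su uT cu (mb_lapp x2 cu bY).
  have d2 := hC2 _ _ _ _ s u s0 su uT cu (mb_lapp x2 cu (mb_lapp' x1 cu bY')).
  have d3 := hC2 _ _ _ _ s u s0 su uT cu (mb_lapp2 (XX u t) cu bY').
  have d4 := mb_lapp x2 cu brho0.
  have d5 := mb_lapp2 (XX u t) cu (rb_dY' rb s0 su uT).
  apply: mb_le (mb_subr m1 (hH g0) cu (mb_subr m1 (hH g0) cu (mb_add m1 (hH g0) cu (mb_add m1 (hH g0) cu d1 d2) d3) d4) d5).
  have -> : g - g0 = b + b' by ring.
  have -> : g1 - g0 = b' by ring.
  have p1 : (u - s) `^ (b + b') * eucl x2 <= (1 + L ^+ 2) * l `^ k.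
    apply: le_trans (_ : l `^ (b + b') * (L * l `^ a) <= _).
      by apply: ler_pM; rewrite ?powR_ge0 ?eucl_ge0// us// addr_ge0// ltW.
    rewrite mulrCA powR_add; last by rewrite !addr_gt0.
    have -> : b + b' + a = k by ring.
    exact: ler_wpM2r.
  have la2 : l `^ a * l `^ a = l `^ (2 * a) by rewrite powR_add ?addr_gt0// mulr_natl mulr2n.
  have lb2 : l `^ b' * l `^ (2 * a) = l `^ (2 * a + b') by rewrite powR_add 1?addrC// addr_gt0// mulr_gt0.
  have p2 : (u - s) `^ b' * (eucl x2 * eucl x1) <= (1 + L ^+ 2) * (c * l `^ k).
    apply: le_trans (_ : l `^ b' * ((L * l `^ a) * (L * l `^ a)) <= _).
      apply: ler_pM; rewrite ?powR_ge0 ?mulr_ge0 ?eucl_ge0//; first by apply: us; exact: ltW.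
      by apply: ler_pM; rewrite ?eucl_ge0.
    rewrite mulrACA la2 mulrCA lb2; apply: ler_pM => //; first by rewrite mulr_ge0.
    exact: powR_ge0.
  have p3 : (u - s) `^ b' * eucl (XX u t) <= (1 + L ^+ 2) * (c * l `^ k).
    apply: le_trans (_ : l `^ b' * (L * l `^ (2 * a)) <= _).
      by apply: ler_pM; rewrite ?powR_ge0 ?eucl_ge0//; apply: us; exact: ltW.
    by rewrite mulrCA lb2; apply: ler_pM => //; exact: powR_ge0.
  by apply: bracket_drift_le => //; exact: le_trans L1.
- have d := mb_lapp x2 cu (mb_subr m1 (hE g1) cu (mb_sub Fsu brho) bR).
  apply: mb_le d.
  have p1 : (u - s) `^ b * eucl x2 <= L * l `^ (a + b).
    apply: le_trans (_ : l `^ b * (L * l `^ a) <= _).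
      by apply: ler_pM; rewrite ?powR_ge0 ?eucl_ge0//; apply: us; exact: ltW.
    by rewrite mulrCA powR_add ?addr_gt0// [b + a]addrC.
  have p2 : (1 + L) * ((u - s) `^ b * eucl x2) <= 2 * (1 + L ^+ 2) * l `^ (a + b).
    apply: le_trans (_ : (1 + L) * (L * l `^ (a + b)) <= _).
      by apply: ler_wpM2l => //; rewrite addr_ge0.
    rewrite mulrA; apply: ler_wpM2r; first exact: powR_ge0.
    exact: L4.
  apply: bracket_noise_le => //; [exact: le_trans L1|exact: powR_ge0].
have [c' b1] := mb_L1 (hE g1) m2 cm (mb_subr m1 (hE g1) cm (mb_sub (complete_sigma_meas cs) brho) bRm).
apply: (orth_op (T := lapp_at x2) (C := E * eucl x2) (hE g1) (hH g1) cs _ _ b1 orho).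
  by rewrite mulr_ge0 ?eucl_ge0.
by move=> A fA; exact: (norm_lapp (hH g1)).
Qed.

End RoughGerm.

(** * Measurable versions of processes *)

Section CondexpPaths.
Variables (R : realType) (d : measure_display) (Omega : measurableType d).
Variables (P : probability Omega R).
Variables (W : lmodType R) (N : R -> W -> \bar R) (g : R) (ip : W -> W -> R) (K : R).
Hypothesis hN : hilb (N g) ip K.
Local Notation cs := (complete_sigma P).
Local Notation L2 := (mb P 2 N g).
Local Notation q := (qn ip).
Local Notation orthg := (orth P N g ip).
Implicit Types (G : set (set Omega)).
Let le12 : (1 : R) <= 2. Proof. by rewrite ler1n. Qed.

Lemma sqr_eq0_small (B C : R) : 0 <= C -> (forall t, 2 * t * B <= t ^+ 2 * C) -> B = 0.
Proof.
move=> C0 h; have C1 : 0 < C + 1 by rewrite ltr_wpDl.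
have := h (B / (C + 1)).
have -> : 2 * (B / (C + 1)) * B = 2 * B ^+ 2 / (C + 1) by ring.
have -> : (B / (C + 1)) ^+ 2 * C = B ^+ 2 * C / (C + 1) ^+ 2 by field; exact: lt0r_neq0.
rewrite ler_pdivrMr// => h1.
have e : B ^+ 2 * C / (C + 1) ^+ 2 * (C + 1) = B ^+ 2 * (C / (C + 1)) by field; exact: lt0r_neq0.
rewrite e in h1; have : C / (C + 1) <= 1 by rewrite ler_pdivrMr// mul1r lerDl.
have B2 := sqr_ge0 B; move=> /(ler_wpM2l B2); rewrite mulr1 => h2.
by apply/eqP; rewrite -sqrf_eq0 eq_le B2 andbT; lra.
Qed.

(** Extends orthogonality from fixed vectors on events to all [G]-measurable factors of L^2. A step
    function [h] close to [x] contributes nothing to the mean B, and the positivity of the mean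
    square of x - h - t y gives 2 t B <= e + t^2 C for every [e]. *)
Lemma orth_ip G x y c c' : cs G -> L2 G x c -> L2 measurable y c' -> orthg G y ->
  mean P (fun w => ip (x w) (y w)) = 0.
Proof.
move=> cG bx by_ oy; have cm := complete_measurable cG.
have up z r : L2 G z r -> L2 measurable z r by apply: mb_sub; exact: (complete_sigma_meas cG).
set B := mean _ _; pose C := mean P (fun w => q (y w) ^+ 2).
have C0 : 0 <= C by apply: mean_ge0 => w; exact: sqr_ge0.
apply: (sqr_eq0_small C0) => t; apply/ler_addgt0Pr => e e0.
have K0' : 0 < K by exact: K0 hN.
pose dl := Num.min 1 (e / K ^+ 2).
have K2 : 0 < K ^+ 2 by rewrite exprn_gt0.
have d0 : 0 < dl by rewrite lt_min ltr01 divr_gt0.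
have [h [sh rh ah]] := step_rv_dist hN cG (mb_rv bx) d0.
have bd : L2 G (fun w => x w - h w) dl.
  apply: (mb_bound le12 hN cG (rv_subr hN cG (mb_rv bx) rh) (ltW d0)).
  by apply: ae1 ah _ => w /ltW.
have bh : L2 G h (c + dl).
  apply: (mb_ae le12 hN cG _ (mb_subr le12 hN cG bx bd)).
  by apply: aeW => w; rewrite subKr.
have ih := ip_integrable hN cm (up _ _ bh) by_.
have ix := ip_integrable hN cm (up _ _ bx) by_.
have h0 := orth_step cG sh (mb_rv by_) ih oy.
have BE : mean P (fun w => ip (x w - h w) (y w)) = B.
  transitivity (mean P (fun w => ip (x w) (y w) + (-1) * ip (h w) (y w))).
    apply: mean_ae.
    - exact: (ip_meas hN cm (rv_subr hN cm (mb_rv (up _ _ bx)) (mb_rv (up _ _ bh))) (mb_rv by_)).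
    - apply: measurable_funD; first exact: (ip_meas hN cm (mb_rv (up _ _ bx)) (mb_rv by_)).
      by apply: measurable_funM => //; exact: (ip_meas hN cm (mb_rv (up _ _ bh)) (mb_rv by_)).
    apply: ae2 (rv_fin (mb_rv bx)) (ae2 (rv_fin (mb_rv bh)) (rv_fin (mb_rv by_)) (fun w => @conj _ _)) _.
    by move=> w fx [fh fy]; rewrite (ipBl hN)// mulN1r.
  by rewrite (mean_lin _ ix ih) /mean h0 mulr0 addr0.
have := mean_sqr_expand hN t cm (up _ _ bd) by_; rewrite BE -/C => E.
have := mean_ge0 P (fun w => sqr_ge0 (q (x w - h w - t *: y w))); rewrite E => p.
have : mean P (fun w => q (x w - h w) ^+ 2) <= e.
  have i := sqr_integrable hN cG bd; have le := sqr_int hN cG bd.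
  rewrite -lee_fin -meanE//; apply: le_trans le _.
  rewrite lee_fin exprMn; have dl1 : dl <= 1 by rewrite ge_min lexx.
  have dl2 : dl <= e / K ^+ 2 by rewrite ge_min lexx orbT.
  apply: le_trans (_ : K ^+ 2 * dl <= _).
    by apply: ler_wpM2l; [exact: ltW|rewrite expr2 ler_piMl// ltW].
  by rewrite mulrC -ler_pdivlMr.
lra.
Qed.

Section Filtration.
Variables (T : R) (F : R -> set (set Omega)).
Hypothesis T0 : 0 <= T.
Hypothesis cF : forall t, 0 <= t -> t <= T -> cs (F t).
Hypothesis mF : forall s t, 0 <= s -> s <= t -> t <= T -> F s `<=` F t.
Local Notation ce t := (condexp P N g (F t)).

(** Pythagoras: the increment of the martingale E_s xi is orthogonal to its value at the earlier
    time. *)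
Lemma condexp_energy xi c s t : L2 measurable xi c -> 0 <= s -> s <= t -> t <= T ->
  mean P (fun w => q (ce t xi w - ce s xi w) ^+ 2) =
  mean P (fun w => q (ce t xi w) ^+ 2) - mean P (fun w => q (ce s xi w) ^+ 2).
Proof.
move=> bx s0 st tT; have t0 := le_trans s0 st; have sT := le_trans st tT.
have cs_ := cF s0 sT; have ct := cF t0 tT; have cm := complete_measurable ct.
have [bs os] := condexpP hN (lexx 2) cs_ bx; have [bt ot] := condexpP hN (lexx 2) ct bx.
have ups z r : L2 (F s) z r -> L2 measurable z r by apply: mb_sub; exact: (complete_sigma_meas cs_).
have upt z r : L2 (F t) z r -> L2 measurable z r by apply: mb_sub; exact: (complete_sigma_meas ct).
have ot' := orth_sub (mF s0 st tT) ot.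
have od := orthB hN (lexx 2) cs_ (mb_subr le12 hN cm (ups _ _ bs) bx) (mb_subr le12 hN cm (upt _ _ bt) bx) os ot'.
have bd := mb_subr le12 hN cm (ups _ _ bs) (upt _ _ bt).
have {}od : orthg (F s) (fun w => ce s xi w - ce t xi w).
  apply: (orth_ae hN cs_ _ _ od).
    exact: mb_rv (mb_subr le12 hN cm (mb_subr le12 hN cm (ups _ _ bs) bx) (mb_subr le12 hN cm (upt _ _ bt) bx)).
  by apply: aeW => w; rewrite opprB addrA subrK.
have e1 := orth_ip cs_ bs bd od.
have e2 : mean P (fun w => ip (ce t xi w) (ce s xi w)) = mean P (fun w => q (ce s xi w) ^+ 2).
  apply/eqP; rewrite eq_sym -subr_eq0; apply/eqP; rewrite -[RHS]e1.
  transitivity (mean P (fun w => q (ce s xi w) ^+ 2 + (-1) * ip (ce t xi w) (ce s xi w))).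
    rewrite mean_lin ?mulN1r//; first exact: (sqr_integrable hN cs_ bs).
    exact: (ip_integrable hN cm (upt _ _ bt) (ups _ _ bs)).
  apply: mean_ae.
  - apply: measurable_funD; first by apply: measurable_funX; exact: (qn_meas hN cs_ (mb_rv bs)).
    by apply: measurable_funM => //; exact: (ip_meas hN cm (mb_rv (upt _ _ bt)) (mb_rv (ups _ _ bs))).
  - exact: (ip_meas hN cm (mb_rv (ups _ _ bs)) (mb_rv bd)).
  apply: ae2 (rv_fin (mb_rv bs)) (rv_fin (mb_rv bt)) _ => w fs ft.
  by rewrite (ipBr hN)// (qn_sqr hN)// mulN1r (hilb_ipC hN ft fs).
have := mean_sqr_expand hN 1 cm (upt _ _ bt) (ups _ _ bs).
rewrite e2 expr1n mul1r mulr1.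
under [X in mean P X = _]funext do rewrite scale1r.
by move=> ->; ring.
Qed.

(** Extends the energy to a monotone function on the whole line, so that its level sets are
    measurable there. *)
Definition clamp_time s := Num.min T (Num.max 0 s).

Lemma clamp_time_in s : 0 <= clamp_time s /\ clamp_time s <= T.
Proof. by rewrite /clamp_time ge_min lexx le_min le_max lexx T0. Qed.

Lemma clamp_time_mono s t : s <= t -> clamp_time s <= clamp_time t.
Proof.
move=> st; rewrite le_min ge_min lexx/= ge_min; apply/orP; right.
by rewrite ge_max !le_max lexx st orbT.
Qed.

Lemma clamp_time_id s : 0 <= s -> s <= T -> clamp_time s = s.
Proof. by move=> s0 sT; rewrite /clamp_time (max_idPr s0) (min_idPr sT). Qed.

Definition energy xi s := mean P (fun w => q (ce (clamp_time s) xi w) ^+ 2).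

Lemma energy_mono xi c : L2 measurable xi c -> nondecreasing_fun (energy xi).
Proof.
move=> bx s t st; have [s0 sT] := clamp_time_in s; have [t0 tT] := clamp_time_in t.
have := condexp_energy bx s0 (clamp_time_mono st) tT; rewrite -/(energy xi s) -/(energy xi t) => e.
rewrite -subr_ge0 -e; apply: mean_ge0 => w; exact: sqr_ge0.
Qed.

Lemma energy_close xi c s t r : L2 measurable xi c -> 0 <= s -> s <= T -> 0 <= t -> t <= T -> 0 <= r ->
  `|energy xi s - energy xi t| <= r ^+ 2 -> L2 measurable (fun w => ce s xi w - ce t xi w) (K * r).
Proof.
move=> bx + + + + r0; wlog st : s t / t <= s => [wl|] s0 sT t0 tT h.
  have [ts|/ltW st] := leP t s; first exact: wl.
  have := wl t s st t0 tT s0 sT; rewrite distrC => /(_ h) b.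
  have cm := complete_measurable (cF s0 sT).
  apply: (mb_ae le12 hN cm _ (mb_opp le12 hN cm b)); by apply: aeW => w; rewrite opprB.
have cm := complete_measurable (cF s0 sT).
have [bs _] := condexpP hN (lexx 2) (cF s0 sT) bx; have [bt _] := condexpP hN (lexx 2) (cF t0 tT) bx.
have bd := mb_subr le12 hN cm (mb_sub (complete_sigma_meas (cF s0 sT)) bs) (mb_sub (complete_sigma_meas (cF t0 tT)) bt).
apply: (mean_sqr_mb hN cm bd r0); rewrite (condexp_energy bx t0 st sT).
move: h; rewrite /energy !clamp_time_id// => h; exact: le_trans (ler_norm _) h.
Qed.

End Filtration.
End CondexpPaths.

Lemma truncn_level_measurable (R : realType) (f : R -> R) (l : nat) : nondecreasing_fun f ->
  measurable ([set x | Num.truncn (f x) = l] : set (measurableTypeR R)).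
Proof.
move=> nf; have : measurable_fun setT (fun x : R => (Num.truncn (f x))%:R : R).
  apply: nondecreasing_measurable => // x y xy; rewrite ler_nat.
  exact: le_truncn (nf _ _ xy).
move=> /(_ measurableT [set l%:R] (measurable_set1 _)); rewrite setTI.
congr (measurable _); apply/seteqP; split=> x /=; last by move=> ->.
by move=> /eqP; rewrite eqr_nat => /eqP.
Qed.

Lemma simplex2_measurable (R : realType) (T : R) :
  measurable (simplex2 T : set (measurableTypeR R * measurableTypeR R)).
Proof.
rewrite (_ : simplex2 T = [set p | 0 <= p.1] `&` ([set p | p.1 <= p.2] `&` [set p | p.2 <= T]))//.
have m1 : measurable_fun setT (fst : measurableTypeR R * measurableTypeR R -> R) by exact: measurable_fst.
have m2 : measurable_fun setT (snd : measurableTypeR R * measurableTypeR R -> R) by exact: measurable_snd.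
apply: measurableI; [|apply: measurableI]; rewrite -[X in measurable X]setTI; exact: measurable_fun_ler.
Qed.

Lemma measurable_fst_set (R : realType) (A : set (measurableTypeR R)) : measurable A ->
  measurable ([set p | A p.1] : set (measurableTypeR R * measurableTypeR R)).
Proof.
move=> mA; have := @measurable_fst _ _ (measurableTypeR R) (measurableTypeR R) measurableT A mA.
by rewrite setTI.
Qed.

Lemma measurable_snd_set (R : realType) (A : set (measurableTypeR R)) : measurable A ->
  measurable ([set p | A p.2] : set (measurableTypeR R * measurableTypeR R)).
Proof.
move=> mA; have := @measurable_snd _ _ (measurableTypeR R) (measurableTypeR R) measurableT A mA.
by rewrite setTI.
Qed.

Lemma truncn_close (R : realType) (h x y : R) : 0 < h -> 0 <= x -> 0 <= y ->
  Num.truncn (x / h) = Num.truncn (y / h) -> `|x - y| <= h.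
Proof.
move=> h0 x0 y0 xy; have /andP[] := truncn_itv (divr_ge0 y0 (ltW h0)); rewrite -xy.
have /andP[] := truncn_itv (divr_ge0 x0 (ltW h0)); move: (Num.truncn _) => n.
rewrite !ler_pdivlMr// !ltr_pdivrMr// -natr1 mulrDl mul1r; move: (_ * h) => z.
by rewrite ler_norml; lra.
Qed.

Section CondexpVersion.
Variables (R : realType) (d : measure_display) (Omega : measurableType d).
Variables (P : probability Omega R).
Variables (W : lmodType R) (N : R -> W -> \bar R) (g : R) (ip : W -> W -> R) (K : R).
Hypothesis hN : hilb (N g) ip K.
Variables (m : R).
Hypothesis m2 : 2 <= m.
Variables (T : R) (F : R -> set (set Omega)).
Hypothesis T0 : 0 <= T.
Hypothesis cF : forall t, 0 <= t -> t <= T -> complete_sigma P (F t).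
Hypothesis mF : forall s t, 0 <= s -> s <= t -> t <= T -> F s `<=` F t.
Let le12 : (1 : R) <= 2. Proof. by rewrite ler1n. Qed.
Let cm : complete_sigma P measurable. Proof. exact: (complete_measurable (cF (lexx 0) T0)). Qed.
Local Notation J := (measurableTypeR R * measurableTypeR R)%type.
Local Notation ce t := (condexp P N g (F t)).
Local Notation mbm := (mb P m N g measurable).
Local Notation L2m := (mb P 2 N g measurable).

Lemma condexp_sub s xi zeta c c' r : 0 <= s -> s <= T -> mbm xi c -> mbm zeta c' -> 0 < r ->
  mbm (fun w => xi w - zeta w) r ->
  L2m (fun w => ce s xi w - ce s zeta w) (4 * K ^+ 2 * (2 * r)).
Proof.
move=> s0 sT bx bz r0 bd; have cs := cF s0 sT.
have bx2 := mb_exponent_bound hN le12 m2 cm bx; have bz2 := mb_exponent_bound hN le12 m2 cm bz.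
have bd2 := mb_exponent_le hN le12 m2 cm r0 bd.
have [b1 o1] := condexpP hN (lexx 2) cs bx2; have [b2 o2] := condexpP hN (lexx 2) cs bz2.
have up y x : mb P 2 N g (F s) y x -> L2m y x by apply: mb_sub; exact: (complete_sigma_meas cs).
apply: mb_sub (complete_sigma_meas cs) _.
apply: (condexp_contraction hN (lexx 2) cs (rv_subr hN cs (mb_rv b1) (mb_rv b2)) _ bd2).
  exact: (mb_L1 hN (lexx 2) cm (mb_subr le12 hN cm (up _ _ b1) (up _ _ b2))).
have d1 := mb_subr le12 hN cm (up _ _ b1) bx2; have d2 := mb_subr le12 hN cm (up _ _ b2) bz2.
apply: (orth_ae hN cs _ _ (orthB hN (lexx 2) cs d1 d2 o1 o2)).
  exact: mb_rv (mb_subr le12 hN cm d1 d2).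
by apply: aeW => w; rewrite !opprB [LHS]addrACA [RHS]addrACA [- xi w + _]addrC.
Qed.

(* In the time variable of the filtration, [s |-> E_s xi] need not be continuous;
   but [s |-> E |E_s xi|^2] is monotone and controls its increments in L^2, so the
   level sets of this function are a measurable partition of the time interval. *)
Lemma condexp_version (A : R -> R -> Omega -> W) (c C nu : R) : 0 < nu -> 0 <= C ->
  (forall s t, simplex2 T (s, t) -> mbm (A s t) c) ->
  (forall s t s' t', simplex2 T (s, t) -> simplex2 T (s', t') ->
     mbm (fun w => A s t w - A s' t' w) (C * (`|s - s'| `^ nu + `|t - t'| `^ nu))) ->
  exists2 A' : J -> Omega -> W,
    borel_on N g (simplex2 T `*` setT) (measurable : set (set (J * Omega)%type))
      (fun p : J * Omega => A' p.1 p.2) &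
    forall p : J, simplex2 T p -> aeeq P (ce p.1 (A p.1 p.2)) (A' p).
Proof.
move=> nu0 C0 bA dA.
apply: (joint_version le12 hN (@simplex2_measurable R T) cm (A := fun p : J => ce p.1 (A p.1 p.2))).
move=> n; set e := (8 ^+ n.+1)^-1; have e0 : 0 < e by rewrite invr_gt0 exprn_gt0.
have K1 := hilb_K hN; have K00 : 0 < K by exact: lt_le_trans K1.
have K2 : 0 < K ^+ 2 by rewrite exprn_gt0.
(* [r0] bounds the oscillation of [A] on a cell, [r1 ^ 2] that of the energy *)
pose r0 := e / (32 * K ^+ 2); have r00 : 0 < r0 by rewrite divr_gt0// mulr_gt0.
pose r1 := e / (4 * K); have r10 : 0 < r1 by rewrite divr_gt0// mulr_gt0.
(* The size of the time cells, for which 2 C h^nu <= r0; the 1 in the divisor covers C = 0. *)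
pose h := (r0 / (2 * C + 1)) `^ nu^-1.
have C10 : 0 < 2 * C + 1 by rewrite ltr_wpDl// mulr_ge0.
have h0 : 0 < h by rewrite powR_gt0// divr_gt0.
have hnu : h `^ nu = r0 / (2 * C + 1).
  by rewrite -powRrM mulVf ?gt_eqF// powRr1// ltW// divr_gt0.
have [cell cellE] : exists cell : R -> nat, cell = (fun x => Num.truncn (x / h)) by eexists.
have cellP x y : 0 <= x -> 0 <= y -> cell x = cell y -> `|x - y| <= h.
  by rewrite cellE; exact: truncn_close.
have osc s t s' t' : simplex2 T (s, t) -> simplex2 T (s', t') -> cell s = cell s' -> cell t = cell t' ->
    mbm (fun w => A s t w - A s' t' w) r0.
  move=> D1 D2 c1 c2; apply: mb_le (dA _ _ _ _ D1 D2).
  have [s0 [st tT]] := D1; have [s0' [st' tT']] := D2; rewrite /= in s0 st tT s0' st' tT'.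
  have q1 : `|s - s'| `^ nu <= h `^ nu by apply: powR_le => //; [exact: ltW|exact: cellP].
  have q2 : `|t - t'| `^ nu <= h `^ nu.
    by apply: powR_le => //; [exact: ltW|apply: cellP => //; [exact: le_trans s0 st|exact: le_trans s0' st']].
  apply: le_trans (_ : C * (h `^ nu + h `^ nu) <= _); first by apply: ler_wpM2l => //; exact: lerD.
  rewrite hnu (_ : C * (r0 / (2 * C + 1) + r0 / (2 * C + 1)) = r0 * (2 * C) / (2 * C + 1)); last by ring.
  by rewrite ler_pdivrMr//; apply: ler_wpM2l; [exact: ltW|rewrite lerDl].
pose inD (ij : nat * nat) (p : J) := simplex2 T p /\ (cell p.1, cell p.2) = ij.
(* One pair of times per cell. The default (0, 0) serves the cells that miss the simplex, and
   belongs to the simplex itself. *)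
pose rep ij : J := xget (0, 0) (inD ij).
have repD ij : simplex2 T (rep ij).
  by rewrite /rep; case: xgetP => [p _ []//|_]; split=> //=.
pose xi ij := A (rep ij).1 (rep ij).2.
have bxi ij : mbm (xi ij) c by apply: bA; have := repD ij; case: (rep ij).
have bxi2 ij := mb_exponent_bound hN le12 m2 cm (bxi ij).
pose ph ij s := energy P N g ip T F (xi ij) s.
have r12 : 0 < r1 ^+ 2 by rewrite exprn_gt0.
have ph0 ij s : 0 <= ph ij s by apply: mean_ge0 => w; exact: sqr_ge0.
have [lev levE] : exists lev : nat * nat -> R -> nat, lev = (fun ij s => Num.truncn (ph ij s / r1 ^+ 2)).
  by eexists.
have levP ij s t : lev ij s = lev ij t -> `|ph ij s - ph ij t| <= r1 ^+ 2.
  by rewrite levE; exact: truncn_close.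
(* Besides the cells of both times, the code records the energy level at [s] of the fixed variable
   attached to these cells. On a level set of the code both [A] and the conditioning vary little. *)
pose code (p : J) : nat := pickle ((cell p.1, cell p.2), lev (cell p.1, cell p.2) p.1).
pose pt i : J := xget (0, 0) [set p | simplex2 T p /\ code p = i].
exists code, (fun i => ce (pt i).1 (A (pt i).1 (pt i).2)); split=> i.
  have [[p0 p0i]|np] := pselect (exists p, code p = i); last first.
    rewrite (_ : _ `&` _ = set0)//; apply/seteqP; split=> // p [_ /= pi]; apply: np; by exists p.
  pose i1 := cell p0.1; pose i2 := cell p0.2; pose l := lev (i1, i2) p0.1.
  have -> : simplex2 T `&` code @^-1` [set i] =
      simplex2 T `&` ([set p | ([set x | cell x = i1] `&` [set x | lev (i1, i2) x = l]) p.1] `&`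
        [set p | [set x | cell x = i2] p.2]).
    rewrite -p0i; apply/seteqP; split=> p /= [pD].
      by move=> /(pcan_inj pickleK)[e1 e2 e3]; move: e3; rewrite e1 e2.
    by move=> [[e1 e2] e3]; split=> //; rewrite /code e1 e3 e2.
  apply: measurableI; first exact: simplex2_measurable.
  have mc j : measurable ([set x | cell x = j] : set (measurableTypeR R)).
    by rewrite cellE; apply: truncn_level_measurable => x y xy; apply: ler_wpM2r => //; rewrite invr_ge0 ltW.
  apply: measurableI; last exact: (measurable_snd_set (mc i2)).
  apply: measurable_fst_set; apply: measurableI; first exact: mc.
  rewrite levE; apply: truncn_level_measurable => x y xy; apply: ler_wpM2r; first by rewrite invr_ge0 ltW.
  exact: (energy_mono hN T0 cF mF (bxi2 _)).
have ptD : simplex2 T (pt i).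
  by rewrite /pt; case: xgetP => [p _ []//|_]; split=> //=.
have [s0 [st tT]] := ptD; split.
  have b := mb_exponent_bound hN le12 m2 cm (bA (pt i).1 (pt i).2 ltac:(by move: ptD; case: (pt i))).
  have sT := le_trans st tT.
  by have [/mb_rv b' _] := condexpP hN (lexx 2) (cF s0 sT) b; apply: rv_sub b'; exact: (complete_sigma_meas (cF s0 sT)).
move=> p pD pc.
have : code (pt i) = i.
  by rewrite /pt; case: xgetP => [y _ []//|/(_ p)]; case; split.
rewrite -pc => /(pcan_inj pickleK)[c1 c2 c3]; rewrite pc in c1 c2 c3.
set ij := (cell p.1, cell p.2).
have [repI repE] : inD ij (rep ij) by rewrite /rep; case: xgetP => [y _ //|/(_ p)]; case; split.
case: repE => r1E r2E.
have [p0 [p1 p2]] := pD.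
have sT := le_trans st tT; have pT := le_trans p1 p2.
have D' (x : J) : simplex2 T x -> simplex2 T (x.1, x.2) by case: x.
(* From [p] to the chosen point of the same code in three moves: replace A_p by [xi ij], change the
   conditioning time, replace [xi ij] by the value of [A] at the chosen point. By the choice of [r0]
   and [r1] each costs e / 4. *)
have o1 : mbm (fun w => A p.1 p.2 w - xi ij w) r0 by apply: osc; [exact: D'|exact: D'|rewrite r1E|rewrite r2E].
have o2 : mbm (fun w => xi ij w - A (pt i).1 (pt i).2 w) r0.
  by apply: osc; [exact: D'|exact: D'|rewrite r1E c1|rewrite r2E c2].
have d1 := condexp_sub p0 pT (bA _ _ (D' _ pD)) (bxi ij) r00 o1.
have d3 := condexp_sub s0 sT (bxi ij) (bA _ _ (D' _ ptD)) r00 o2.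
have d2 : L2m (fun w => ce p.1 (xi ij) w - ce (pt i).1 (xi ij) w) (K * r1).
  apply: (energy_close hN cF mF (bxi2 ij) p0 pT s0 sT (ltW r10)); apply: levP.
  by move: c3; rewrite c1 c2.
apply: (mb_ae le12 hN cm _ (mb_le _ (mb_add le12 hN cm (mb_add le12 hN cm d1 d2) d3))).
  by apply: aeW => w /=; rewrite !addrA !subrK pc.
rewrite /r0 /r1 (_ : 4 * K ^+ 2 * (2 * (e / (32 * K ^+ 2))) = e / 4); last by field; exact: lt0r_neq0.
rewrite (_ : K * (e / (4 * K)) = e / 4); last by field; exact: lt0r_neq0.
lra.
Qed.

Lemma condexp_measurable xi c : mbm xi c -> aeeq P (condexp P N g measurable xi) xi.
Proof.
move=> b; apply: (condexp_eq hN m2 cm b b) => B GB v fv; apply: integral0_eq => w _.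
by rewrite subrr (hilb_ipC hN fv (fin0 hN)) (ip0l hN).
Qed.

Lemma Econd_meas_adapted2 (A : R -> R -> Omega -> W) (c C nu : R) : 0 < nu -> 0 <= C ->
  (forall s t, simplex2 T (s, t) -> mbm (A s t) c) ->
  (forall s t s' t', simplex2 T (s, t) -> simplex2 T (s', t') ->
     mbm (fun w => A s t w - A s' t' w) (C * (`|s - s'| `^ nu + `|t - t'| `^ nu))) ->
  meas_adapted2 P T F N g (Econd P F N g A).
Proof.
move=> nu0 C0 bA dA; have [A' mA aA] := condexp_version nu0 C0 bA dA.
exists (fun s t => A' (s, t)); first by move=> s t D; exact: (aA (s, t) D).
have mA' : borel_on N g (simplex2 T `*` setT)
    (measurable : set (set (measurableTypeR R * measurableTypeR R * Omega)%type))
    (fun p : R * R * Omega => A' (p.1.1, p.1.2) p.2).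
  rewrite (_ : (fun p => _) = (fun p : J * Omega => A' p.1 p.2))//.
  by apply/funext => -[[x y] z].
split=> // s t D; have [s0 [st tT]] := D; rewrite /= in s0 st tT.
have sT := le_trans st tT; have t0 := le_trans s0 st.
have fA w : (N g (A' (s, t) w) < +oo)%E by exact: (mA'.1 (s, t, w)).
apply: (rv_borel (cF t0 tT) _ fA).
apply: rv_sub (mF s0 st tT) _.
apply: (rv_ae _ (mb_rv (condexpP hN m2 (cF s0 sT) (bA _ _ D)).1)).
by have := aA (s, t) D => h; apply: ae1 h _ => w ->.
Qed.

End CondexpVersion.

Section ProcessVersion.
Variables (R : realType) (d : measure_display) (Omega : measurableType d).
Variables (P : probability Omega R).
Variables (W : lmodType R) (N : R -> W -> \bar R) (g : R) (ip : W -> W -> R) (K : R).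
Hypothesis hN : hilb (N g) ip K.
Variables (m : R).
Hypothesis m2 : 2 <= m.
Variables (T : R) (F : R -> set (set Omega)).
Hypothesis T0 : 0 <= T.
Hypothesis cF : forall t, 0 <= t -> t <= T -> complete_sigma P (F t).
Let cm : complete_sigma P measurable. Proof. exact: (complete_measurable (cF (lexx 0) T0)). Qed.
Local Notation mbm := (mb P m N g measurable).

(** For the constant filtration of all measurable sets the conditional expectation is the identity,
    so the construction for E_s A applies to [A] itself; adaptedness of the version follows at each
    pair by completeness. *)
Lemma continuous_meas_adapted2 (A : R -> R -> Omega -> W) (c C nu : R) : 0 < nu -> 0 <= C ->
  (forall s t, simplex2 T (s, t) -> mb P m N g (F t) (A s t) c) ->
  (forall s t s' t', simplex2 T (s, t) -> simplex2 T (s', t') ->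
     mbm (fun w => A s t w - A s' t' w) (C * (`|s - s'| `^ nu + `|t - t'| `^ nu))) ->
  meas_adapted2 P T F N g A.
Proof.
move=> nu0 C0 bA dA.
have bAm s t : simplex2 T (s, t) -> mbm (A s t) c.
  move=> D; have [s0 [st tT]] := D; apply: mb_sub (bA _ _ D).
  exact: (complete_sigma_meas (cF (le_trans s0 st) tT)).
have [A' aA mA] := Econd_meas_adapted2 hN m2 T0 (F := fun=> measurable)
  (fun _ _ _ => cm) (fun _ _ _ _ _ => @subset_refl _ _) nu0 C0 bAm dA.
have aA' s t : simplex2 T (s, t) -> aeeq P (A s t) (A' s t).
  move=> D; apply: ae2 (condexp_measurable hN m2 T0 (F := fun=> measurable) (fun _ _ _ => cm) (bAm _ _ D)) (aA _ _ D) _.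
  by move=> w <-.
exists A' => //; case: mA => mA _; split=> // s t D; have [s0 [st tT]] := D; rewrite /= in s0 st tT.
have fA w : (N g (A' s t w) < +oo)%E by exact: (mA.1 (s, t, w)).
apply: (rv_borel (cF (le_trans s0 st) tT) _ fA).
apply: (rv_ae _ (mb_rv (bA _ _ D))).
by have := aA' s t D => h; apply: ae1 h _ => w ->.
Qed.

Lemma continuous_meas_adapted (Z : R -> Omega -> W) (c C nu : R) : 0 < nu -> 0 <= C ->
  (forall t, 0 <= t -> t <= T -> mb P m N g (F t) (Z t) c) ->
  (forall s t, 0 <= s -> s <= t -> t <= T ->
     mbm (fun w => Z t w - Z s w) (C * (t - s) `^ nu)) ->
  meas_adapted P T F N g Z.
Proof.
move=> nu0 C0 bZ dZ; have m1 : 1 <= m by apply: le_trans m2; rewrite ler1n.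
have [|s t s' t'|A' aA [mA bA]] := @continuous_meas_adapted2 (fun s t => Z t) c C nu nu0 C0.
- by move=> s t [s0 [st tT]]; apply: bZ => //; exact: le_trans s0 st.
- move=> [s0 [st tT]] [s0' [st' tT']]; rewrite /= in s0 st tT s0' st' tT'.
  have t0 := le_trans s0 st; have t0' := le_trans s0' st'.
  apply: (@mb_le _ _ _ _ _ _ _ _ _ _ (C * `|t - t'| `^ nu)).
    by apply: ler_wpM2l => //; rewrite lerDr powR_ge0.
  have [tt|tt] := leP t' t.
    by rewrite ger0_norm ?subr_ge0//; exact: dZ.
  rewrite distrC ger0_norm ?subr_ge0 ?(ltW tt)//.
  apply: (mb_ae m1 hN cm _ (mb_opp m1 hN cm (dZ _ _ t0 (ltW tt) tT'))).
  by apply: aeW => w; rewrite opprB.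
exists (fun t => A' 0 t); first by move=> t /andP[t0 tT]; apply: aA.
split; last by move=> t /andP[t0 tT]; exact: bA.
split; first by move=> [t w] [/= + _]; rewrite in_itv/= => /andP[t0 tT]; apply: (mA.1 (0, t, w)).
move=> U oU; have := mA.2 U oU => mU.
have mf : measurable_fun setT (fun p : measurableTypeR R * Omega => ((0, p.1), p.2) : measurableTypeR R * measurableTypeR R * Omega).
  apply: measurable_fun_pair; last exact: measurable_snd.
  by apply: measurable_fun_pair; [exact: measurable_cst|exact: measurable_fst].
have := mf measurableT _ mU; rewrite setTI; congr (measurable _).
apply/seteqP; split=> -[t w] /= [[D _] u]; split=> //; split=> //.
  by move: D => [_ [t0 tT]]; rewrite in_itv/= t0 tT.
by move: D; rewrite in_itv/= => /andP[t0 tT].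
Qed.

End ProcessVersion.

Lemma mb_interpolation (R : realType) (d : measure_display) (Omega : measurableType d)
    (P : probability Omega R) (m : R) (W : lmodType R) (N : R -> W -> \bar R) (l1 l2 l3 : R)
    (ip1 ip2 ip3 : W -> W -> R) (K1 K2 K3 : R) (m1 : 1 <= m)
    (h1 : hilb (N l1) ip1 K1) (h2 : hilb (N l2) ip2 K2) (h3 : hilb (N l3) ip3 K3)
    (G : set (set Omega)) (xi : Omega -> W) (C c1 c3 r1 r3 : R) : complete_sigma P G ->
  random_var P N l2 G xi -> 0 <= C -> 0 <= c1 -> 0 <= c3 ->
  (forall v, (N l3 v < +oo)%E -> (N l2 v <= C%:E * (c1%:E * N l1 v + c3%:E * N l3 v))%E) ->
  mb P m N l1 G xi r1 -> mb P m N l3 G xi r3 ->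
  mb P m N l2 G xi (C * (c1 * r1 + c3 * r3)).
Proof.
move=> cG rx C0 c10 c30 i b1 b3; split=> //; have m0 : 0 < m by exact: lt_le_trans m1.
have M1 := rv_measurable_norm h1 cG (mb_rv b1); have M2 := rv_measurable_norm h2 cG rx.
have M3 := rv_measurable_norm h3 cG (mb_rv b3).
have mZ (c : R) (f : Omega -> \bar R) : measurable_fun setT f -> measurable_fun setT (fun w => c%:E * f w)%E.
  by move=> mf; apply: emeasurable_funM => //; exact: measurable_cst.
have P1 w : (0 <= N l1 (xi w))%E by exact: (hilb_ge0 h1).
have P3 w : (0 <= N l3 (xi w))%E by exact: (hilb_ge0 h3).
have Q1 w : (0 <= c1%:E * N l1 (xi w))%E by rewrite mule_ge0.
have Q3 w : (0 <= c3%:E * N l3 (xi w))%E by rewrite mule_ge0.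
have fZ (c : R) (f : Omega -> \bar R) : (forall w, (0 <= f w)%E) -> 0 <= c ->
    {ae P, forall w, (f w < +oo)%E} -> {ae P, forall w, (c%:E * f w < +oo)%E}.
  move=> f0 c0 h; apply: ae1 h _ => w h; apply: lte_mul_pinfty => //.
have mS := emeasurable_funD (mZ c1 _ M1) (mZ c3 _ M3).
apply: le_trans (Lnorm_le m0 M2 (mZ C _ mS) _ _ _) _.
- by move=> w; exact: (hilb_ge0 h2).
- by move=> w; rewrite mule_ge0//; exact: adde_ge0 (Q1 w) (Q3 w).
- by apply: ae1 (rv_fin (mb_rv b3)) _ => w; exact: i.
rewrite (Lnorm_scale P m0 C0 mS (fun w => adde_ge0 (Q1 w) (Q3 w))).
rewrite EFinM; apply: lee_wpmul2l; first by rewrite lee_fin.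
apply: le_trans (LnormD m1 (mZ c1 _ M1) (mZ c3 _ M3) Q1 Q3 (fZ _ _ P1 c10 (rv_fin (mb_rv b1))) (fZ _ _ P3 c30 (rv_fin (mb_rv b3)))) _.
rewrite !Lnorm_scale// EFinD !EFinM.
by apply: leeD; apply: lee_wpmul2l; rewrite ?lee_fin//; [exact: b1.2|exact: b3.2].
Qed.

(** * Estimates on the integral *)

Lemma powR_shift (R : realType) (x y l T0 : R) : 0 <= x -> x <= y -> 0 <= l -> l <= T0 ->
  l `^ y <= (1 + T0 `^ (y - x)) * l `^ x.
Proof.
move=> x0 xy l0 lT; apply: le_trans (powR_interval x0 xy l0 lT) _.
by apply: ler_wpM2r; rewrite ?powR_ge0// lerDr.
Qed.

Section DecompositionCondexp.
Variables (R : realType) (H : monotone_family R) (T0 : R) (m : R).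
Hypothesis m2 : 2 <= m.
Let m1 : 1 <= m. Proof. by apply: le_trans m2; rewrite ler1n. Qed.
Local Notation hn := (@hnorm R H).
Local Notation hH := (hnorm_hilb H).
Implicit Types (B : stochastic_basis T0).

(* Only the first part contributes to the conditional expectation, which inherits
   its higher regularity. *)
Lemma decomp_condexp B h gD gM s u (E : sb_space B -> ambient H) rD rM : h <= gD -> h <= gM ->
  0 <= s -> s <= u -> u <= horizon B -> decomp m gD gM s u E rD rM ->
  mb (sb_prob B) m hn gD (sb_filt s) (condexp (sb_prob B) hn h (sb_filt s) E) (4 * rD).
Proof.
move=> hD hM s0 su uT [D [M [aE bD bM oM]]].
have sT := le_trans su uT; have u0 := le_trans s0 su.
have cs := sb_complete s0 sT; have cu := sb_complete u0 uT; have cm := complete_measurable cs.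
have bDm := mb_sub (complete_sigma_meas cu) bD; have bMm := mb_sub (complete_sigma_meas cu) bM.
have [bz oz] := condexpP (hH gD) m2 cs bDm.
set z := condexp _ _ gD _ D in bz oz.
have [Ch _ hC] := mb_embedding H T0 m2 hD; have [Ch' _ hC'] := mb_embedding H T0 m2 hM.
have bzm := mb_sub (complete_sigma_meas cs) bz.
have bE := mb_ae m1 (hH h) cm aE (mb_add m1 (hH h) cm (hC _ _ _ _ cm bDm) (hC' _ _ _ _ cm bMm)).
have oh := orth_embedding m2 hD s0 sT (mb_subr m1 (hH gD) cm bzm bDm) oz.
have oM' := orth_embedding m2 hM s0 sT bMm oM.
have bd := mb_subr m1 (hH h) cm (hC _ _ _ _ cm bzm) (hC _ _ _ _ cm bDm).
have od : orth (sb_prob B) hn h (hip h) (sb_filt s) (fun w => z w - E w).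
  apply: (orth_ae (hH h) cs _ _ (orthB (hH h) m2 cs bd (hC' _ _ _ _ cm bMm) oh oM')).
    exact: mb_rv (mb_subr m1 (hH h) cm bd (hC' _ _ _ _ cm bMm)).
  by apply: ae1 aE _ => w ->; rewrite opprD addrA.
have e := condexp_eq (hH h) m2 cs bE (hC _ _ _ _ cs bz) od.
by apply: (mb_ae m1 (hH gD) cs e); apply: mb_le bz; rewrite expr1n mulr1.
Qed.

End DecompositionCondexp.

Section IntegralEstimates.
Variables (R : realType) (H : monotone_family R) (T0 : R) (S : propagator H T0).
Variables (m : R) (e : nat) (a b b' g : R).
Hypothesis m2 : 2 <= m.
Hypothesis a2 : a <= 1 / 2.
Hypothesis b'0 : 0 < b'.
Hypothesis b'b : b' <= b.
Hypothesis ba : b <= a.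
Hypothesis abb1 : 1 < a + b + b'.
Let m1 : 1 <= m. Proof. by apply: le_trans m2; rewrite ler1n. Qed.
Let b0 : 0 < b. Proof. exact: lt_le_trans b'b. Qed.
Let a0 : 0 < a. Proof. exact: lt_le_trans ba. Qed.
Local Notation hn := (@hnorm R H).
Local Notation Ne := (opnorm (e := e) hn).
Local Notation Om B := (sb_space B).
Local Notation hH := (hnorm_hilb H).
Local Notation hE := (fun g => opnorm_hilb (hH g) e).
Local Notation T B := (horizon B).
Local Notation g0 := (g - b - b').
Local Notation g1 := (g - b).
Local Notation k := (a + b + b').
Local Notation p := (a + b).
Implicit Types (B : stochastic_basis T0).
Local Notation mbh B h G xi c := (mb (sb_prob B) m hn h G xi c).
Let g01 : g0 <= g1. Proof. by rewrite lerBlDr lerDl ltW. Qed.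
Let p2 : 1 < 2 * p. Proof. move: b'b ba abb1; lra. Qed.

(* The estimates on the integral [Z] depend on the data through [Q] only. *)
Record rough_solution B (X : R -> 'rV[R]_e) (XX : R -> R -> 'M[R]_e)
    (Y : R -> Om B -> {ffun 'I_e -> ambient H})
    (Y' : R -> Om B -> {ffun 'I_e -> {ffun 'I_e -> ambient H}}) (L M Q : R)
    (Z : R -> Om B -> ambient H) : Prop := RoughSolution {
  rs_bounds : rough_bounds m a b b' g X XX Y Y' L M ;
  rs_Q : M * (1 + L ^+ 2) <= Q ;
  rs_germ : germ_bounds S m g0 g1 k p (germ X XX Y Y') Q ;
  rs_sewing : sewing_integral S m g0 g1 k p (germ X XX Y Y') (hdelta S Z) Q ;
  rs_start : aeeq (sb_prob B) (Z 0) (fun=> 0)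
}.

(** The process is the sewn integral from time 0; additivity identifies its [hdelta] with the
    integral over [s, t]. *)
Lemma rough_solution_exists : exists2 C : R, 1 <= C & forall B X XX Y Y' L M,
  @rough_bounds R H T0 m e a b b' g B X XX Y Y' L M ->
  exists Z, rough_solution X XX Y Y' L M (C * (M * (1 + L ^+ 2))) Z.
Proof.
have [C1 C11 hC1] := rough_germ_bounds S e g m2 a2 b'0 b'b ba.
have [C2 C21 hC2] := sewing S m2 g01 abb1 p2.
have C10 : 0 <= C1 by exact: le_trans C11.
have C20 : 0 <= C2 by exact: le_trans C21.
exists (C2 * C1); first by rewrite -[1]mulr1 ler_pM.
move=> B X XX Y Y' L M rb; have gb := hC1 _ _ _ _ _ _ _ rb.
set V := M * (1 + L ^+ 2) in gb *.
have V0 : 0 <= V by rewrite mulr_ge0 ?(rb_M rb)// addr_ge0// sqr_ge0.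
have [I [Ir Ia]] := hC2 _ _ _ gb (mulr_ge0 C10 V0).
have I0 t : 0 <= t -> t <= T B -> aeeq (sb_prob B) (I t t) (fun=> 0).
  move=> t0 tT; apply: ae1 (Ia t t t t0 (lexx t) (lexx t) tT) _ => w.
  rewrite prop_id ?t0 ?(le_trans tT (horizon_le B))// => h.
  by apply: (@addrI _ (I t t w)); rewrite -h addr0.
have IE s t : 0 <= s -> s <= t -> t <= T B -> aeeq (sb_prob B) (hdelta S (fun t => I 0 t) s t) (I s t).
  move=> s0 st tT; apply: ae1 (Ia 0 s t (lexx 0) s0 st tT) _ => w.
  by rewrite /hdelta => ->; rewrite addrAC subrr add0r.
exists (fun t => I 0 t); split => //.
- rewrite -/V -[leLHS]mul1r; apply: ler_wpM2r => //; rewrite -[leLHS]mulr1; exact: ler_pM.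
- split; first by move=> t w t0 tT; exact: (germ_diag gb).
  move=> s u t s0 su ut tT; have su0 : 0 <= t - s by rewrite subr_ge0 (le_trans su).
  have q : C1 * V <= C2 * C1 * V by rewrite -mulrA ler_peMl// mulr_ge0.
  apply: decomp_le (germ_bracket gb s0 su ut tT); apply: ler_wpM2r => //; exact: powR_ge0.
- split.
    move=> s t s0 st tT; rewrite -(mulrA C2).
    apply: (decomp_ae _ (Ir s t s0 st tT)).
    by apply: ae1 (IE s t s0 st tT) _ => w ->.
  move=> s u t s0 su ut tT; apply: aeW => w; rewrite /hdelta.
  rewrite (linearB (prop S u t)) prop_comp// ?(le_trans tT (horizon_le B))//.
  by rewrite [RHS]addrC addrA subrK.
- by apply: I0 => //; exact: ltW (horizon_gt0 B).
Qed.

Lemma rs_Q0 B X XX Y Y' L M Q Z : @rough_solution B X XX Y Y' L M Q Z -> 0 <= Q.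
Proof.
move=> rs; apply: le_trans (rs_Q rs); have rb := rs_bounds rs.
by rewrite mulr_ge0 ?(rb_M rb)// addr_ge0// sqr_ge0.
Qed.

Lemma rs_M B X XX Y Y' L M Q Z : @rough_solution B X XX Y Y' L M Q Z -> M <= Q.
Proof.
move=> rs; apply: le_trans (rs_Q rs); have rb := rs_bounds rs.
by rewrite ler_peMr ?(rb_M rb)// lerDl sqr_ge0.
Qed.

Lemma rs_LM B X XX Y Y' L M Q Z : @rough_solution B X XX Y Y' L M Q Z -> L * M <= Q.
Proof.
move=> rs; apply: le_trans (rs_Q rs); have rb := rs_bounds rs.
have [_ h _ _] := square_bounds (rb_L rb).
by rewrite mulrC; apply: ler_wpM2l => //; exact: (rb_M rb).
Qed.

(** The martingale part already has index b' above the drift, so it is smoothed only by the excess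
    [zeta] of eta over b'. Its order a + b - zeta is then the minimum in the statement, and stays at
    a + b for eta <= b'. *)
Lemma rest_decomp eta : 0 <= eta -> eta < k -> exists2 C : R, 1 <= C &
  forall B X XX Y Y' L M Q Z, @rough_solution B X XX Y Y' L M Q Z ->
  forall s t, 0 <= s -> s <= t -> t <= T B ->
  decomp m (g0 + eta) (g0 + Num.max eta b') s t
    (fun w => hdelta S Z s t w - prop S s t (germ X XX Y Y' s t w))
    (C * Q * (t - s) `^ (k - eta)) (C * Q * (t - s) `^ Num.min (k - eta) p).
Proof.
move=> e0 ek; pose zeta := Num.max eta b' - b'.
have z0 : 0 <= zeta by rewrite subr_ge0 le_max lexx orbT.
have zp : zeta < p by rewrite /zeta; case: (leP eta b') => _; move: b'b ba b'0; lra.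
have e2 : eta <= 2 by move: ek a2 b'b ba; lra.
have z2 : zeta <= 2 by move: zp a2 ba; lra.
have [C C1 hC] := rest_smoothing S m2 g01 e0 e2 ek z0 z2 zp.
exists C => // B X XX Y Y' L M Q Z rs s t s0 st tT.
have -> : g0 + Num.max eta b' = g1 + zeta by rewrite /zeta; ring.
have -> : Num.min (k - eta) p = p - zeta.
  by rewrite /zeta; case: (leP eta b') => h; case: (leP (k - eta) p) => h'; move: h h'; lra.
exact: (hC _ _ _ _ (rs_germ rs) (rs_sewing rs) (rs_Q0 rs)).
Qed.

Lemma rest_mb eta : 0 <= eta -> eta < k -> exists2 C : R, 1 <= C &
  forall B X XX Y Y' L M Q Z, @rough_solution B X XX Y Y' L M Q Z ->
  forall s t, 0 <= s -> s <= t -> t <= T B ->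
  mbh B (g0 + eta) (sb_filt t) (fun w => hdelta S Z s t w - prop S s t (germ X XX Y Y' s t w))
    (C * Q * (t - s) `^ Num.min (k - eta) p) /\
  mbh B (g0 + eta) (sb_filt s)
    (condexp (sb_prob B) hn g0 (sb_filt s) (fun w => hdelta S Z s t w - prop S s t (germ X XX Y Y' s t w)))
    (C * Q * (t - s) `^ (k - eta)).
Proof.
move=> e0 ek; have [C C1 hC] := rest_decomp e0 ek.
have em : g0 + eta <= g0 + Num.max eta b' by rewrite lerD2l le_max lexx.
have [C' C'1 hC'] := decomp_mb H T0 m2 (lexx (g0 + eta)) em.
pose c := 1 + T0 `^ (k - eta - Num.min (k - eta) p).
have c1 : 1 <= c by rewrite lerDl powR_ge0.
have C0 : 0 <= C by exact: le_trans C1.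
have C'0 : 0 <= C' by exact: le_trans C'1.
exists (C' * (C * (c + 1)) + 4 * C); first by rewrite ler_wpDl// ?mulr_ge0//; move: C1 c1 C0; lra.
move=> B X XX Y Y' L M Q Z rs s t s0 st tT; have d := hC _ _ _ _ _ _ _ _ _ rs s t s0 st tT.
have Q0 := rs_Q0 rs; have tS : 0 <= t - s by rewrite subr_ge0.
have lT : t - s <= T0 by apply: le_trans (horizon_le B); move: s0 tT; lra.
split.
  apply: mb_le (hC' _ _ _ _ _ _ (le_trans s0 st) tT d).
  have q : (t - s) `^ (k - eta) <= c * (t - s) `^ Num.min (k - eta) p.
    apply: powR_shift => //; last by rewrite ge_min lexx.
    by rewrite le_min; apply/andP; split; move: ek b0 a0; lra.
  set l := (t - s) `^ Num.min _ _ in q *; have l0 : 0 <= l by exact: powR_ge0.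
  rewrite -mulrDr; apply: le_trans (_ : C' * (C * Q * (c * l + l)) <= _).
    by apply: ler_wpM2l => //; apply: ler_wpM2l; [exact: mulr_ge0|exact: lerD].
  rewrite (_ : C' * _ = C' * (C * (c + 1)) * Q * l); last by ring.
  by rewrite !ler_wpM2r// lerDl mulr_ge0.
have ge : g0 <= g0 + eta by rewrite lerDl.
apply: mb_le (decomp_condexp m2 ge (le_trans ge em) s0 st tT d).
rewrite !mulrA; do 2 (apply: ler_wpM2r; rewrite ?powR_ge0//).
by rewrite lerDr; apply: mulr_ge0; [exact: mulr_ge0|rewrite addr_ge0// (le_trans _ c1)].
Qed.

(** The term in Y loses theta and keeps the order a - theta. The one in Y' starts from the index g -
    b and loses b + theta, which leaves 2 a - b - theta >= a - theta. *)
Lemma germ_smoothing theta : 0 <= theta -> theta < a -> exists2 C : R, 1 <= C &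
  forall B X XX Y Y' L M Q Z, @rough_solution B X XX Y Y' L M Q Z ->
  forall s t, 0 <= s -> s < t -> t <= T B ->
  mbh B (g + theta) (sb_filt t) (fun w => prop S s t (germ X XX Y Y' s t w))
    (C * Q * (t - s) `^ (a - theta)).
Proof.
move=> h0 ha; have i1 : g <= g + theta by rewrite lerDl.
have i2 : g + theta <= g + 2 by rewrite lerD2l; move: ha a2; lra.
have i3 : g1 <= g + theta by move: b0 h0; lra.
have i4 : g + theta <= g1 + 2 by move: ha a2 ba; lra.
have [C1 C11 hC1] := mb_smoothing S m2 i1 i2; have [C2 C21 hC2] := mb_smoothing S m2 i3 i4.
pose c := 1 + T0 `^ (2 * a - b - theta - (a - theta)).
have c1 : 1 <= c by rewrite lerDl powR_ge0.
have C10 : 0 <= C1 by exact: le_trans C11.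
have C20 : 0 <= C2 by exact: le_trans C21.
pose E : R := e%:R; have E0 : 0 <= E by exact: ler0n.
exists (1 + (C1 * E + C2 * E ^+ 2 * c)).
  by rewrite lerDl addr_ge0 ?mulr_ge0 ?exprn_ge0// (le_trans _ c1).
move=> B X XX Y Y' L M Q Z rs s t s0 st tT; have rb := rs_bounds rs.
have Q0 := rs_Q0 rs; have tS : 0 <= t - s by rewrite subr_ge0 ltW.
have lT : t - s <= T0 by apply: le_trans (horizon_le B); move: s0 tT; lra.
have sT : s <= T B by exact: le_trans (ltW st) tT.
have t0 : 0 <= t by exact: le_trans (ltW st).
have cs := sb_complete s0 sT; have ct := sb_complete t0 tT; have sub := sb_mono s0 (ltW st) tT.
have x1 := rb_X rb s0 (ltW st) tT; have x2 := rb_XX rb s0 (ltW st) tT.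
have d1 := hC1 _ _ _ _ _ _ s0 st tT cs (mb_lapp m2 (incr X s t) cs (rb_Y rb s0 sT)).
have d2 := hC2 _ _ _ _ _ _ s0 st tT cs (mb_lapp2 m2 (XX s t) cs (rb_Y' rb s0 sT)).
apply: mb_sub sub _; apply: (mb_ae m1 (hH (g + theta)) cs _ (mb_le _ (mb_add m1 (hH (g + theta)) cs d1 d2))).
  by apply: aeW => w; rewrite /germ linearD.
set l := t - s in x1 x2 tS lT *.
have q0 : 0 <= l `^ (a - theta) by exact: powR_ge0.
have -> : g - (g + theta) = - theta by ring.
have -> : g1 - (g + theta) = - (b + theta) by ring.
have M0 := rb_M rb; have LM := rs_LM rs.
have p1 : l `^ (- theta) * (eucl (incr X s t) * M) <= Q * l `^ (a - theta).
  apply: le_trans (_ : l `^ (- theta) * (L * l `^ a * M) <= _).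
    by apply: ler_wpM2l; [exact: powR_ge0|exact: ler_wpM2r].
  rewrite (_ : _ * _ = L * M * (l `^ (- theta) * l `^ a)); last by ring.
  rewrite powR_add; last by move: ha; lra.
  by rewrite [- theta + a]addrC; apply: ler_wpM2r.
have p3 : l `^ (- (b + theta)) * (eucl (XX s t) * M) <= Q * (c * l `^ (a - theta)).
  apply: le_trans (_ : l `^ (- (b + theta)) * (L * l `^ (2 * a) * M) <= _).
    by apply: ler_wpM2l; [exact: powR_ge0|exact: ler_wpM2r].
  rewrite (_ : _ * _ = L * M * (l `^ (- (b + theta)) * l `^ (2 * a))); last by ring.
  rewrite powR_add; last by move: ha ba; lra.
  apply: ler_pM => //; [exact: mulr_ge0 (rb_L rb) M0|exact: powR_ge0|].
  rewrite (_ : - (b + theta) + 2 * a = 2 * a - b - theta); last by ring.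
  by apply: powR_shift => //; move: ha ba; lra.
rewrite (_ : C1 * _ * _ = C1 * E * (l `^ (- theta) * (eucl (incr X s t) * M))); last by rewrite /E; ring.
rewrite (_ : C2 * _ * _ = C2 * E ^+ 2 * (l `^ (- (b + theta)) * (eucl (XX s t) * M))); last by rewrite /E; ring.
apply: le_trans (_ : C1 * E * (Q * l `^ (a - theta)) + C2 * E ^+ 2 * (Q * (c * l `^ (a - theta))) <= _).
  by apply: lerD; apply: ler_wpM2l => //; rewrite !mulr_ge0 ?exprn_ge0.
rewrite (_ : _ + _ = (C1 * E + C2 * E ^+ 2 * c) * Q * l `^ (a - theta)); last by ring.
by do 2 (apply: ler_wpM2r => //); rewrite lerDr.
Qed.

(** The rest is used at eta = theta + b + b', which reaches the index g + theta with order a -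
    theta. This is below a + b, so the martingale part does not worsen the exponent. *)
Lemma hdelta_mb theta : 0 <= theta -> theta < a -> exists2 C : R, 1 <= C &
  forall B X XX Y Y' L M Q Z, @rough_solution B X XX Y Y' L M Q Z ->
  forall s t, 0 <= s -> s <= t -> t <= T B ->
  mbh B (g + theta) (sb_filt t) (hdelta S Z s t) (C * Q * (t - s) `^ (a - theta)).
Proof.
move=> h0 ha; have [C1 C11 hC1] := germ_smoothing h0 ha.
have e0 : 0 <= theta + b + b' by rewrite !addr_ge0// ltW.
have ek : theta + b + b' < k by rewrite !ltrD2r.
have [C2 C21 hC2] := rest_mb e0 ek.
exists (C2 + C1); first by move: C11 C21; lra.
move=> B X XX Y Y' L M Q Z rs s t s0; rewrite le_eqVlt => /orP[/eqP<- sT|st tT].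
  rewrite subrr powR0 ?mulr0; last by move: ha; lra.
  have cs := sb_complete s0 sT.
  apply: (mb_ae m1 (hH (g + theta)) cs _ (mb0 m1 (hH (g + theta)) cs)); apply: aeW => w.
  by rewrite /hdelta prop_id ?subrr// s0 (le_trans sT (horizon_le B)).
have ct := sb_complete (le_trans s0 (ltW st)) tT.
have [d2 _] := hC2 _ _ _ _ _ _ _ _ _ rs s t s0 (ltW st) tT.
have q : g0 + (theta + b + b') = g + theta by ring.
have q' : Num.min (k - (theta + b + b')) p = a - theta.
  by rewrite (min_idPl _); [ring|move: b0 h0; lra].
rewrite q q' in d2; have d1 := hC1 _ _ _ _ _ _ _ _ _ rs s t s0 st tT.
apply: (mb_ae m1 (hH (g + theta)) ct _ (mb_le _ (mb_add m1 (hH (g + theta)) ct d2 d1))).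
  by apply: aeW => w; rewrite subrK.
by rewrite !mulrDl.
Qed.

Lemma hdelta0 B X XX Y Y' L M Q Z : @rough_solution B X XX Y Y' L M Q Z ->
  forall t, aeeq (sb_prob B) (Z t) (hdelta S Z 0 t).
Proof.
move=> rs t; apply: ae1 (rs_start rs) _ => w z0.
by rewrite /hdelta z0 linear0 subr0.
Qed.

Lemma solution_mb theta : 0 <= theta -> theta < a -> exists2 C : R, 1 <= C &
  forall B X XX Y Y' L M Q Z, @rough_solution B X XX Y Y' L M Q Z ->
  forall t, 0 <= t -> t <= T B ->
  mbh B (g + theta) (sb_filt t) (Z t) (C * Q * T B `^ (a - theta)).
Proof.
move=> h0 ha; have [C C1 hC] := hdelta_mb h0 ha.
exists C => // B X XX Y Y' L M Q Z rs t t0 tT.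
have ct := sb_complete t0 tT.
apply: (mb_ae m1 (hH (g + theta)) ct (hdelta0 rs t)).
apply: mb_le (hC _ _ _ _ _ _ _ _ _ rs 0 t (lexx 0) t0 tT); rewrite subr0.
apply: ler_wpM2l; first by rewrite mulr_ge0 ?(rs_Q0 rs)// (le_trans _ C1).
by apply: powR_le => //; move: ha; lra.
Qed.

Lemma solution_increment B (Z : R -> Om B -> ambient H) s t w :
  Z t w - Z s w = hdelta S Z s t w + (prop S s t (Z s w) - Z s w).
Proof. by rewrite /hdelta addrA subrK. Qed.

(** The increment is [hdelta] plus (S - 1) Z_s. For S - 1 to yield a positive power, Z_s is measured
    at an index [th'] halfway between the target [th] and the limit [a]. *)
Lemma solution_holder h : h < g + a -> exists2 nu : R, 0 < nu & exists2 C : R, 1 <= C &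
  forall B X XX Y Y' L M Q Z, @rough_solution B X XX Y Y' L M Q Z ->
  (forall t, 0 <= t -> t <= T B -> mbh B h (sb_filt t) (Z t) (C * Q)) /\
  (forall s t, 0 <= s -> s <= t -> t <= T B ->
    mbh B h (sb_filt t) (fun w => Z t w - Z s w) (C * Q * (t - s) `^ nu)).
Proof.
move=> ha; pose th := Num.max 0 (h - g); pose th' := (th + a) / 2.
have th0 : 0 <= th by rewrite le_max lexx.
have tha : th < a by rewrite gt_max a0; move: ha; lra.
have tt' : th <= th' by rewrite /th'; lra.
have t'a : th' < a by rewrite /th'; lra.
have hth : h <= g + th by rewrite -lerBlDl le_max lexx orbT.
have t'0 := le_trans th0 tt'.
have [C1 C11 hC1] := hdelta_mb th0 tha; have [C2 C21 hC2] := solution_mb t'0 t'a.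
have [C3 C31 hC3] := mb_embedding H T0 m2 hth.
have i1 : g + th <= g + th' by rewrite lerD2l.
have i2 : g + th' <= g + th + 1 by rewrite /th'; move: a2; lra.
have [C4 C41 hC4] := mb_regularity S m2 i1 i2.
have [C5 C51 hC5] := solution_mb th0 tha.
pose nu := th' - th; have nu0 : 0 < nu by rewrite /nu /th'; lra.
have [n1 n2 n3] : [/\ nu <= a - th, 0 <= a - th & 0 <= a - th'] by rewrite /nu /th'; split; lra.
pose c := 1 + T0 `^ (a - th - nu); have c1 : 1 <= c by rewrite lerDl powR_ge0.
pose c' := 1 + T0 `^ (a - th'); pose c5 := 1 + T0 `^ (a - th).
have c'1 : 1 <= c' by rewrite lerDl powR_ge0.
have c51 : 1 <= c5 by rewrite lerDl powR_ge0.
have [D1 D2 D3 D4 D5] : [/\ 0 <= C1, 0 <= C2, 0 <= C3, 0 <= C4 & 0 <= C5].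
  by split; [exact: le_trans C11|exact: le_trans C21|exact: le_trans C31|exact: le_trans C41|exact: le_trans C51].
have [e1 e2 e3] : [/\ 0 <= c, 0 <= c' & 0 <= c5] by split; [exact: le_trans c1|exact: le_trans c'1|exact: le_trans c51].
exists nu => //; exists (1 + (C3 * (C1 * c + C4 * (C2 * c')) + C3 * (C5 * c5))).
  by rewrite lerDl !addr_ge0 ?mulr_ge0// addr_ge0// !mulr_ge0.
move=> B X XX Y Y' L M Q Z rs; have Q0 := rs_Q0 rs.
have TT x : 0 <= x -> T B `^ x <= 1 + T0 `^ x.
  move=> x0; rewrite -[leLHS]add0r; apply: lerD => //; apply: powR_le => //.
    exact: ltW (horizon_gt0 B).
  exact: horizon_le.
split=> [t t0 tT|s t s0 st tT].
  have ct := sb_complete t0 tT.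
  apply: mb_le (hC3 _ _ _ _ ct (hC5 _ _ _ _ _ _ _ _ _ rs t t0 tT)).
  rewrite (_ : C3 * _ = (C3 * C5) * T B `^ (a - th) * Q); last by ring.
  apply: ler_wpM2r => //; apply: le_trans (_ : C3 * C5 * c5 <= _).
    by apply: ler_wpM2l; [exact: mulr_ge0|exact: TT].
  by rewrite -(mulrA C3) addrA lerDr addr_ge0// !mulr_ge0// addr_ge0// !mulr_ge0.
have ct := sb_complete (le_trans s0 st) tT; have sT := le_trans st tT.
have sub := sb_mono s0 st tT; have cs := sb_complete s0 sT.
have tS : 0 <= t - s by rewrite subr_ge0.
have lT : t - s <= T0 by apply: le_trans (horizon_le B); move: s0 tT; lra.
have d1 := hC1 _ _ _ _ _ _ _ _ _ rs s t s0 st tT.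
have d2 := hC4 _ _ _ _ _ _ s0 st tT ct (mb_sub sub (hC2 _ _ _ _ _ _ _ _ _ rs s s0 sT)).
apply: (mb_ae m1 (hH h) ct _ (mb_le _ (hC3 _ _ _ _ ct (mb_add m1 (hH (g + th)) ct d1 d2)))).
  by apply: aeW => w; exact: solution_increment.
have -> : g + th' - (g + th) = nu by rewrite /nu; ring.
set l := t - s in tS lT *; have l0 : 0 <= l `^ nu by exact: powR_ge0.
have q1 : l `^ (a - th) <= c * l `^ nu by apply: powR_shift => //; exact: ltW.
have q2 : T B `^ (a - th') <= c' by exact: TT.
apply: le_trans (_ : C3 * (C1 * Q * (c * l `^ nu) + C4 * l `^ nu * (C2 * Q * c')) <= _).
  by apply: ler_wpM2l => //; apply: lerD; apply: ler_wpM2l; rewrite ?mulr_ge0//; apply: ler_wpM2l; rewrite ?mulr_ge0.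
rewrite (_ : C3 * _ = C3 * (C1 * c + C4 * (C2 * c')) * Q * l `^ nu); last by ring.
do 2 (apply: ler_wpM2r => //).
by rewrite [leRHS]addrCA lerDl addr_ge0// !mulr_ge0.
Qed.

(** * Estimates with a small power of the horizon *)

Section SmallPower.
Variable theta : R.
Hypothesis theta0 : 0 <= theta.
Hypothesis thetab : theta <= b'.
Hypothesis thetaa : theta < a.
Local Notation kap := (Num.min (a - b) (b - b')).
Let kap0 : 0 <= kap. Proof. by rewrite le_min !subr_ge0 ba b'b. Qed.
Let kapab : kap <= a - b. Proof. by rewrite ge_min lexx. Qed.
Let kapbb : kap <= b - b'. Proof. by rewrite ge_min lexx orbT. Qed.
Local Notation h0 := (g + theta - b - b').

Lemma horizon_power B x : kap <= x -> T B `^ x <= (1 + T0 `^ (x - kap)) * T B `^ kap.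
Proof.
by move=> kx; apply: powR_shift => //; [exact: ltW (horizon_gt0 B)|exact: horizon_le].
Qed.

(* The factor [T ^ kap] is the surplus of powers of the increment. *)
Lemma interval_power B l x y : 0 <= y -> y + kap <= x -> 0 <= l -> l <= T B ->
  l `^ x <= (1 + T0 `^ (x - y - kap)) * (T B `^ kap * l `^ y).
Proof.
move=> y0 yx l0 lT; have yx' : y <= x by move: kap0 yx; lra.
apply: le_trans (powR_interval y0 yx' l0 lT) _.
rewrite mulrA; apply: ler_wpM2r; first exact: powR_ge0.
by apply: horizon_power; move: yx; lra.
Qed.

Lemma solution_small : exists2 C : R, 1 <= C &
  forall B X XX Y Y' L M Q Z, @rough_solution B X XX Y Y' L M Q Z ->
  forall t, 0 <= t -> t <= T B ->
  mbh B (g + theta) (sb_filt t) (Z t) (C * (Q * T B `^ kap)).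
Proof.
have [C C1 hC] := solution_mb theta0 thetaa.
pose c := 1 + T0 `^ (a - theta - kap); have c1 : 1 <= c by rewrite lerDl powR_ge0.
have C0 : 0 <= C by exact: le_trans C1.
exists (C * c); first by rewrite -[leLHS]mulr1; exact: ler_pM.
move=> B X XX Y Y' L M Q Z rs t t0 tT; apply: mb_le (hC _ _ _ _ _ _ _ _ _ rs t t0 tT).
rewrite (_ : C * c * _ = C * Q * (c * T B `^ kap)); last by ring.
apply: ler_wpM2l; first by rewrite mulr_ge0// (rs_Q0 rs).
by apply: horizon_power; move: kapab thetab b'b; lra.
Qed.

(** The surplus a - b of the order of [hdelta] yields the small factor; in the other term, (S - 1)
    Z_s, it comes from the smallness of Z itself. *)
Lemma solution_increment_small : exists2 C : R, 1 <= C &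
  forall B X XX Y Y' L M Q Z, @rough_solution B X XX Y Y' L M Q Z ->
  forall s t, 0 <= s -> s <= t -> t <= T B ->
  mbh B (g + theta - b) (sb_filt t) (fun w => Z t w - Z s w)
    (C * (Q * T B `^ kap) * (t - s) `^ b).
Proof.
have [C1 C11 hC1] := hdelta_mb (lexx 0) a0.
have [C2 C21 hC2] := solution_small.
have i0 : g + theta - b <= g + 0 by move: thetab b'b; lra.
have [C3 C31 hC3] := mb_embedding H T0 m2 i0.
have i1 : g + theta - b <= g + theta by move: b0; lra.
have i2 : g + theta <= g + theta - b + 1 by move: a2 ba; lra.
have [C4 C41 hC4] := mb_regularity S m2 i1 i2.
pose c := 1 + T0 `^ (a - b - kap); have c1 : 1 <= c by rewrite lerDl powR_ge0.
have [D1 D2 D3 D4] : [/\ 0 <= C1, 0 <= C2, 0 <= C3 & 0 <= C4].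
  by split; [exact: le_trans C11|exact: le_trans C21|exact: le_trans C31|exact: le_trans C41].
have c0 : 0 <= c by exact: le_trans c1.
exists (1 + (C3 * C1 * c + C4 * C2)); first by rewrite lerDl addr_ge0 ?mulr_ge0.
move=> B X XX Y Y' L M Q Z rs s t s0 st tT; have Q0 := rs_Q0 rs.
have ct := sb_complete (le_trans s0 st) tT; have sT := le_trans st tT.
have sub := sb_mono s0 st tT.
have tS : 0 <= t - s by rewrite subr_ge0.
have lT : t - s <= T B by move: s0 tT; lra.
have d1 := hC3 _ _ _ _ ct (hC1 _ _ _ _ _ _ _ _ _ rs s t s0 st tT).
have d2 := hC4 _ _ _ _ _ _ s0 st tT ct (mb_sub sub (hC2 _ _ _ _ _ _ _ _ _ rs s s0 sT)).
apply: (mb_ae m1 (hH _) ct _ (mb_le _ (mb_add m1 (hH _) ct d1 d2))).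
  by apply: aeW => w; exact: solution_increment.
have -> : g + theta - (g + theta - b) = b by ring.
rewrite subr0; set l := t - s in tS lT *; set Tk := T B `^ kap.
have Tk0 : 0 <= Tk by exact: powR_ge0.
have q1 : l `^ a <= c * (Tk * l `^ b) by apply: interval_power => //; [exact: ltW|move: kapab; lra].
apply: le_trans (_ : C3 * (C1 * Q * (c * (Tk * l `^ b))) + C4 * l `^ b * (C2 * (Q * Tk)) <= _).
  by rewrite lerD2r; apply: ler_wpM2l => //; apply: ler_wpM2l => //; exact: mulr_ge0.
rewrite (_ : _ + _ = (C3 * C1 * c + C4 * C2) * (Q * Tk) * l `^ b); last by ring.
apply: ler_wpM2r; first exact: powR_ge0.
by apply: ler_wpM2r; [exact: mulr_ge0|rewrite lerDr].
Qed.

Lemma solution_remainder B X XX (Y : R -> Om B -> {ffun 'I_e -> ambient H}) Y' (Z : R -> Om B -> ambient H) s t w :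
  remainder X Z Y s t w = hdelta S Z s t w - prop S s t (germ X XX Y Y' s t w) +
    ((prop S s t (Z s w) - Z s w) + (prop S s t (lapp (Y s w) (incr X s t)) - lapp (Y s w) (incr X s t)) +
     prop S s t (lapp2 (Y' s w) (XX s t))).
Proof.
rewrite /remainder /hdelta /delta /germ linearD.
move: (Z t w) (Z s w) (prop S s t (Z s w)) (lapp (Y s w) _) (prop S s t (lapp _ _)) (prop S s t (lapp2 _ _)).
move=> x y z u v r; rewrite opprD !addrA.
by rewrite [RHS](ACl (1*6*8*(2*5)*(3*7)*(4*9)))/= !addNr !addr0.
Qed.

(* Every term of the remainder other than the sewing error is [F_s]-measurable. *)
Lemma remainder_decomp : exists2 C : R, 1 <= C &
  forall B X XX Y Y' L M Q Z, @rough_solution B X XX Y Y' L M Q Z ->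
  forall s t, 0 <= s -> s <= t -> t <= T B ->
  decomp m h0 g1 s t (remainder X Z Y s t)
    (C * (Q * T B `^ kap) * (t - s) `^ (b + b')) (C * Q * (t - s) `^ (b + b')).
Proof.
have bb0 : 0 <= b + b' by rewrite addr_ge0// ltW.
have [n1 n2 n3] : [/\ b + b' + kap <= k - theta, b + b' + kap <= 2 * a & 0 < b + b' - theta + a].
  by move: kapab thetab b'b ba a0 b0; split; lra.
have [n4 n5 n6] : [/\ b + b' + kap <= b + b' - theta + a, b + b' <= k - theta & b + b' <= p].
  by move: kapab thetab b'b ba a0 b0; split; lra.
have hk : theta < k by move: thetaa b0 b'0; lra.
have [C1 C11 hC1] := rest_decomp theta0 hk.
have [C2 C21 hC2] := solution_small.
have i1 : h0 <= g + theta by move: b0 b'0; lra.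
have i2 : g + theta <= h0 + 1 by move: a2 ba b'b; lra.
have [C3 C31 hC3] := mb_regularity S m2 i1 i2.
have i3 : h0 <= g by move: b0 thetab; lra.
have i4 : g <= h0 + 1 by move: a2 ba b'b theta0; lra.
have [C4 C41 hC4] := mb_regularity S m2 i3 i4.
have i5 : h0 <= g1 by move: thetab; lra.
have [C5 C51 hC5] := mb_embedding H T0 m2 i5.
have [C6 C61 hC6] := prop_bound S h0.
pose c1 := 1 + T0 `^ (k - theta - (b + b') - kap); pose c2 := 1 + T0 `^ (2 * a - (b + b') - kap).
pose c3 := 1 + T0 `^ (p - (b + b')); pose c4 := 1 + T0 `^ (k - theta - (b + b')).
pose c5 := 1 + T0 `^ (b + b' - theta + a - (b + b') - kap).
have [E1 E2 E3 E4 E5] : [/\ 0 <= c1, 0 <= c2, 0 <= c3, 0 <= c4 & 0 <= c5].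
  by rewrite /c1 /c2 /c3 /c4 /c5; split; rewrite addr_ge0// powR_ge0.
have [D1 D2 D3] : [/\ 0 <= C1, 0 <= C2 & 0 <= C3].
  by split; [exact: le_trans C11|exact: le_trans C21|exact: le_trans C31].
have [D4 D5 D6] : [/\ 0 <= C4, 0 <= C5 & 0 <= C6].
  by split; [exact: le_trans C41|exact: le_trans C51|exact: le_trans C61].
pose E : R := e%:R; have E0 : 0 <= E by exact: ler0n.
exists (1 + (C1 * c3 + C1 * c4) + (C1 * c1 + (C3 * C2 + C4 * E * c5 + C6 * C5 * E ^+ 2 * c2))).
  by rewrite -addrA lerDl !addr_ge0 ?mulr_ge0 ?exprn_ge0.
move=> B X XX Y Y' L M Q Z rs s t s0 st tT; have rb := rs_bounds rs; have Q0 := rs_Q0 rs.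
have LM := rs_LM rs; have M0 := rb_M rb; have L0 := rb_L rb.
have t0 := le_trans s0 st; have sT := le_trans st tT.
have ct := sb_complete t0 tT; have cs := sb_complete s0 sT.
have sub := sb_mono s0 st tT.
have tS : 0 <= t - s by rewrite subr_ge0.
have lT : t - s <= T B by move: s0 tT; lra.
have lT0 : t - s <= T0 by exact: le_trans lT (horizon_le B).
have x1 := rb_X rb s0 st tT; have x2 := rb_XX rb s0 st tT.
have d1 := hC1 _ _ _ _ _ _ _ _ _ rs s t s0 st tT.
have eh0 : g0 + theta = h0 by ring.
have eg1 : g0 + Num.max theta b' = g1 by rewrite (max_idPr thetab); ring.
rewrite eh0 eg1 in d1.
have d2 := hC3 _ _ _ _ _ _ s0 st tT cs (hC2 _ _ _ _ _ _ _ _ _ rs s s0 sT).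
have d3 := hC4 _ _ _ _ _ _ s0 st tT cs (mb_lapp m2 (incr X s t) cs (rb_Y rb s0 sT)).
have d4' := hC5 _ _ _ _ cs (mb_lapp2 m2 (XX s t) cs (rb_Y' rb s0 sT)).
have bS v : (hn h0 v < +oo)%E -> (hn h0 (prop S s t v) <= C6%:E * hn h0 v)%E.
  by apply: hC6 => //; exact: le_trans tT (horizon_le B).
have d4 := mb_op m1 (hH h0) (hH h0) cs (linearB (prop S s t)) bS D6 d4'.
have d5 := mb_add m1 (hH h0) cs (mb_add m1 (hH h0) cs d2 d3) d4.
have z1 := mb0 (P := sb_prob B) m1 (hH g1) ct.
have d : decomp m h0 g1 s t (fun w => (prop S s t (Z s w) - Z s w) +
    (prop S s t (lapp (Y s w) (incr X s t)) - lapp (Y s w) (incr X s t)) +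
     prop S s t (lapp2 (Y' s w) (XX s t)))
    (C3 * (t - s) `^ (g + theta - h0) * (C2 * (Q * T B `^ kap)) +
     C4 * (t - s) `^ (g - h0) * (E * eucl (incr X s t) * M) +
     C6 * (C5 * (E ^+ 2 * eucl (XX s t) * M))) 0.
  eexists; exists (fun=> 0); split; [|exact: mb_sub sub d5|exact: z1|].
    by apply: aeW => w; rewrite addr0.
  by move=> A FA v fv; apply: integral0_eq => w _; rewrite (hilb_ipC (hH g1) fv (fin0 (hH g1))) (ip0l (hH g1)).
apply: (decomp_ae (E := fun w => _ + _) _ (decomp_le _ _ (decomp_add m2 s0 st tT d1 d))).
- by apply: aeW => w; exact: solution_remainder.
- have -> : g + theta - h0 = b + b' by ring.
  have -> : g - h0 = b + b' - theta by ring.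
  set l := t - s in x1 x2 tS lT lT0 *; set Tk := T B `^ kap; set lb := l `^ (b + b').
  have Tk0 : 0 <= Tk by exact: powR_ge0.
  have lb0 : 0 <= lb by exact: powR_ge0.
  have q1 : l `^ (k - theta) <= c1 * (Tk * lb) by exact: interval_power.
  have q2 : eucl (XX s t) * M <= Q * (c2 * (Tk * lb)).
    apply: le_trans (_ : L * l `^ (2 * a) * M <= _); first by apply: ler_wpM2r.
    rewrite mulrAC; apply: ler_pM => //; [exact: mulr_ge0|exact: powR_ge0|].
    exact: interval_power.
  have q3 : l `^ (b + b' - theta) * (eucl (incr X s t) * M) <= Q * (c5 * (Tk * lb)).
    apply: le_trans (_ : l `^ (b + b' - theta) * (L * l `^ a * M) <= _).
      by apply: ler_wpM2l; [exact: powR_ge0|exact: ler_wpM2r].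
    rewrite (_ : _ * _ = L * M * (l `^ (b + b' - theta) * l `^ a)); last by ring.
    rewrite (powR_add _ n3).
    apply: ler_pM => //; [exact: mulr_ge0|exact: powR_ge0|].
    exact: interval_power.
  rewrite (_ : C4 * _ * _ = C4 * E * (l `^ (b + b' - theta) * (eucl (incr X s t) * M))); last by ring.
  rewrite (_ : C6 * _ = C6 * C5 * E ^+ 2 * (eucl (XX s t) * M)); last by ring.
  apply: le_trans (_ : C1 * Q * (c1 * (Tk * lb)) + (C3 * lb * (C2 * (Q * Tk)) +
      C4 * E * (Q * (c5 * (Tk * lb))) + C6 * C5 * E ^+ 2 * (Q * (c2 * (Tk * lb)))) <= _).
    apply: lerD; first by apply: ler_wpM2l => //; exact: mulr_ge0.
    apply: lerD; first by rewrite lerD2l; apply: ler_wpM2l => //; exact: mulr_ge0.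
    by apply: ler_wpM2l => //; rewrite !mulr_ge0// exprn_ge0.
  rewrite (_ : _ + _ = (C1 * c1 + (C3 * C2 + C4 * E * c5 + C6 * C5 * E ^+ 2 * c2)) * (Q * Tk) * lb); last by ring.
  apply: ler_wpM2r => //; apply: ler_wpM2r; first exact: mulr_ge0.
  by rewrite lerDr !addr_ge0 ?mulr_ge0.
- rewrite addr0; set l := t - s in x1 x2 tS lT lT0 *.
  have q : l `^ Num.min (k - theta) p <= (c3 + c4) * l `^ (b + b').
    rewrite mulrDl; case: (leP (k - theta) p) => _.
      apply: le_trans (_ : c4 * l `^ (b + b') <= _); last by rewrite lerDr mulr_ge0// powR_ge0.
      exact: powR_shift.
    apply: le_trans (_ : c3 * l `^ (b + b') <= _); last by rewrite lerDl mulr_ge0// powR_ge0.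
    exact: powR_shift.
  apply: le_trans (_ : C1 * Q * ((c3 + c4) * l `^ (b + b')) <= _).
    by apply: ler_wpM2l => //; exact: mulr_ge0.
  rewrite (_ : _ * _ = (C1 * c3 + C1 * c4) * Q * l `^ (b + b')); last by ring.
  apply: ler_wpM2r; first exact: powR_ge0.
  apply: ler_wpM2r => //; rewrite -addrA (addrC 1) -[X in X <= _]addr0 -!addrA !lerD2l.
  by rewrite addr_ge0 ?mulr_ge0// !addr_ge0 ?mulr_ge0 ?exprn_ge0.
Qed.

(** Y_t - Y_0 is of order b in H_(g-b) and bounded in H_g. Interpolation with the horizon as
    parameter gives the power b - theta of the horizon, and b - theta >= b - b' because theta <= b'.
    Only Y_0 is left without a small factor. *)
Lemma second_component_sup : exists2 C : R, 1 <= C &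
  forall B X XX Y Y' L M, @rough_bounds R H T0 m e a b b' g B X XX Y Y' L M ->
  forall M0 t, mb (sb_prob B) m Ne g (sb_filt 0) (Y 0) M0 -> 0 <= t -> t <= T B ->
  mb (sb_prob B) m Ne (g + theta - b) (sb_filt t) (Y t) (C * (M0 + T B `^ kap * M)).
Proof.
have i1 : g1 <= g + theta - b by move: theta0; lra.
have i2 : g + theta - b <= g by move: thetab b'b; lra.
have i3 : g1 < g by move: b0; lra.
have [C1 C11 hC1] := mb_embedding_e H T0 e m2 i2.
have [C2 C21 hC2] := interpolation_bound H i1 i2 i3.
pose c := 1 + T0 `^ (b - theta - kap); have c1 : 1 <= c by rewrite lerDl powR_ge0.
have [D1 D2] : 0 <= C1 /\ 0 <= C2 by split; [exact: le_trans C11|exact: le_trans C21].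
have c0 : 0 <= c by exact: le_trans c1.
exists (C1 + C2 * (c * 3)); first by rewrite ler_wpDr ?mulr_ge0.
move=> B X XX Y Y' L M rb M0 t bY0 t0 tT; have M00 := rb_M rb.
have T0' : 0 <= T B by exact: ltW (horizon_gt0 B).
have ct := sb_complete t0 tT; have c0' := sb_complete (lexx 0) T0'.
have sub := sb_mono (lexx 0) t0 tT.
have d1 := hC1 _ _ _ _ ct (mb_sub sub bY0).
have d2 := rb_dY rb (lexx 0) t0 tT.
have d3 := mb_subr m1 (hE g) ct (rb_Y rb t0 tT) (mb_sub sub (rb_Y rb (lexx 0) T0')).
have d4 : mb (sb_prob B) m Ne (g + theta - b) (sb_filt t) (fun w => Y t w - Y 0 w)
    (C2 * (T B `^ (g1 - (g + theta - b)) * (M * T B `^ b) + T B `^ (g - (g + theta - b)) * (M + M))).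
  have i (A : {ffun 'I_e -> ambient H}) := opnorm_interpolation hH (e := e) D2 (powR_ge0 _ _) (powR_ge0 _ _)
    (fun v fv => hC2 (T B) v (horizon_gt0 B) fv) (A := A).
  apply: (mb_interpolation m1 (hE _) (hE _) (hE _) ct _ D2 (powR_ge0 _ _) (powR_ge0 _ _) i _ d3).
    exact: mb_rv (hC1 _ _ _ _ ct d3).
  apply: mb_le d2; apply: ler_wpM2l => //; rewrite subr0.
  by apply: powR_le => //; exact: ltW b0.
apply: (mb_ae m1 (hE _) ct _ (mb_le _ (mb_add m1 (hE _) ct d1 d4))).
  by apply: aeW => w /=; rewrite addrC subrK.
have -> : g1 - (g + theta - b) = - theta by ring.
have -> : g - (g + theta - b) = b - theta by ring.
rewrite (_ : T B `^ (- theta) * (M * T B `^ b) = M * T B `^ (b - theta)); last first.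
  rewrite mulrCA -powRD; first by rewrite addrC.
  by apply/implyP => _; rewrite gt_eqF// (horizon_gt0 B).
rewrite (_ : C2 * _ = C2 * (3 * M) * T B `^ (b - theta)); last by ring.
have q : T B `^ (b - theta) <= c * T B `^ kap by apply: horizon_power; move: kapbb thetab; lra.
apply: le_trans (_ : C1 * M0 + C2 * (3 * M) * (c * T B `^ kap) <= _).
  by rewrite lerD2l; apply: ler_wpM2l => //; rewrite !mulr_ge0.
have Tk := powR_ge0 (T B) kap; have M0' := mb_ge0 bY0.
rewrite (_ : C2 * _ * _ = C2 * (c * 3) * (T B `^ kap * M)); last by ring.
rewrite [leRHS](_ : _ = C1 * M0 + C2 * (c * 3) * (T B `^ kap * M) +
  (C1 * (T B `^ kap * M) + C2 * (c * 3) * M0)); last by ring.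
by rewrite lerDl addr_ge0 ?mulr_ge0.
Qed.

Lemma second_component_increment : exists2 C : R, 1 <= C &
  forall B X XX Y Y' L M, @rough_bounds R H T0 m e a b b' g B X XX Y Y' L M ->
  forall s t, 0 <= s -> s <= t -> t <= T B ->
  mb (sb_prob B) m Ne h0 (sb_filt t) (fun w => Y t w - Y s w) (C * (T B `^ kap * M) * (t - s) `^ b').
Proof.
have i1 : h0 <= g1 by move: thetab; lra.
have [C1 C11 hC1] := mb_embedding_e H T0 e m2 i1.
pose c := 1 + T0 `^ (b - b' - kap); have c1 : 1 <= c by rewrite lerDl powR_ge0.
have C10 : 0 <= C1 by exact: le_trans C11.
exists (C1 * c); first by rewrite -[leLHS]mulr1; exact: ler_pM.
move=> B X XX Y Y' L M rb s t s0 st tT.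
have ct := sb_complete (le_trans s0 st) tT.
apply: mb_le (hC1 _ _ _ _ ct (rb_dY rb s0 st tT)).
have q : (t - s) `^ b <= c * (T B `^ kap * (t - s) `^ b').
  apply: interval_power; [exact: ltW|by move: kapbb; lra|by rewrite subr_ge0|by move: s0 tT; lra].
apply: le_trans (_ : C1 * (M * (c * (T B `^ kap * (t - s) `^ b'))) <= _).
  by apply: ler_wpM2l => //; apply: ler_wpM2l => //; exact: (rb_M rb).
by rewrite le_eqVlt; apply/orP; left; apply/eqP; ring.
Qed.

End SmallPower.

Lemma partition_limit : exists2 C : R, 1 <= C &
  forall B X XX Y Y' L M Q Z, @rough_solution B X XX Y Y' L M Q Z ->
  forall s t h (pi : seq R), 0 <= s -> t <= T B -> itv_partition s t pi -> mesh s pi <= h ->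
  mbh B g0 (sb_filt t) (fun w => hdelta S Z s t w - riemann_sum S X XX Y Y' s t pi w)
    (C * Q * (h `^ (k - 1) * (t - s) + Num.sqrt (h `^ (2 * p - 1) * (t - s)))).
Proof.
have [C1 C11 hC1] := partition_rest S m2 g0 g1 abb1 p2.
have [C2 C21 hC2] := decomp_mb H T0 m2 (lexx g0) g01.
have C10 : 0 <= C1 by exact: le_trans C11.
exists (C2 * C1); first by rewrite -[leLHS]mulr1; exact: ler_pM.
move=> B X XX Y Y' L M Q Z rs s t h pi s0 tT [pp lt] mh.
pose c i := nth s (s :: pi) i.
have c_step i : (i < size pi)%N -> c i < c i.+1 by move=> ip; exact: (pathP s pp i ip).
have cl i : (i < size pi)%N -> c i <= c i.+1 by move=> /c_step/ltW.
have cn : c (size pi) = t by rewrite /c -(eqP lt) -nth_last; case: (pi).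
have ch i : (i < size pi)%N -> c i.+1 - c i <= h.
  move=> ip; apply: le_trans mh; rewrite /mesh.
  exact: (le_bigmax _ (fun i : 'I_(size pi) => right_pt s pi i - left_pt s pi i) (Ordinal ip)).
have st : s <= t.
  have sc n : (n <= size pi)%N -> s <= c n.
    elim: n => [//|n IH] np; apply: le_trans (cl n np); apply: IH; exact: ltnW.
  by rewrite -cn; exact: sc.
have c0s : 0 <= c 0%N by [].
have cnT : c (size pi) <= T B by rewrite cn.
have := hC1 _ _ _ _ (rs_sewing rs) (rs_Q0 rs) h (size pi) c c0s cnT cl ch.
rewrite cn => d; have t0 := le_trans s0 st.
apply: mb_le (hC2 _ _ _ _ _ _ t0 tT d).
by rewrite -mulrDr !mulrA.
Qed.


End IntegralEstimates.

(** * Spaces of processes *)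

Lemma powR_small (R : realType) (C nu eps : R) : 0 <= C -> 0 < nu -> 0 < eps ->
  exists2 del : R, 0 < del & forall x, 0 <= x -> x <= del -> C * x `^ nu < eps.
Proof.
move=> C0 nu0 e0; have C1 : 0 < C + 1 by rewrite ltr_wpDl.
have q0 : 0 < eps / (C + 1) by rewrite divr_gt0.
exists ((eps / (C + 1)) `^ nu^-1); first by rewrite powR_gt0.
move=> x x0 xd; apply: le_lt_trans (_ : C * (eps / (C + 1)) < _).
  apply: ler_wpM2l => //; apply: le_trans (powR_le (ltW nu0) x0 xd) _.
  by rewrite -powRrM mulVf ?gt_eqF// powRr1// ltW.
by rewrite mulrA ltr_pdivrMr// mulrC ltr_pM2l// ltrDl.
Qed.

Section ProcessSpaces.
Variables (R : realType) (d : measure_display) (Omega : measurableType d).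
Variables (P : probability Omega R) (T m : R).
Hypothesis m2 : 2 <= m.
Hypothesis T_gt0 : 0 < T.
Let m1 : 1 <= m. Proof. by apply: le_trans m2; rewrite ler1n. Qed.
Variables (W : lmodType R) (N : R -> W -> \bar R) (g : R) (ip : W -> W -> R) (K : R).
Hypothesis hN : hilb (N g) ip K.
Hypothesis cm : complete_sigma P measurable.
Local Notation mbm := (mb P m N g measurable).

Lemma mb_Lm xi c : mbm xi c -> Lm P N m g xi.
Proof. by move=> [r n]; split=> //; exact: le_lt_trans n (ltry _). Qed.

Lemma Lm_mb xi : Lm P N m g xi -> mbm xi (fine (mnorm P N m g xi)).
Proof.
by move=> [r n]; split=> //; rewrite fineK// ge0_fin_numE// mnorm_ge0.
Qed.

Lemma mb_fine xi c : mbm xi c -> fine (mnorm P N m g xi) <= c.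
Proof.
move=> b; have [_ n] := Lm_mb (mb_Lm b); rewrite -lee_fin fineK; first exact: b.2.
by rewrite ge0_fin_numE ?mnorm_ge0//; exact: (mb_Lm b).2.
Qed.

Lemma norm0_le (Z : R -> Omega -> W) (c : R) :
  (forall t, 0 <= t -> t <= T -> (mnorm P N m g (Z t) <= c%:E)%E) -> (norm0 P T N m g Z <= c%:E)%E.
Proof.
by move=> h; apply: ge_ereal_sup => _ [t tD <-]; move: tD; rewrite /= in_itv/= => /andP[]; exact: h.
Qed.

Lemma norm2_le b (A : R -> R -> Omega -> W) (c : R) :
  (forall s t, 0 <= s -> s < t -> t <= T -> (mnorm P N m g (A s t) <= (c * (t - s) `^ b)%:E)%E) ->
  (norm2 P T N b m g A <= c%:E)%E.
Proof.
move=> h; apply: ge_ereal_sup => _ [[s t] /= [/= s0 [st tT]] <-].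
have q : 0 < (t - s) `^ b by rewrite powR_gt0// subr_gt0.
by rewrite lee_pdivrMr// -EFinM; exact: h.
Qed.

Lemma norm2_ge b (A : R -> R -> Omega -> W) s t : (norm2 P T N b m g A < +oo)%E ->
  0 <= s -> s < t -> t <= T ->
  (mnorm P N m g (A s t) <= (fine (norm2 P T N b m g A) * (t - s) `^ b)%:E)%E.
Proof.
move=> f s0 st tT; have q : 0 < (t - s) `^ b by rewrite powR_gt0// subr_gt0.
have h : (mnorm P N m g (A s t) * (((t - s) `^ b)^-1)%:E <= norm2 P T N b m g A)%E.
  by apply: ereal_sup_ubound; exists (s, t).
have p0 : (0 <= mnorm P N m g (A s t) * (((t - s) `^ b)^-1)%:E)%E.
  by rewrite mule_ge0 ?mnorm_ge0// lee_fin invr_ge0 ltW.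
rewrite EFinM -lee_pdivrMr// fineK//.
by rewrite ge0_fin_numE//; exact: le_trans p0 h.
Qed.

Lemma holder_modulus (Z : R -> Omega -> W) C nu : 0 <= C ->
  (forall s t, 0 <= s -> s <= t -> t <= T -> mbm (fun w => Z t w - Z s w) (C * (t - s) `^ nu)) ->
  forall s t, 0 <= s -> s <= T -> 0 <= t -> t <= T -> mbm (fun w => Z t w - Z s w) (C * `|t - s| `^ nu).
Proof.
move=> C0 h s t s0 sT t0 tT; have [st|/ltW ts] := leP s t.
  by rewrite ger0_norm ?subr_ge0//; exact: h.
rewrite distrC ger0_norm ?subr_ge0//.
apply: (mb_ae m1 hN cm _ (mb_opp m1 hN cm (h _ _ t0 ts sT))).
by apply: aeW => w; rewrite opprB.
Qed.

Lemma holder_CLm (Z : R -> Omega -> W) C nu : 0 <= C -> 0 < nu ->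
  (forall t, 0 <= t -> t <= T -> exists c, mbm (Z t) c) ->
  (forall s t, 0 <= s -> s <= t -> t <= T -> mbm (fun w => Z t w - Z s w) (C * (t - s) `^ nu)) ->
  CLm P T N m g Z.
Proof.
move=> C0 nu0 hb hd; split=> [t /andP[t0 tT]|t /andP[t0 tT]].
  by have [c b] := hb t t0 tT; exact: mb_Lm b.
apply/ecvg0P; first by move=> x; exact: mnorm_ge0.
move=> eps e0; have [del d0 hdel] := powR_small C0 nu0 e0.
rewrite near_withinE; apply/nbhs_ballP; exists del => //= s ts; rewrite in_itv/= => /andP[s0 sT].
have [_ n] := holder_modulus C0 hd t0 tT s0 sT.
apply: le_lt_trans n _; rewrite lte_fin; apply: hdel => //.
by rewrite distrC; exact: ltW ts.
Qed.

(** The L^m norm of a process continuous in L^m is a continuous function of time, hence bounded on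
    the compact [0, T]. *)
Lemma CLm_bounded (Z : R -> Omega -> W) : CLm P T N m g Z ->
  exists2 c : R, 0 <= c & forall t, 0 <= t -> t <= T -> mbm (Z t) c.
Proof.
move=> [L cZ]; pose f t := fine (mnorm P N m g (Z t)).
have Lb t : 0 <= t -> t <= T -> mbm (Z t) (f t) by move=> t0 tT; apply: Lm_mb; apply: L; rewrite t0.
have cf : {within `[0, T], continuous f}.
  apply/subspace_continuousP => t; rewrite /= in_itv/= => /andP[t0 tT].
  apply/cvgrPdist_lt => eps e0; have tD : 0 <= t <= T by rewrite t0.
  have /ecvg0P : mnorm P N m g (fun w => Z s w - Z t w) @[s --> within `[0, T] (nbhs t)] --> 0%E by exact: cZ.
  move=> /(_ (fun x => mnorm_ge0 P m N g _) eps e0).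
  rewrite !near_withinE; apply: filterS => s h sD; have {}h := h sD.
  move: sD; rewrite /= in_itv/= => /andP[s0 sT].
  have bs := Lb s s0 sT; have bt := Lb t t0 tT.
  set x := mnorm _ _ _ _ _ in h.
  have xE : x = (fine x)%:E by rewrite fineK// ge0_fin_numE ?mnorm_ge0//; exact: lt_trans h (ltry _).
  have bd : mbm (fun w => Z s w - Z t w) (fine x).
    by split; [exact: (mb_subr m1 hN cm bs bt).1|rewrite -xE].
  have x_eps : fine x < eps by move: h; rewrite xE lte_fin.
  have q1 : f s <= fine x + f t.
    apply: mb_fine; apply: (mb_ae m1 hN cm _ (mb_add m1 hN cm bd bt)).
    by apply: aeW => w /=; rewrite subrK.
  have q2 : f t <= f s + fine x.
    apply: mb_fine; apply: (mb_ae m1 hN cm _ (mb_subr m1 hN cm bs bd)).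
    by apply: aeW => w /=; rewrite subKr.
  have : `|f t - f s| < eps by rewrite ltr_norml; lra.
  by [].
have [c _ hc] := EVT_max (ltW T_gt0) cf.
exists (f c); first by apply: fine_ge0; exact: mnorm_ge0.
by move=> t t0 tT; apply: mb_le (Lb t t0 tT); apply: hc; rewrite in_itv/= t0.
Qed.


Lemma modulus_C2 (A : R -> R -> Omega -> W) C nu : 0 <= C -> 0 < nu ->
  (forall s t s' t', simplex2 T (s, t) -> simplex2 T (s', t') ->
     mbm (fun w => A s t w - A s' t' w) (C * (`|s - s'| `^ nu + `|t - t'| `^ nu))) ->
  forall p, simplex2 T p ->
    mnorm P N m g (fun w => A q.1 q.2 w - A p.1 p.2 w) @[q --> within (simplex2 T) (nbhs p)] --> 0%E.
Proof.
move=> C0 nu0 dA [s' t'] D'; apply/ecvg0P; first by move=> x; exact: mnorm_ge0.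
have C20 : 0 <= 2 * C by rewrite mulr_ge0.
move=> eps e0; have [del d0 hdel] := powR_small C20 nu0 e0.
rewrite near_withinE; apply/nbhs_ballP; exists del => //= -[s t] [/= ss tt] D.
apply: le_lt_trans (dA _ _ _ _ D D').2 _; rewrite lte_fin.
apply: le_lt_trans (_ : C * (del `^ nu + del `^ nu) < _); last first.
  by rewrite -mulr2n -[del `^ nu *+ 2]mulr_natl mulrA (mulrC C); apply: hdel => //; exact: ltW.
by apply: ler_wpM2l => //; apply: lerD; apply: powR_le => //; rewrite ?ltW// distrC; [exact: ss|exact: tt].
Qed.

End ProcessSpaces.

(** * Real bounds extracted from the norms of the data *)

Section RoughPathBounds.
Variables (R : realType) (e : nat) (T a : R) (X : R -> 'rV[R]_e) (XX : R -> R -> 'M[R]_e).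
Hypothesis T_gt0 : 0 < T.
Hypothesis hX : rough_path T a X XX.

Lemma eucl0 n q : eucl (0 : 'M[R]_(n, q)) = 0.
Proof.
rewrite /eucl big1 ?sqrtr0// => i _; rewrite big1// => j _.
by rewrite mxE expr0n.
Qed.

Lemma det_holder_ge0 n q b (A : R -> R -> 'M[R]_(n, q)) : (0 <= det_holder T b A)%E.
Proof.
apply: le_trans (_ : (eucl (A 0 T) / (T - 0) `^ b)%:E <= _)%E.
  by rewrite lee_fin divr_ge0 ?eucl_ge0// powR_ge0.
by apply: ereal_sup_ubound; exists (0, T).
Qed.

Lemma det_holder_le n q b (A : R -> R -> 'M[R]_(n, q)) s t : (det_holder T b A < +oo)%E ->
  0 <= s -> s < t -> t <= T -> eucl (A s t) <= fine (det_holder T b A) * (t - s) `^ b.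
Proof.
move=> f s0 st tT; have q0 : 0 < (t - s) `^ b by rewrite powR_gt0// subr_gt0.
rewrite -ler_pdivrMr// -lee_fin fineK; last by rewrite ge0_fin_numE// det_holder_ge0.
by apply: ereal_sup_ubound; exists (s, t).
Qed.

Lemma rough_norm_fin : rough_norm T a X XX = (fine (rough_norm T a X XX))%:E.
Proof.
rewrite fineK// ge0_fin_numE; last by rewrite adde_ge0// det_holder_ge0.
exact: lte_add_pinfty (rough_path_holder1 hX) (rough_path_holder2 hX).
Qed.

Lemma rough_norm_ge0 : 0 <= fine (rough_norm T a X XX).
Proof. by apply: fine_ge0; rewrite adde_ge0// det_holder_ge0. Qed.

Lemma rough_norm_split : fine (det_holder T a (incr X)) <= fine (rough_norm T a X XX) /\
  fine (det_holder T (2 * a) XX) <= fine (rough_norm T a X XX).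
Proof.
have f1 : det_holder T a (incr X) \is a fin_num.
  by rewrite ge0_fin_numE ?det_holder_ge0//; exact: rough_path_holder1 hX.
have f2 : det_holder T (2 * a) XX \is a fin_num.
  by rewrite ge0_fin_numE ?det_holder_ge0//; exact: rough_path_holder2 hX.
rewrite /rough_norm fineD//; split; rewrite ?lerDl ?lerDr; apply: fine_ge0; exact: det_holder_ge0.
Qed.

Lemma rough_path_incr s t : 0 <= s -> s <= t -> t <= T ->
  eucl (incr X s t) <= fine (rough_norm T a X XX) * (t - s) `^ a.
Proof.
move=> s0; rewrite le_eqVlt => /orP[/eqP<- _|st tT].
  by rewrite /incr !subrr eucl0 mulr_ge0 ?rough_norm_ge0// powR_ge0.
apply: le_trans (det_holder_le (rough_path_holder1 hX) s0 st tT) _.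
by apply: ler_wpM2r; [exact: powR_ge0|exact: rough_norm_split.1].
Qed.

Lemma rough_path_second s t : 0 <= s -> s <= t -> t <= T ->
  eucl (XX s t) <= fine (rough_norm T a X XX) * (t - s) `^ (2 * a).
Proof.
move=> s0; rewrite le_eqVlt => /orP[/eqP<- sT|st tT].
  have := rough_path_chen hX s0 (lexx s) (lexx s) sT.
  rewrite subrr sub0r /incr subrr mulmx0 => /eqP; rewrite oppr_eq0 => /eqP->.
  by rewrite eucl0 mulr_ge0 ?rough_norm_ge0// powR_ge0.
apply: le_trans (det_holder_le (rough_path_holder2 hX) s0 st tT) _.
by apply: ler_wpM2r; [exact: powR_ge0|exact: rough_norm_split.2].
Qed.

End RoughPathBounds.

Section FilteredBasis.
Variables (R : realType) (T0 T : R) (hT : 0 < T <= T0).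
Variables (d : measure_display) (Omega : measurableType d) (P : probability Omega R).
Variables (F : R -> set (set Omega)) (hF : usual_filtration P T F).

Let T_gt0 : 0 < T. Proof. by case/andP: hT. Qed.
Let T_le : T <= T0. Proof. by case/andP: hT. Qed.

Lemma filtration_complete_sigma t : 0 <= t -> t <= T -> complete_sigma P (F t).
Proof.
move=> t0 tT; have tD : 0 <= t <= T by rewrite t0.
split; [exact: (filtration_sigma hF tD)|exact: (filtration_measurable hF tD)|].
move=> A nA; apply: (filtration_mono hF (s := 0)); last exact: (filtration_complete hF).
by split => //=; rewrite lexx.
Qed.

Lemma filtration_increasing s t : 0 <= s -> s <= t -> t <= T -> F s `<=` F t.
Proof. by move=> s0 st tT; apply: (filtration_mono hF). Qed.

Definition filtered_basis : stochastic_basis T0 :=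
  StochasticBasis T_gt0 T_le filtration_complete_sigma filtration_increasing.

End FilteredBasis.

(* A variable which is measurable with respect to [G] in a larger space coincides
   with its conditional expectation, computed in the smaller one. *)
Lemma rv_upgrade (R : realType) (d : measure_display) (Omega : measurableType d)
    (P : probability Omega R) (m : R) (W : lmodType R) (N : R -> W -> \bar R) (l l' : R)
    (ip ip' : W -> W -> R) (K K' C : R) (h : hilb (N l) ip K) (h' : hilb (N l') ip' K')
    (G : set (set Omega)) (xi : Omega -> W) (c : R) : 2 <= m -> complete_sigma P G -> 0 <= C ->
  (forall v, (N l v < +oo)%E -> (N l' v <= C%:E * N l v)%E) ->
  mb P m N l measurable xi c -> random_var P N l' G xi -> random_var P N l G xi.
Proof.
move=> m2 cG C0 emb bx rx; have m1 : 1 <= m by apply: le_trans m2; rewrite ler1n.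
have cm := complete_measurable cG.
have [bz oz] := condexpP h m2 cG bx; set z := condexp _ _ _ _ _ in bz oz.
have bzm := mb_sub (complete_sigma_meas cG) bz.
have [c' b1] := mb_L1 h m2 cm (mb_subr m1 h cm bzm bx).
have oz' := orth_op (T := idfun) h h' cG C0 emb b1 oz.
have bz' := mb_op m1 h' h cG (T := idfun) (fun _ _ => erefl) emb C0 bz.
have bx' : mb P m N l' G xi (C * c).
  by split => //; exact: (mb_op m1 h' h cm (T := idfun) (fun _ _ => erefl) emb C0 bx).2.
have e := orth_unique h' m2 cG bz' bx' oz'.
by apply: (rv_ae _ (mb_rv bz)); apply: ae1 e _ => w /= ->.
Qed.

Section ControlledBounds.
Variables (R : realType) (H : monotone_family R) (T0 T : R) (hT : 0 < T <= T0).
Variables (m : R) (e : nat) (a b b' g : R).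
Hypothesis m2 : 2 <= m.
Hypothesis b'0 : 0 < b'.
Hypothesis b0 : 0 < b.
Variables (d : measure_display) (Omega : measurableType d) (P : probability Omega R).
Variables (F : R -> set (set Omega)) (hF : usual_filtration P T F).
Variables (X : R -> 'rV[R]_e) (XX : R -> R -> 'M[R]_e) (hX : rough_path T a X XX).
Let m1 : 1 <= m. Proof. by apply: le_trans m2; rewrite ler1n. Qed.
Let T_gt0 : 0 < T. Proof. by case/andP: hT. Qed.
Let cF := filtration_complete_sigma hF.
Let mF := filtration_increasing hF.
Let cm : complete_sigma P measurable.
Proof. exact: (complete_measurable (cF (lexx 0) (ltW T_gt0))). Qed.
Local Notation B := (filtered_basis hT hF).
Local Notation hH := (hnorm_hilb H).
Local Notation Ne := (opnorm (@hnorm R H) (e := e)).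
Local Notation Nee := (opnorm Ne (e := e)).

Section Increments.
Variables (W : lmodType R) (N : R -> W -> \bar R).
Variables (ip : R -> W -> W -> R) (K : R -> R).
Hypothesis hN : forall l, hilb (N l) (ip l) (K l).
Hypothesis emb : forall l l', l' <= l -> exists2 C : R, 0 <= C &
  forall v, (N l v < +oo)%E -> (N l' v <= C%:E * N l v)%E.

(** Extended norms are turned into one real bound. Adaptedness is supplied in the space of index l -
    r only, and [rv_upgrade] lifts it to the index l. *)
Lemma ELm_bounds r l (Z : R -> Omega -> W) : 0 < r -> ELm P T F N r m l Z ->
  [/\ normE P T N r m l Z = (fine (normE P T N r m l Z))%:E, 0 <= fine (normE P T N r m l Z),
    (forall t, 0 <= t -> t <= T -> mb P m N l (F t) (Z t) (fine (normE P T N r m l Z))) &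
    (forall s t, 0 <= s -> s <= t -> t <= T ->
      mb P m N (l - r) (F t) (fun w => Z t w - Z s w) (fine (normE P T N r m l Z) * (t - s) `^ r))].
Proof.
move=> r0 [cZ [aZ cZ' nZ]].
have [c c0 hc] := CLm_bounded m2 T_gt0 (hN l) cm cZ.
have n0 : (norm0 P T N m l Z <= c%:E)%E by apply: norm0_le => t t0 tT; exact: (hc t t0 tT).2.
have p0 : (0 <= norm0 P T N m l Z)%E.
  apply: le_trans (mnorm_ge0 P m N l (Z 0)) _; apply: ereal_sup_ubound; exists 0 => //.
  by rewrite /= in_itv/= lexx ltW.
have p2 : (0 <= norm2 P T N r m (l - r) (delta Z))%E.
  apply: le_trans (_ : mnorm P N m (l - r) (delta Z 0 T) * (((T - 0) `^ r)^-1)%:E <= _)%E.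
    by rewrite mule_ge0 ?mnorm_ge0// lee_fin invr_ge0 powR_ge0.
  by apply: ereal_sup_ubound; exists (0, T).
have f0 : norm0 P T N m l Z \is a fin_num by rewrite ge0_fin_numE//; exact: le_lt_trans n0 (ltry _).
have f2 : norm2 P T N r m (l - r) (delta Z) \is a fin_num by rewrite ge0_fin_numE.
have fE : normE P T N r m l Z \is a fin_num by rewrite fin_numD f0.
have M0 : 0 <= fine (normE P T N r m l Z) by apply: fine_ge0; rewrite adde_ge0.
have eE := fineD f0 f2; rewrite -/(normE P T N r m l Z) in eE.
have q0 := fine_ge0 p0; have q2 := fine_ge0 p2.
have rZ t : 0 <= t -> t <= T -> random_var P N (l - r) (F t) (Z t).
  move=> t0 tT; have tD : 0 <= t <= T by rewrite t0.
  by case: aZ => Z' aZ [_ bZ]; exists (Z' t); [exact: bZ|exact: aZ].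
split=> //; first by rewrite fineK.
  move=> t t0 tT; split.
    have [C C0 hC] := emb (lerB (lexx l) (ltW r0)).
    rewrite subr0 in hC.
    exact: (rv_upgrade (hN l) (hN (l - r)) m2 (cF t0 tT) C0 hC (hc t t0 tT) (rZ t t0 tT)).
  apply: le_trans (_ : norm0 P T N m l Z <= _)%E.
    by apply: ereal_sup_ubound; exists t => //; rewrite /= in_itv/= t0.
  by rewrite -(fineK f0) lee_fin eE lerDl.
move=> s t s0 st tT; have t0 := le_trans s0 st; have sT := le_trans st tT.
split; first exact: (rv_subr (hN (l - r)) (cF t0 tT) (rZ t t0 tT) (rv_sub (mF s0 st tT) (rZ s s0 sT))).
move: st; rewrite le_eqVlt => /orP[/eqP<-|st].
  rewrite subrr powR0 ?gt_eqF// mulr0.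
  apply: (mb_ae m1 (hN (l - r)) cm _ (mb0 m1 (hN (l - r)) cm)).2.
  by apply: aeW => w; rewrite subrr.
apply: le_trans (norm2_ge nZ s0 st tT) _; rewrite lee_fin.
by apply: ler_wpM2r; [exact: powR_ge0|rewrite eE lerDr].
Qed.

End Increments.

Lemma hnorm_emb l l' : l' <= l -> exists2 C : R, 0 <= C &
  forall v, (hnorm (H := H) l v < +oo)%E -> (hnorm l' v <= C%:E * hnorm l v)%E.
Proof. by move=> ll; have [C C1 hC] := embedding_bound H ll; exists C => //; exact: le_trans C1. Qed.

Lemma opnorm_emb (W : lmodType R) (N : R -> W -> \bar R) (ip : R -> W -> W -> R) (K : R -> R)
    (hN : forall l, hilb (N l) (ip l) (K l)) :
  (forall l l', l' <= l -> exists2 C : R, 0 <= C &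
    forall v, (N l v < +oo)%E -> (N l' v <= C%:E * N l v)%E) ->
  forall l l', l' <= l -> exists2 C : R, 0 <= C &
    forall v, (opnorm (e := e) N l v < +oo)%E -> (opnorm (e := e) N l' v <= C%:E * opnorm N l v)%E.
Proof. by move=> h l l' ll; have [C C0 hC] := h l l' ll; exists C => //; exact: (opnorm_embedding hN). Qed.

Variables (Y : R -> Omega -> {ffun 'I_e -> ambient H}).
Variables (Y' : R -> Omega -> {ffun 'I_e -> {ffun 'I_e -> ambient H}}).
Local Notation Dnorm := (controlled_norm P T F Ne X b b' m g Y Y').
Local Notation hE := (fun g => opnorm_hilb (hH g) e).
Local Notation hEE := (fun g => opnorm_hilb (opnorm_hilb (hH g) e) e).

Lemma controlled_rough_bounds : controlled P T F Ne X b b' m g Y Y' ->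
  Dnorm = (fine Dnorm)%:E /\
  @rough_bounds R H T0 m e a b b' g B X XX Y Y' (fine (rough_norm T a X XX)) (fine Dnorm).
Proof.
move=> [EY EY' [aR LR sR nR]].
have [f1 p1 bY dY] := ELm_bounds hE (opnorm_emb hH hnorm_emb) b0 EY.
have [f2 p2 bY' dY'] := ELm_bounds hEE (opnorm_emb hE (opnorm_emb hH hnorm_emb)) b'0 EY'.
set n3 := norm2 _ _ _ _ _ _ _ in nR.
have p3 : (0 <= n3)%E.
  apply: le_trans (_ : mnorm P Ne m (g - b - b') (Econd P F Ne (g - b - b') (remainder X Y Y') 0 T) *
     (((T - 0) `^ (b + b'))^-1)%:E <= _)%E.
    by rewrite mule_ge0 ?mnorm_ge0// lee_fin invr_ge0 powR_ge0.
  by apply: ereal_sup_ubound; exists (0, T).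
have f3 : n3 = (fine n3)%:E by rewrite fineK// ge0_fin_numE.
have DE : Dnorm = (fine (normE P T Ne b m g Y) + fine (normE P T Nee b' m (g - b) Y') + fine n3)%:E.
  by rewrite /controlled_norm f1 f2 -/n3 f3 !EFinD.
have q3 := fine_ge0 p3.
set x := fine (normE P T Ne b m g Y) in f1 p1 bY dY DE.
set y := fine (normE P T Nee b' m (g - b) Y') in f2 p2 bY' dY' DE.
have [D0 [D1 [D2 D3]]] : 0 <= fine Dnorm /\ x <= fine Dnorm /\ y <= fine Dnorm /\ fine n3 <= fine Dnorm.
  by rewrite DE /=; split; [|split; [|split]]; lra.
split; first by rewrite DE.
split => //=.
- exact: rough_norm_ge0.
- by move=> s t s0 st tT; exact: rough_path_incr.
- by move=> s t s0 st tT; exact: rough_path_second.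
- exact: (rough_path_chen hX).
- by move=> t t0 tT; exact: mb_le D1 (bY t t0 tT).
- by move=> s t s0 st tT; apply: mb_le (dY s t s0 st tT); apply: ler_wpM2r => //; exact: powR_ge0.
- by move=> t t0 tT; exact: mb_le D2 (bY' t t0 tT).
- by move=> s t s0 st tT; apply: mb_le (dY' s t s0 st tT); apply: ler_wpM2r => //; exact: powR_ge0.
move=> s t s0 st tT; have sT := le_trans st tT; have cs := cF s0 sT.
have h0 := hE (g - b - b').
have i1 : g - b - b' <= g - b by rewrite lerBlDr lerDl ltW.
have [C C1 hC] := mb_embedding_e H T0 e m2 i1.
have up n (W : lmodType R) (N : R -> W -> \bar R) l xi c : 0 <= n -> n <= T -> mb P m N l (F n) xi c ->
    mb P m N l measurable xi c.
  by move=> n0 nT; apply: mb_sub; exact: (complete_sigma_meas (cF n0 nT)).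
have bd := hC B measurable _ _ cm (up _ _ _ _ _ _ (le_trans s0 st) tT (dY s t s0 st tT)).
have bl := hC B measurable _ _ cm (@mb_lapp' R H T0 m e m2 B (g - b) measurable _ (incr X s t) _ cm (up _ _ _ _ _ _ s0 sT (bY' s s0 sT))).
have br : mb P m Ne (g - b - b') measurable (remainder X Y Y' s t) _ := mb_subr m1 h0 cm bd bl.
split; first exact: (condexpP h0 m2 cs br).1.1.
(* The seminorm is a supremum over s < t; on the diagonal the remainder vanishes, and its
   conditional expectation with it. *)
move: st; rewrite le_eqVlt => /orP[/eqP st|st].
  rewrite -st subrr powR0 ?mulr0; last by rewrite gt_eqF// addr_gt0.
  rewrite -st in br.
  have z0 := mb0 (P := P) m1 h0 cs.
  have r0 w : remainder X Y Y' s s w = 0.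
    by rewrite /remainder /delta /incr !subrr (_ : lapp _ 0 = 0) ?subr0// /lapp big1// => i _; rewrite mxE scale0r.
  have o0 : orth P Ne (g - b - b') (opip (e := e) (hip (H := H) (g - b - b'))) (F s) (fun w => 0 - remainder X Y Y' s s w).
    move=> A FA v fv; apply: integral0_eq => w _.
    by rewrite r0 subr0 (hilb_ipC h0 fv (fin0 h0)) (ip0l h0).
  by apply: (mb_ae m1 h0 cs _ z0).2; exact: (condexp_eq h0 m2 cs br z0 o0).
apply: le_trans (norm2_ge nR s0 st tT) _; rewrite lee_fin.
by apply: ler_wpM2r; [exact: powR_ge0|exact: D3].
Qed.

End ControlledBounds.

Lemma CLm_embedding (R : realType) (d : measure_display) (Omega : measurableType d)
    (P : probability Omega R) (T m : R) (W : lmodType R) (N : R -> W -> \bar R) (l l' : R)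
    (ip ip' : W -> W -> R) (K K' C : R) (h : hilb (N l) ip K) (h' : hilb (N l') ip' K')
    (Z : R -> Omega -> W) : 1 <= m -> complete_sigma P measurable -> 0 <= C ->
  (forall v, (N l v < +oo)%E -> (N l' v <= C%:E * N l v)%E) ->
  CLm P T N m l Z -> CLm P T N m l' Z.
Proof.
move=> m1 cm C0 emb [L cZ].
have op xi c : mb P m N l measurable xi c -> mb P m N l' measurable xi (C * c).
  exact: (mb_op m1 h' h cm (T := idfun) (fun _ _ => erefl) emb C0).
split=> [t tD|t tD]; first exact: (mb_Lm (op _ _ (Lm_mb (L t tD)))).
apply/ecvg0P; first by move=> x; exact: mnorm_ge0.
move=> eps e0; have C1 : 0 < C + 1 by rewrite ltr_wpDl.
have /ecvg0P := cZ t tD => /(_ (fun x => mnorm_ge0 P m N l _) _ (divr_gt0 e0 C1)).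
rewrite !near_withinE; apply: filterS => s hs sD; have {}hs := hs sD.
move: sD; rewrite /= in_itv/= => sD.
have bs := Lm_mb (L s sD); have bt := Lm_mb (L t tD).
set x := mnorm _ _ _ _ _ in hs.
have xE : x = (fine x)%:E by rewrite fineK// ge0_fin_numE ?mnorm_ge0//; exact: lt_trans hs (ltry _).
have bd : mb P m N l measurable (fun w => Z s w - Z t w) (fine x).
  by split; [exact: (mb_subr m1 h cm bs bt).1|rewrite -xE].
apply: le_lt_trans (op _ _ bd).2 _; rewrite lte_fin.
move: hs; rewrite xE lte_fin ltr_pdivlMr// => hs; apply: le_lt_trans hs.
rewrite mulrDr mulr1 mulrC lerDl; apply: fine_ge0; exact: mnorm_ge0.
Qed.

(** * The sewn process is the rough integral, and the only one *)

Section SolutionSpaces.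
Variables (R : realType) (H : monotone_family R) (T0 : R) (S : propagator H T0).
Variables (m : R) (e : nat) (a b b' g : R).
Hypothesis m2 : 2 <= m.
Hypothesis a2 : a <= 1 / 2.
Hypothesis b'0 : 0 < b'.
Hypothesis b'b : b' <= b.
Hypothesis ba : b <= a.
Hypothesis abb1 : 1 < a + b + b'.
Let m1 : 1 <= m. Proof. by apply: le_trans m2; rewrite ler1n. Qed.
Let b0 : 0 < b. Proof. exact: lt_le_trans b'b. Qed.
Let a0 : 0 < a. Proof. exact: lt_le_trans ba. Qed.
Local Notation hn := (@hnorm R H).
Local Notation Ne := (opnorm (e := e) hn).
Local Notation hH := (hnorm_hilb H).
Local Notation hE := (fun g => opnorm_hilb (hH g) e).
Local Notation g0 := (g - b - b').
Local Notation k := (a + b + b').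
Local Notation p := (a + b).
Variable B : stochastic_basis T0.
Local Notation P := (sb_prob B).
Local Notation T := (horizon B).
Local Notation F := (@sb_filt R T0 B).
Variables (X : R -> 'rV[R]_e) (XX : R -> R -> 'M[R]_e).
Variables (Y : R -> sb_space B -> {ffun 'I_e -> ambient H}).
Variables (Y' : R -> sb_space B -> {ffun 'I_e -> {ffun 'I_e -> ambient H}}).
Variables (L M Q : R).
Local Notation sol := (rough_solution S m a b b' g X XX Y Y' L M Q).
Let T_gt0 : 0 < T. Proof. exact: horizon_gt0. Qed.
Let T0_ : 0 <= T. Proof. exact: ltW. Qed.
Let cF t : 0 <= t -> t <= T -> complete_sigma P (F t). Proof. exact: sb_complete. Qed.
Let cm : complete_sigma P measurable. Proof. exact: sb_meas. Qed.
Let up l t xi c : 0 <= t -> t <= T -> mb P m hn l (F t) xi c -> mb P m hn l measurable xi c.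
Proof. by move=> t0 tT; apply: mb_sub; exact: (complete_sigma_meas (cF t0 tT)). Qed.

Lemma solution_space Z h : sol Z -> h < g + a ->
  CLm P T hn m h Z /\ meas_adapted P T F hn h Z.
Proof.
move=> rs ha; have [nu nu0 [C C1 hC]] := solution_holder S e m2 a2 b'0 b'b ba ha.
have [bZ dZ] := hC _ _ _ _ _ _ _ _ _ rs; have Q0 := rs_Q0 rs.
have CQ : 0 <= C * Q by rewrite mulr_ge0// (le_trans _ C1).
have dZm s t : 0 <= s -> s <= t -> t <= T -> mb P m hn h measurable (fun w => Z t w - Z s w) (C * Q * (t - s) `^ nu).
  by move=> s0 st tT; apply: up (dZ s t s0 st tT) => //; exact: le_trans s0 st.
split.
  apply: (holder_CLm m2 (hH h) cm CQ nu0 _ dZm) => t t0 tT.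
  by exists (C * Q); exact: (up t0 tT (bZ t t0 tT)).
exact: (continuous_meas_adapted (hH h) m2 T0_ cF nu0 CQ bZ dZm).
Qed.

Lemma hdelta_ae Z Z' : (forall t, 0 <= t -> t <= T -> aeeq P (Z t) (Z' t)) ->
  forall s t, 0 <= s -> s <= t -> t <= T -> aeeq P (hdelta S Z' s t) (hdelta S Z s t).
Proof.
move=> h s t s0 st tT; have t0 := le_trans s0 st; have sT := le_trans st tT.
by apply: ae2 (h t t0 tT) (h s s0 sT) _ => w e1 e2; rewrite /hdelta e1 e2.
Qed.

Lemma solution_ae Z Z' : (forall t, 0 <= t -> t <= T -> aeeq P (Z t) (Z' t)) -> sol Z -> sol Z'.
Proof.
move=> h [rb hQ gb [sr sa] z0]; have hd := hdelta_ae h.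
split=> //; last by apply: ae2 (h 0 (lexx 0) T0_) z0 _ => w -> ->.
split=> [s t s0 st tT|s u t s0 su ut tT].
  apply: (decomp_ae _ (sr s t s0 st tT)); apply: ae1 (hd s t s0 st tT) _ => w /= ->.
  by [].
have st := le_trans su ut; have uT := le_trans ut tT; have u0 := le_trans s0 su.
apply: ae2 (hd s t s0 st tT) (ae2 (hd s u s0 su uT) (ae2 (hd u t u0 ut tT) (sa s u t s0 su ut tT)
   (fun w => @conj _ _)) (fun w => @conj _ _)) _.
by move=> w -> [-> [-> ->]].
Qed.

Lemma hdelta_rough Z : sol Z -> exists2 c : R, 0 <= c & forall s t, 0 <= s -> s <= t -> t <= T ->
  mb P m hn g0 (F t) (hdelta S Z s t) (c * (t - s) `^ a).
Proof.
move=> rs; have [C C1 hC] := hdelta_mb S e g m2 a2 b'0 b'b ba (lexx 0) a0.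
have i : g0 <= g + 0 by move: b0 b'0; lra.
have [C' C'1 hC'] := mb_embedding H T0 m2 i.
have Q0 := rs_Q0 rs.
exists (C' * (C * Q)); first by rewrite !mulr_ge0 ?(le_trans _ C1) ?(le_trans _ C'1).
move=> s t s0 st tT; have ct := cF (le_trans s0 st) tT.
by have := hC' _ _ _ _ ct (hC _ _ _ _ _ _ _ _ _ rs s t s0 st tT); rewrite subr0 !mulrA.
Qed.

Lemma solution_limit Z : sol Z -> forall eps : R, 0 < eps -> exists2 del : R, 0 < del &
  forall s t pi, 0 <= s -> t <= T -> itv_partition s t pi -> mesh s pi < del ->
  mb P m hn g0 (F t) (fun w => hdelta S Z s t w - riemann_sum S X XX Y Y' s t pi w) eps.
Proof.
move=> rs eps e0; have [C C1 hC] := partition_limit S e g m2 b'0 b'b ba abb1.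
have Q0 := rs_Q0 rs; have CQ : 0 <= C * Q by rewrite mulr_ge0// (le_trans _ C1).
have p21 : 0 < 2 * p - 1 by move: b'b ba abb1; lra.
have k1 : 0 < k - 1 by rewrite subr_gt0.
have CQ1 : 0 < C * Q + 1 by rewrite ltr_wpDl.
pose r := eps / (2 * (C * Q + 1)); have r0 : 0 < r by rewrite divr_gt0// mulr_gt0.
have [d1 d10 h1] := powR_small T0_ k1 r0.
have r20 : 0 < r ^+ 2 by rewrite exprn_gt0.
have [d2 d20 h2] := powR_small T0_ p21 r20.
exists (Num.min d1 d2); first by rewrite lt_min d10.
move=> s t pi s0 tT pp; set h := mesh s pi => /ltW hd.
have h0 : 0 <= h by exact: bigmax_ge_id.
have := hC _ _ _ _ _ _ _ _ _ rs s t h pi s0 tT pp (lexx h); apply: mb_le.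
have tsT : t - s <= T by move: s0 tT; lra.
have q1 : h `^ (k - 1) * (t - s) <= r.
  apply: le_trans (_ : T * h `^ (k - 1) <= _); first by rewrite mulrC; apply: ler_wpM2r => //; exact: powR_ge0.
  by apply: ltW; apply: h1 => //; apply: le_trans hd _; rewrite ge_min lexx.
have q2 : Num.sqrt (h `^ (2 * p - 1) * (t - s)) <= r.
  rewrite -[leRHS](gtr0_norm r0) -sqrtr_sqr; apply: ler_wsqrtr.
  apply: le_trans (_ : T * h `^ (2 * p - 1) <= _); first by rewrite mulrC; apply: ler_wpM2r => //; exact: powR_ge0.
  by apply: ltW; apply: h2 => //; apply: le_trans hd _; rewrite ge_min lexx orbT.
apply: le_trans (_ : C * Q * (r + r) <= _); first by apply: ler_wpM2l => //; exact: lerD.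
rewrite /r (_ : C * Q * (_ + _) = eps * (C * Q) / (C * Q + 1)); last by field; exact: lt0r_neq0.
by rewrite ler_pdivrMr//; apply: ler_wpM2l; [exact: ltW|rewrite lerDl].
Qed.

Lemma solution_integral Z : sol Z -> is_rough_integral S P T F X XX Y Y' a b b' m g Z.
Proof.
move=> rs; have ha : g0 < g + a by move: b0 b'0 a0; lra.
have [cZ aZ] := solution_space rs ha; have [c c0 hc] := hdelta_rough rs.
split; last 1 first.
- move=> s t [/= s0 [st tT]] eps e0; have [del d0 hd] := solution_limit rs (divr_gt0 e0 (ltr0n R 2)).
  exists del => // pi pp mp; apply: le_lt_trans (hd s t pi s0 tT pp mp).2 _.
  by rewrite lte_fin ltr_pdivrMr// mulr_natr mulr2n ltrDl.
- split=> //; apply: le_lt_trans (ltry c); apply: norm2_le => s t s0 st tT.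
  exact: (hc s t s0 (ltW st) tT).2.
exact: (rs_start rs).
Qed.

Lemma uniform_partition (t del : R) : 0 < t -> 0 < del ->
  exists2 pi, itv_partition 0 t pi & mesh 0 pi < del.
Proof.
move=> t0 d0; pose n := (Num.truncn (t / del)).+1.
have tn : t / del < n%:R by exact: truncnS_gt.
have n0 : (0 : R) < n%:R by rewrite ltr0n.
have [c cE] : exists c : nat -> R, c = (fun i => i%:R * (t / n%:R)) by eexists.
have cS i : c i.+1 - c i = t / n%:R by rewrite cE -natr1 mulrDl mul1r addrC addKr.
have h0 : 0 < t / n%:R by rewrite divr_gt0.
pose pi := mkseq (fun i => c i.+1) n.
have nthc i : (i <= n)%N -> nth 0 (0 :: pi) i = c i.
  case: i => [|i] ni /=; first by rewrite cE mul0r.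
  by rewrite nth_mkseq.
exists pi.
  split.
    apply/(pathP 0) => i; rewrite size_mkseq => ni.
    by rewrite nthc ?(ltnW ni)// nth_mkseq// -subr_gt0 cS.
  rewrite -nth_last size_mkseq (set_nth_default 0) ?size_mkseq// nth_mkseq//= cE.
  by apply/eqP; rewrite mulrCA divff ?mulr1// gt_eqF.
rewrite /mesh; apply: bigmax_lt => // i _; rewrite /right_pt /left_pt.
have ni : (i < n)%N by rewrite -(size_mkseq (fun i => c i.+1) n).
rewrite (nthc i (ltnW ni)) nth_mkseq// cS.
by rewrite ltr_pdivrMr// mulrC -ltr_pdivrMr.
Qed.

(** Both processes start at 0 and are limits of the same Riemann sums over [0, t], so one
    sufficiently fine partition bounds their distance. *)
Lemma integral_unique Z Z' : sol Z -> is_rough_integral S P T F X XX Y Y' a b b' m g Z' ->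
  forall t, 0 <= t -> t <= T -> aeeq P (Z t) (Z' t).
Proof.
move=> rs [[_ cZ' _] z0' lim'] t; rewrite le_eqVlt => /orP[/eqP<- _|t0 tT].
  by apply: ae2 (rs_start rs) z0' _ => w -> ->.
have hZ : mb P m hn g0 measurable (hdelta S Z' 0 t) (fine (mnorm P hn m g0 (Z' t))).
  have tD : 0 <= t <= T by rewrite ltW.
  apply: (mb_ae m1 (hH g0) cm _ (Lm_mb (cZ'.1 t tD))).
  by apply: ae1 z0' _ => w z; rewrite /hdelta z linear0 subr0.
have bd0 : aeeq P (fun w => hdelta S Z 0 t w - hdelta S Z' 0 t w) (fun=> 0).
  apply: (mb_eq0 m1 (hH g0) cm) => eps e0.
  have e20 : 0 < eps / 2 by rewrite divr_gt0.
  have [d1 d10 h1] := solution_limit rs e20.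
  have Dt : simplex2 T (0, t) by split => //=; rewrite ltW.
  have [d2 d20 h2] := lim' 0 t Dt _ e20.
  have [d10' d20'] : 0 < Num.min d1 d2 /\ True by rewrite lt_min d10.
  have [pi pp mp] := uniform_partition t0 d10'.
  have [mp1 mp2] : mesh 0 pi < d1 /\ mesh 0 pi < d2 by move: mp; rewrite lt_min => /andP.
  have b1 := up (ltW t0) tT (h1 0 t pi (lexx 0) tT pp mp1).
  have [c c0 hc] := hdelta_rough rs; have bz := up (ltW t0) tT (hc 0 t (lexx 0) (ltW t0) tT).
  (* Measurability of the Riemann sum, as a difference of two random variables. *)
  have rr := rv_subr (hH g0) cm (mb_rv bz) (mb_rv b1).
  have b2 : mb P m hn g0 measurable (fun w => hdelta S Z' 0 t w - riemann_sum S X XX Y Y' 0 t pi w) (eps / 2).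
    split; last by apply: ltW; exact: (h2 pi pp mp2).
    apply: (rv_ae _ (rv_subr (hH g0) cm (mb_rv hZ) rr)).
    by apply: aeW => w; rewrite subKr.
  apply: (mb_ae m1 (hH g0) cm _ (mb_le _ (mb_subr m1 (hH g0) cm b1 b2))).
    apply: aeW => w; move: (hdelta S Z 0 t w) (hdelta S Z' 0 t w) (riemann_sum _ _ _ _ _ _ _ _ w) => x y z.
    by rewrite opprB addrA subrK.
  by rewrite -mulr2n -[_ *+ 2]mulr_natr divfK.
apply: ae2 (hdelta0 rs t) (ae2 z0' bd0 (fun w => @conj _ _)) _ => w -> [z /eqP].
by rewrite subr_eq0 => /eqP ->; rewrite /hdelta z linear0 subr0.
Qed.


Lemma eucl_opp n q (A : 'M[R]_(n, q)) : eucl (- A) = eucl A.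
Proof.
rewrite /eucl; congr (Num.sqrt _); apply: eq_bigr => i _; apply: eq_bigr => j _.
by rewrite mxE sqrrN.
Qed.

Lemma incr_modulus : rough_bounds m a b b' g X XX Y Y' L M ->
  forall s t, 0 <= s -> s <= T -> 0 <= t -> t <= T -> eucl (X t - X s) <= L * `|t - s| `^ a.
Proof.
move=> rb s t s0 sT t0 tT; have [st|/ltW ts] := leP s t.
  by rewrite ger0_norm ?subr_ge0//; exact: (rb_X rb).
by rewrite -eucl_opp opprB distrC ger0_norm ?subr_ge0//; exact: (rb_X rb).
Qed.

Lemma remainder_difference (Z : R -> sb_space B -> ambient H) s t s' t' w :
  remainder X Z Y s t w - remainder X Z Y s' t' w =
  (Z t w - Z t' w) - (Z s w - Z s' w) - lapp (Y s w - Y s' w) (X t - X s) -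
  (lapp (Y s' w) (X t - X t') - lapp (Y s' w) (X s - X s')).
Proof.
have lBr A (x y : 'rV[R]_e) : lapp (A : {ffun 'I_e -> ambient H}) (x - y) = lapp A x - lapp A y.
  rewrite /lapp -sumrB; apply: eq_bigr => i _; by rewrite !mxE scalerBl.
rewrite /remainder /delta /incr lappB !lBr.
move: (lapp _ _) (lapp _ _) (lapp _ _) (lapp _ _) (Z t w) (Z s w) (Z t' w) (Z s' w).
move=> p1 p2 p3 p4 z1 z2 z3 z4; rewrite !opprD !opprK !addrA.
by rewrite [RHS](ACl (1*3*5*6*2*4*10*12*(7*9)*(8*11)))/= subrr addNr !addr0.
Qed.

(** Joint Hölder continuity in both times, between arbitrary pairs. It provides the continuity of
    the remainder and the modulus needed for a measurable version of its conditional expectation.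
    The condition theta <= b' places the increments of Y, controlled in H_(g-b), in the target
    space. *)
Lemma remainder_modulus theta Z : 0 <= theta -> theta <= b' -> sol Z ->
  exists nu C, [/\ 0 < nu, 0 <= C &
    forall s t s' t', simplex2 T (s, t) -> simplex2 T (s', t') ->
    mb P m hn (g + theta - b - b') measurable (fun w => remainder X Z Y s t w - remainder X Z Y s' t' w)
      (C * (`|s - s'| `^ nu + `|t - t'| `^ nu))].
Proof.
move=> th0 thb rs; have rb := rs_bounds rs; set h := g + theta - b - b'.
have ha : h < g + a by rewrite /h; move: thb b0 a0; lra.
have hg : h <= g - b by rewrite /h; move: thb; lra.
have hg' : h <= g by rewrite /h; move: thb b0; lra.
have [nz nz0 [C1 C11 hC1]] := solution_holder S e m2 a2 b'0 b'b ba ha.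
have [_ dZ] := hC1 _ _ _ _ _ _ _ _ _ rs; have Q0 := rs_Q0 rs.
have [C2 C21 hC2] := mb_embedding_e H T0 e m2 hg.
have [C3 C31 hC3] := mb_embedding_e H T0 e m2 hg'.
have [L0 M0] := (rb_L rb, rb_M rb).
have [D1 D2 D3] : [/\ 0 <= C1, 0 <= C2 & 0 <= C3].
  by split; [exact: le_trans C11|exact: le_trans C21|exact: le_trans C31].
have dZ' := holder_modulus m2 (hH h) cm (mulr_ge0 D1 Q0)
  (fun s t s0 st tT => up (le_trans s0 st) tT (dZ s t s0 st tT)).
have upe l t xi c : 0 <= t -> t <= T -> mb P m Ne l (F t) xi c -> mb P m Ne l measurable xi c.
  by move=> t0 tT; apply: mb_sub; exact: (complete_sigma_meas (cF t0 tT)).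
have dY := holder_modulus m2 (hE (g - b)) cm M0
  (fun s t s0 st tT => upe _ _ _ _ (le_trans s0 st) tT (rb_dY rb s0 st tT)).
pose nu := Num.min nz b; have nu0 : 0 < nu by rewrite lt_min nz0 b0.
have [nuz nub] : nu <= nz /\ nu <= b by rewrite /nu !ge_min !lexx orbT.
have nua : nu <= a by apply: le_trans nub ba.
pose E : R := e%:R; have E0 : 0 <= E by exact: ler0n.
pose c1 := 1 + T `^ (nz - nu); pose c2 := 1 + T `^ (b - nu); pose c3 := 1 + T `^ (a - nu).
have [e1 e2 e3] : [/\ 0 <= c1, 0 <= c2 & 0 <= c3] by split; rewrite addr_ge0// powR_ge0.
pose LT := L * T `^ a; have LT0 : 0 <= LT by rewrite mulr_ge0// powR_ge0.
pose A := C1 * Q * c1; pose A2 := E * LT * (C2 * (M * c2)); pose A3 := E * (L * c3) * (C3 * M).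
have [A0 A20 A30] : [/\ 0 <= A, 0 <= A2 & 0 <= A3].
  by rewrite /A /A2 /A3; split; repeat (apply: mulr_ge0 => //).
exists nu, (A + A2 + A3); split => //; first by rewrite !addr_ge0.
move=> s t s' t' [/= s0 [st tT]] [/= s0' [st' tT']].
have [sT sT'] := (le_trans st tT, le_trans st' tT').
have [t0 t0'] := (le_trans s0 st, le_trans s0' st').
have dist x y : 0 <= x -> x <= T -> 0 <= y -> y <= T -> `|x - y| <= T.
  by move=> x0 xT y0 yT; rewrite ler_norml; lra.
have d1 := dZ' _ _ t0' tT' t0 tT; have d2 := dZ' _ _ s0' sT' s0 sT.
have d3 := mb_lapp m2 (X t - X s) cm (hC2 _ _ _ _ cm (dY _ _ s0' sT' s0 sT)).
have bY := hC3 _ _ _ _ cm (upe _ _ _ _ s0' sT' (rb_Y rb s0' sT')).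
have d4 := mb_lapp m2 (X t - X t') cm bY; have d5 := mb_lapp m2 (X s - X s') cm bY.
apply: (mb_ae m1 (hH h) cm _ (mb_le _ (mb_subr m1 (hH h) cm (mb_subr m1 (hH h) cm
   (mb_subr m1 (hH h) cm d1 d2) d3) (mb_subr m1 (hH h) cm d4 d5)))).
  by apply: aeW => w; exact: remainder_difference.
have [ns nt] := (dist _ _ s0 sT s0' sT', dist _ _ t0 tT t0' tT').
have q1 : eucl (X t - X s) <= LT.
  apply: le_trans (incr_modulus rb s0 sT t0 tT) _; apply: ler_wpM2l => //.
  by apply: powR_le => //; [exact: ltW|exact: dist].
have q2 := incr_modulus rb t0' tT' t0 tT; have q3 := incr_modulus rb s0' sT' s0 sT.
have sh (x n n' : R) : 0 <= n -> n <= n' -> `|x| <= T -> `|x| `^ n' <= (1 + T `^ (n' - n)) * `|x| `^ n.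
  by move=> n0 nn xT; exact: powR_shift.
have z1 := sh _ _ _ (ltW nu0) nuz ns; have z2 := sh _ _ _ (ltW nu0) nuz nt.
have z3 := sh _ _ _ (ltW nu0) nub ns.
have z4 := sh _ _ _ (ltW nu0) nua ns; have z5 := sh _ _ _ (ltW nu0) nua nt.
set ps := `|s - s'| `^ nu in z1 z3 z4 *; set pt := `|t - t'| `^ nu in z2 z5 *.
have [ps0 pt0] : 0 <= ps /\ 0 <= pt by split; exact: powR_ge0.
rewrite -/c1 -/c2 -/c3 in z1 z2 z3 z4 z5.
have y1 : C1 * Q * `|t - t'| `^ nz <= A * pt.
  by rewrite /A -(mulrA (C1 * Q)); apply: ler_wpM2l => //; exact: mulr_ge0.
have y2 : C1 * Q * `|s - s'| `^ nz <= A * ps.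
  by rewrite /A -(mulrA (C1 * Q)); apply: ler_wpM2l => //; exact: mulr_ge0.
have y3 : E * eucl (X t - X s) * (C2 * (M * `|s - s'| `^ b)) <= A2 * ps.
  rewrite /A2 (_ : _ * ps = E * LT * (C2 * (M * (c2 * ps)))); last by ring.
  apply: ler_pM; [by rewrite mulr_ge0// eucl_ge0|by rewrite !mulr_ge0// powR_ge0|exact: ler_wpM2l|].
  by apply: ler_wpM2l => //; exact: ler_wpM2l.
have y4 : E * eucl (X t - X t') * (C3 * M) <= A3 * pt.
  rewrite /A3 (_ : _ * pt = E * (L * (c3 * pt)) * (C3 * M)); last by ring.
  apply: ler_wpM2r; first exact: mulr_ge0.
  by apply: ler_wpM2l => //; apply: le_trans q2 _; exact: ler_wpM2l.
have y5 : E * eucl (X s - X s') * (C3 * M) <= A3 * ps.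
  rewrite /A3 (_ : _ * ps = E * (L * (c3 * ps)) * (C3 * M)); last by ring.
  apply: ler_wpM2r; first exact: mulr_ge0.
  by apply: ler_wpM2l => //; apply: le_trans q3 _; exact: ler_wpM2l.
apply: le_trans (lerD (lerD (lerD y1 y2) y3) (lerD y4 y5)) _.
have A2p : 0 <= A2 * pt by exact: mulr_ge0.
rewrite [leRHS](_ : _ = A * pt + A * ps + A2 * ps + (A3 * pt + A3 * ps) + A2 * pt); last by ring.
by rewrite lerDl.
Qed.

End SolutionSpaces.

(** * The integral as a controlled rough path *)

Section ControlledIntegral.
Variables (R : realType) (H : monotone_family R) (T0 : R) (S : propagator H T0).
Variables (m : R) (e : nat) (a b b' g theta : R).
Hypothesis m2 : 2 <= m.
Hypothesis a2 : a <= 1 / 2.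
Hypothesis b'0 : 0 < b'.
Hypothesis b'b : b' <= b.
Hypothesis ba : b <= a.
Hypothesis theta0 : 0 <= theta.
Hypothesis thetab : theta <= b'.
Hypothesis thetaa : theta < a.
Let m1 : 1 <= m. Proof. by apply: le_trans m2; rewrite ler1n. Qed.
Let b0 : 0 < b. Proof. exact: lt_le_trans b'b. Qed.
Local Notation hn := (@hnorm R H).
Local Notation Ne := (opnorm (e := e) hn).
Local Notation hH := (hnorm_hilb H).
Local Notation hE := (fun g => opnorm_hilb (hH g) e).
Local Notation h0 := (g + theta - b - b').
Local Notation T B := (horizon B).
Local Notation kap := (Num.min (a - b) (b - b')).
Let bb0 : 0 < b + b'. Proof. exact: addr_gt0. Qed.
Let kap0 : 0 <= kap. Proof. by rewrite le_min !subr_ge0 ba b'b. Qed.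

Lemma solution_remainder_bounds : exists2 C : R, 1 <= C &
  forall B X XX Y Y' L M Q Z, @rough_solution R H T0 S m e a b b' g B X XX Y Y' L M Q Z ->
  forall s t, 0 <= s -> s <= t -> t <= T B ->
  mb (sb_prob B) m hn h0 (sb_filt t) (remainder X Z Y s t) (C * Q * (t - s) `^ (b + b')) /\
  mb (sb_prob B) m hn h0 (sb_filt s) (condexp (sb_prob B) hn h0 (sb_filt s) (remainder X Z Y s t))
    (C * (Q * T B `^ kap) * (t - s) `^ (b + b')).
Proof.
have [C C1 hC] := remainder_decomp S e g m2 a2 b'0 b'b ba theta0 thetab thetaa.
have i : h0 <= g - b by move: thetab; lra.
have [C' C'1 hC'] := decomp_mb H T0 m2 (lexx h0) i.
have [C0 C'0] : 0 <= C /\ 0 <= C' by split; [exact: le_trans C1|exact: le_trans C'1].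
pose c := 1 + T0 `^ kap; have c0 : 0 <= c by rewrite addr_ge0// powR_ge0.
exists (4 * C + C' * (C * (c + 1))).
  apply: (@le_trans _ _ (4 * C)); first by move: C1; lra.
  by rewrite lerDl mulr_ge0// mulr_ge0// addr_ge0.
move=> B X XX Y Y' L M Q Z rs s t s0 st tT; have Q0 := rs_Q0 rs.
have d := hC _ _ _ _ _ _ _ _ _ rs s t s0 st tT.
have Tk : T B `^ kap <= c.
  by rewrite -[leLHS]add0r; apply: lerD => //; apply: powR_le => //; [exact: ltW (horizon_gt0 B)|exact: horizon_le].
have Tk0 := powR_ge0 (T B) kap.
split.
  apply: mb_le (hC' _ _ _ _ _ _ (le_trans s0 st) tT d).
  have l0 := powR_ge0 (t - s) (b + b').
  rewrite -mulrDl mulrA; apply: ler_wpM2r => //.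
  apply: le_trans (_ : C' * (C * (Q * c) + C * Q) <= _).
    by apply: ler_wpM2l => //; rewrite lerD2r; apply: ler_wpM2l => //; exact: ler_wpM2l.
  rewrite (_ : _ * _ = C' * (C * (c + 1)) * Q); last by ring.
  by apply: ler_wpM2r => //; rewrite lerDr mulr_ge0.
apply: mb_le (decomp_condexp m2 (lexx h0) i s0 st tT d).
rewrite !mulrA; apply: ler_wpM2r; first exact: powR_ge0.
do 2 (apply: ler_wpM2r => //).
by rewrite lerDl !mulr_ge0// addr_ge0.
Qed.

(** The remainder is Hölder in both times and is treated as a continuous field. Its conditional
    expectation at time s may jump in s, and receives its measurable version from the energy
    argument. *)
Lemma solution_strictly_controlled B X XX Y Y' L M Q Z :
  @rough_solution R H T0 S m e a b b' g B X XX Y Y' L M Q Z ->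
  CLm (sb_prob B) (T B) Ne m g Y ->
  strictly_controlled (sb_prob B) (T B) (@sb_filt R T0 B) hn X b b' m (g + theta) Z Y.
Proof.
move=> rs cY; have rb := rs_bounds rs; have M0 := rb_M rb; have Q0 := rs_Q0 rs.
have cm := sb_meas B; have T_ge0 : 0 <= T B by exact: ltW (horizon_gt0 B).
have ab : 0 <= T B `^ (b + b') by exact: powR_ge0.
have [C1 C11 hC1] := solution_increment_small S e g m2 a2 b'0 b'b ba theta0 thetab thetaa.
have [C2 C21 hC2] := second_component_increment H T0 e g m2 b'0 b'b ba thetab.
have [C3 C31 hC3] := solution_remainder_bounds.
have [nu [C4 [nu0 C40 hC4]]] := remainder_modulus m2 a2 b'0 b'b ba theta0 thetab rs.
have i1 : g + theta - b <= g by move: thetab b'b; lra.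
have i2 : h0 <= g by move: thetab b0; lra.
have [C5 C51 hC5] := mb_embedding_e H T0 e m2 i2.
have [C6 C61 hC6] := embedding_bound H i1.
have j1 : g + theta < g + a by rewrite ltrD2l.
have j2 : g + theta - b < g + a by move: thetaa b0; lra.
have [cZ _] := solution_space m2 a2 b'0 b'b ba rs j1.
have [cZ' aZ'] := solution_space m2 a2 b'0 b'b ba rs j2.
have [D1 D2 D3] : [/\ 0 <= C1, 0 <= C2 & 0 <= C3].
  by split; [exact: le_trans C11|exact: le_trans C21|exact: le_trans C31].
have Tk0 := powR_ge0 (T B) kap.
have K3 : 0 <= C3 * (Q * T B `^ kap) by rewrite !mulr_ge0.
have lp s t : 0 <= s -> s <= t -> t <= T B -> (t - s) `^ (b + b') <= T B `^ (b + b').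
  move=> s0 st tT; apply: powR_le; [exact: ltW|by rewrite subr_ge0|by move: s0 tT; lra].
have bR s t : simplex2 (T B) (s, t) ->
    mb (sb_prob B) m hn h0 (sb_filt t) (remainder X Z Y s t) (C3 * Q * T B `^ (b + b')).
  move=> [/= s0 [st tT]]; apply: mb_le (hC3 _ _ _ _ _ _ _ _ _ rs s t s0 st tT).1.
  by apply: ler_wpM2l; [exact: mulr_ge0|exact: lp].
have bE s t : simplex2 (T B) (s, t) -> mb (sb_prob B) m hn h0 (sb_filt s)
    (condexp (sb_prob B) hn h0 (sb_filt s) (remainder X Z Y s t)) (C3 * (Q * T B `^ kap) * T B `^ (b + b')).
  move=> [/= s0 [st tT]]; apply: mb_le (hC3 _ _ _ _ _ _ _ _ _ rs s t s0 st tT).2.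
  by apply: ler_wpM2l => //; exact: lp.
have up (W : lmodType R) (N : R -> W -> \bar R) l t xi c : 0 <= t -> t <= T B ->
    mb (sb_prob B) m N l (sb_filt t) xi c -> mb (sb_prob B) m N l measurable xi c.
  by move=> t0 tT; apply: mb_sub; exact: (complete_sigma_meas (sb_complete t0 tT)).
have bRm s t : simplex2 (T B) (s, t) ->
    mb (sb_prob B) m hn h0 measurable (remainder X Z Y s t) (C3 * Q * T B `^ (b + b')).
  by move=> D; apply: up (bR s t D); case: D => /= s0 [st tT] //; exact: le_trans s0 st.
have dY s t : 0 <= s -> s <= t -> t <= T B -> _ := hC2 _ _ _ _ _ _ _ rb s t.
have C2M : 0 <= C2 * (T B `^ kap * M) by rewrite !mulr_ge0.
have bY t : 0 <= t -> t <= T B -> mb (sb_prob B) m Ne h0 (sb_filt t) (Y t) (C5 * M).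
  by move=> t0 tT; exact: (hC5 _ _ _ _ (sb_complete t0 tT) (rb_Y rb t0 tT)).
have dYm s t : 0 <= s -> s <= t -> t <= T B -> mb (sb_prob B) m Ne h0 measurable
    (fun w => Y t w - Y s w) (C2 * (T B `^ kap * M) * (t - s) `^ b').
  by move=> s0 st tT; apply: up (dY s t s0 st tT) => //; exact: le_trans s0 st.
split.
  split.
  - split=> //; split => //.
    apply: le_lt_trans (ltry (C1 * (Q * T B `^ kap))); apply: norm2_le => s t s0 st tT.
    exact: (hC1 _ _ _ _ _ _ _ _ _ rs s t s0 (ltW st) tT).2.
  - split.
      have C60 : 0 <= C6 by exact: le_trans C61.
      exact: (CLm_embedding (hE g) (hE (g + theta - b)) m1 cm C60 (opnorm_embedding hH C60 hC6) cY).
    split.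
    + exact: (continuous_meas_adapted (hE h0) m2 T_ge0 (@sb_complete R T0 B) b'0 C2M bY dYm).
    + apply: (holder_CLm m2 (hE h0) cm C2M b'0 _ dYm) => t t0 tT.
      by exists (C5 * M); exact: (up _ _ _ _ _ _ t0 tT (bY t t0 tT)).
    + apply: le_lt_trans (ltry (C2 * (T B `^ kap * M))); apply: norm2_le => s t s0 st tT.
      exact: (dY s t s0 (ltW st) tT).2.
  - split.
    + exact: (Econd_meas_adapted2 (hH h0) m2 T_ge0 (@sb_complete R T0 B) (@sb_mono R T0 B) nu0 C40 bRm hC4).
    + move=> s t D; have [/= s0 [st tT]] := D.
      by apply: mb_Lm (up _ _ _ _ _ _ s0 _ (bE s t D)); exact: le_trans st tT.
    + apply: le_lt_trans (ltry (C3 * (Q * T B `^ kap) * T B `^ (b + b'))).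
      by apply: ge_ereal_sup => _ [[s t] D <-]; exact: (bE s t D).2.
    + apply: le_lt_trans (ltry (C3 * (Q * T B `^ kap))); apply: norm2_le => s t s0 st tT.
      exact: (hC3 _ _ _ _ _ _ _ _ _ rs s t s0 (ltW st) tT).2.2.
split; last exact: (modulus_C2 C40 nu0 hC4).
split.
- exact: (continuous_meas_adapted2 (hH h0) m2 T_ge0 (@sb_complete R T0 B) nu0 C40 bR hC4).
- by move=> s t D; exact: (mb_Lm (bRm s t D)).
- apply: le_lt_trans (ltry (C3 * Q * T B `^ (b + b'))).
  by apply: ge_ereal_sup => _ [[s t] D <-]; exact: (bR s t D).2.
apply: le_lt_trans (ltry (C3 * Q)); apply: norm2_le => s t s0 st tT.
exact: (hC3 _ _ _ _ _ _ _ _ _ rs s t s0 (ltW st) tT).1.2.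
Qed.

(** Of the five seminorms, all but the supremum of the second component carry the small factor
    throughout; there the initial value Y_0 remains. *)
Lemma solution_norm : exists2 C : R, 1 <= C &
  forall B X XX Y Y' L M Q Z, @rough_solution R H T0 S m e a b b' g B X XX Y Y' L M Q Z ->
  forall M0, mb (sb_prob B) m Ne g (sb_filt 0) (Y 0) M0 ->
  (controlled_norm (sb_prob B) (T B) (@sb_filt R T0 B) hn X b b' m (g + theta) Z Y
    <= (C * (M0 + T B `^ kap * Q))%:E)%E.
Proof.
have [C1 C11 hC1] := solution_small S e g m2 a2 b'0 b'b ba theta0 thetab thetaa.
have [C2 C21 hC2] := solution_increment_small S e g m2 a2 b'0 b'b ba theta0 thetab thetaa.
have [C3 C31 hC3] := second_component_sup H T0 e g m2 b'0 b'b ba theta0 thetab.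
have [C4 C41 hC4] := second_component_increment H T0 e g m2 b'0 b'b ba thetab.
have [C5 C51 hC5] := solution_remainder_bounds.
have [[D1 D2] [D3 D4] D5] : [/\ 0 <= C1 /\ 0 <= C2, 0 <= C3 /\ 0 <= C4 & 0 <= C5].
  by split; [split; [exact: le_trans C11|exact: le_trans C21]|split; [exact: le_trans C31|exact: le_trans C41]|exact: le_trans C51].
exists (C1 + C2 + (C3 + C4) + C5); first by move: C11 D2 D3 D4 D5; lra.
move=> B X XX Y Y' L M Q Z rs M0 bY0; have rb := rs_bounds rs.
have Q0 := rs_Q0 rs; have MQ := rs_M rs; have M00 := mb_ge0 bY0; have Mp := rb_M rb.
set Tk := T B `^ kap; have Tk0 : 0 <= Tk by exact: powR_ge0.
have n1 : (norm0 (sb_prob B) (T B) hn m (g + theta) Z <= (C1 * (Q * Tk))%:E)%E.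
  by apply: norm0_le => t t0 tT; exact: (hC1 _ _ _ _ _ _ _ _ _ rs t t0 tT).2.
have n2 : (norm2 (sb_prob B) (T B) hn b m (g + theta - b) (delta Z) <= (C2 * (Q * Tk))%:E)%E.
  by apply: norm2_le => s t s0 st tT; exact: (hC2 _ _ _ _ _ _ _ _ _ rs s t s0 (ltW st) tT).2.
have n3 : (norm0 (sb_prob B) (T B) Ne m (g + theta - b) Y <= (C3 * (M0 + Tk * M))%:E)%E.
  by apply: norm0_le => t t0 tT; exact: (hC3 _ _ _ _ _ _ _ rb M0 t bY0 t0 tT).2.
have n4 : (norm2 (sb_prob B) (T B) Ne b' m h0 (delta Y) <= (C4 * (Tk * M))%:E)%E.
  by apply: norm2_le => s t s0 st tT; exact: (hC4 _ _ _ _ _ _ _ rb s t s0 (ltW st) tT).2.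
have n5 : (norm2 (sb_prob B) (T B) hn (b + b') m h0
    (Econd (sb_prob B) (@sb_filt R T0 B) hn h0 (remainder X Z Y)) <= (C5 * (Q * Tk))%:E)%E.
  by apply: norm2_le => s t s0 st tT; exact: (hC5 _ _ _ _ _ _ _ _ _ rs s t s0 (ltW st) tT).2.2.
apply: le_trans (leeD (leeD (leeD n1 n2) (leeD n3 n4)) n5) _.
rewrite -!EFinD lee_fin.
have TM : Tk * M <= Tk * Q by exact: ler_wpM2l.
have TQ : 0 <= Tk * Q by exact: mulr_ge0.
apply: le_trans (_ : C1 * (Q * Tk) + C2 * (Q * Tk) + (C3 * (M0 + Tk * Q) + C4 * (Tk * Q)) + C5 * (Q * Tk) <= _).
  by rewrite lerD2r lerD2l; apply: lerD; apply: ler_wpM2l => //; rewrite lerD2l.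
rewrite [leRHS](_ : _ = C1 * (Q * Tk) + C2 * (Q * Tk) + (C3 * (M0 + Tk * Q) + C4 * (Tk * Q)) + C5 * (Q * Tk) +
  (C1 + C2 + C4 + C5) * M0); last by ring.
by rewrite lerDl mulr_ge0// !addr_ge0.
Qed.

End ControlledIntegral.

Lemma lapp_lin (R : realType) (W : lmodType R) (e : nat) (c : R) (A A' : {ffun 'I_e -> W}) x :
  lapp (c *: A + A') x = c *: lapp A x + lapp A' x.
Proof. by rewrite lappD lappZ. Qed.

Lemma lapp2_lin (R : realType) (W : lmodType R) (e : nat) (c : R)
    (A A' : {ffun 'I_e -> {ffun 'I_e -> W}}) x : lapp2 (c *: A + A') x = c *: lapp2 A x + lapp2 A' x.
Proof.
rewrite /lapp2 scaler_sumr -big_split/=; apply: eq_bigr => i _.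
rewrite scaler_sumr -big_split/=; apply: eq_bigr => j _.
by rewrite !ffunE scalerDr !scalerA mulrC.
Qed.

Section Linearity.
Variables (R : realType) (H : monotone_family R) (T0 : R) (S : propagator H T0).
Variables (m : R) (e : nat) (a b b' g : R).
Hypothesis m2 : 2 <= m.
Hypothesis a2 : a <= 1 / 2.
Hypothesis b'0 : 0 < b'.
Hypothesis b'b : b' <= b.
Hypothesis ba : b <= a.
Hypothesis abb1 : 1 < a + b + b'.
Let m1 : 1 <= m. Proof. by apply: le_trans m2; rewrite ler1n. Qed.
Variables (B : stochastic_basis T0) (X : R -> 'rV[R]_e) (XX : R -> R -> 'M[R]_e) (c : R).
Variables (Y1 Y2 : R -> sb_space B -> {ffun 'I_e -> ambient H}).
Variables (Y1' Y2' : R -> sb_space B -> {ffun 'I_e -> {ffun 'I_e -> ambient H}}).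
Variables (L M1 Q1 M2 Q2 : R) (Z1 Z2 : R -> sb_space B -> ambient H).
Hypothesis rs1 : rough_solution S m a b b' g X XX Y1 Y1' L M1 Q1 Z1.
Hypothesis rs2 : rough_solution S m a b b' g X XX Y2 Y2' L M2 Q2 Z2.
Local Notation hn := (@hnorm R H).
Local Notation hH := (hnorm_hilb H).
Local Notation g0 := (g - b - b').
Local Notation P := (sb_prob B).
Local Notation T := (horizon B).
Local Notation F := (@sb_filt R T0 B).
Local Notation Z := (fun t w => c *: Z1 t w + Z2 t w).
Local Notation Y := (fun t w => c *: Y1 t w + Y2 t w).
Local Notation Y' := (fun t w => c *: Y1' t w + Y2' t w).

Lemma hdelta_lin s t w : hdelta S Z s t w = c *: hdelta S Z1 s t w + hdelta S Z2 s t w.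
Proof. by rewrite /hdelta linearP opprD addrACA scalerBr. Qed.

Lemma riemann_sum_lin s t pi w : riemann_sum S X XX Y Y' s t pi w =
  c *: riemann_sum S X XX Y1 Y1' s t pi w + riemann_sum S X XX Y2 Y2' s t pi w.
Proof.
rewrite /riemann_sum scaler_sumr -big_split/=; apply: eq_bigr => i _.
by rewrite -linearP /germ lapp_lin lapp2_lin scalerDr addrACA.
Qed.

(** Checked on the definition of the integral: [hdelta] and Riemann sums are linear, and so are the
    modulus of continuity and the limit. *)
Lemma combination_integral : is_rough_integral S P T F X XX Y Y' a b b' m g Z.
Proof.
have cm := sb_meas B; have T_ge0 : 0 <= T by exact: ltW (horizon_gt0 B).
have ha : g0 < g + a by move: b'0 b'b ba; lra.
have [nu nu0 [C C1 hC]] := solution_holder S e m2 a2 b'0 b'b ba ha.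
have [bZ1 dZ1] := hC _ _ _ _ _ _ _ _ _ rs1; have [bZ2 dZ2] := hC _ _ _ _ _ _ _ _ _ rs2.
have [Q10 Q20] := (rs_Q0 rs1, rs_Q0 rs2).
have C0 : 0 <= C by exact: le_trans C1.
have up l t xi r : 0 <= t -> t <= T -> mb P m hn l (F t) xi r -> mb P m hn l measurable xi r.
  by move=> t0 tT; apply: mb_sub; exact: (complete_sigma_meas (sb_complete t0 tT)).
pose V := `|c| * (C * Q1) + C * Q2; have V0 : 0 <= V by rewrite addr_ge0 ?mulr_ge0.
have bZ t : 0 <= t -> t <= T -> mb P m hn g0 (F t) (Z t) V.
  move=> t0 tT; have ct := sb_complete t0 tT.
  exact: (mb_add m1 (hH g0) ct (mb_scale m1 (hH g0) c ct (bZ1 t t0 tT)) (bZ2 t t0 tT)).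
have dZ s t : 0 <= s -> s <= t -> t <= T -> mb P m hn g0 measurable (fun w => Z t w - Z s w) (V * (t - s) `^ nu).
  move=> s0 st tT; have t0 := le_trans s0 st.
  have d1 := up _ _ _ _ t0 tT (dZ1 s t s0 st tT); have d2 := up _ _ _ _ t0 tT (dZ2 s t s0 st tT).
  apply: (mb_ae m1 (hH g0) cm _ (mb_le _ (mb_add m1 (hH g0) cm (mb_scale m1 (hH g0) c cm d1) d2))).
    by apply: aeW => w; rewrite opprD addrACA scalerBr.
  by rewrite /V mulrDl !mulrA.
have [c1 c10 hd1] := hdelta_rough m2 a2 b'0 b'b ba rs1.
have [c2 c20 hd2] := hdelta_rough m2 a2 b'0 b'b ba rs2.
split.
- split.
  + exact: (continuous_meas_adapted (hH g0) m2 T_ge0 (@sb_complete R T0 B) nu0 V0 bZ dZ).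
  + apply: (holder_CLm m2 (hH g0) cm V0 nu0 _ dZ) => t t0 tT; exists V.
    exact: (up _ _ _ _ t0 tT (bZ t t0 tT)).
  apply: le_lt_trans (ltry (`|c| * c1 + c2)); apply: norm2_le => s t s0 st tT.
  have t0 := le_trans s0 (ltW st); have ct := sb_complete t0 tT.
  have d1 := mb_scale m1 (hH g0) c ct (hd1 s t s0 (ltW st) tT).
  rewrite mulrDl -mulrA; apply: (mb_ae m1 (hH g0) ct _ (mb_add m1 (hH g0) ct d1 (hd2 s t s0 (ltW st) tT))).2.
  by apply: aeW => w; exact: hdelta_lin.
- apply: ae2 (rs_start rs1) (rs_start rs2) _ => w -> ->.
  by rewrite scaler0 addr0.
move=> s t [/= s0 [st tT]] eps e0; have t0 := le_trans s0 st; have ct := sb_complete t0 tT.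
have c1' : 0 < `|c| + 1 by rewrite ltr_wpDl.
have e1 : 0 < eps / (2 * (`|c| + 1)) by rewrite divr_gt0// mulr_gt0.
have [d1 d10 h1] := solution_limit m2 b'0 b'b ba abb1 rs1 e1.
have [d2 d20 h2] := solution_limit m2 b'0 b'b ba abb1 rs2 e1.
exists (Num.min d1 d2); first by rewrite lt_min d10.
move=> pi pp; rewrite lt_min => /andP[mp1 mp2].
have b1 := mb_scale m1 (hH g0) c ct (h1 s t pi s0 tT pp mp1).
have b2 := h2 s t pi s0 tT pp mp2.
apply: le_lt_trans (_ : ((eps / 2)%:E < _)%E); last first.
  by rewrite lte_fin ltr_pdivrMr// mulr_natr mulr2n ltrDl.
apply: (mb_ae m1 (hH g0) ct _ (mb_le _ (mb_add m1 (hH g0) ct b1 b2))).2.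
  apply: aeW => w; rewrite hdelta_lin riemann_sum_lin.
  by rewrite opprD addrACA scalerBr.
rewrite (_ : _ + _ = eps / 2)//; field; exact: lt0r_neq0.
Qed.

End Linearity.

(** Any process meeting the definition of the integral agrees at each time, almost surely, with the
    sewn one, and a solution remains one under such modifications. All the estimates thus apply to
    an arbitrary integral. *)
Lemma controlled_integral_solution (R : realType) (H : monotone_family R) (T0 : R) (S : propagator H T0)
    (e : nat) (a b b' g m : R) : 2 <= m -> a <= 1 / 2 -> 0 < b' -> b' <= b -> b <= a ->
  1 < a + b + b' -> exists2 C : R, 1 <= C &
  forall (T : R) (hT : 0 < T <= T0) (d : measure_display) (Omega : measurableType d)
    (P : probability Omega R) (F : R -> set (set Omega)) (hF : usual_filtration P T F)
    (X : R -> 'rV[R]_e) (XX : R -> R -> 'M[R]_e), rough_path T a X XX ->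
  forall Y Y', controlled P T F (opnorm (@hnorm R H) (e := e)) X b b' m g Y Y' ->
  let M := fine (controlled_norm P T F (opnorm (@hnorm R H) (e := e)) X b b' m g Y Y') in
  let L := fine (rough_norm T a X XX) in
  let sol := @rough_solution R H T0 S m e a b b' g (filtered_basis hT hF) X XX Y Y' L M (C * (M * (1 + L ^+ 2))) in
  (exists Z, sol Z) /\
  forall Z, is_rough_integral S P T F X XX Y Y' a b b' m g Z -> sol Z.
Proof.
move=> m2 a2 b'0 b'b ba abb1.
have b0 : 0 < b by exact: lt_le_trans b'b.
have [C C1 hC] := rough_solution_exists S e g m2 a2 b'0 b'b ba abb1.
exists C => // T hT d Omega P F hF X XX hX Y Y' D M L sol.
have [_ rb] := controlled_rough_bounds hT m2 b'0 b0 hF hX D.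
have [Z rs] := hC _ _ _ _ _ _ _ rb.
split; first by exists Z.
move=> Z' iZ'; apply: (solution_ae _ rs).
exact: (integral_unique m2 a2 b'0 b'b ba abb1 rs iZ').
Qed.

(** Lets the constants be chosen as total functions of eta or theta, although the estimates hold in
    a range only; outside it the value is 1. *)
Lemma constant_if (R : realType) (A : Prop) (Q : R -> Prop) :
  (A -> exists2 C : R, 1 <= C & Q C) -> exists C : R, A -> 1 <= C /\ Q C.
Proof.
move=> h; have [/h[C C1 hC]|nA] := pselect A; first by exists C.
by exists 1.
Qed.

Theorem theorem3p4 (R : realType) (H : monotone_family R)
    (T0 : R) (hT0 : 0 < T0) (S : propagator H T0)
    (e : nat) (a b b' g m : R)
    (ha : 1 / 3 < a <= 1 / 2) (hb' : 0 < b') (hb'b : b' <= b) (hba : b <= a)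
    (habb' : 1 < a + b + b') (hm : 2 <= m) :
  (* C1, C2, C3 are the constants of the three estimates; their arguments are
     T \/ 1 and eta (for C1) or theta (for C2, C3) *)
  exists C1 C2 C3 : R -> R -> R,
  forall (T : R) (hT : 0 < T <= T0)
    (d : measure_display) (Omega : measurableType d) (P : probability Omega R)
    (F : R -> set (set Omega)) (hF : usual_filtration P T F)
    (X : R -> 'rV[R]_e) (XX : R -> R -> 'M[R]_e) (hX : rough_path T a X XX),
  let N := @hnorm R H in
  let Ne := opnorm (@hnorm R H) (e := e) in
  let proc := R -> Omega -> ambient H in
  let proc_e := R -> Omega -> {ffun 'I_e -> ambient H} in
  let proc_ee := R -> Omega -> {ffun 'I_e -> {ffun 'I_e -> ambient H}} in
  let D (Y : proc_e) (Y' : proc_ee) := controlled P T F Ne X b b' m g Y Y' in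
  let Dnorm (Y : proc_e) (Y' : proc_ee) :=
    controlled_norm P T F Ne X b b' m g Y Y' in
  let integral (Y : proc_e) (Y' : proc_ee) (Z : proc) :=
    is_rough_integral S P T F X XX Y Y' a b b' m g Z in
  let normX := rough_norm T a X XX in
  (forall Y Y', D Y Y' ->
    exists2 Z, integral Y Y' Z &
    [/\ (forall Z', integral Y Y' Z' ->
           forall t : R, 0 <= t <= T -> aeeq P (Z t) (Z' t)),
        (* the unconditional exponent is a + b + b' - eta for eta >= b'; for
           smaller eta it saturates at a + b, and only the conditional
           expectation keeps the exponent a + b + b' - eta *)
        (forall eta s t : R, 0 <= eta < a + b + b' -> simplex2 T (s, t) ->
           let rest w :=
             hdelta S Z s t w - prop S s t (germ X XX Y Y' s t w) in
           let bound := ((C1 (Num.max T 1) eta)%:E *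
                         (Dnorm Y Y' * (1 + normX ^+ 2)))%E in
           (mnorm P N m (g + eta - b - b')%R rest
            <= bound * ((t - s) `^ Num.min (a + b + b' - eta) (a + b))%:E)%E /\
           (mnorm P N m (g + eta - b - b')%R
              (condexp P N (g - b - b')%R (F s) rest)
            <= bound * ((t - s) `^ (a + b + b' - eta))%:E)%E) &
        (forall theta : R, 0 <= theta < a ->
           hCbLm S P T F (a - theta) m (g + theta) Z /\
           (norm2 P T N (a - theta)%R m (g + theta)%R (hdelta S Z)
            <= (C2 (Num.max T 1) theta)%:E *
               (Dnorm Y Y' * (1 + normX ^+ 2)))%E)]) /\
  (forall theta : R, 0 <= theta < a -> theta <= b' ->
    let norm_ZY (Z : proc) (Y : proc_e) :=
      controlled_norm P T F N X b b' m (g + theta) Z Y in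
    [/\ (forall Y Y' Z, D Y Y' -> integral Y Y' Z ->
           strictly_controlled P T F N X b b' m (g + theta) Z Y),
        (forall (c : R) Y1 Y1' Z1 Y2 Y2' Z2,
           D Y1 Y1' -> integral Y1 Y1' Z1 -> D Y2 Y2' -> integral Y2 Y2' Z2 ->
           integral (fun t w => c *: Y1 t w + Y2 t w)
                    (fun t w => c *: Y1' t w + Y2' t w)
                    (fun t w => c *: Z1 t w + Z2 t w)),
        (exists K : R, forall Y Y' Z, D Y Y' -> integral Y Y' Z ->
           (norm_ZY Z Y <= K%:E * Dnorm Y Y')%E) &
        (forall Y Y' Z, D Y Y' -> integral Y Y' Z ->
           (norm_ZY Z Y
            <= (C3 (Num.max T 1) theta)%:E *
               (mnorm P Ne m g (Y 0%R) * (1 + normX) +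
                (T `^ (Num.min (a - b) (b - b')))%:E *
                (Dnorm Y Y' * (1 + normX ^+ 2))))%E)]).
Proof.
have [a3 a2] := andP ha.
have b0 : 0 < b by exact: lt_le_trans hb'b.
have a0 : 0 < a by exact: lt_le_trans hba.
have m1 : 1 <= m by apply: le_trans hm; rewrite ler1n.
have [D0 D01 hsol] := controlled_integral_solution S e g hm a2 hb' hb'b hba habb'.
have D00 : 0 <= D0 by exact: le_trans D01.
have [c1 hc1] := choice (fun eta : R => constant_if (fun h : 0 <= eta < a + b + b' =>
  rest_mb S e g hm a2 hb' hb'b hba (proj1 (andP h)) (proj2 (andP h)))).
have [c2 hc2] := choice (fun theta : R => constant_if (fun h : 0 <= theta < a =>
  hdelta_mb S e g hm a2 hb' hb'b hba (proj1 (andP h)) (proj2 (andP h)))).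
have [c3 hc3] := choice (fun theta : R => constant_if (fun h : (0 <= theta < a) && (theta <= b') =>
  solution_norm S e g hm a2 hb' hb'b hba (proj1 (andP (proj1 (andP h)))) (proj2 (andP h))
    (proj2 (andP (proj1 (andP h)))))).
(* The estimates are uniform over horizons up to [T0], so one value serves every [T]. The factor
   [D0] is the ratio between the parameter [Q] of the solution and M (1 + L^2). *)
exists (fun _ eta => c1 eta * D0), (fun _ theta => c2 theta * D0), (fun _ theta => c3 theta * D0).
move=> T hT d Omega P F hF X XX hX N Ne proc proc_e proc_ee D Dnorm integral normX.
have DE Y Y' : D Y Y' -> Dnorm Y Y' = (fine (Dnorm Y Y'))%:E.
  by move=> hD; have [] := controlled_rough_bounds hT hm hb' b0 hF hX hD.
have [T_gt0 T_le] := andP hT.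
have LE : normX = (fine normX)%:E by exact: (rough_norm_fin T_gt0 hX).
have L0 : 0 <= fine normX by exact: rough_norm_ge0.
set L := fine normX in LE L0.
pose M Y Y' := fine (Dnorm Y Y'); pose V Y Y' := M Y Y' * (1 + L ^+ 2).
have VE Y Y' : D Y Y' -> (Dnorm Y Y' * (1 + normX ^+ 2))%E = (V Y Y')%:E.
  by move=> hD; rewrite (DE _ _ hD) LE -EFin_expe -EFinD -EFinM.
pose B := filtered_basis hT hF.
have ex Y Y' (hD : D Y Y') : exists Z, @rough_solution R H T0 S m e a b b' g B X XX Y Y' L (M Y Y') (D0 * V Y Y') Z.
  exact: (hsol T hT d Omega P F hF X XX hX Y Y' hD).1.
have un Y Y' Z (hD : D Y Y') : integral Y Y' Z -> @rough_solution R H T0 S m e a b b' g B X XX Y Y' L (M Y Y') (D0 * V Y Y') Z.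
  exact: (hsol T hT d Omega P F hF X XX hX Y Y' hD).2.
split.
  move=> Y Y' hD; have [Z rs] := ex Y Y' hD.
  have iZ : integral Y Y' Z by exact: (solution_integral hm a2 hb' hb'b hba habb' rs).
  exists Z => //; split.
  - move=> Z' iZ' t /andP[t0 tT].
    exact: (integral_unique (B := B) hm a2 hb' hb'b hba habb' rs iZ' t0 tT).
  - move=> eta s t eD [s0 [st tT]] rest bound; rewrite /= in s0 st tT.
    have [_ /(_ B _ _ _ _ _ _ _ _ rs s t s0 st tT)[r1 r2]] := hc1 eta eD.
    have boundE : bound = (c1 eta * D0 * V Y Y')%:E by rewrite /bound (VE _ _ hD) -EFinM.
    have gE : g + eta - b - b' = g - b - b' + eta by ring.
    rewrite boundE -!EFinM gE -(mulrA (c1 eta)).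
    by split; [exact: r1.2|exact: r2.2].
  - move=> theta tD; have [th0 tha] := andP tD.
    have [_ hd] := hc2 theta tD.
    have bd s t : 0 <= s -> s < t -> t <= T ->
        (mnorm P N m (g + theta) (hdelta S Z s t) <= (c2 theta * D0 * V Y Y' * (t - s) `^ (a - theta))%:E)%E.
      move=> s0 st tT; rewrite -(mulrA (c2 theta)).
      exact: (hd B _ _ _ _ _ _ _ _ rs s t s0 (ltW st) tT).2.
    have n2 := norm2_le bd.
    have ha' : g + theta < g + a by rewrite ltrD2l.
    have [cZ aZ] := solution_space hm a2 hb' hb'b hba rs ha'.
    rewrite (VE _ _ hD) -EFinM; split => //; split => //.
    exact: le_lt_trans n2 (ltry _).
move=> theta tD thb norm_ZY; have [th0 tha] := andP tD.
have [c31 hn] := hc3 theta (introT andP (conj tD thb)).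
have est Y Y' Z : D Y Y' -> integral Y Y' Z -> (norm_ZY Z Y <= (c3 theta * D0)%:E *
    (mnorm P Ne m g (Y 0%R) * (1 + normX) + (T `^ (Num.min (a - b) (b - b')))%:E *
       (Dnorm Y Y' * (1 + normX ^+ 2))))%E.
  move=> hD iZ; have rs := un Y Y' Z hD iZ; have rb := rs_bounds rs.
  have bY := rb_Y rb (lexx 0) (ltW T_gt0).
  have nf : mnorm P Ne m g (Y 0) = (fine (mnorm P Ne m g (Y 0)))%:E.
    by rewrite fineK// ge0_fin_numE ?mnorm_ge0//; exact: le_lt_trans bY.2 (ltry _).
  have bY0 : mb P m Ne g (F 0) (Y 0) (fine (mnorm P Ne m g (Y 0))).
    by split; [exact: bY.1|rewrite -nf].
  apply: le_trans (hn B _ _ _ _ _ _ _ _ rs _ bY0) _.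
  rewrite (VE _ _ hD) LE -[(1 + L%:E)%E]EFinD.
  rewrite nf; set y0 := fine (mnorm P Ne m g (Y 0)).
  have -> : (y0%:E * (1 + L)%:E + (T `^ Num.min (a - b) (b - b'))%:E * (V Y Y')%:E)%E =
      (y0 * (1 + L) + T `^ Num.min (a - b) (b - b') * V Y Y')%:E by [].
  rewrite -EFinM lee_fin /=.
  have V0 : 0 <= V Y Y' by rewrite mulr_ge0 ?(rb_M rb)// addr_ge0// sqr_ge0.
  have Y00 : 0 <= y0 by apply: fine_ge0; exact: mnorm_ge0.
  rewrite -mulrA; apply: ler_wpM2l; first exact: le_trans c31.
  rewrite mulrDr; apply: lerD; last by rewrite mulrCA.
  rewrite -[leLHS]mul1r; apply: ler_pM => //.
  by rewrite ler_peMr// lerDl.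
split.
- move=> Y Y' Z hD iZ; have rs := un Y Y' Z hD iZ.
  have [[cY _] _ _] := hD.
  exact: (solution_strictly_controlled hm a2 hb' hb'b hba th0 thb tha rs cY).
- move=> c Y1 Y1' Z1 Y2 Y2' Z2 hD1 i1 hD2 i2.
  exact: (combination_integral hm a2 hb' hb'b hba habb' c (un _ _ _ hD1 i1) (un _ _ _ hD2 i2)).
(* Boundedness of the linear map follows from the last estimate by bounding the norm of Y_0 by that
   of the controlled path. *)
- exists (c3 theta * D0 * (1 + L + T `^ (Num.min (a - b) (b - b')) * (1 + L ^+ 2))) => Y Y' Z hD iZ.
  apply: le_trans (est Y Y' Z hD iZ) _; have rb := rs_bounds (un Y Y' Z hD iZ).
  rewrite (VE _ _ hD) (DE _ _ hD) LE -!EFinM [leRHS](_ : _ = (c3 theta * D0)%:E *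
    ((M Y Y')%:E * (1 + L%:E) + (T `^ Num.min (a - b) (b - b') * V Y Y')%:E))%E; last first.
    transitivity (c3 theta * D0 * (M Y Y' * (1 + L) + T `^ Num.min (a - b) (b - b') * V Y Y'))%:E => //.
    by congr (_%:E); rewrite /V /M; ring.
  apply: lee_wpmul2l; first by rewrite lee_fin mulr_ge0// (le_trans _ c31).
  rewrite leeD2r//; apply: lee_wpmul2r; first by rewrite -EFinD lee_fin addr_ge0.
  exact: (rb_Y rb (lexx 0) (ltW T_gt0)).2.
- exact: est.
Qed.
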